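(* Let $G$ be a locally compact group, let $\tau$ be a coaction functor, and let $\sigma$ be the associated crossed-product functor on actions of $G$, i.e. $A\rtimes_{\alpha,\sigma}G:=(A\rtimes_\alpha G)^\tau$ for every action $(A,\alpha)$ and $\phi\rtimes_\sigma G:=(\phi\rtimes G)^\tau$ for every morphism $\phi$ of actions. If $\tau$ is exact, then $\sigma$ is exact; if $\tau$ is Morita compatible, then $\sigma$ is Morita compatible. Moreover, if $\tau_1,\tau_2$ are coaction functors with associated crossed-product functors $\sigma_1,\sigma_2$ and $\tau_1\le\tau_2$, then $\sigma_1\le\sigma_2$.
   Context: **Conventions.** $G$ is a locally compact group; ideals of $C^*$-algebras are closed and two-sided; homomorphisms are $*$-homomorphisms; $\otimes$ is the minimal tensor product; $\mathcal K=\mathcal K(L^2(G))$. For $C^*$-algebras $A,C$ put $\widetilde M(A\otimes C)=\{m\in M(A\otimes C): m(1\otimes C)\cup(1\otimes C)m\subset A\otimes C\}$; a homomorphism $\phi:A\to B$ has a canonical extension $\overline{\phi\otimes\mathrm{id}}:\widetilde M(A\otimes C)\to\widetilde M(B\otimes C)$ with $\overline{\phi\otimes\mathrm{id}}(m)(1\otimes c)=(\phi\otimes\mathrm{id})(m(1\otimes c))$. Let $\delta_G:C^*(G)\to M(C^*(G)\otimes C^*(G))$ be the comultiplication, $\delta_G(s)=s\otimes s$ for $s\in G$. **Coactions.** A coaction $(A,\delta)$ of $G$ is a $C^*$-algebra $A$ with an injective nondegenerate homomorphism $\delta:A\to \widetilde M(A\otimes C^*(G))\subset M(A\otimes C^*(G))$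 such that $(\delta\otimes\mathrm{id})\circ\delta=(\mathrm{id}\otimes\delta_G)\circ\delta$ and $\overline{\mathrm{span}}\,\delta(A)(1\otimes C^*(G))=A\otimes C^*(G)$. The category $\mathbf{Coact}$ has coactions of $G$ as objects; a morphism $\phi:(A,\delta)\to(B,\epsilon)$ is a homomorphism $\phi:A\to B$ (not into multipliers) with $\epsilon\circ\phi=\overline{\phi\otimes\mathrm{id}}\circ\delta$. A short exact sequence of coactions is a sequence $0\to(I,\gamma)\to(A,\delta)\to(B,\epsilon)\to0$ in $\mathbf{Coact}$ whose underlying sequence of $C^*$-algebras is exact. **Crossed products.** Let $w_G\in M(C_0(G)\otimes C^*(G))$ be the unitary function $w_G(s)=s$. $(A\rtimes_\delta G,j_A,j_G)$ is the crossed product, universal for pairs of nondegenerate homomorphisms $\pi:A\to M(C)$, $\mu:C_0(G)\to M(C)$ satisfying $(\pi\otimes\mathrm{id})\circ\delta(a)=\mathrm{Ad}\,(\mu\otimes\mathrm{id})(w_G)(\pi(a)\otimes1)$; it carries the dual action $\widehat\delta$ of $G$ (fixing $j_A(A)$ and acting by right translation on $j_G(C_0(G))$). It is functorial on $\mathbf{Coact}$, $\phi\mapsto\phi\rtimes G$. With $\lambda,\rho$ the left and right regular representations and $M$ the multiplication representation of $C_0(G)$ on $L^2(G)$, there is a canonical surjection $\Phi=\big((\mathrm{id}\otimes\lambda)\circ\delta\times(1\otimes M)\big)\times(1\otimes\rho):A\rtimes_\delta G\rtimes_{\widehat\delta}G\to A\otimes\mathcal K$. The coaction is maximal if $\Phi$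 is an isomorphism, and normal if $\Phi$ factors through an isomorphism $A\rtimes_\delta G\rtimes_{\widehat\delta,r}G\cong A\otimes\mathcal K$. **Maximalization and normalization.** Every coaction $(A,\delta)$ has a maximalization: a maximal coaction $(A^m,\delta^m)$ and a surjective morphism $q^m_A:(A^m,\delta^m)\to(A,\delta)$ with $q^m_A\rtimes G$ an isomorphism; and a normalization: a normal coaction $(A^n,\delta^n)$ and a surjective morphism $\Lambda_A:(A,\delta)\to(A^n,\delta^n)$ with $\Lambda_A\rtimes G$ an isomorphism. Both are unique up to isomorphism and, after choices, functors on $\mathbf{Coact}$ with $q^m$, $\Lambda$ natural. One identifies $A^{mn}=A^n$, so $\Lambda_{A^m}=\Lambda_A\circ q^m_A:A^m\to A^n$. **Coaction functors.** A coaction functor is a functor $\tau:(A,\delta)\mapsto(A^\tau,\delta^\tau)$ on $\mathbf{Coact}$ together with a natural transformation $q^\tau$ from maximalization to $\tau$ such that for every $(A,\delta)$ the map $q^\tau_A:A^m\to A^\tau$ is surjective and $\ker q^\tau_A\subset\ker\Lambda_{A^m}$; then $\Lambda_{A^m}=\Lambda^\tau_A\circ q^\tau_A$ for a unique surjection $\Lambda^\tau_A:A^\tau\to A^n$. Put $A^m_\tau:=\ker q^\tau_A$. Write $\tau_1\le\tau_2$ if $A^m_{\tau_2}\subset A^m_{\tau_1}$ for every coaction $(A,\delta)$. $\tau$ is exact if it takes short exact sequences of coactions to short exact sequences. **Morita compatibility of coaction functors.** An $(A,\delta)-(B,\epsilon)$ imprimitivity bimodule $(X,\zeta)$ is an $A-B$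 imprimitivity bimodule $X$ with a $\delta-\epsilon$ compatible coaction $\zeta:X\to M(X\otimes C^*(G))$; equivalently $\delta,\zeta,\epsilon$ combine to a coaction on the linking algebra $L(X)$. Let $Y=X\rtimes_\zeta G\rtimes_{\widehat\zeta}G$ be the upper right corner of the double crossed product of $L(X)$, an $(A\rtimes_\delta G\rtimes_{\widehat\delta}G)-(B\rtimes_\epsilon G\rtimes_{\widehat\epsilon}G)$ imprimitivity bimodule. Using the isomorphisms $A\rtimes_\delta G\rtimes_{\widehat\delta}G\cong A^m\rtimes_{\delta^m}G\rtimes_{\widehat{\delta^m}}G\cong A^m\otimes\mathcal K$ (inverse of $q^m_A\rtimes G\rtimes G$, then $\Phi$ for $A^m$), and likewise for $B$, regard $Y$ as an $(A^m\otimes\mathcal K)-(B^m\otimes\mathcal K)$ imprimitivity bimodule. Put $X^m=\{m\in M(Y):(1\otimes k)\cdot m=m\cdot(1\otimes k)\in Y\text{ for all }k\in\mathcal K\}$, which is an $A^m-B^m$ imprimitivity bimodule (identifying $A^m=A^m\otimes1$, $B^m=B^m\otimes1$). The coaction functor $\tau$ is Morita compatible if for every such $(X,\zeta)$ the Rieffel correspondence of ideals given by $X^m$ satisfies $X^m\text{-}\mathrm{Ind}\,B^m_\tau=A^m_\tau$. **Crossed-product functors (in the sense of Baum–Guentner–Willett).** Morphisms of actions $(A,\alpha)\to(B,\beta)$ are $G$-equivariant homomorphisms $A\to B$. The full crossed product $A\rtimes_\alpha G$, with canonical maps $i_A,i_G$, carries the dual coaction $\widehat\alpha(i_A(a)i_G(c))=(i_A(a)\otimes1)(i_G\otimes\mathrm{id})(\delta_G(c))$,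 which is maximal, with normalization the regular representation $A\rtimes_\alpha G\to A\rtimes_{\alpha,r}G$; so one takes $(A\rtimes_\alpha G)^m=A\rtimes_\alpha G$ and $(A\rtimes_\alpha G)^n=A\rtimes_{\alpha,r}G$. A crossed-product functor is a functor $(A,\alpha)\mapsto A\rtimes_{\alpha,\sigma}G$ from actions to $C^*$-algebras with natural transformations $A\rtimes_\alpha G\to A\rtimes_{\alpha,\sigma}G\to A\rtimes_{\alpha,r}G$ composing to the regular representation, the first map being surjective; for $\sigma$ coming from $\tau$ these are $q^\tau_{A\rtimes_\alpha G}$ and $\Lambda^\tau_{A\rtimes_\alpha G}$. $\sigma$ is exact if it takes short exact sequences of actions to short exact sequences of $C^*$-algebras. $\sigma$ is Morita compatible if, for every action $(A,\alpha)$, the unwinding isomorphism $(A\otimes\mathcal K)\rtimes_{\alpha\otimes\mathrm{Ad}\lambda}G\to(A\rtimes_\alpha G)\otimes\mathcal K$, the integrated form of the covariant pair $\pi(a\otimes k)=i_A(a)\otimes k$, $u_s=i_G(s)\otimes\lambda_s$, descends to an isomorphism $(A\otimes\mathcal K)\rtimes_{\alpha\otimes\mathrm{Ad}\lambda,\sigma}G\cong(A\rtimes_{\alpha,\sigma}G)\otimes\mathcal K$. Write $\sigma_1\le\sigma_2$ if for every action the natural surjection $A\rtimes_{\alpha,\sigma_2}G\to A\rtimes_{\alpha,r}G$ factors through the natural surjection $A\rtimes_{\alpha,\sigma_1}G\to A\rtimes_{\alpha,r}G$. *)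

(* Defs.v *)
From HB Require Import structures.
From mathcomp Require Import all_boot all_order all_algebra.
From mathcomp Require Import all_classical all_reals all_analysis.
From mathcomp Require Import complex.
Set Implicit Arguments.
Unset Strict Implicit.
Unset Printing Implicit Defensive.
Import Order.TTheory GRing.Theory Num.Theory.
Import numFieldNormedType.Exports.
Local Open Scope classical_set_scope.
Local Open Scope ring_scope.

HB.mixin Record Lmodule_isStarAlgebra (K : numClosedFieldType) A
    of GRing.Lmodule K A := {
  smul : A -> A -> A;
  star : A -> A;
  smulA : forall x y z, smul x (smul y z) = smul (smul x y) z;
  smulDl : forall x y z, smul (x + y) z = smul x z + smul y z;
  smulDr : forall x y z, smul x (y + z) = smul x y + smul x z;
  smulZl : forall c x y, smul (c *: x) y = c *: smul x y;
  smulZr : forall c x y, smul x (c *: y) = c *: smul x y;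
  starK : involutive star;
  starD : forall x y, star (x + y) = star x + star y;
  starZ : forall c x, star (c *: x) = Num.conj c *: star x;
  starM : forall x y, star (smul x y) = smul (star y) (star x)
}.
#[short(type="starAlgType")]
HB.structure Definition StarAlgebra (K : numClosedFieldType) :=
  {A of GRing.Lmodule K A & Lmodule_isStarAlgebra K A}.

Notation "x ** y" := (smul x y) (at level 40, left associativity) : ring_scope.

HB.mixin Record isCStar (R : realType) A
    of StarAlgebra R[i] A & CompleteNormedModule R[i] A := {
  cstar_normM : forall x y : A, `|x ** y| <= `|x| * `|y|;
  cstar_normC : forall x : A, `|star x ** x| = `|x| ^+ 2
}.
#[short(type="cstarType")]
HB.structure Definition CStar (R : realType) :=
  {A of StarAlgebra R[i] A & CompleteNormedModule R[i] A & isCStar R A}.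

Definition starhom (K : numClosedFieldType) (A B : starAlgType K) (f : A -> B) :=
  [/\ linear f, forall x y, f (x ** y) = f x ** f y
    & forall x, f (star x) = star (f x)].

(** Double centralizers.  Linearity and boundedness of both maps follow from
    the identity relating them. *)
Record mult (R : realType) (A : cstarType R) := Mult {
  ml : A -> A;
  mr : A -> A;
  mlr : forall a b, a ** ml b = mr a ** b
}.

HB.instance Definition _ (R : realType) (A : cstarType R) :=
  gen_eqMixin (mult A).
HB.instance Definition _ (R : realType) (A : cstarType R) :=
  gen_choiceMixin (mult A).

Section Multipliers.
Variables (R : realType) (A : cstarType R).
Implicit Types (a b : A) (m n p : mult A).

Lemma star0 : star (0 : A) = 0.
Proof. by apply: (@addrI _ (star 0)); rewrite -starD !addr0. Qed.

Lemma smulr0 a : a ** 0 = 0.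
Proof. by rewrite -(scale0r (0 : A)) smulZr !scale0r. Qed.

Lemma smul0r a : 0 ** a = 0.
Proof. by rewrite -(scale0r (0 : A)) smulZl !scale0r. Qed.

Lemma star_smul_eq0 a : star a ** a = 0 -> a = 0.
Proof.
move=> h; apply/eqP; rewrite -normr_eq0 -sqrf_eq0.
by rewrite -cstar_normC h normr0.
Qed.

Lemma smul_injr a b : (forall c, c ** a = c ** b) -> a = b.
Proof.
move=> h; apply/eqP; rewrite -subr_eq0; apply/eqP; apply: star_smul_eq0.
by rewrite -scaleN1r smulDr smulZr h !scaleN1r subrr.
Qed.

Lemma smul_injl a b : (forall c, a ** c = b ** c) -> a = b.
Proof.
move=> h; apply: (can_inj starK); apply: smul_injr => c.
by apply: (can_inj starK); rewrite !starM !starK h.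
Qed.

Lemma mult_ext m n : ml m =1 ml n -> mr m =1 mr n -> m = n.
Proof.
case: m n => [l r h] [l' r' h'] /= /funext El /funext Er.
by subst; congr Mult; apply: Prop_irrelevance.
Qed.

Lemma mlD m a b : ml m (a + b) = ml m a + ml m b.
Proof. by apply: smul_injr => c; rewrite smulDr !mlr smulDr. Qed.
Lemma mlZ m k a : ml m (k *: a) = k *: ml m a.
Proof. by apply: smul_injr => c; rewrite smulZr !mlr smulZr. Qed.
Lemma mrD m a b : mr m (a + b) = mr m a + mr m b.
Proof. by apply: smul_injl => c; rewrite smulDl -!mlr smulDl. Qed.
Lemma mrZ m k a : mr m (k *: a) = k *: mr m a.
Proof. by apply: smul_injl => c; rewrite smulZl -!mlr smulZl. Qed.

Definition mzero : mult A.
Proof. by exists (fun=> 0) (fun=> 0) => a b; rewrite smulr0 smul0r. Defined.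

Definition mone : mult A.
Proof. by exists id id. Defined.

Definition madd m n : mult A.
Proof.
exists (fun a => ml m a + ml n a) (fun a => mr m a + mr n a) => a b.
by rewrite smulDr smulDl !mlr.
Defined.

Definition mscale (k : R[i]) m : mult A.
Proof.
exists (fun a => k *: ml m a) (fun a => k *: mr m a) => a b.
by rewrite smulZr smulZl mlr.
Defined.

Definition mopp m := mscale (- 1) m.

Definition mmul m n : mult A.
Proof.
by exists (fun a => ml m (ml n a)) (fun a => mr n (mr m a)) => a b; rewrite !mlr.
Defined.

Definition mstar m : mult A.
Proof.
exists (fun a => star (mr m (star a))) (fun a => star (ml m (star a))) => a b.
by rewrite -{1}[a]starK -[b in RHS]starK -!starM mlr.
Defined.

Definition emb a : mult A.
Proof. by exists (fun b => a ** b) (fun b => b ** a) => b c; rewrite smulA. Defined.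

Fact maddA : associative madd.
Proof. by move=> m n p; apply: mult_ext => a /=; rewrite addrA. Qed.
Fact maddC : commutative madd.
Proof. by move=> m n; apply: mult_ext => a /=; rewrite addrC. Qed.
Fact madd0 : left_id mzero madd.
Proof. by move=> m; apply: mult_ext => a /=; rewrite add0r. Qed.
Fact maddN : left_inverse mzero mopp madd.
Proof. by move=> m; apply: mult_ext => a /=; rewrite scaleN1r addNr. Qed.
HB.instance Definition _ :=
  GRing.isZmodule.Build (mult A) maddA maddC madd0 maddN.

Fact mscaleA k l m : mscale k (mscale l m) = mscale (k * l) m.
Proof. by apply: mult_ext => a /=; rewrite scalerA. Qed.
Fact mscale1 : left_id 1 mscale.
Proof. by move=> m; apply: mult_ext => a /=; rewrite scale1r. Qed.
Fact mscaleDr : right_distributive mscale +%R.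
Proof. by move=> k m n; apply: mult_ext => a /=; rewrite scalerDr. Qed.
Fact mscaleDl m : {morph mscale^~ m : k l / k + l}.
Proof. by move=> k l; apply: mult_ext => a /=; rewrite scalerDl. Qed.
HB.instance Definition _ := GRing.Zmodule_isLmodule.Build R[i] (mult A)
  mscaleA mscale1 mscaleDr mscaleDl.

Fact mmulA m n p : mmul m (mmul n p) = mmul (mmul m n) p.
Proof. by apply: mult_ext. Qed.
Fact mmulDl m n p : mmul (m + n) p = mmul m p + mmul n p.
Proof. by apply: mult_ext => a //=; rewrite mrD. Qed.
Fact mmulDr m n p : mmul m (n + p) = mmul m n + mmul m p.
Proof. by apply: mult_ext => a //=; rewrite mlD. Qed.
Fact mmulZl k m n : mmul (k *: m) n = k *: mmul m n.
Proof. by apply: mult_ext => a //=; rewrite mrZ. Qed.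
Fact mmulZr k m n : mmul m (k *: n) = k *: mmul m n.
Proof. by apply: mult_ext => a //=; rewrite mlZ. Qed.
Fact mstarK : involutive mstar.
Proof. by move=> m; apply: mult_ext => a /=; rewrite !starK. Qed.
Fact mstarD m n : mstar (m + n) = mstar m + mstar n.
Proof. by apply: mult_ext => a /=; rewrite starD. Qed.
Fact mstarZ k m : mstar (k *: m) = Num.conj k *: mstar m.
Proof. by apply: mult_ext => a /=; rewrite starZ. Qed.
Fact mstarM m n : mstar (mmul m n) = mmul (mstar n) (mstar m).
Proof. by apply: mult_ext => a /=; rewrite starK. Qed.
HB.instance Definition _ := Lmodule_isStarAlgebra.Build R[i] (mult A)
  mmulA mmulDl mmulDr mmulZl mmulZr mstarK mstarD mstarZ mstarM.

End Multipliers.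

Definition cspan (R : realType) (V : normedModType R[i]) (S : set V) : set V :=
  closure [set x | exists n (c : 'I_n -> R[i]) (v : 'I_n -> V),
    (forall i, S (v i)) /\ x = \sum_i c i *: v i].

Definition nondeg (R : realType) (A B : cstarType R) (f : A -> mult B) :=
  cspan [set y | exists a b, y = ml (f a) b] = setT.

(** Maps that exist and are determined by their values on a dense set are
    introduced by [xget]; the default value is irrelevant. *)

(** The canonical extension M(A) -> M(B) of a nondegenerate f : A -> M(B). *)
Definition ext (R : realType) (A B : cstarType R) (f : A -> mult B)
    (m : mult A) : mult B :=
  xget (mone B) [set n | forall a, n ** f a = f (ml m a)].

(** The extension M(A) -> p M(B) p of f : A -> B, for p a projection in M(B)
    such that f is nondegenerate as a map into p B p. *)
Definition cext (R : realType) (A B : cstarType R) (p : mult B) (f : A -> B)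
    (m : mult A) : mult B :=
  xget (mone B) [set n | [/\ p ** n = n, n ** p = n
    & forall a, n ** emb (f a) = emb (f (ml m a))]].

Definition inv_of (A B : choiceType) (x0 : A) (f : A -> B) (y : B) : A :=
  xget x0 [set x | f x = y].

Record hilbert (R : realType) := Hilbert {
  hil_space :> completeNormedModType R[i];
  ip : hil_space -> hil_space -> R[i];
  ip_linear : forall c x y z, ip (c *: x + y) z = c * ip x z + ip y z;
  ip_conj : forall x y, ip y x = Num.conj (ip x y);
  ip_norm : forall x, ip x x = `|x| ^+ 2
}.

(** Boundedness of each [p a] follows from the existence of its adjoint. *)
Definition is_rep (R : realType) (A : cstarType R) (H : hilbert R)
    (p : A -> H -> H) :=
  [/\ forall a, linear (p a),
      forall c a b x, p (c *: a + b) x = c *: p a x + p b x,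
      forall a b x, p (a ** b) x = p a (p b x)
    & forall a x y, ip (p a x) y = ip x (p (star a) y)].

Definition faithful (R : realType) (A : cstarType R) (H : hilbert R)
    (p : A -> H -> H) := forall a, (forall x, p a x = 0) -> a = 0.

(** [t] exhibits L as the Hilbert space tensor product of H and K; its
    bilinearity follows from the formula for the inner product. *)
Definition is_hilbert_tensor (R : realType) (H K L : hilbert R)
    (t : H -> K -> L) :=
  (forall x y x' y', ip (t x y) (t x' y') = ip x x' * ip y y') /\
  cspan [set z | exists x y, z = t x y] = setT.

Record mintensor (R : realType) (A B : cstarType R) := MinTensor {
  mt_alg :> cstarType R;
  mt : A -> B -> mt_alg;
  mt_linl : forall b, linear (mt^~ b);
  mt_linr : forall a, linear (mt a);
  mt_mul : forall a a' b b', mt a b ** mt a' b' = mt (a ** a') (b ** b');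
  mt_star : forall a b, star (mt a b) = mt (star a) (star b);
  mt_dense : cspan [set x | exists a b, x = mt a b] = setT;
  mt_spatial : forall (H K L : hilbert R) (t : H -> K -> L)
      (p : A -> H -> H) (r : B -> K -> K),
    is_hilbert_tensor t -> is_rep p -> is_rep r ->
    exists w : mt_alg -> L -> L,
      [/\ is_rep w,
          forall a b x y, w (mt a b) (t x y) = t (p a x) (r b y)
        & faithful p -> faithful r -> faithful w]
}.

HB.mixin Record isLocallyCompactGroup G of Group G & Topological G := {
  mulg_cont : continuous (fun x : G * G => (x.1 * x.2)%g);
  invg_cont : continuous (fun x : G => (x^-1)%g);
  lcg_hausdorff : hausdorff_space G;
  lcg_lcompact : locally_compact [set: G]
}.
#[short(type="lcGroupType")]
HB.structure Definition LocallyCompactGroup :=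
  {G of Group G & Topological G & isLocallyCompactGroup G}.

(** Strictly continuous unitary homomorphisms G -> UM(D). *)
Definition is_unirep (R : realType) (G : lcGroupType) (D : cstarType R)
    (v : G -> mult D) :=
  [/\ v 1%g = mone D, forall s t, v (s * t)%g = v s ** v t,
      forall s, star (v s) = v (s^-1)%g
    & forall d, continuous (fun s => ml (v s) d)].

Record group_cstar (R : realType) (G : lcGroupType) := GroupCStar {
  gc_alg :> cstarType R;
  gc_u : G -> mult gc_alg;
  gc_unirep : is_unirep gc_u;
  gc_univ : forall (D : cstarType R) (v : G -> mult D), is_unirep v ->
    exists h : gc_alg -> mult D,
      [/\ starhom h, nondeg h & forall s, ext h (gc_u s) = v s];
  gc_uniq : forall (D : cstarType R) (h k : gc_alg -> mult D),
    starhom h -> nondeg h -> starhom k -> nondeg k ->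
    (forall s, ext h (gc_u s) = ext k (gc_u s)) -> h =1 k
}.

Record c0_alg (R : realType) (G : lcGroupType) := C0Alg {
  c0_car :> cstarType R;
  c0_ev : c0_car -> G -> R[i];
  c0_inj : injective c0_ev;
  c0_range : forall f : G -> R[i], (exists x, c0_ev x = f) <->
    continuous (f : G -> R[i]^o) /\
    forall e : R[i], 0 < e -> compact [set s | e <= `|f s|];
  c0_lin : forall c x y s, c0_ev (c *: x + y) s = c * c0_ev x s + c0_ev y s;
  c0_mul : forall x y s, c0_ev (x ** y) s = c0_ev x s * c0_ev y s;
  c0_star : forall x s, c0_ev (star x) s = Num.conj (c0_ev x s)
}.

Definition cc (R : realType) (G : lcGroupType) (f : G -> R[i]) :=
  continuous (f : G -> R[i]^o) /\
  exists2 K : set G, compact K & forall s, ~ K s -> f s = 0.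

(** Left Haar measure as a Radon integral on C_c(G), with the modular
    function. *)
Record haar (R : realType) (G : lcGroupType) := Haar {
  hr_int : (G -> R[i]) -> R[i];
  hr_lin : forall c f g, cc f -> cc g ->
    hr_int (fun t => c * f t + g t) = c * hr_int f + hr_int g;
  hr_pos : forall f, cc f -> (forall t, 0 <= f t) -> 0 <= hr_int f;
  hr_neq0 : exists2 f, cc f & hr_int f <> 0;
  hr_inv : forall f s, cc f -> hr_int (fun t => f (s * t)%g) = hr_int f;
  hr_mod : G -> R;
  hr_mod_gt0 : forall s, 0 < hr_mod s;
  hr_modE : forall f s, cc f ->
    hr_int (fun t => f (t * s)%g) = (hr_mod s)^-1%:C%C * hr_int f
}.

Record l2_space (R : realType) (G : lcGroupType) (mu : haar R G) := L2Space {
  l2_hil :> hilbert R;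
  l2_of : (G -> R[i]) -> l2_hil;
  l2_ip : forall f g, cc f -> cc g ->
    ip (l2_of f) (l2_of g) = hr_int mu (fun t => f t * Num.conj (g t));
  l2_dense : closure [set l2_of f | f in [set f | cc f]] = setT
}.

Record compact_ops (R : realType) (H : hilbert R) := CompactOps {
  ko_alg :> cstarType R;
  ko_act : ko_alg -> H -> H;
  ko_rep : is_rep ko_act;
  ko_faithful : faithful ko_act;
  ko_rank1 : forall x y, exists k, forall h, ko_act k h = ip h y *: x;
  ko_dense :
    cspan [set k | exists x y, forall h, ko_act k h = ip h y *: x] = setT
}.

(** Models, unique up to canonical isomorphism, of the objects attached to G
    and of the minimal tensor product. *)
Record setting (R : realType) (G : lcGroupType) := Setting {
  tens : forall A B : cstarType R, mintensor A B;
  CG : group_cstar R G;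
  C0G : c0_alg R G;
  hmu : haar R G;
  L2G : l2_space hmu;
  KG : compact_ops L2G
}.

Section Coactions.
Variables (R : realType) (G : lcGroupType) (S : setting R G).
Implicit Types (A B D E : cstarType R) (s t : G).

Definition tp A B : A -> B -> tens S A B := @mt R A B (tens S A B).
Local Notation "a '\ox' b" := (tp a b) (at level 38, left associativity).

(** m (x) n in M(A (x) B) for multipliers m of A and n of B. *)
Definition mtp A B (m : mult A) (n : mult B) : mult (tens S A B) :=
  xget (mone _) [set p | forall a b, ml p (a \ox b) = ml m a \ox ml n b].

(** f (x) g : A (x) B -> D (x) E for homomorphisms f : A -> D, g : B -> E. *)
Definition tmap A B D E (f : A -> D) (g : B -> E) : tens S A B -> tens S D E :=
  xget (fun=> 0) [set h : tens S A B -> tens S D E |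
    starhom h /\ forall a b, h (a \ox b) = f a \ox g b].

(** f (x) g : A (x) B -> M(D (x) E) for nondegenerate homomorphisms
    f : A -> M(D), g : B -> M(E). *)
Definition htp A B D E (f : A -> mult D) (g : B -> mult E) :
    tens S A B -> mult (tens S D E) :=
  xget (fun=> 0) [set h : tens S A B -> mult (tens S D E) |
    starhom h /\ forall a b, h (a \ox b) = mtp (f a) (g b)].

Definition tassoc A B D :
    tens S (tens S A B) D -> tens S A (tens S B D) :=
  xget (fun=> 0)
    [set h : tens S (tens S A B) D -> tens S A (tens S B D) |
     starhom h /\ forall a b d, h (a \ox b \ox d) = a \ox (b \ox d)].

Definition gu s : mult (CG S) := gc_u (CG S) s.

Definition integ D (v : G -> mult D) : CG S -> mult D :=
  xget (fun=> 0) [set h : CG S -> mult D |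
    [/\ starhom h, nondeg h & forall s, ext h (gu s) = v s]].

Definition deltaG : CG S -> mult (tens S (CG S) (CG S)) :=
  integ (fun s => mtp (gu s) (gu s)).

(** The bounded operator on L^2(G) extending [T] on C_c(G). *)
Definition l2_op (T : (G -> R[i]) -> (G -> R[i])) : L2G S -> L2G S :=
  xget (fun=> 0) [set F : L2G S -> L2G S |
    [/\ linear F, continuous F & forall f, cc f ->
      F (l2_of (L2G S) f) = l2_of (L2G S) (T f)]].

(** Bounded operators on L^2(G) as multipliers of the compact operators. *)
Definition op_mult (F : L2G S -> L2G S) : mult (KG S) :=
  xget (mone _) [set m | forall k x, ko_act (ml m k) x = F (ko_act k x)].

Definition lamG s : mult (KG S) :=
  op_mult (l2_op (fun f t => f (s^-1 * t)%g)).
Definition rhoG s : mult (KG S) :=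
  op_mult (l2_op (fun f t => (Num.sqrt (hr_mod (hmu S) s))%:C%C * f (t * s)%g)).
Definition lamC : CG S -> mult (KG S) := integ lamG.
Definition rhoC : CG S -> mult (KG S) := integ rhoG.
Definition MG (g : C0G S) : mult (KG S) :=
  op_mult (l2_op (fun f t => c0_ev g t * f t)).

(** Evaluation at s on C_0(G) (x) D = C_0(G, D), and on D (x) C_0(G). *)
Definition evl D s : tens S (C0G S) D -> D :=
  xget (fun=> 0) [set h : tens S (C0G S) D -> D |
    starhom h /\ forall (g : C0G S) d, h (g \ox d) = c0_ev g s *: d].
Definition evr D s : tens S D (C0G S) -> D :=
  xget (fun=> 0) [set h : tens S D (C0G S) -> D |
    starhom h /\ forall d (g : C0G S), h (d \ox g) = c0_ev g s *: d].

(** The multiplier of C_0(G, C*(G)) given by the function s |-> s. *)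
Definition wG : mult (tens S (C0G S) (CG S)) :=
  xget (mone _) [set w | forall s x, evl s (ml w x) = ml (gu s) (evl s x)].

Definition onec A (c : CG S) : mult (tens S A (CG S)) := mtp (mone A) (emb c).

Record is_coaction A (d : A -> mult (tens S A (CG S))) : Prop := IsCoaction {
  coa_hom : starhom d;
  coa_tilde : forall a c, (exists x, d a ** onec A c = emb x) /\
                          (exists x, onec A c ** d a = emb x);
  coa_inj : injective d;
  coa_nondeg : nondeg d;
  coa_id : forall a,
    ext (@emb R _ \o @tassoc A (CG S) (CG S)) (ext (htp d (@emb R _)) (d a)) =
    ext (htp (@emb R _) deltaG) (d a);
  coa_dense :
    cspan [set x | exists a c, emb x = d a ** onec A c] = setT
}.

Record coaction := Coaction {
  co_alg :> cstarType R;
  co : co_alg -> mult (tens S co_alg (CG S));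
  coP : is_coaction co
}.

Definition is_comor (A B : coaction) (f : A -> B) :=
  starhom f /\ forall a c x, emb x = co a ** onec A c ->
    emb (tmap f id x) = co (f a) ** onec B c.

Definition short_exact A B D (f : A -> B) (g : B -> D) :=
  [/\ injective f, range f = [set b | g b = 0] & range g = setT].

Record is_action A (al : G -> A -> A) : Prop := IsAction {
  act_hom : forall s, starhom (al s);
  act1 : forall a, al 1%g a = a;
  actM : forall s t a, al (s * t)%g a = al s (al t a);
  act_cont : forall a, continuous (al^~ a)
}.

Record action := Action {
  ac_alg :> cstarType R;
  ac : G -> ac_alg -> ac_alg;
  acP : is_action ac
}.

Definition is_acmor (al be : action) (f : al -> be) :=
  starhom f /\ forall s a, f (ac s a) = ac s (f a).

Definition act_covariant (al : action) D (p : al -> mult D) (v : G -> mult D) :=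
  [/\ starhom p, nondeg p, is_unirep v
    & forall s a, p (ac s a) = v s ** p a ** star (v s)].

Record full_cp (al : action) := FullCP {
  fc_alg :> cstarType R;
  iA : al -> mult fc_alg;
  iG : CG S -> mult fc_alg;
  iG_hom : starhom iG;
  iG_nondeg : nondeg iG;
  fc_cov : act_covariant iA (fun s => ext iG (gu s));
  fc_prod : forall a c, exists x, emb x = iA a ** iG c;
  fc_dense : cspan [set x | exists a c, emb x = iA a ** iG c] = setT;
  fc_univ : forall D (p : al -> mult D) (v : G -> mult D), act_covariant p v ->
    exists h : fc_alg -> mult D, [/\ starhom h, nondeg h,
      forall a, ext h (iA a) = p a & forall s, ext h (ext iG (gu s)) = v s];
  fc_co : fc_alg -> mult (tens S fc_alg (CG S));
  fc_coP : is_coaction fc_co;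
  fc_coE : forall a c x, emb x = iA a ** iG c ->
    fc_co x = mtp (iA a) (mone _) ** ext (htp iG (@emb R _)) (deltaG c)
}.

Definition co_covariant (A : coaction) D (p : A -> mult D)
    (m : C0G S -> mult D) :=
  [/\ starhom p, nondeg p, starhom m, nondeg m
    & let W := ext (htp m (@emb R _)) wG in
      forall a, ext (htp p (@emb R _)) (co a) =
                W ** mtp (p a) (mone _) ** star W].

Record co_cp (A : coaction) := CoCP {
  cc_alg :> cstarType R;
  jA : A -> mult cc_alg;
  jG : C0G S -> mult cc_alg;
  cc_cov : co_covariant jA jG;
  cc_prod : forall a g, exists x, emb x = jA a ** jG g;
  cc_dense : cspan [set x | exists a g, emb x = jA a ** jG g] = setT;
  cc_univ : forall D (p : A -> mult D) (m : C0G S -> mult D),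
    co_covariant p m ->
    exists h : cc_alg -> mult D, [/\ starhom h, nondeg h,
      forall a, ext h (jA a) = p a & forall g, ext h (jG g) = m g];
  cc_ac : G -> cc_alg -> cc_alg;
  cc_acP : is_action cc_ac;
  cc_acA : forall s a, ext (@emb R _ \o cc_ac s) (jA a) = jA a;
  cc_acG : forall s (f g : C0G S), (forall t, c0_ev g t = c0_ev f (t * s)%g) ->
    ext (@emb R _ \o cc_ac s) (jG f) = jG g
}.

(** The regular representation of A x_alpha G in M(A (x) K): the integrated
    form of (pi, 1 (x) lambda), with pi a the function t |-> alpha_t^-1 a. *)
Definition ac_tilde (al : action) (a : al) : mult (tens S al (C0G S)) :=
  xget (mone _) [set m | forall t x,
    evr t (ml m x) = ac (t^-1)%g a ** evr t x].

Definition regrep (al : action) (X : full_cp al) : X -> mult (tens S al (KG S)) :=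
  xget (fun=> 0) [set h : X -> mult (tens S al (KG S)) |
    [/\ starhom h, nondeg h,
        forall a, ext h (iA X a) = ext (htp (@emb R _) MG) (ac_tilde a)
      & forall c, ext h (iG X c) = mtp (mone _) (lamC c)]].

Record red_cp (al : action) (X : full_cp al) := RedCP {
  rc_alg :> cstarType R;
  reg : X -> rc_alg;
  reg_hom : starhom reg;
  reg_surj : range reg = setT;
  reg_ker : forall x, reg x = 0 <-> regrep x = 0
}.

End Coactions.

(** Models, unique up to canonical isomorphism, of all crossed products. *)
Record crossed (R : realType) (G : lcGroupType) (S : setting R G) := Crossed {
  cp : forall al : action R G, full_cp S al;
  rcp : forall al : action R G, red_cp (cp al);
  ccp : forall A : coaction S, co_cp A
}.

Section Functors.
Variables (R : realType) (G : lcGroupType) (S : setting R G) (X : crossed S).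
Implicit Types (A B D : coaction S) (al be : action R G).

Local Notation "a '\ox' b" := (tp S a b) (at level 38, left associativity).

Definition dual_co al : coaction S := Coaction (fc_coP (cp X al)).
Definition dual_ac A : action R G := Action (cc_acP (ccp X A)).

(** The functors phi |-> phi x G on actions and on coactions. *)
Definition cpmap al be (f : al -> be) : cp X al -> cp X be :=
  xget (fun=> 0) [set h : cp X al -> cp X be | starhom h /\
    forall a c x, emb x = iA (cp X al) a ** iG (cp X al) c ->
      emb (h x) = iA (cp X be) (f a) ** iG (cp X be) c].

Definition ccpmap A B (f : A -> B) : ccp X A -> ccp X B :=
  xget (fun=> 0) [set h : ccp X A -> ccp X B | starhom h /\
    forall a g x, emb x = jA (ccp X A) a ** jG (ccp X A) g ->
      emb (h x) = jA (ccp X B) (f a) ** jG (ccp X B) g].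

Definition dcp A : full_cp S (dual_ac A) := cp X (dual_ac A).
Definition dcpmap A B (f : A -> B) : dcp A -> dcp B :=
  @cpmap (dual_ac A) (dual_ac B) (ccpmap f).

Definition PhiA A : ccp X A -> mult (tens S A (KG S)) :=
  xget (fun=> 0) [set h : ccp X A -> mult (tens S A (KG S)) |
    [/\ starhom h, nondeg h,
        forall a, ext h (jA (ccp X A) a) = ext (htp (@emb R _) (@lamC R G S)) (co a)
      & forall g, ext h (jG (ccp X A) g) = mtp S (mone _) (MG g)]].

Definition Phi A : dcp A -> tens S A (KG S) :=
  xget (fun=> 0) [set h : dcp A -> tens S A (KG S) |
    [/\ starhom h,
        forall x, ext (@emb R _ \o h) (iA (dcp A) x) = PhiA x
      & forall c, ext (@emb R _ \o h) (iG (dcp A) c) = mtp S (mone _) (rhoC c)]].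

Definition maximal A := bijective (@Phi A).

Definition normal A := exists2 Psi : rcp X (dual_ac A) -> tens S A (KG S),
  starhom Psi /\ bijective Psi & forall x, Phi x = Psi (reg (rcp X (dual_ac A)) x).

(** Functors on Coact.  A morphism is its underlying function, so [f_mor] is
    only meaningful on functions satisfying [is_comor]. *)
Record cofunctor := CoFunctor {
  f_obj :> coaction S -> coaction S;
  f_mor : forall A B, (A -> B) -> f_obj A -> f_obj B;
  f_comor : forall A B (f : A -> B), is_comor f -> is_comor (f_mor f);
  f_id : forall A, f_mor (@id A) =1 id;
  f_comp : forall A B D (f : A -> B) (g : B -> D), is_comor f -> is_comor g ->
    f_mor (g \o f) =1 f_mor g \o f_mor f
}.

Global Arguments f_mor : clear implicits.
Global Arguments f_mor _ {A B} f _.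

(** A choice of maximalizations.  The dual coaction on a full crossed product
    being maximal, it is taken to be its own maximalization: [mx_q] is an
    isomorphism there. *)
Record maximalization := Maximalization {
  mx :> cofunctor;
  mx_max : forall A, maximal (mx A);
  mx_q : forall A, mx A -> A;
  mx_q_mor : forall A, is_comor (mx_q (A := A));
  mx_q_surj : forall A, range (mx_q (A := A)) = setT;
  mx_q_iso : forall A, bijective (ccpmap (mx_q (A := A)));
  mx_q_nat : forall A B (f : A -> B), is_comor f ->
    forall x, mx_q (f_mor mx f x) = f (mx_q x);
  mx_dual : forall al, bijective (mx_q (A := dual_co al))
}.

Global Arguments mx_q : clear implicits.
Global Arguments mx_q _ {A} _.

(** A choice of normalizations.  The normalization of the dual coaction on a
    full crossed product is the regular representation. *)
Record normalization := Normalization {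
  nm :> cofunctor;
  nm_norm : forall A, normal (nm A);
  nm_L : forall A, A -> nm A;
  nm_L_mor : forall A, is_comor (nm_L (A := A));
  nm_L_surj : forall A, range (nm_L (A := A)) = setT;
  nm_L_iso : forall A, bijective (ccpmap (nm_L (A := A)));
  nm_L_nat : forall A B (f : A -> B), is_comor f ->
    forall x, nm_L (f x) = f_mor nm f (nm_L x);
  nm_dual : forall al (x : cp X al),
    nm_L (A := dual_co al) x = 0 <-> reg (rcp X al) x = 0
}.

Global Arguments nm_L : clear implicits.
Global Arguments nm_L _ {A} _.

Variables (M : maximalization) (N : normalization).

(** Lambda of A^m, under the identification A^mn = A^n. *)
Definition Lam_max A (x : M A) : N A := nm_L N (mx_q M x).

Record coaction_functor := CoactionFunctor {
  tau :> cofunctor;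
  tau_q : forall A, M A -> tau A;
  tau_q_mor : forall A, is_comor (tau_q (A := A));
  tau_q_nat : forall A B (f : A -> B), is_comor f ->
    forall x, tau_q (f_mor M f x) = f_mor tau f (tau_q x);
  tau_q_surj : forall A, range (tau_q (A := A)) = setT;
  tau_q_ker : forall A (x : M A), tau_q x = 0 -> Lam_max x = 0
}.

Global Arguments tau_q : clear implicits.
Global Arguments tau_q _ {A} _.

Implicit Types T : coaction_functor.

Definition tau_Lam T A : T A -> N A :=
  xget (fun=> 0) [set h : T A -> N A | forall x, h (tau_q T x) = Lam_max x].

Definition tau_ker T A : set (M A) := [set x | tau_q T x = 0].

Global Arguments tau_ker : clear implicits.

Definition tau_le T1 T2 := forall A, tau_ker T2 A `<=` tau_ker T1 A.

Definition tau_exact T := forall A B D (f : A -> B) (g : B -> D),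
  is_comor f -> is_comor g -> short_exact f g ->
  short_exact (f_mor T f) (f_mor T g).

End Functors.

Definition positive (R : realType) (A : cstarType R) (a : A) :=
  exists b, a = star b ** b.

Record imprim (R : realType) (A B : cstarType R) := Imprim {
  im_space :> completeNormedModType R[i];
  lact : A -> im_space -> im_space;
  ract : im_space -> B -> im_space;
  lip : im_space -> im_space -> A;
  rip : im_space -> im_space -> B;
  lact_linl : forall x, linear (lact^~ x);
  lact_linr : forall a, linear (lact a);
  lactM : forall a a' x, lact (a ** a') x = lact a (lact a' x);
  ract_linl : forall b, linear (ract^~ b);
  ract_linr : forall x, linear (ract x);
  ractM : forall x b b', ract x (b ** b') = ract (ract x b) b';
  lip_lin : forall z, linear (lip^~ z);
  lip_star : forall x y, star (lip x y) = lip y x;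
  lip_act : forall a x y, lip (lact a x) y = a ** lip x y;
  lip_pos : forall x, positive (lip x x);
  rip_lin : forall z, linear (rip z);
  rip_star : forall x y, star (rip x y) = rip y x;
  rip_act : forall x y b, rip x (ract y b) = rip x y ** b;
  rip_pos : forall x, positive (rip x x);
  im_lact : forall a x y, rip (lact a x) y = rip x (lact (star a) y);
  im_ract : forall b x y, lip (ract x b) y = lip x (ract y (star b));
  im_assoc : forall x y z, lact (lip x y) z = ract x (rip y z);
  lip_full : cspan [set a | exists x y, a = lip x y] = setT;
  rip_full : cspan [set b | exists x y, b = rip x y] = setT;
  im_norm : forall x, `|x| ^+ 2 = `|rip x x|
}.

(** The C*-algebra of matrices (a x ; y~ b), with [lkX y] adjoint to y~. *)
Record linking (R : realType) (A B : cstarType R) (Z : imprim A B) := Linking {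
  lk_alg :> cstarType R;
  lkA : A -> lk_alg;
  lkX : Z -> lk_alg;
  lkB : B -> lk_alg;
  lkA_hom : starhom lkA;
  lkB_hom : starhom lkB;
  lkX_lin : linear lkX;
  lk_AX : forall a x, lkA a ** lkX x = lkX (lact a x);
  lk_XB : forall x b, lkX x ** lkB b = lkX (ract x b);
  lk_XX' : forall x y, lkX x ** star (lkX y) = lkA (lip x y);
  lk_X'X : forall x y, star (lkX x) ** lkX y = lkB (rip x y);
  lk_AB : forall a b, lkA a ** lkB b = 0;
  lk_XA : forall x a, lkX x ** lkA a = 0;
  lk_BX : forall b x, lkB b ** lkX x = 0;
  lk_XX : forall x y, lkX x ** lkX y = 0;
  lk_span : forall l, exists a x y b, l = lkA a + lkX x + star (lkX y) + lkB b;
  lk_free : forall a x y b, lkA a + lkX x + star (lkX y) + lkB b = 0 ->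
    [/\ a = 0, x = 0, y = 0 & b = 0]
}.

Definition lk_p (R : realType) (A B : cstarType R) (Z : imprim A B)
    (L : linking Z) : mult L :=
  xget (mone _) [set p | forall a x y b,
    ml p (lkA L a + lkX L x + star (lkX L y) + lkB L b) = lkA L a + lkX L x].

Definition lk_q (R : realType) (A B : cstarType R) (Z : imprim A B)
    (L : linking Z) : mult L :=
  xget (mone _) [set p | forall a x y b,
    ml p (lkA L a + lkX L x + star (lkX L y) + lkB L b)
    = star (lkX L y) + lkB L b].

Section Morita.
Variables (R : realType) (G : lcGroupType) (S : setting R G) (X : crossed S).
Variables (M : maximalization X) (N : normalization X).
Implicit Types (A B : coaction S) (T : coaction_functor M N).

(** A coaction on the imprimitivity bimodule Z, compatible with those of A and
    B, as a coaction on the linking algebra extending them. *)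
Record bimodule_coaction A B (Z : imprim A B) := BimoduleCoaction {
  bc_lk : linking Z;
  bc_co : bc_lk -> mult (tens S bc_lk (CG S));
  bc_coP : is_coaction bc_co;
  bc_A : is_comor (B := Coaction bc_coP) (lkA bc_lk);
  bc_B : is_comor (B := Coaction bc_coP) (lkB bc_lk)
}.

Section Corner.
Variables (A B : coaction S) (Z : imprim A B) (zeta : bimodule_coaction Z).

Definition lk_co : coaction S := Coaction (bc_coP zeta).

Local Notation LL := (dcp X lk_co).

(** The image in M(L(X) x G x G) of a multiplier of L(X). *)
Definition dbl (m : mult lk_co) : mult LL :=
  ext (iA LL) (ext (jA (ccp X lk_co)) m).

Definition pY : mult LL := dbl (lk_p (bc_lk zeta)).
Definition qY : mult LL := dbl (lk_q (bc_lk zeta)).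

(** The identification of A^m (x) K with the corner A x G x G of
    L(X) x G x G, and likewise for B. *)
Definition thA (z : tens S (M A) (KG S)) : LL :=
  dcpmap (B := lk_co) (lkA (bc_lk zeta))
    (dcpmap (mx_q M (A := A)) (inv_of 0 (Phi (A := M A)) z)).
Definition thB (z : tens S (M B) (KG S)) : LL :=
  dcpmap (B := lk_co) (lkB (bc_lk zeta))
    (dcpmap (mx_q M (A := B)) (inv_of 0 (Phi (A := M B)) z)).

(** The actions of M(A^m (x) K) and M(B^m (x) K) on M(Y) = p M(L(Y)) q, where
    L(Y) = L(X) x G x G. *)
Definition thA' : mult (tens S (M A) (KG S)) -> mult LL := cext pY thA.
Definition thB' : mult (tens S (M B) (KG S)) -> mult LL := cext qY thB.

Definition Xmax : set (mult LL) :=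
  [set m | pY ** m ** qY = m /\ forall k : KG S, exists y : LL,
    thA' (mtp S (mone _) (emb k)) ** m = emb y /\
    m ** thB' (mtp S (mone _) (emb k)) = emb y].

(** X^m-Ind J, the closed span of the inner products <x b, y>, for x, y in X^m
    and b in J. *)
Definition ind (J : set (M B)) : set (M A) :=
  cspan [set a | exists x y b, [/\ Xmax x, Xmax y, J b &
    x ** thB' (mtp S (emb b) (mone _)) ** star y =
    thA' (mtp S (emb a) (mone _))]].

End Corner.

Definition tau_morita T := forall A B (Z : imprim A B)
  (zeta : bimodule_coaction Z), ind zeta (tau_ker T B) = tau_ker T A.

(** The data of a crossed-product functor: its values on objects and morphisms,
    and its natural maps from the full and to the reduced crossed product. *)
Record cp_functor := CPFunctor {
  s_obj :> action R G -> cstarType R;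
  s_mor : forall al be : action R G, (al -> be) -> s_obj al -> s_obj be;
  s_q : forall al, cp X al -> s_obj al;
  s_L : forall al, s_obj al -> rcp X al
}.

Global Arguments s_mor : clear implicits.
Global Arguments s_mor _ {al be} f _.
Global Arguments s_q : clear implicits.
Global Arguments s_q _ {al} _.
Global Arguments s_L : clear implicits.
Global Arguments s_L _ {al} _.

Implicit Types F : cp_functor.

Definition cp_exact F := forall (al be ga : action R G) (f : al -> be)
    (g : be -> ga),
  is_acmor f -> is_acmor g -> short_exact f g ->
  short_exact (s_mor F f) (s_mor F g).

(** [be] is alpha (x) Ad lambda; these formulas determine it. *)
Definition is_stabilization (al : action R G)
    (be : G -> tens S al (KG S) -> tens S al (KG S)) :=
  forall s (a : al) (k k' : KG S),
    emb k' = lamG S s ** emb k ** star (lamG S s) ->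
    be s (tp S a k) = tp S (ac s a) k'.

Definition is_unwinding (al be : action R G)
    (i : al -> KG S -> be) (Th : cp X be -> tens S (cp X al) (KG S)) :=
  [/\ starhom Th,
      forall a k, ext (@emb R _ \o Th) (iA (cp X be) (i a k)) =
                  mtp S (iA (cp X al) a) (emb k)
    & forall s, ext (@emb R _ \o Th) (ext (iG (cp X be)) (gu S s)) =
                mtp S (ext (iG (cp X al)) (gu S s)) (lamG S s)].

Definition cp_morita F := forall (al : action R G) b (bP : is_action b),
  is_stabilization (al := al) b ->
  let be := Action bP in
  exists2 Th : cp X be -> tens S (cp X al) (KG S),
    is_unwinding (be := be) (fun (a : al) k => tp S a k) Th &
    exists Ths : F be -> tens S (F al) (KG S),
      [/\ starhom Ths, bijective Ths
        & forall x, Ths (s_q F x) = tmap (s_q F (al := al)) id (Th x)].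

Definition cp_le F1 F2 := forall al : action R G,
  exists2 h : F2 al -> F1 al, starhom h &
    forall y, s_L F1 (h y) = s_L F2 y.

(** The identification of (A x G)^n with the reduced crossed product. *)
Definition dual_nm (al : action R G) : N (dual_co X al) -> rcp X al :=
  xget (fun=> 0) [set h : N (dual_co X al) -> rcp X al |
    forall x : cp X al, h (nm_L N (A := dual_co X al) x) = reg (rcp X al) x].

(** The crossed-product functor associated with T, where A x G is identified
    with its maximalization along [mx_q]. *)
Definition assoc_cp T : cp_functor := CPFunctor
  (fun al be (f : al -> be) => f_mor T (@cpmap _ _ _ X al be f
     : dual_co X al -> dual_co X be))
  (fun al x => tau_q T (inv_of 0 (mx_q M (A := dual_co X al)) x))
  (fun al y => dual_nm (tau_Lam y)).

End Morita.

(* Main.v *)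
From HB Require Import structures.
Require Import Defs.
From mathcomp Require Import all_boot all_order all_algebra.
From mathcomp Require Import all_classical all_reals all_analysis.
From mathcomp Require Import complex ring lra.
Set Implicit Arguments.
Unset Strict Implicit.
Unset Printing Implicit Defensive.
Import Order.TTheory GRing.Theory Num.Theory.
Import numFieldNormedType.Exports.
Local Open Scope classical_set_scope.
Local Open Scope ring_scope.

Reserved Notation "a '\ox' b" (at level 38, left associativity).
Local Notation Re := complex.Re.
Local Notation Im := complex.Im.

(** An exact sequence of actions induces an exact sequence of full crossed products
    and of their dual coactions, so exactness of [tau] passes to [sigma]; the order
    is inherited by evaluating at dual coactions and using that the maps to the
    reduced crossed products are determined on the common full crossed product.

    For Morita compatibility one must see that, after unwinding, the kernel of
    [q^tau] on [(A (x) K) x G] is [ker q (x) K], where [q] is [q^tau] on [A x G].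
    Put [L = L^2(G) + C].  The unwinding isomorphism for [L] in place of [L^2(G)]
    exhibits [(A x G) (x) K(L)] as the crossed product of [A (x) K(L)], and cutting
    down by the two coordinate projections makes it the linking algebra of a
    coaction imprimitivity bimodule between [(A (x) K) x G] and [A x G].  Katayama
    duality identifies the double crossed product of that bimodule, hence [X^m],
    and the Rieffel correspondence sends [ker q] to [ker q (x) K]; finally the
    minimal tensor product with the compact operators preserves exactness. *)

(** Group algebras and crossed products are known through universal properties only, so no integral
    formula leads from $G$ to $C^*(G)$: statements about group elements reach integrated forms
    through the uniqueness clause [gc_uniq], applied after conjugation by a unitary or after
    restriction to an invariant subspace. Those properties speak of nondegenerate maps, whereas
    inclusions of ideals and corners are degenerate; ideals are treated by restricting multipliers
    to them, corners by the extension [cext] cut down by a projection. The line added to $L^2(G)$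
    carries the trivial representation, so that its corner is $A\rtimes G$ itself and not a twisted
    copy. Canonical maps are chosen by [xget]; bijectivity of a chosen map excludes its default
    value except on the zero algebra. Injectivity of $A\to M(A\rtimes G)$, obtained from induced
    representations, makes the duality map faithful on single crossed products. *)

(** A decision procedure for identities between linear combinations: atoms are
    numbered, and the coefficients of each atom are compared. *)
Section LinearTerms.
Variables (K : comPzRingType) (V : lmodType K).

Inductive lterm := LVar of nat | LZero | LAdd of lterm & lterm | LOpp of lterm
  | LScale of K & lterm.

Fixpoint leval (env : seq V) t := match t with
  | LVar n => nth 0 env n | LZero => 0 | LAdd s t => leval env s + leval env t
  | LOpp t => - leval env t | LScale c t => c *: leval env t end.

Fixpoint lcoef t (i : nat) : K := match t with
  | LVar n => if Nat.eqb n i then 1 else 0 | LZero => 0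
  | LAdd s t => lcoef s i + lcoef t i
  | LOpp t => - lcoef t i | LScale c t => c * lcoef t i end.

Fixpoint lvars_ok n t := match t with
  | LVar k => Nat.ltb k n | LZero => true
  | LAdd s t => lvars_ok n s && lvars_ok n t
  | LOpp t => lvars_ok n t | LScale _ t => lvars_ok n t end.

Fixpoint lsame n s t := if n is n'.+1 then lcoef s n' = lcoef t n' /\ lsame n' s t
  else True.

Lemma levalE env t : lvars_ok (size env) t ->
  leval env t = \sum_(i < size env) lcoef t i *: nth 0 env i.
Proof.
elim: t => [n|_|s ihs t iht /andP[/ihs es /iht et]|t ih /ih et|c t ih /ih et] /=.
- move=> /PeanoNat.Nat.ltb_lt /ssrnat.ltP hn.
  rewrite (bigD1 (Ordinal hn)) //= PeanoNat.Nat.eqb_refl scale1r big1 ?addr0 // => i ni.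
  case: PeanoNat.Nat.eqb_spec => [e|_]; last by rewrite scale0r.
  by move: ni; rewrite -val_eqE /= e eqxx.
- by rewrite big1 // => i _; rewrite scale0r.
- by rewrite es et -big_split /=; apply: eq_bigr => i _; rewrite scalerDl.
- by rewrite et -sumrN; apply: eq_bigr => i _; rewrite scaleNr.
- by rewrite et scaler_sumr; apply: eq_bigr => i _; rewrite scalerA.
Qed.

Lemma leval_eq env s t : lvars_ok (size env) s && lvars_ok (size env) t ->
  lsame (size env) s t -> leval env s = leval env t.
Proof.
move=> /andP[/levalE -> /levalE ->] h; apply: eq_bigr => -[i hi] _ /=; congr (_ *: _).
elim: (size env) hi h => [//|n ih]; rewrite ltnS leq_eqVlt => /orP[/eqP -> []//|/ih h [_ /h]].
by [].
Qed.

End LinearTerms.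

(** The nested [match goal] runs a unification for its success alone while a term is being built, so
    that two atoms count as equal when they unify and not only when they are syntactically the
    same. *)
Ltac lmem x env := match env with
  | nil => constr:(false)
  | ?y :: ?l => match goal with
     | _ => let _ := match goal with _ => first [constr_eq x y | unify x y] end in constr:(true)
     | _ => lmem x l end end.
Ltac lindex x env := match env with
  | ?y :: ?l => match goal with
     | _ => let _ := match goal with _ => first [constr_eq x y | unify x y] end in constr:(O)
     | _ => let n := lindex x l in constr:(S n) end end.
Ltac latoms t env := match t with
  | @GRing.add _ ?a ?b => let e := latoms a env in latoms b e
  | @GRing.opp _ ?a => latoms a env
  | @GRing.scale _ _ _ ?a => latoms a env
  | @GRing.zero _ => env
  | _ => let b := lmem t env in match b with true => env | false => constr:(t :: env) end
  end.
Ltac lquote K t env := match t with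
  | @GRing.add _ ?a ?b => let x := lquote K a env in let y := lquote K b env in
      constr:(@LAdd K x y)
  | @GRing.opp _ ?a => let x := lquote K a env in constr:(@LOpp K x)
  | @GRing.scale _ _ ?c ?a => let x := lquote K a env in constr:(@LScale K c x)
  | @GRing.zero _ => constr:(@LZero K)
  | _ => let n := lindex t env in constr:(@LVar K n)
  end.
Ltac lmod_core K V := match goal with |- ?l = ?r =>
  let e0 := latoms l (@nil V) in let env := latoms r e0 in
  let s := lquote K l env in let t := lquote K r env in
  refine (@leval_eq K V env s t isT _); cbn [lsame lcoef size PeanoNat.Nat.eqb];
  repeat split end.
Ltac lmod R := match goal with |- @eq ?T _ _ =>
  lmod_core (R[i] : comPzRingType) (T : lmodType R[i]) end.

(** * Real-valued norms, sequences, closed subspaces and extension by continuity *)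

Section RealNorm.
Variable R : realType.
Implicit Types (V W : normedZmodType R[i]).

(** Norms over [R[i]] are complex numbers; the real part is taken so that estimates live in the
    ordered field [R], where [lra] and [nra] apply. *)
Definition rn V (x : V) : R := Re `|x|.

Lemma rnE V (x : V) : `|x| = (rn x)%:C%C.
Proof. by rewrite RRe_real // normr_real. Qed.

Lemma rn_ge0 V (x : V) : 0 <= rn x.
Proof. by rewrite -lecR -rnE normr_ge0. Qed.

Lemma rn0 V : rn (0 : V) = 0.
Proof. by rewrite /rn normr0. Qed.

Lemma rn_eq0 V (x : V) : rn x = 0 -> x = 0.
Proof. by move=> h; apply/eqP; rewrite -normr_eq0 rnE h. Qed.

Lemma rn_le0 V (x : V) : rn x <= 0 -> x = 0.
Proof. by move=> h; apply: rn_eq0; apply/eqP; rewrite eq_le h rn_ge0. Qed.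

Lemma rnD V (x y : V) : rn (x + y) <= rn x + rn y.
Proof. by rewrite -lecR rmorphD /= -!rnE ler_normD. Qed.

Lemma rnN V (x : V) : rn (- x) = rn x.
Proof. by rewrite /rn normrN. Qed.

Lemma rnC V (x y : V) : rn (x - y) = rn (y - x).
Proof. by rewrite -rnN opprB. Qed.

Lemma rn_tri V (x y z : V) : rn (x - z) <= rn (x - y) + rn (y - z).
Proof. by rewrite -[x - z](subrKA y) rnD. Qed.

Lemma rn_leD V (x y : V) : rn x <= rn y + rn (x - y).
Proof. by rewrite -{1}[x](subrK y) addrC rnD. Qed.

Lemma rnZ (V : normedModType R[i]) (c : R[i]) (x : V) :
  rn (c *: x) = rn c * rn x.
Proof. by apply: complexI; rewrite rmorphM /= -!rnE normrZ. Qed.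

Lemma rn_real (r : R) : rn (r%:C%C : R[i]) = `|r|.
Proof. by rewrite /rn normc_def /= expr0n addr0 sqrtr_sqr. Qed.

Lemma rnM (a b : R[i]) : rn (a * b) = rn a * rn b.
Proof. by apply: complexI; rewrite rmorphM /= -!rnE normrM. Qed.

Lemma rn1 : rn (1 : R[i]) = 1.
Proof. by rewrite /rn normr1. Qed.

Lemma rn_conj (a : R[i]) : rn (a^*) = rn a.
Proof. by rewrite /rn norm_conjC. Qed.

Lemma rnZr (V : normedModType R[i]) (c : R) (x : V) : 0 <= c ->
  rn (c%:C%C *: x) = c * rn x.
Proof. by move=> h; rewrite rnZ rn_real ger0_norm. Qed.

Definition cvs V (u : nat -> V) l :=
  forall e : R, 0 < e -> exists N, forall n, (N <= n)%N -> rn (u n - l) < e.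

Definition cauchys V (u : nat -> V) := forall e : R, 0 < e ->
  exists N, forall m n, (N <= m)%N -> (N <= n)%N -> rn (u m - u n) < e.

Lemma le0_eps (x : R) : (forall e, 0 < e -> x <= e) -> x <= 0.
Proof.
move=> h; rewrite leNgt; apply/negP => x0.
by have := h (x / 2) ltac:(lra); lra.
Qed.

Lemma le_eps (x y : R) : (forall e, 0 < e -> x <= y + e) -> x <= y.
Proof.
by move=> h; rewrite -subr_le0; apply: le0_eps => e /h; lra.
Qed.

Lemma cvs_unique V (u : nat -> V) l l' : cvs u l -> cvs u l' -> l = l'.
Proof.
move=> h h'; apply/eqP; rewrite -subr_eq0; apply/eqP; apply: rn_le0.
apply: le0_eps => e e0.
have e2 : 0 < e / 2 by lra.
have [N hN] := h _ e2; have [N' hN'] := h' _ e2.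
have := hN (maxn N N') (leq_maxl _ _); have := hN' (maxn N N') (leq_maxr _ _).
have := rn_tri l (u (maxn N N')) l'; rewrite (rnC l (u _)); lra.
Qed.

Lemma cvs_cst V (l : V) : cvs (fun=> l) l.
Proof. by move=> e e0; exists 0%N => n _; rewrite subrr rn0. Qed.

Lemma cvs_cauchy V (u : nat -> V) l : cvs u l -> cauchys u.
Proof.
move=> h e e0; have [N hN] := h (e / 2) ltac:(lra).
exists N => m n /hN hm /hN hn; have := rn_tri (u m) l (u n).
by rewrite (rnC l); lra.
Qed.

Lemma cvsD V (u v : nat -> V) l m : cvs u l -> cvs v m ->
  cvs (fun n => u n + v n) (l + m).
Proof.
move=> hu hv e e0; have [N hN] := hu (e / 2) ltac:(lra).
have [N' hN'] := hv (e / 2) ltac:(lra).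
exists (maxn N N') => n; rewrite geq_max => /andP[/hN h1 /hN' h2].
by rewrite opprD addrACA; apply: (le_lt_trans (rnD _ _)); lra.
Qed.

Lemma cvs_le V (u : nat -> V) l (M : R) : cvs u l ->
  (exists N, forall n, (N <= n)%N -> rn (u n) <= M) -> rn l <= M.
Proof.
move=> h [K hK]; apply: le_eps => e e0; have [N hN] := h e e0.
have := rn_leD l (u (maxn N K)); have := hN _ (leq_maxl N K).
have := hK _ (leq_maxr N K); rewrite rnC; lra.
Qed.

Lemma cvs_comp V W (f : V -> W) (M : R) (u : nat -> V) l :
  (forall x y, rn (f x - f y) <= M * rn (x - y)) -> cvs u l ->
  cvs (f \o u) (f l).
Proof.
(* [M] may be negative, hence the positive majorant |M| + 1. *)
move=> hf h e e0; have M0 : 0 < `|M| + 1 by have := normr_ge0 M; lra.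
have [N hN] := h (e / (`|M| + 1)) ltac:(by rewrite divr_gt0).
exists N => n /hN; rewrite ltr_pdivlMr // => h1.
apply: le_lt_trans h1; apply: (le_trans (hf _ _)); rewrite mulrC.
by apply: ler_wpM2l; [exact: rn_ge0 | have := ler_norm M; lra].
Qed.

Lemma cvs_ext V (u v : nat -> V) l : u =1 v -> cvs u l -> cvs v l.
Proof. by move=> h hu e /hu[N hN]; exists N => n /hN; rewrite h. Qed.

Lemma cvs_shift V (u : nat -> V) l : cvs u l -> cvs (fun n => u n.+1) l.
Proof.
by move=> h e /h[N hN]; exists N => n Nn; apply: hN; apply: leq_trans Nn _.
Qed.

Lemma inv_small (e : R) : 0 < e -> exists N, forall n, (N <= n)%N ->
  n.+1%:R^-1 < e.
Proof.
move=> e0; exists (Num.truncn e^-1) => n Nn.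
rewrite invf_plt ?posrE //; apply: (@lt_le_trans _ _ (Num.truncn e^-1).+1%:R).
  exact: truncnS_gt.
by rewrite ler_nat.
Qed.

Lemma inv_gt0 n : 0 < (n.+1%:R : R)^-1.
Proof. by rewrite invr_gt0. Qed.

End RealNorm.

#[global] Hint Extern 0 (is_true (_ <= rn _)) => exact: rn_ge0 : core.

Section SeqTop.
Variable R : realType.
Implicit Types V : normedModType R[i].

Lemma near_ball V (x : V) (A : set V) :
  nbhs x A <-> exists2 e : R, 0 < e & forall y, rn (x - y) < e -> A y.
Proof.
split=> [/nbhs_normP[/= e e0 h]|[e e0 h]].
  exists (Re e); first by move: e0; rewrite ltcE => /andP[].
  move=> y hy; apply: h => /=; rewrite rnE ltcE /= hy andbT.
  by move: e0; rewrite ltcE => /andP[].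
by apply/nbhs_normP; exists e%:C%C => /=; [rewrite ltcR | move=> y /=; rewrite rnE ltcR; apply: h].
Qed.

Lemma closureP V (S : set V) x :
  closure S x <-> forall e : R, 0 < e -> exists2 y, S y & rn (x - y) < e.
Proof.
split=> [h e e0|h A /near_ball[e /h[y Sy xy] hA]]; last first.
  by exists y; split => //; apply: hA.
have [y [Sy xy]] : S `&` [set y | rn (x - y) < e] !=set0.
  by apply: h; apply/near_ball; exists e.
by exists y.
Qed.

Lemma cauchy_cvs (V : completeNormedModType R[i]) (u : nat -> V) :
  cauchys u -> exists l, cvs u l.
Proof.
move=> hu; have : cauchy (u @ \oo).
  apply/cauchyP => e e0.
  have e0' : 0 < Re e by move: e0; rewrite ltcE => /andP[].
  have [N hN] := hu _ e0'; exists (u N); exists N => // n /= Nn.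
  rewrite -ball_normE /= rnE ltcE /= hN // andbT.
  by move: e0; rewrite ltcE => /andP[].
move=> /cauchy_cvg/cvg_ex[l hl]; exists l => e e0.
have /hl[N _ hN] : nbhs l [set y | rn (y - l) < e].
  by apply/near_ball; exists e => // y; rewrite rnC.
by exists N => n /hN.
Qed.

(** In a Cauchy filter pick centres of balls of radius 1/(n+1) that belong to the filter; any two
    such balls meet because the filter is proper, so the centres form a Cauchy sequence. *)
Lemma seq_complete V : (forall u : nat -> V, cauchys u -> exists l, cvs u l) ->
  forall F : set_system V, ProperFilter F -> cauchy F -> cvg F.
Proof.
move=> hV F FF /cauchyP hF.
have ch n : exists x : V, F [set y | rn (x - y) < n.+1%:R^-1].
  have [|x hx] := hF (n.+1%:R^-1)%:C%C; first by rewrite ltcR inv_gt0.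
  exists x; apply: filterS hx => y; rewrite -ball_normE /= rnE ltcR //.
pose u n := projT1 (cid (ch n)).
have Fu n : F [set y | rn (u n - y) < n.+1%:R^-1] by exact: (projT2 (cid (ch n))).
have [l hl] : exists l, cvs u l.
  apply: hV => e e0; have [N hN] := inv_small (e := e / 2) ltac:(lra).
  exists N => m n /hN hm /hN hn.
  have [y [/= h1 h2]] := filter_ex (filterI (Fu m) (Fu n)).
  have := rn_tri (u m) y (u n); rewrite (rnC y (u n)).
  by have := lt_trans h1 hm; have := lt_trans h2 hn; lra.
apply/cvg_ex; exists l => A /near_ball[e e0 hA].
have [N hN] := hl (e / 2) ltac:(lra).
have [N' hN'] := inv_small (e := e / 2) ltac:(lra).
apply: filterS (Fu (maxn N N')) => y /= hy; apply: hA.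
have := rn_tri l (u (maxn N N')) y.
have := hN _ (leq_maxl N N'); have := lt_trans hy (hN' _ (leq_maxr N N')).
by rewrite (rnC l (u _)); lra.
Qed.

End SeqTop.

Section Linear.
Variables (K : numClosedFieldType) (V W U : lmodType K).

Section One.
Variables (f : V -> W) (lf : linear f).
Lemma linD x y : f (x + y) = f x + f y.
Proof. by rewrite -[x]scale1r lf !scale1r. Qed.
Lemma lin0 : f 0 = 0.
Proof. by apply: (@addrI _ (f 0)); rewrite -linD !addr0. Qed.
Lemma linZ c x : f (c *: x) = c *: f x.
Proof. by rewrite -[c *: x]addr0 lf lin0 addr0. Qed.
Lemma linN x : f (- x) = - f x.
Proof. by rewrite -scaleN1r linZ scaleN1r. Qed.
Lemma linB x y : f (x - y) = f x - f y.
Proof. by rewrite linD linN. Qed.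
Lemma lin_sum I (r : seq I) (F : I -> V) :
  f (\sum_(i <- r) F i) = \sum_(i <- r) f (F i).
Proof.
elim: r => [|i r ih]; first by rewrite !big_nil lin0.
by rewrite !big_cons linD ih.
Qed.
Lemma lin_inj : (forall x, f x = 0 -> x = 0) -> injective f.
Proof.
move=> h x y /eqP; rewrite -subr_eq0 -linB => /eqP/h/eqP.
by rewrite subr_eq0 => /eqP.
Qed.
End One.

Lemma lin_comp (f : V -> W) (g : W -> U) : linear f -> linear g -> linear (g \o f).
Proof. by move=> lf lg c x y /=; rewrite lf lg. Qed.

(** Combinations are lists of coefficient-label pairs, with repetitions allowed: concatenation is
    then addition, with no bookkeeping of supports. *)
Definition lc T (g : T -> V) (s : seq (K * T)) : V := \sum_(p <- s) p.1 *: g p.2.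

Lemma lc_nil T (g : T -> V) : lc g [::] = 0. Proof. exact: big_nil. Qed.
Lemma lc_cons T (g : T -> V) p s : lc g (p :: s) = p.1 *: g p.2 + lc g s.
Proof. exact: big_cons. Qed.
Lemma lc_cat T (g : T -> V) s1 s2 : lc g (s1 ++ s2) = lc g s1 + lc g s2.
Proof. exact: big_cat. Qed.

Lemma lc_scale T (g : T -> V) c s :
  lc g [seq (c * p.1, p.2) | p <- s] = c *: lc g s.
Proof.
by rewrite /lc big_map scaler_sumr; apply: eq_bigr => p _; rewrite scalerA.
Qed.

End Linear.

Lemma lin_lc (K : numClosedFieldType) (V W : lmodType K) T (f : V -> W) (g : T -> V) s :
  linear f -> f (lc g s) = lc (f \o g) s.
Proof.
by move=> lf; rewrite /lc lin_sum //; apply: eq_bigr => p _; rewrite linZ.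
Qed.

Section Closed.
Variables (R : realType).
Implicit Types (V W : normedModType R[i]).

Definition blin V W (f : V -> W) :=
  linear f /\ exists2 M : R, 0 <= M & forall x, rn (f x) <= M * rn x.

(** Closed subspaces serve as induction predicates: by [cspanT_ind], whatever is linear and
    continuous is checked on a total set. Most density arguments below take this form, which is why
    closure is stated with [rn] and not with filters. *)
Record clsub V (P : set V) : Prop := ClSub {
  cls0 : P 0;
  clsL : forall c x y, P x -> P y -> P (c *: x + y);
  clsC : forall x, (forall e : R, 0 < e -> exists2 y, P y & rn (x - y) < e) -> P x
}.

Section ClSub.
Variables (V : normedModType R[i]) (P : set V) (cP : clsub P).
Lemma clsD x y : P x -> P y -> P (x + y).
Proof. by move=> Px Py; rewrite -[x]scale1r; apply: clsL. Qed.
Lemma clsZ c x : P x -> P (c *: x).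
Proof. by move=> Px; rewrite -[c *: x]addr0; apply: clsL => //; apply: cls0. Qed.
Lemma clsN x : P x -> P (- x).
Proof. by move=> Px; rewrite -scaleN1r; apply: clsZ. Qed.
Lemma clsB x y : P x -> P y -> P (x - y).
Proof. by move=> Px Py; apply: clsD => //; apply: clsN. Qed.
Lemma cls_cvs u l : (forall n, P (u n)) -> cvs u l -> P l.
Proof.
move=> hu hl; apply: (clsC cP) => e /hl[N hN].
by exists (u N) => //; rewrite rnC; apply: hN.
Qed.
End ClSub.

Lemma blin_lip V W (f : V -> W) : blin f ->
  exists M : R, forall x y, rn (f x - f y) <= M * rn (x - y).
Proof. by case=> lf [M _ h]; exists M => x y; rewrite -linB. Qed.

Lemma blin_cvs V W (f : V -> W) u l : blin f -> cvs u l -> cvs (f \o u) (f l).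
Proof. by move=> /blin_lip[M h]; apply: cvs_comp h. Qed.

Lemma blin_comp V W (U : normedModType R[i]) (f : V -> W) (g : W -> U) :
  blin f -> blin g -> blin (g \o f).
Proof.
case=> lf [M M0 hf] [lg [N N0 hg]]; split; first exact: lin_comp.
exists (N * M) => [|x /=]; first exact: mulr_ge0.
by apply: (le_trans (hg _)); rewrite -mulrA ler_wpM2l.
Qed.

Lemma blin_id V : blin (@id V).
Proof. by split=> //; exists 1 => // x; rewrite mul1r. Qed.

Lemma blinD V W (f g : V -> W) : blin f -> blin g -> blin (fun x => f x + g x).
Proof.
case=> lf [M M0 hf] [lg [N N0 hg]]; split.
  by move=> c x y; rewrite lf lg scalerDr addrACA.
exists (M + N) => [|x]; first exact: addr_ge0.
by rewrite mulrDl; apply: (le_trans (rnD _ _)); apply: lerD.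
Qed.

Lemma blinZ V W (f : V -> W) c : blin f -> blin (fun x => c *: f x).
Proof.
case=> lf [M M0 hf]; split.
  by move=> k x y; rewrite lf scalerDr !scalerA mulrC.
exists (rn c * M) => [|x]; first by rewrite mulr_ge0 // rn_ge0.
by rewrite rnZ -mulrA ler_wpM2l // rn_ge0.
Qed.

Lemma blinB V W (f g : V -> W) : blin f -> blin g -> blin (fun x => f x - g x).
Proof.
move=> bf /(blinZ (-1)) bg; have := blinD bf bg.
by under [X in blin X -> _]funext do rewrite scaleN1r.
Qed.

Lemma clsub_pre V W (f : V -> W) (P : set W) : blin f -> clsub P ->
  clsub [set x | P (f x)].
Proof.
case=> lf [M M0 hf] cP; split => [|c x y /= Px Py|x h] /=.
- by rewrite lin0 //; apply: cls0.
- by rewrite lf; apply: clsL.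
- apply: (clsC cP) => e e0; have M1 : 0 < M + 1 by lra.
  have [y /= Py hy] := h (e / (M + 1)) ltac:(by rewrite divr_gt0).
  exists (f y) => //; rewrite -linB //; apply: (le_lt_trans (hf _)).
  move: hy; rewrite ltr_pdivlMr // => hy; apply: le_lt_trans hy.
  by rewrite mulrC ler_wpM2l //; lra.
Qed.

Lemma clsub0 V : clsub [set (0 : V)].
Proof.
split => [//|c x y /= -> ->|x h /=]; first by rewrite scaler0 addr0.
by apply: rn_le0; apply: le0_eps => e /h[y /= ->]; rewrite subr0 => /ltW.
Qed.

Lemma clsub_ker V W (f : V -> W) : blin f -> clsub [set x | f x = 0].
Proof. by move=> bf; apply: (clsub_pre bf (clsub0 W)). Qed.

Lemma clsub_eq V W (f g : V -> W) : blin f -> blin g -> clsub [set x | f x = g x].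
Proof.
move=> bf bg; have := clsub_ker (blinB bf bg).
rewrite (_ : [set x | f x - g x = 0] = [set x | f x = g x]) //.
by apply/seteqP; split => x /= /eqP; rewrite ?subr_eq0 => /eqP // ->; rewrite subrr.
Qed.

Lemma clsubI V I (P : I -> set V) : (forall i, clsub (P i)) ->
  clsub [set x | forall i, P i x].
Proof.
move=> h; split => [i|c x y hx hy i|x hx i]; first exact: cls0.
- by apply: clsL.
- by apply: clsC => // e /hx[y /(_ i)]; exists y.
Qed.

Lemma clsub_setI V (P Q : set V) : clsub P -> clsub Q -> clsub (P `&` Q).
Proof.
move=> cP cQ; split => [|c x y [Px Qx] [Py Qy]|x hx]; first by split; apply: cls0.
- by split; apply: clsL.
- by split; apply: clsC => // e /hx[y []]; exists y.
Qed.

Lemma clsubT V : clsub (@setT V).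
Proof. by []. Qed.

Lemma cspanP V (S : set V) x : cspan S x <->
  forall e : R, 0 < e -> exists2 y, (exists2 s : seq (R[i] * V),
    (forall p, List.In p s -> S p.2) & y = lc id s) & rn (x - y) < e.
Proof.
split=> [/closureP h e /h[y [n [c [v [Sv ->]]]] xy]|h].
  exists (\sum_i c i *: v i) => //.
  exists [seq (c i, v i) | i <- index_enum 'I_n].
    by move=> p /List.in_map_iff[i [<- _]] /=.
  by rewrite /lc big_map.
apply/closureP => e /h[y [s Ss ->] xy]; exists (lc id s) => //.
exists (size s), (fun i => (nth (0, 0) s i).1), (fun i => (nth (0, 0) s i).2).
split=> [i|]; last by rewrite /lc (big_nth (0, 0)) big_mkord.
apply: Ss; move: i; case=> i /=; elim: s {xy} i => [//|p s ih] [|i] /=; first by left.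
by move=> hi; right; apply: ih.
Qed.

Lemma cspan_ind V (S P : set V) : clsub P -> S `<=` P -> cspan S `<=` P.
Proof.
move=> cP SP x /cspanP h; apply: (clsC cP) => e /h[y [s Ss ->] xy].
exists (lc id s) => //; elim: s Ss {xy h} => [|p s ih] Ss.
  by rewrite lc_nil; apply: cls0.
rewrite lc_cons; apply: clsL => //; first by apply: SP; apply: Ss; left.
by apply: ih => q hq; apply: Ss; right.
Qed.

Lemma cspan_sub V (S : set V) : S `<=` cspan S.
Proof.
move=> x Sx; apply/cspanP => e e0; exists x; last by rewrite subrr rn0.
exists [:: (1, x)]; first by move=> p [<-|[]].
by rewrite lc_cons lc_nil /= scale1r addr0.
Qed.

Lemma cspan_clsub V (S : set V) : clsub (cspan S).
Proof.
split => [|c x y /cspanP hx /cspanP hy|x h].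
- apply/cspanP => e e0; exists 0; last by rewrite subrr rn0.
  by exists [::] => //; rewrite lc_nil.
- apply/cspanP => e e0; have c1 : 0 < 2 * (rn c + 1) by have := rn_ge0 c; lra.
  have [_ [s Ss ->] hs] := hx (e / (2 * (rn c + 1))) ltac:(by rewrite divr_gt0).
  have [_ [t St ->] ht] := hy (e / 2) ltac:(lra).
  exists (c *: lc id s + lc id t).
    exists ([seq (c * p.1, p.2) | p <- s] ++ t); last by rewrite lc_cat lc_scale.
    move=> p /List.in_app_iff[|/St //].
    by move=> /List.in_map_iff[q [<- /Ss]].
  rewrite opprD addrACA -scalerBr; apply: (le_lt_trans (rnD _ _)).
  rewrite rnZ; move: hs; rewrite ltr_pdivlMr //.
  have := rn_ge0 (x - lc id s); nra.
- apply/cspanP => e e0; have [y /cspanP hy xy] := h (e / 2) ltac:(lra).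
  have [z hz yz] := hy (e / 2) ltac:(lra); exists z => //.
  by have := rn_tri x y z; lra.
Qed.

Lemma cspanT_ind V (S P : set V) : cspan S = setT -> clsub P -> S `<=` P ->
  forall x, P x.
Proof. by move=> h cP SP x; apply: (cspan_ind cP SP); rewrite h. Qed.

(** Density as an elimination principle, the form in which nondegeneracy and fullness are both
    proved and used. *)
Lemma cspan_eqT V (S : set V) : (forall P, clsub P -> S `<=` P -> forall x, P x) ->
  cspan S = setT.
Proof.
move=> h; apply/seteqP; split => // x _; apply: h; first exact: cspan_clsub.
exact: cspan_sub.
Qed.

Lemma cspan_range V T (g : T -> V) x : cspan (range g) x ->
  forall e : R, 0 < e -> exists s, rn (x - lc g s) < e.
Proof.
move=> /cspanP h e /h[_ [s Ss ->] xs].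
have [s' hs'] : exists s', lc g s' = lc id s.
  elim: s Ss {xs h} => [|[c v] s ih] Ss; first by exists [::]; rewrite !lc_nil.
  have [|s' hs'] := ih; first by move=> q hq; apply: Ss; right.
  have [t _ gt] : range g v by apply: (Ss (c, v)); left.
  by exists ((c, t) :: s'); rewrite !lc_cons /= hs' gt.
by exists s'; rewrite hs'.
Qed.

(** The extension is the closure of a graph: [Rel x y] holds when one and the same combination
    approximates [x] through [g] and [y] through [u]. The bound on combinations makes this relation
    functional, relations among the vectors [g t] included. *)
Lemma blt V (W : completeNormedModType R[i]) T (g : T -> V) (u : T -> W) (M : R) :
  0 <= M -> cspan (range g) = setT ->
  (forall s, rn (lc u s) <= M * rn (lc g s)) ->
  exists F : V -> W, [/\ linear F, forall x, rn (F x) <= M * rn x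
    & forall t, F (g t) = u t].
Proof.
move=> M0 gT hb.
pose Rel x y := forall e : R, 0 < e ->
  exists s, rn (x - lc g s) < e /\ rn (y - lc u s) < e.
(* A difference of combinations is again a combination, so that [hb] bounds differences. *)
have lcN S' (Z : lmodType R[i]) (k : S' -> Z) s t :
    lc k s - lc k t = lc k (s ++ [seq (-1 * p.1, p.2) | p <- t]).
  by rewrite lc_cat lc_scale scaleN1r.
have ex x : exists y, Rel x y.
  have ap n : exists s, rn (x - lc g s) < n.+1%:R^-1.
    by apply: cspan_range; rewrite ?gT // invr_gt0.
  pose s n := projT1 (cid (ap n)).
  have hs n : rn (x - lc g (s n)) < n.+1%:R^-1 by exact: (projT2 (cid (ap n))).
  have [y hy] : exists y, cvs (fun n => lc u (s n)) y.
    apply: cauchy_cvs => e e0; have M1 : 0 < 2 * (M + 1) by lra.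
    have [N hN] := inv_small (e := e / (2 * (M + 1))) ltac:(by rewrite divr_gt0).
    exists N => m n /hN hm /hN hn; rewrite lcN.
    apply: (le_lt_trans (hb _)); rewrite -lcN.
    have h1 := lt_trans (hs m) hm; have h2 := lt_trans (hs n) hn.
    move: h1 h2; rewrite !ltr_pdivlMr // => h1 h2.
    have := rn_tri (lc g (s m)) x (lc g (s n)); rewrite (rnC _ x).
    have := rn_ge0 (lc g (s m) - lc g (s n)); nra.
  exists y => e e0; have [N hN] := hy e e0; have [N' hN'] := inv_small e0.
  exists (s (maxn N N')); split; last by rewrite rnC hN // leq_maxl.
  by apply: (lt_trans (hs _)); apply: hN'; rewrite leq_maxr.
have bd x y : Rel x y -> rn y <= M * rn x.
  move=> h; apply: le_eps => e e0; have M1 : 0 < M + 1 by lra.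
  have [s [h1 h2]] := h (e / (M + 1)) ltac:(by rewrite divr_gt0).
  move: h1 h2; rewrite !ltr_pdivlMr // => h1 h2.
  have := hb s; have := rn_leD y (lc u s).
  have := rn_leD (lc g s) x; rewrite (rnC (lc g s)).
  have := rn_ge0 (x - lc g s); have := rn_ge0 (y - lc u s); nra.
have lin c x y x' y' : Rel x x' -> Rel y y' -> Rel (c *: x + y) (c *: x' + y').
  move=> hx hy e e0; have c1 : 0 < 2 * (rn c + 1) by have := rn_ge0 c; lra.
  have [s [h1 h2]] := hx (e / (2 * (rn c + 1))) ltac:(by rewrite divr_gt0).
  have [t [h3 h4]] := hy (e / 2) ltac:(lra).
  exists ([seq (c * p.1, p.2) | p <- s] ++ t).
  move: h1 h2; rewrite !lc_cat !lc_scale !ltr_pdivlMr // => h1 h2.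
  split; rewrite opprD addrACA -scalerBr; apply: (le_lt_trans (rnD _ _));
    rewrite rnZ.
  - by have := rn_ge0 (x - lc g s); nra.
  - by have := rn_ge0 (x' - lc u s); nra.
have un x y y' : Rel x y -> Rel x y' -> y = y'.
  move=> h h'; apply/eqP; rewrite -subr_eq0; apply/eqP; apply: rn_le0.
  have /bd := lin (-1) _ _ _ _ h' h.
  by rewrite !scaleN1r addNr rn0 mulr0 addrC.
pose F x := projT1 (cid (ex x)).
have hF x : Rel x (F x) by exact: (projT2 (cid (ex x))).
exists F; split => [c x y|x|t].
- by apply: un (hF _) _; apply: lin.
- exact: bd.
- apply: un (hF _) _ => e e0; exists [:: (1, t)].
  by rewrite !lc_cons !lc_nil /= !scale1r !addr0 !subrr !rn0.
Qed.

End Closed.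

(** * Operator norms and uniform boundedness *)

Section OperatorNorm.
Variables (R : realType) (T : lmodType R[i]) (X : Type) (W : normedModType R[i]).
Variables (w : X -> R) (act : T -> X -> W).
Hypothesis w_ge0 : forall x, 0 <= w x.
Hypothesis actL : forall c t u x, act (c *: t + u) x = c *: act t x + act u x.
Hypothesis act_inj : forall t, (forall x, act t x = 0) -> t = 0.
Hypothesis act_bd : forall t, exists2 M, 0 <= M & forall x, rn (act t x) <= M * w x.

(** The infimum of the admissible constants for an action of [T] on a set weighted by [w]. The
    instances are multipliers and operators, weighted by the norm, and functions dominated by a
    weight. *)
Definition opn (t : T) : R :=
  inf [set M : R | 0 <= M /\ forall x, rn (act t x) <= M * w x].

Let opn_lb t : has_lbound [set M : R | 0 <= M /\ forall x, rn (act t x) <= M * w x].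
Proof. by exists 0 => M []. Qed.

Lemma opn_ge0 t : 0 <= opn t.
Proof.
have [M M0 hM] := act_bd t.
by apply: lb_le_inf; [exists M | move=> ? []].
Qed.

Lemma opn_le t (M : R) : 0 <= M -> (forall x, rn (act t x) <= M * w x) -> opn t <= M.
Proof. by move=> M0 hM; apply: ge_inf. Qed.

Lemma opn_bd t x : rn (act t x) <= opn t * w x.
Proof.
have [M M0 hM] := act_bd t.
have [w0|w0] := eqVneq (w x) 0; first by have := hM x; rewrite w0 !mulr0.
have wp : 0 < w x by rewrite lt_neqAle eq_sym w0 w_ge0.
rewrite -ler_pdivrMr //; apply: lb_le_inf; first by exists M.
by move=> N [_ hN]; rewrite ler_pdivrMr.
Qed.

Let act0 x : act 0 x = 0.
Proof.
have := actL (-1) 0 0 x; rewrite scaler0 addr0 scaleN1r addNr //.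
Qed.
Let actD t u x : act (t + u) x = act t x + act u x.
Proof. by have := actL 1 t u x; rewrite !scale1r. Qed.
Let actZ c t x : act (c *: t) x = c *: act t x.
Proof. by have := actL c t 0 x; rewrite !addr0 act0 addr0. Qed.

Lemma opnD t u : opn (t + u) <= opn t + opn u.
Proof.
apply: opn_le => [|x]; first by apply: addr_ge0; apply: opn_ge0.
by rewrite actD mulrDl; apply: (le_trans (rnD _ _)); apply: lerD; apply: opn_bd.
Qed.

Lemma opn_scale_le c t : opn (c *: t) <= rn c * opn t.
Proof.
apply: opn_le => [|x]; first by rewrite mulr_ge0 ?rn_ge0 ?opn_ge0.
by rewrite actZ rnZ -mulrA ler_wpM2l // opn_bd.
Qed.

Lemma opnZ c t : opn (c *: t) = rn c * opn t.
Proof.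
apply/eqP; rewrite eq_le opn_scale_le /=.
have [->|c0] := eqVneq c 0; first by rewrite rn0 mul0r opn_ge0.
have := opn_scale_le c^-1 (c *: t).
rewrite scalerA mulVf // scale1r => h.
apply: (le_trans (ler_wpM2l (rn_ge0 c) h)).
by rewrite mulrA -rnM mulfV // rn1 mul1r.
Qed.

Lemma opn_eq0 t : opn t = 0 -> t = 0.
Proof.
by move=> h; apply: act_inj => x; apply: rn_le0; have := opn_bd t x; rewrite h mul0r.
Qed.

Lemma opnCD t u : (opn (t + u))%:C%C <= (opn t)%:C%C + (opn u)%:C%C :> R[i].
Proof. by rewrite -rmorphD /= lecR opnD. Qed.
Lemma opnCZ (c : R[i]) t : (opn (c *: t))%:C%C = `|c| * (opn t)%:C%C.
Proof. by rewrite opnZ rmorphM /= -rnE. Qed.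
Lemma opnC_eq0 t : (opn t)%:C%C = 0 :> R[i] -> t = 0.
Proof. by move=> h; apply: opn_eq0; apply: complexI. Qed.

Hypothesis W_complete : forall u : nat -> W, cauchys u -> exists l, cvs u l.
Hypothesis act_lim : forall (u : nat -> T) (F : X -> W) (M : R), 0 <= M ->
  (forall n x, rn (act (u n) x) <= M * w x) ->
  (forall x, cvs (fun n => act (u n) x) (F x)) ->
  (forall e : R, 0 < e -> exists N, forall m n, (N <= m)%N -> (N <= n)%N ->
     opn (u m - u n) < e) -> exists t, act t =1 F.

(** Pointwise limits exist since the target is complete; whether such a limit is again given by an
    element of [T] depends on the instance, and is the hypothesis [act_lim]. *)
Lemma opn_complete (u : nat -> T) :
  (forall e : R, 0 < e -> exists N, forall m n, (N <= m)%N -> (N <= n)%N ->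
     opn (u m - u n) < e) ->
  exists l, forall e : R, 0 < e -> exists N, forall n, (N <= n)%N ->
     opn (u n - l) < e.
Proof.
move=> hu.
have actB t v x : act (t - v) x = act t x - act v x.
  by rewrite actD -scaleN1r actZ scaleN1r.
have hF x : exists l, cvs (fun n => act (u n) x) l.
  apply: W_complete => e e0; have w1 : 0 < w x + 1 by have := w_ge0 x; lra.
  have [N hN] := hu (e / (w x + 1)) ltac:(by rewrite divr_gt0).
  exists N => m n hm hn; have := hN m n hm hn; rewrite ltr_pdivlMr // => h.
  rewrite -actB; apply: (le_lt_trans (opn_bd _ _)).
  by have := opn_ge0 (u m - u n); nra.
pose F x := projT1 (cid (hF x)).
have hFx x : cvs (fun n => act (u n) x) (F x) by exact: (projT2 (cid (hF x))).
have [N0 hN0] := hu 1 ltac:(lra).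
have opN t : opn (- t) = opn t by rewrite -scaleN1r opnZ rnN rn1 mul1r.
have tail (e : R) : 0 < e -> exists N, forall n x, (N <= n)%N ->
    rn (act (u n) x - F x) <= e * w x.
  move=> e0; have [N hN] := hu e e0; exists N => n x hn.
  apply: (@cvs_le _ _ (fun k => act (u n) x - act (u k) x)); last first.
    exists N => k hk; rewrite -actB; apply: (le_trans (opn_bd _ _)).
    by rewrite ler_wpM2r // ltW // hN.
  refine (cvs_comp (f := fun y => act (u n) x - y) (M := 1) _ (hFx x)) => y z.
  by rewrite opprB addrC addrA subrK mul1r rnC.
have [N1 hN1] := tail 1 ltac:(lra).
(* Each later term is within 1 of [F], and [F] is within 1 of [u N1]. *)
pose M := opn (u N1) + 2.
have M0 : 0 <= M by have := opn_ge0 (u N1); rewrite /M; lra.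
have [t ht] : exists t, act t =1 F.
  apply: (act_lim (u := fun n => u (n + N1)%N) (M := M)) => // [n x|x e e0|e /hu[N hN]].
    have := hN1 (n + N1)%N x (leq_addl _ _); have := hN1 N1 x (leqnn _).
    have := opn_bd (u N1) x; have := rn_tri (act (u (n + N1)%N) x) (F x) 0.
    have := rn_tri (F x) (act (u N1) x) 0; rewrite !subr0 (rnC (F x)) /M.
    by rewrite mulrDl; lra.
  have [N hN] := hFx x e e0; exists N => n hn; apply: hN.
  by apply: leq_trans hn _; apply: leq_addr.
  exists N => m n hm hn; apply: hN;
    [apply: leq_trans hm _ | apply: leq_trans hn _]; exact: leq_addr.
exists t => e e0; have [N hN] := tail (e / 2) ltac:(lra).
exists N => n hn; apply: (@le_lt_trans _ _ (e / 2)); last by lra.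
apply: opn_le => [|x]; first lra.
by rewrite actB ht hN.
Qed.

End OperatorNorm.

Section Unbundled.
Variables (R : realType).

(** Gliding hump. *)
Lemma adjoint_bounded (V W : normedModType R[i]) (q : V -> V -> W) (f f' : V -> V) :
  (forall u : nat -> V, cauchys u -> exists l, cvs u l) ->
  (forall x y z, q x (y + z) = q x y + q x z) ->
  (forall c x y, q x (c *: y) = c *: q x y) ->
  (forall x y, rn (q x y) <= rn x * rn y) ->
  (forall x, rn (q x x) = rn x ^+ 2) ->
  (forall x y, q x (f y) = q (f' x) y) ->
  exists2 M : R, 0 <= M & forall x, rn (f' x) <= M * rn x.
Proof.
move=> cV qD qZ qle qq adj.
have linf' c x : rn (f' x) * rn (f' x) <= rn x * rn (f (f' x)).
  by have := qq (f' x); rewrite -adj expr2 => <-; apply: qle.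
apply: contrapT => nb.
have big n : exists x, rn (f' x) > (4 ^+ n) * rn x.
  apply: contrapT => h; apply: nb; exists (4 ^+ n) => [|x]; first by rewrite exprn_ge0.
  by rewrite leNgt; apply/negP => hx; apply: h; exists x.
pose y n := projT1 (cid (big n)).
have hy n : rn (f' (y n)) > (4 ^+ n) * rn (y n) by exact: (projT2 (cid (big n))).
pose b n := rn (f' (y n)).
have b0 n : 0 < b n.
  by apply: le_lt_trans (hy n); rewrite mulr_ge0 ?exprn_ge0.
(* The factor 1/3 makes all corrections after the n-th add up to half of it, so they cannot undo the
   gain made at step n; the ratio 4/3 that remains still diverges. *)
pose z n := ((3^-1 ^+ n / b n)%:C%C : R[i]) *: f' (y n).
have rz n : rn (z n) = 3^-1 ^+ n.
  rewrite rnZr ?divr_ge0 ?exprn_ge0 ?ltW // -/(b n).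
  by rewrite divfK // gt_eqF.
(* The two signs give values that differ by twice [q (f' (y n)) (z n)], so one of them is at least
   as large as that value. *)
have pick n (s : V) : exists e : bool,
    rn (q (f' (y n)) (s + (-1) ^+ e *: z n)) >= 3^-1 ^+ n * b n.
  have e1 : rn (q (f' (y n)) (z n)) = 3^-1 ^+ n * b n.
    rewrite qZ rnZr ?divr_ge0 ?exprn_ge0 ?ltW // qq -/(b n).
    by rewrite expr2 mulrA divfK // gt_eqF.
  apply: contrapT => h.
  have h0 : rn (q (f' (y n)) (s + z n)) < 3^-1 ^+ n * b n.
    by rewrite ltNge; apply/negP => hx; apply: h; exists false; rewrite expr0 scale1r.
  have h1 : rn (q (f' (y n)) (s - z n)) < 3^-1 ^+ n * b n.
    by rewrite ltNge; apply/negP => hx; apply: h; exists true; rewrite expr1 scaleN1r.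
  have := rnD (q (f' (y n)) (s + z n)) (- q (f' (y n)) (s - z n)); rewrite rnN.
  have -> : q (f' (y n)) (s + z n) - q (f' (y n)) (s - z n) = q (f' (y n)) (2%:R *: z n).
    apply: (addIr (q (f' (y n)) (s - z n))); rewrite subrK -qD; congr (q _ _).
    by rewrite scaler_nat mulr2n [RHS]addrC addrA subrK.
  by rewrite qZ rnZ -(rmorph_nat (real_complex R) 2) /= rn_real normr_nat e1; lra.
pose e n s := projT1 (cid (pick n s)).
have he n s : rn (q (f' (y n)) (s + (-1) ^+ (e n s) *: z n)) >= 3^-1 ^+ n * b n.
  exact: (projT2 (cid (pick n s))).
pose s := fix s n := if n is m.+1 then s m + (-1) ^+ (e m (s m)) *: z m else 0.
have step n : rn (s n.+1 - s n) = 3^-1 ^+ n.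
  by rewrite /= addrAC subrr add0r rnZ rz; case: (e _ _); rewrite ?expr1 ?expr0 ?rnN rn1 mul1r.
have tail n k : rn (s (n + k)%N - s n) <= 3^-1 ^+ n * (3 / 2 - 3^-1 ^+ k * (3 / 2)).
  elim: k => [|k ih]; first by rewrite addn0 subrr rn0 expr0 mul1r subrr mulr0.
  apply: (le_trans (rn_tri _ (s (n + k)%N) _)); rewrite addnS step exprD exprS.
  by have : 0 <= (3^-1 : R) ^+ n * 3^-1 ^+ k; [rewrite mulr_ge0 ?exprn_ge0 | nra].
have p3 n : 0 < (3^-1 : R) ^+ n by rewrite exprn_gt0.
have tail' n k : (n <= k)%N -> rn (s k - s n) <= 3^-1 ^+ n * (3 / 2).
  move=> nk; rewrite -(subnKC nk); apply: (le_trans (tail _ _)).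
  by have := p3 n; have := p3 (k - n)%N; nra.
have pow n : (n%:R : R) / 3 + 1 <= 4 ^+ n / 3 ^+ n.
  elim: n => [|n ih]; first by rewrite mul0r add0r !expr0 divr1.
  rewrite !exprS -mulf_div; have : 0 <= (n%:R : R) by [].
  by rewrite -natr1; nra.
have [x hx] : exists x, cvs s x.
  apply: cV => d d0.
  have [N hN] := inv_small (e := d / 9) ltac:(lra).
  exists N => m n hm hn.
  have := tail' N m hm; have := tail' N n hn; have := rn_tri (s m) (s N) (s n).
  rewrite (rnC (s N)); have := hN N (leqnn _).
  have : (3^-1 : R) ^+ N <= 3 * N.+1%:R^-1.
    rewrite exprVn ler_pdivlMr ?ltr0Sn // mulrC ler_pdivrMr ?exprn_gt0 //.
    elim: N {hN hm hn} => [|N ih]; first by rewrite expr0; lra.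
    rewrite exprS -natr1; have : 0 <= (N%:R : R) by []; nra.
  move: (N.+1%:R^-1) => t; lra.
have xs n : rn (x - s n.+1) <= 3^-1 ^+ n / 2.
  apply: (@cvs_le _ _ (fun k => s k - s n.+1)).
    refine (cvs_comp (f := fun v => v - s n.+1) (M := 1) _ hx) => u v.
    by rewrite opprB addrA subrK mul1r.
  by exists n.+1 => k /tail'; rewrite exprS; lra.
(* At the limit [x] half of the gain of step [n] survives, whereas the adjoint relation bounds the
   value by |y n| |f x|. *)
have key n : (4 ^+ n / 3 ^+ n) <= 2 * rn (f x).
  have h1 := he n (s n); have h2 := xs n.
  have h3 : rn (q (f' (y n)) (x - s n.+1)) <= b n * (3^-1 ^+ n / 2).
    by apply: (le_trans (qle _ _)); rewrite ler_wpM2l // rn_ge0.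
  have h4 : 3^-1 ^+ n * b n / 2 <= rn (q (f' (y n)) x).
    have : q (f' (y n)) x = q (f' (y n)) (x - s n.+1) + q (f' (y n)) (s n.+1).
      by rewrite -qD subrK.
    have := rnD (q (f' (y n)) x) (- q (f' (y n)) (x - s n.+1)); rewrite rnN.
    by move=> + e2; rewrite {1}e2 addrC addKr; move: h1 h3; rewrite /=; lra.
  have h5 : rn (q (f' (y n)) x) <= rn (y n) * rn (f x) by rewrite -adj.
  have h6 := hy n; rewrite -/(b n) in h6.
  have h7 : 0 <= rn (f x) by exact: rn_ge0.
  have p4 : 0 < (4 : R) ^+ n by rewrite exprn_gt0.
  rewrite -exprVn; have h8 : b n * (3^-1 ^+ n * 4 ^+ n) <= b n * (2 * rn (f x)).
    have : rn (y n) * 4 ^+ n * rn (f x) <= b n * rn (f x).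
      by rewrite ler_wpM2r // mulrC ltW.
    have : 3^-1 ^+ n * b n / 2 * 4 ^+ n <= rn (y n) * rn (f x) * 4 ^+ n.
      by apply: ler_wpM2r; [exact: ltW | exact: le_trans h4 h5].
    by lra.
  by move: h8; rewrite ler_pM2l // mulrC.
have [N hN] := inv_small (e := (6 * rn (f x) + 1)^-1)
  ltac:(by rewrite invr_gt0; have := rn_ge0 (f x); lra).
have := hN N (leqnn _); rewrite ltf_pV2 ?posrE ?ltr0Sn //; last first.
  by have := rn_ge0 (f x); lra.
by have := le_trans (pow N) (key N); rewrite -(natr1 N); lra.
Qed.

End Unbundled.

(** * C*-norms, multiplier algebras and bounded operators *)

Section CStarBasics.
Variables (R : realType).
Implicit Types (A B : cstarType R).

Lemma conjE (z : R[i]) : z^* = (z^*)%C.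
Proof. by []. Qed.

(** Cauchy-Schwarz as the discriminant of a nonnegative quadratic, free of any inner product: it
    serves Hilbert spaces, kernels, positive functionals and the nearest point argument. The optimum
    is [l = b / d]; for [d = 0] a suitable multiple of [b] forces [b = 0]. *)
Lemma cs_num (a d : R) (b : R[i]) : 0 <= a -> 0 <= d ->
  (forall l : R[i], 0 <= a - 2 * Re (l^* * b) + rn l ^+ 2 * d) ->
  rn b ^+ 2 <= a * d.
Proof.
move=> a0 d0 h; set B := rn b ^+ 2.
have hB : 0 <= B by rewrite sqr_ge0.
have {}h (t : R) : 0 <= a - 2 * (t * B) + t ^+ 2 * B * d.
  have := h (t%:C%C * b); rewrite rnM rn_real exprMn real_normK ?num_real //.
  have -> : Re ((t%:C%C * b)^* * b) = t * B.
    rewrite rmorphM /= [(t%:C%C)^*]conjc_real -mulrA -normCKC rnE.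
    by rewrite -rmorphXn -rmorphM.
  by [].
have [d1|d1] := eqVneq d 0.
  have := h ((a + 1) / (2 * B)); rewrite d1 !mulr0 addr0.
  have [->|B0] := eqVneq B 0; first by rewrite mulr0.
  have Bp : 0 < B by rewrite lt_neqAle eq_sym B0.
  have -> : 2 * ((a + 1) / (2 * B) * B) = a + 1 by field.
  by lra.
have dp : 0 < d by rewrite lt_neqAle eq_sym d1.
have := h d^-1; have -> : a - 2 * (d^-1 * B) + d^-1 ^+ 2 * B * d = a - B / d by field.
by rewrite subr_ge0 ler_pdivrMr.
Qed.

Lemma rn_star A (x : A) : rn (star x) = rn x.
Proof.
suff h (y : A) : rn y <= rn (star y).
  by apply/eqP; rewrite eq_le h -{2}(starK x) h.
have [->|y0] := eqVneq y 0; first by rewrite star0.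
have yp : 0 < rn y.
  rewrite lt_neqAle rn_ge0 andbT eq_sym; apply: contra y0 => /eqP/rn_eq0/eqP//.
rewrite -(ler_pM2r yp) -expr2; have := cstar_normM (star y) y.
by rewrite cstar_normC !rnE -rmorphM -rmorphXn /= lecR.
Qed.

Lemma rnM_le A (x y : A) : rn (x ** y) <= rn x * rn y.
Proof. by have := cstar_normM x y; rewrite !rnE -rmorphM lecR. Qed.

Lemma rn_starM A (x : A) : rn (star x ** x) = rn x ^+ 2.
Proof. by have := cstar_normC x; rewrite !rnE -rmorphXn => /complexI. Qed.

Lemma rn_Mstar A (x : A) : rn (x ** star x) = rn x ^+ 2.
Proof. by rewrite -{1}(starK x) rn_starM rn_star. Qed.

Lemma starN A (x : A) : star (- x) = - star x.
Proof. by rewrite -scaleN1r starZ rmorphN1 scaleN1r. Qed.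
Lemma starB A (x y : A) : star (x - y) = star x - star y.
Proof. by rewrite starD starN. Qed.

End CStarBasics.

Section StarAlg.
Variables (K : numClosedFieldType) (A : starAlgType K).
Implicit Types x y z : A.
Lemma sm0r x : x ** 0 = 0.
Proof. by rewrite -(scale0r (0 : A)) smulZr !scale0r. Qed.
Lemma sm0l x : 0 ** x = 0.
Proof. by rewrite -(scale0r (0 : A)) smulZl !scale0r. Qed.
Lemma smNr x y : x ** (- y) = - (x ** y).
Proof. by rewrite -scaleN1r smulZr scaleN1r. Qed.
Lemma smNl x y : (- x) ** y = - (x ** y).
Proof. by rewrite -scaleN1r smulZl scaleN1r. Qed.
Lemma smBr x y z : x ** (y - z) = x ** y - x ** z.
Proof. by rewrite smulDr smNr. Qed.
Lemma smBl x y z : (x - y) ** z = x ** z - y ** z.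
Proof. by rewrite smulDl smNl. Qed.
Lemma st0 : star (0 : A) = 0.
Proof. by apply: (@addrI _ (star 0)); rewrite -starD !addr0. Qed.
Lemma stN x : star (- x) = - star x.
Proof. by rewrite -scaleN1r starZ rmorphN1 scaleN1r. Qed.
Lemma stB x y : star (x - y) = star x - star y.
Proof. by rewrite starD stN. Qed.
Lemma sm_suml I (r : seq I) (F : I -> A) z :
  (\sum_(i <- r) F i) ** z = \sum_(i <- r) F i ** z.
Proof. by elim: r => [|i r ih]; rewrite ?big_nil ?sm0l // !big_cons smulDl ih. Qed.
Lemma sm_sumr I (r : seq I) (F : I -> A) z :
  z ** (\sum_(i <- r) F i) = \sum_(i <- r) z ** F i.
Proof. by elim: r => [|i r ih]; rewrite ?big_nil ?sm0r // !big_cons smulDr ih. Qed.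
Lemma st_sum I (r : seq I) (F : I -> A) :
  star (\sum_(i <- r) F i) = \sum_(i <- r) star (F i).
Proof. by elim: r => [|i r ih]; rewrite ?big_nil ?st0 // !big_cons starD ih. Qed.
End StarAlg.

Section MultNorm.
Variables (R : realType) (A : cstarType R).
Implicit Types (m n : mult A) (a b : A).

Lemma mr_star m a : mr m a = star (ml (star m) (star a)).
Proof. by rewrite /= !starK. Qed.

Lemma ml_adj m a b : star (ml m a) ** b = star a ** ml (star m) b.
Proof. by rewrite [ml (star m) b]/= -starM -mlr starM starK. Qed.

Lemma mult_eq m n : ml m =1 ml n -> m = n.
Proof.
move=> h; apply: mult_ext => // a; apply: smul_injl => b.
by rewrite -!mlr h.
Qed.

(** For the [A]-valued inner product [star x ** y] the maps [ml m] and [ml (star m)] are adjoint to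
    each other, and everywhere defined maps with an adjoint are bounded by [adjoint_bounded]. *)
Lemma ml_bd m : exists2 M : R, 0 <= M & forall a, rn (ml m a) <= M * rn a.
Proof.
apply: (@adjoint_bounded R A A (fun x y => star x ** y) (ml (star m)) (ml m)).
- exact: cauchy_cvs.
- by move=> x y z; rewrite smulDr.
- by move=> c x y; rewrite smulZr.
- by move=> x y; apply: (le_trans (rnM_le _ _)); rewrite rn_star.
- by move=> x; rewrite rn_starM.
- by move=> x y; rewrite ml_adj.
Qed.

Definition mnorm (m : mult A) : R := opn (@rn R A) (@ml R A) m.

Let w0 (a : A) : 0 <= rn a. Proof. exact: rn_ge0. Qed.
Let mL c m n a : ml (c *: m + n) a = c *: ml m a + ml n a. Proof. by []. Qed.
Let mI m : (forall a, ml m a = 0) -> m = 0.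
Proof. by move=> h; apply: mult_eq => a; rewrite h. Qed.

Lemma mnorm_bd m a : rn (ml m a) <= mnorm m * rn a.
Proof. exact: (opn_bd w0 ml_bd). Qed.
Lemma mnorm_le m (M : R) : 0 <= M -> (forall a, rn (ml m a) <= M * rn a) -> mnorm m <= M.
Proof. exact: opn_le. Qed.
Lemma mnorm_ge0 m : 0 <= mnorm m. Proof. exact: (opn_ge0 ml_bd). Qed.

HB.instance Definition _ := Lmodule_isNormed.Build R[i] (mult A)
  (opnCD w0 mL ml_bd) (opnCZ w0 mL ml_bd) (opnC_eq0 w0 mI ml_bd).

Lemma rn_ml m a : rn (ml m a) <= rn m * rn a.
Proof. exact: mnorm_bd. Qed.

Lemma mult_cstar_id m : mnorm (star m ** m) = mnorm m ^+ 2.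
Proof.
have le_star n : mnorm n ^+ 2 <= mnorm (star n ** n).
  have h a : rn (ml n a) <= Num.sqrt (mnorm (star n ** n)) * rn a.
    rewrite -(@ler_pXn2r _ 2) ?nnegrE ?rn_ge0 ?mulr_ge0 ?sqrtr_ge0 //.
    rewrite exprMn sqr_sqrtr ?mnorm_ge0 // -rn_starM ml_adj.
    apply: (le_trans (rnM_le _ _)); rewrite rn_star expr2.
    apply: (le_trans (ler_wpM2l (rn_ge0 a) (mnorm_bd (star n ** n) a))).
    by rewrite mulrCA mulrA.
  by rewrite -[leRHS]sqr_sqrtr ?mnorm_ge0 // lerXn2r ?nnegrE ?mnorm_ge0 ?sqrtr_ge0 // mnorm_le.
have subm n p : mnorm (n ** p) <= mnorm n * mnorm p.
  apply: mnorm_le => [|a]; first by rewrite mulr_ge0 ?mnorm_ge0.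
  apply: (le_trans (mnorm_bd n (ml p a))); rewrite -mulrA.
  by rewrite ler_wpM2l ?mnorm_ge0 // mnorm_bd.
have st n : mnorm n <= mnorm (star n).
  have [->|n0] := eqVneq (mnorm n) 0; first exact: mnorm_ge0.
  have np : 0 < mnorm n by rewrite lt_neqAle eq_sym n0 mnorm_ge0.
  rewrite -(ler_pM2r np) -expr2; apply: (le_trans (le_star n)); exact: subm.
apply/eqP; rewrite eq_le le_star andbT; apply: (le_trans (subm _ _)).
by rewrite expr2 ler_wpM2r ?mnorm_ge0 // -{2}(starK m) st.
Qed.

Lemma mnormM m n : mnorm (m ** n) <= mnorm m * mnorm n.
Proof.
apply: mnorm_le => [|a]; first by rewrite mulr_ge0 ?mnorm_ge0.
apply: (le_trans (mnorm_bd m (ml n a))); rewrite -mulrA.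
by rewrite ler_wpM2l ?mnorm_ge0 // mnorm_bd.
Qed.

Lemma mnorm_star m : mnorm (star m) = mnorm m.
Proof.
suff h n : mnorm n <= mnorm (star n) by apply/eqP; rewrite eq_le h -{2}(starK m) h.
have [->|n0] := eqVneq (mnorm n) 0; first exact: mnorm_ge0.
have np : 0 < mnorm n by rewrite lt_neqAle eq_sym n0 mnorm_ge0.
rewrite -(ler_pM2r np) -expr2 -mult_cstar_id; exact: mnormM.
Qed.

Lemma mult_complete (u : nat -> mult A) : cauchys u -> exists l, cvs u l.
Proof.
apply: (opn_complete w0 mL ml_bd (@cauchy_cvs _ A)) => v F M M0 _ hF hv.
(* The star is isometric, so the adjoints converge pointwise as well; the two limits together form a
   double centralizer. *)
have cs a : exists l, cvs (fun k : nat => ml (star (v k)) a) l.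
  apply: cauchy_cvs => e e0; have a1 : 0 < rn a + 1 by have := rn_ge0 a; lra.
  have [N hN] := hv (e / (rn a + 1)) ltac:(by rewrite divr_gt0).
  exists N => k l hm hn; have := hN k l hm hn; rewrite ltr_pdivlMr // => h.
  have -> : ml (star (v k)) a - ml (star (v l)) a = ml (star (v k - v l)) a.
    by rewrite stB /= scaleN1r.
  apply: (le_lt_trans (mnorm_bd _ _)); rewrite mnorm_star.
  by have := mnorm_ge0 (v k - v l); rewrite -/(mnorm _) in h *; nra.
pose F' a := projT1 (cid (cs a)).
have hF' a : cvs (fun k : nat => ml (star (v k)) a) (F' a) by exact: (projT2 (cid (cs a))).
have rel a b : a ** F b = star (F' (star a)) ** b.
  have lip1 : cvs (fun k : nat => a ** ml (v k) b) (a ** F b).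
    refine (cvs_comp (f := fun y => a ** y) (M := rn a) _ (hF b)) => x y.
    by rewrite -smBr rnM_le.
  apply: (cvs_unique lip1).
  apply: (@cvs_ext _ _ (fun k : nat => star (ml (star (v k)) (star a)) ** b)).
    by move=> k; rewrite ml_adj !starK.
  refine (cvs_comp (f := fun y => star y ** b) (M := rn b) _ (hF' (star a))) => x y.
  by rewrite -smBl -stB mulrC; apply: (le_trans (rnM_le _ _)); rewrite rn_star.
by exists (Mult rel).
Qed.

HB.instance Definition _ := Uniform_isComplete.Build (mult A)
  (seq_complete mult_complete).

Fact mult_normM m n : `|m ** n| <= `|m| * `|n|.
Proof. by rewrite !rnE -rmorphM lecR; apply: mnormM. Qed.
Fact mult_normC m : `|star m ** m| = `|m| ^+ 2.
Proof. by rewrite !rnE -rmorphXn; congr (_ %:C)%C; apply: mult_cstar_id. Qed.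

HB.instance Definition _ := isCStar.Build R (mult A) mult_normM mult_normC.

End MultNorm.

Section InjectedModule.
Variables (K : pzRingType) (V : lmodType K).

(** Module laws are pulled back along an injection into a known module, once for operators,
    subspaces and weighted functions. *)
Lemma injected_zmod T (i : T -> V) z a (o : T -> T) : injective i -> i z = 0 ->
  (forall x y, i (a x y) = i x + i y) -> (forall x, i (o x) = - i x) ->
  (associative a * commutative a) * (left_id z a * left_inverse z o a).
Proof.
move=> ij iz ia io; (split; split; [move=> x y t | move=> x y | move=> x | move=> x]);
  apply: ij; rewrite !(ia, io, iz).
- exact: addrA.
- exact: addrC.
- exact: add0r.
- exact: addNr.
Qed.

Lemma injected_lmod (T : zmodType) (i : T -> V) (s : K -> T -> T) : injective i ->
  {morph i : x y / x + y} -> (forall k x, i (s k x) = k *: i x) ->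
  ((forall k l x, s k (s l x) = s (k * l) x) * left_id 1 s) *
  (right_distributive s +%R * (forall x, {morph s^~ x : k l / k + l})).
Proof.
move=> ij ia is_; (split; split; [move=> k l x | move=> x | move=> k x y | move=> x k l]);
  apply: ij; rewrite !(ia, is_).
- exact: scalerA.
- exact: scale1r.
- exact: scalerDr.
- exact: scalerDl.
Qed.
End InjectedModule.

Section HilbertBasics.
Variables (R : realType) (H : hilbert R).
Implicit Types (x y z : H) (c : R[i]).

Lemma ipDl x y z : ip (x + y) z = ip x z + ip y z.
Proof. by have := ip_linear 1 x y z; rewrite scale1r mul1r. Qed.
Lemma ip0l z : ip (0 : H) z = 0.
Proof. by apply: (@addrI _ (ip (0 : H) z)); rewrite -ipDl !addr0. Qed.
Lemma ipZl c x z : ip (c *: x) z = c * ip x z.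
Proof. by have := ip_linear c x 0 z; rewrite !addr0 ip0l addr0. Qed.
Lemma ipDr x y z : ip z (x + y) = ip z x + ip z y.
Proof. by rewrite ip_conj ipDl rmorphD /= -!ip_conj. Qed.
Lemma ip0r z : ip z (0 : H) = 0.
Proof. by rewrite ip_conj ip0l rmorph0. Qed.
Lemma ipZr c x z : ip z (c *: x) = c^* * ip z x.
Proof. by rewrite ip_conj ipZl rmorphM /= -ip_conj. Qed.
Lemma ipNl x z : ip (- x) z = - ip x z.
Proof. by rewrite -scaleN1r ipZl mulN1r. Qed.
Lemma ipNr x z : ip z (- x) = - ip z x.
Proof. by rewrite -scaleN1r ipZr rmorphN1 mulN1r. Qed.
Lemma ipBl x y z : ip (x - y) z = ip x z - ip y z.
Proof. by rewrite ipDl ipNl. Qed.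
Lemma ipBr x y z : ip z (x - y) = ip z x - ip z y.
Proof. by rewrite ipDr ipNr. Qed.

Lemma ip_rn x : ip x x = (rn x ^+ 2)%:C%C.
Proof. by rewrite ip_norm rnE rmorphXn. Qed.

Lemma rn_ipE x : rn x ^+ 2 = Re (ip x x).
Proof. by rewrite ip_rn. Qed.

Lemma rn_sqrB x y c : rn (x - c *: y) ^+ 2 =
  rn x ^+ 2 - 2 * Re (c^* * ip x y) + rn c ^+ 2 * rn y ^+ 2.
Proof.
rewrite !rn_ipE ipBl !ipBr !ipZl !ipZr [ip y x]ip_conj !ip_rn.
have -> : rn c ^+ 2 = Re (c * c^*) by rewrite -normCK rnE -rmorphXn.
move: (rn x ^+ 2) (rn y ^+ 2) (ip x y) => a b [p q]; case: c => u v.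
by rewrite !conjE /=; ring.
Qed.

Lemma ip_cs x y : rn (ip x y) <= rn x * rn y.
Proof.
rewrite -(@ler_pXn2r _ 2) ?nnegrE ?mulr_ge0 // exprMn.
by apply: cs_num => [||l]; rewrite ?sqr_ge0 // -rn_sqrB sqr_ge0.
Qed.

Lemma ip_inj x y : (forall z, ip x z = ip y z) -> x = y.
Proof.
move=> h; apply/eqP; rewrite -subr_eq0 -normr_eq0 -sqrf_eq0 -ip_norm.
by rewrite ipBl h subrr.
Qed.

Lemma ip_injr x y : (forall z, ip z x = ip z y) -> x = y.
Proof. by move=> h; apply: ip_inj => z; rewrite ip_conj h -ip_conj. Qed.

Lemma parallelogram x y :
  rn (x + y) ^+ 2 + rn (x - y) ^+ 2 = 2 * rn x ^+ 2 + 2 * rn y ^+ 2.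
Proof.
rewrite !rn_ipE ipBl !ipBr ipDl !ipDr.
move: (ip x x) (ip x y) (ip y x) (ip y y) => [a a'] [b b'] [c c'] [d d'] /=; ring.
Qed.

Lemma blin_ipl z : blin (fun x => (ip x z : R[i]^o)).
Proof.
split=> [c x y|]; first by rewrite ip_linear.
by exists (rn z) => [|x]; rewrite // mulrC; apply: ip_cs.
Qed.

Lemma clsub_perp z : clsub [set x : H | ip x z = 0].
Proof. exact: (clsub_ker (blin_ipl z)). Qed.

Lemma ip_dense (S : set H) x y : cspan S = setT ->
  (forall z, S z -> ip x z = ip y z) -> x = y.
Proof.
move=> hS h; apply/eqP; rewrite -subr_eq0; apply/eqP; apply: ip_injr => z.
apply: (cspanT_ind hS (clsub_pre (blin_id H) (P := [set z | ip z (x - y) = ip z 0]) _)).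
  by rewrite (_ : [set z | _] = [set z | ip z (x - y) = 0]); [exact: clsub_perp | by apply/seteqP; split => u /=; rewrite ip0r].
by move=> u Su /=; rewrite ip0r ip_conj ipBl h // subrr rmorph0.
Qed.

End HilbertBasics.

Section BoundedOps.
Variables (R : realType) (H : hilbert R).

(** The adjoint is part of the data, so that the star needs no representation theorem; the
    underlying map still determines the operator by [bop_eq]. *)
Record bop := BOp {
  ba :> H -> H;
  bs : H -> H;
  bas : forall x y, ip (ba x) y = ip x (bs y);
  bab : exists2 M : R, 0 <= M & forall x, rn (ba x) <= M * rn x
}.

HB.instance Definition _ := gen_eqMixin bop.
HB.instance Definition _ := gen_choiceMixin bop.

Implicit Types (S T U : bop) (x y : H).

Lemma bop_eq S T : S =1 T -> S = T.
Proof.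
move=> /funext; case: S T => [f f' h k] [g g' h' k'] /= e; subst g.
have e : f' = g'.
  by apply/funext => y; apply: ip_injr => x; rewrite -h -h'.
by subst g'; congr BOp; apply: Prop_irrelevance.
Qed.

Lemma bop_lin T : linear T.
Proof. by move=> c x y; apply: ip_inj => z; rewrite bas !ip_linear -!bas. Qed.

Lemma bsa T x y : ip (bs T x) y = ip x (T y).
Proof. by rewrite ip_conj -bas -ip_conj. Qed.

Lemma bsb T : exists2 M : R, 0 <= M & forall x, rn (bs T x) <= M * rn x.
Proof.
have [M M0 hM] := bab T; exists M => // x.
have [->|n0] := eqVneq (rn (bs T x)) 0; first by rewrite mulr_ge0 // rn_ge0.
have np : 0 < rn (bs T x) by rewrite lt_neqAle eq_sym n0 rn_ge0.
rewrite -(ler_pM2r np) -expr2 rn_ipE bsa.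
apply: (@le_trans _ _ (rn (ip x (T (bs T x))))).
  by rewrite -bsa ip_rn rn_real real_ler_norm // num_real.
apply: (le_trans (ip_cs _ _)); rewrite mulrC -mulrA.
apply: (le_trans (ler_wpM2r (rn_ge0 x) (hM _))).
by rewrite -!mulrA ler_wpM2l // mulrC.
Qed.

Definition bzero : bop.
Proof.
exists (fun=> 0) (fun=> 0) => [x y|]; first by rewrite ip0l ip0r.
by exists 0 => // x; rewrite rn0 mul0r.
Defined.
Definition badd S T : bop.
Proof.
exists (fun x => S x + T x) (fun x => bs S x + bs T x) => [x y|].
  by rewrite ipDl ipDr !bas.
have [M M0 hM] := bab S; have [N N0 hN] := bab T.
exists (M + N) => [|x]; first exact: addr_ge0.
by rewrite mulrDl; apply: (le_trans (rnD _ _)); apply: lerD.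
Defined.
Definition bscale (c : R[i]) T : bop.
Proof.
exists (fun x => c *: T x) (fun x => c^* *: bs T x) => [x y|].
  by rewrite ipZl ipZr bas conjCK.
have [M M0 hM] := bab T; exists (rn c * M) => [|x]; first by rewrite mulr_ge0.
by rewrite rnZ -mulrA ler_wpM2l.
Defined.
Definition bmul S T : bop.
Proof.
exists (fun x => S (T x)) (fun x => bs T (bs S x)) => [x y|]; first by rewrite !bas.
have [M M0 hM] := bab S; have [N N0 hN] := bab T.
exists (M * N) => [|x]; first exact: mulr_ge0.
by apply: (le_trans (hM _)); rewrite -mulrA ler_wpM2l.
Defined.
Definition bstar T : bop.
Proof.
exists (bs T) (ba T) => [x y|]; first exact: bsa.
exact: bsb.
Defined.
Definition bone : bop.
Proof. by exists id id => //; exists 1 => // x; rewrite mul1r. Defined.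

Fact ba_inj : injective ba. Proof. by move=> S T e; apply: bop_eq => x; rewrite e. Qed.
Definition bop_zmod := @injected_zmod _ _ _ ba bzero badd (bscale (-1)) ba_inj
  erefl (fun _ _ => erefl) (fun T => funext (fun x => scaleN1r (T x))).
HB.instance Definition _ := GRing.isZmodule.Build bop
  bop_zmod.1.1 bop_zmod.1.2 bop_zmod.2.1 bop_zmod.2.2.
Definition bop_lmod := @injected_lmod R[i] _ _ ba bscale ba_inj (fun _ _ => erefl)
  (fun _ _ => erefl).
HB.instance Definition _ := GRing.Zmodule_isLmodule.Build R[i] bop
  bop_lmod.1.1 bop_lmod.1.2 bop_lmod.2.1 bop_lmod.2.2.
Fact bmulA S T U : bmul S (bmul T U) = bmul (bmul S T) U.
Proof. exact: bop_eq. Qed.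
Fact bmulDl S T U : bmul (S + T) U = bmul S U + bmul T U.
Proof. exact: bop_eq. Qed.
Fact bmulDr S T U : bmul S (T + U) = bmul S T + bmul S U.
Proof. by apply: bop_eq => x /=; rewrite (linD (bop_lin S)). Qed.
Fact bmulZl k S T : bmul (k *: S) T = k *: bmul S T.
Proof. exact: bop_eq. Qed.
Fact bmulZr k S T : bmul S (k *: T) = k *: bmul S T.
Proof. by apply: bop_eq => x /=; rewrite (linZ (bop_lin S)). Qed.
Fact bstarK : involutive bstar.
Proof. by move=> T; apply: bop_eq. Qed.
Fact bstarD S T : bstar (S + T) = bstar S + bstar T.
Proof. exact: bop_eq. Qed.
Fact bstarZ k T : bstar (k *: T) = k^* *: bstar T.
Proof. exact: bop_eq. Qed.
Fact bstarM S T : bstar (bmul S T) = bmul (bstar T) (bstar S).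
Proof. exact: bop_eq. Qed.
HB.instance Definition _ := Lmodule_isStarAlgebra.Build R[i] bop
  bmulA bmulDl bmulDr bmulZl bmulZr bstarK bstarD bstarZ bstarM.

Lemma bop_adj T x y : ip (T x) y = ip x (star T y).
Proof. exact: bas. Qed.

Definition bnorm (T : bop) : R := opn (@rn R H) ba T.
Let w0 x : 0 <= rn x. Proof. exact: rn_ge0. Qed.
Let bL c S T x : (c *: S + T : bop) x = c *: S x + T x. Proof. by []. Qed.
Let bI T : (forall x, T x = 0) -> T = 0.
Proof. by move=> h; apply: bop_eq. Qed.

Lemma bnorm_bd T x : rn (T x) <= bnorm T * rn x.
Proof. exact: (opn_bd w0 bab). Qed.
Lemma bnorm_le T (M : R) : 0 <= M -> (forall x, rn (T x) <= M * rn x) -> bnorm T <= M.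
Proof. exact: opn_le. Qed.
Lemma bnorm_ge0 T : 0 <= bnorm T. Proof. exact: (opn_ge0 bab). Qed.

HB.instance Definition _ := Lmodule_isNormed.Build R[i] bop
  (opnCD w0 bL bab) (opnCZ w0 bL bab) (opnC_eq0 w0 bI bab).

Lemma rn_bop T x : rn (T x) <= rn T * rn x.
Proof. exact: bnorm_bd. Qed.
Lemma rn_bop_le T (M : R) : 0 <= M -> (forall x, rn (T x) <= M * rn x) -> rn T <= M.
Proof. exact: bnorm_le. Qed.

Lemma bnormM S T : bnorm (S ** T) <= bnorm S * bnorm T.
Proof.
apply: bnorm_le => [|x]; first by rewrite mulr_ge0 ?bnorm_ge0.
apply: (le_trans (bnorm_bd S (T x))); rewrite -mulrA.
by rewrite ler_wpM2l ?bnorm_ge0 // bnorm_bd.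
Qed.

Lemma bop_cstar_le T : bnorm T ^+ 2 <= bnorm (star T ** T).
Proof.
have h x : rn (T x) <= Num.sqrt (bnorm (star T ** T)) * rn x.
  rewrite -(@ler_pXn2r _ 2) ?nnegrE ?rn_ge0 ?mulr_ge0 ?sqrtr_ge0 //.
  rewrite exprMn sqr_sqrtr ?bnorm_ge0 // rn_ipE bop_adj.
  apply: (@le_trans _ _ (rn (ip x (star T (T x))))).
    by rewrite -bop_adj ip_rn rn_real real_ler_norm // num_real.
  apply: (le_trans (ip_cs _ _)); rewrite expr2.
  apply: (le_trans (ler_wpM2l (rn_ge0 x) (bnorm_bd (star T ** T) x))).
  by rewrite mulrCA mulrA.
by rewrite -[leRHS]sqr_sqrtr ?bnorm_ge0 // lerXn2r ?nnegrE ?bnorm_ge0 ?sqrtr_ge0 // bnorm_le.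
Qed.

Lemma bnorm_star T : bnorm (star T) = bnorm T.
Proof.
suff h S : bnorm S <= bnorm (star S) by apply/eqP; rewrite eq_le h -{2}(starK T) h.
have [->|n0] := eqVneq (bnorm S) 0; first exact: bnorm_ge0.
have np : 0 < bnorm S by rewrite lt_neqAle eq_sym n0 bnorm_ge0.
rewrite -(ler_pM2r np) -expr2; apply: (le_trans (bop_cstar_le S)); exact: bnormM.
Qed.

Lemma bop_cstar_id T : bnorm (star T ** T) = bnorm T ^+ 2.
Proof.
apply/eqP; rewrite eq_le bop_cstar_le andbT; apply: (le_trans (bnormM _ _)).
by rewrite bnorm_star expr2.
Qed.

Lemma bop_complete (u : nat -> bop) : cauchys u -> exists l, cvs u l.
Proof.
apply: (opn_complete w0 bL bab (@cauchy_cvs _ H)) => v F M M0 hM hF hv.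
have cs x : exists l, cvs (fun k => star (v k) x) l.
  apply: cauchy_cvs => e e0; have a1 : 0 < rn x + 1 by have := rn_ge0 x; lra.
  have [N hN] := hv (e / (rn x + 1)) ltac:(by rewrite divr_gt0).
  exists N => k l hm hn; have := hN k l hm hn; rewrite ltr_pdivlMr // => h.
  have -> : star (v k) x - star (v l) x = (star (v k - v l)) x.
    by rewrite stB /= scaleN1r.
  apply: (le_lt_trans (bnorm_bd _ _)); rewrite bnorm_star.
  by have := bnorm_ge0 (v k - v l); rewrite -/(bnorm _) in h *; nra.
pose F' x := projT1 (cid (cs x)).
have hF' x : cvs (fun k => star (v k) x) (F' x) by exact: (projT2 (cid (cs x))).
have rel x y : ip (F x) y = ip x (F' y).
  have c1 : cvs (fun k : nat => (ip (v k x) y : R[i])) (ip (F x) y).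
    refine (cvs_comp (f := fun z => ip z y) (M := rn y) _ (hF x)) => z z'.
    by rewrite -ipBl mulrC; apply: ip_cs.
  apply: (cvs_unique c1).
  apply: (@cvs_ext _ _ (fun k => ip x (star (v k) y))).
    by move=> k; rewrite bop_adj.
  refine (cvs_comp (f := fun z => ip x z) (M := rn x) _ (hF' y)) => z z'.
  by rewrite -ipBr; apply: ip_cs.
have bd : exists2 M : R, 0 <= M & forall x, rn (F x) <= M * rn x.
  by exists M => // x; apply: (cvs_le (hF x)); exists 0%N => k _.
by exists (BOp rel bd).
Qed.

HB.instance Definition _ := Uniform_isComplete.Build bop (seq_complete bop_complete).

Fact bop_normM S T : `|S ** T| <= `|S| * `|T|.
Proof. by rewrite !rnE -rmorphM lecR; apply: bnormM. Qed.
Fact bop_normC T : `|star T ** T| = `|T| ^+ 2.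
Proof. by rewrite !rnE -rmorphXn; congr (_ %:C)%C; apply: bop_cstar_id. Qed.
HB.instance Definition _ := isCStar.Build R bop bop_normM bop_normC.

End BoundedOps.
Arguments bone {R} H.

(** * Square roots and positivity without spectral theory *)

Section Commute.
Variables (K : numClosedFieldType) (A : starAlgType K).
Implicit Types x y z : A.
Definition com x y := x ** y = y ** x.
Definition sa x := star x = x.
Lemma comC x y : com x y -> com y x. Proof. by []. Qed.
Lemma comD x y z : com x y -> com x z -> com x (y + z).
Proof. by rewrite /com smulDl smulDr => -> ->. Qed.
Lemma comN x y : com x y -> com x (- y).
Proof. by rewrite /com smNr smNl => ->. Qed.
Lemma comB x y z : com x y -> com x z -> com x (y - z).
Proof. by move=> h k; apply: comD => //; apply: comN. Qed.
Lemma comZ c x y : com x y -> com x (c *: y).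
Proof. by rewrite /com smulZl smulZr => ->. Qed.
Lemma comM x y z : com x y -> com x z -> com x (y ** z).
Proof. by rewrite /com => h k; rewrite smulA h -smulA k smulA. Qed.
Lemma com0 x : com x 0. Proof. by rewrite /com sm0r sm0l. Qed.
Lemma saD x y : sa x -> sa y -> sa (x + y).
Proof. by rewrite /sa starD => -> ->. Qed.
Lemma saN x : sa x -> sa (- x). Proof. by rewrite /sa stN => ->. Qed.
Lemma saB x y : sa x -> sa y -> sa (x - y).
Proof. by move=> h k; apply: saD => //; apply: saN. Qed.
Lemma saM x y : com x y -> sa x -> sa y -> sa (x ** y).
Proof. by rewrite /sa /com starM => h -> ->; rewrite h. Qed.
Lemma sa2 x : sa x -> sa (x ** x). Proof. by move=> h; apply: saM. Qed.
Lemma sa0 : sa (0 : A). Proof. exact: st0. Qed.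
Lemma sa_starM x : sa (star x ** x). Proof. by rewrite /sa starM starK. Qed.
Lemma sa_Mstar x : sa (x ** star x). Proof. by rewrite /sa starM starK. Qed.
End Commute.

Lemma saZ (R : realType) (A : starAlgType R[i]) (r : R) (x : A) : sa x -> sa (r%:C%C *: x).
Proof. by rewrite /sa starZ => ->; congr (_ *: _); apply: conjc_real. Qed.

Section SqrtIteration.
Variables (R : realType).

(** The recursion [sk] for the scalar [t], whose fixed point in [0, 1] is 1 - sqrt (1 - t). It
    increases and is bounded by 1 even at [t = 1], and its increments majorize those of [sk]; this
    gives convergence on the whole closed unit ball. *)
Fixpoint sg (t : R) k := if k is k'.+1 then (t + sg t k' ^+ 2) / 2 else 0.

Lemma sg_bounds t k : 0 <= t <= 1 -> 0 <= sg t k <= 1 /\ sg t k <= sg t k.+1.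
Proof.
move=> /andP[t0 t1]; elim: k => [|k [/andP[h0 h1] h2]].
  by rewrite /= expr0n addr0 lexx ler01; split=> //; lra.
have a0 : 0 <= sg t k.+1 by apply: le_trans h0 _.
have a1 : sg t k.+1 <= 1.
  have := exprn_ile1 2 h0 h1; rewrite /=; lra.
split; first by rewrite a0.
have : sg t k ^+ 2 <= sg t k.+1 ^+ 2 by rewrite lerXn2r ?nnegrE.
have e1 : sg t k.+1 = (t + sg t k ^+ 2) / 2 by [].
by have -> : sg t k.+2 = (t + sg t k.+1 ^+ 2) / 2 by []; lra.
Qed.

Lemma sg_cauchy t : 0 <= t <= 1 -> forall e : R, 0 < e ->
  exists N, forall m, (N <= m)%N -> sg t m - sg t N < e.
Proof.
move=> ht e e0; have hs : has_sup (range (sg t)).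
  split; first by exists (sg t 0), 0%N.
  by exists 1 => _ [k _ <-]; have [/andP[]] := sg_bounds k ht.
have [_ [N _ <-] hN] := sup_adherent e0 hs; exists N => m _.
have : sg t m <= sup (range (sg t)) by apply: sup_upper_bound => //; exists m.
by lra.
Qed.

Variable A : cstarType R.
Implicit Types x y : A.

Definition hlf : R[i] := (2^-1 : R)%:C%C.

Fixpoint sk x k := if k is k'.+1 then hlf *: (x + sk x k' ** sk x k') else 0.

Lemma sk_com x y k : com y x -> com y (sk x k).
Proof.
move=> h; elim: k => [|k ih]; first exact: com0.
by apply/comZ/comD => //; apply: comM.
Qed.

Lemma sk_com2 x k l : com (sk x k) (sk x l).
Proof. by apply: sk_com; apply: comC; apply: sk_com. Qed.

Lemma sk_sub (P : set A) x k : clsub P -> (forall a b, P a -> P b -> P (a ** b)) ->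
  P x -> P (sk x k).
Proof.
move=> cP mP Px; elim: k => [|k ih] /=; first exact: cls0.
by apply: (clsZ cP); apply: (clsD cP) => //; apply: mP.
Qed.

Lemma sk_sa x k : sa x -> sa (sk x k).
Proof. by move=> h; elim: k => [|k ih] /=; [exact: sa0 | apply/saZ/saD => //; exact: sa2]. Qed.

Lemma sk_le x k : rn x <= 1 -> rn (sk x k) <= sg (rn x) k.
Proof.
move=> hx; elim: k => [|k ih] /=; first by rewrite rn0.
rewrite rnZr ?invr_ge0 // mulrC ler_wpM2r ?invr_ge0 //.
apply: (le_trans (rnD _ _)); rewrite lerD2l; apply: (le_trans (rnM_le _ _)).
by rewrite expr2; apply: ler_pM.
Qed.

(** On both sides a difference of squares is factored as (difference) times (sum); in the algebra
    this uses that the iterates commute. *)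
Lemma sk_step x k : rn x <= 1 ->
  rn (sk x k.+1 - sk x k) <= sg (rn x) k.+1 - sg (rn x) k.
Proof.
move=> hx; elim: k => [|k ih].
  by rewrite /= subr0 sm0l addr0 expr0n addr0 subr0 rnZr ?invr_ge0 // mulrC.
have -> : sk x k.+2 - sk x k.+1 =
    hlf *: ((sk x k.+1 - sk x k) ** (sk x k.+1 + sk x k)).
  have -> : sk x k.+2 = hlf *: (x + sk x k.+1 ** sk x k.+1) by [].
  have {2}-> : sk x k.+1 = hlf *: (x + sk x k ** sk x k) by [].
  rewrite -scalerBr opprD addrACA subrr add0r; congr (_ *: _).
  by rewrite smBl !smulDr (sk_com2 x k k.+1) opprD addrACA addrA addrNK.
have -> : sg (rn x) k.+2 - sg (rn x) k.+1 =
    2^-1 * ((sg (rn x) k.+1 - sg (rn x) k) * (sg (rn x) k.+1 + sg (rn x) k)).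
  have -> : sg (rn x) k.+2 = (rn x + sg (rn x) k.+1 ^+ 2) / 2 by [].
  have {2}-> : sg (rn x) k.+1 = (rn x + sg (rn x) k ^+ 2) / 2 by [].
  by field.
rewrite rnZr ?invr_ge0 // ler_wpM2l ?invr_ge0 //; apply: (le_trans (rnM_le _ _)).
apply: ler_pM; rewrite //; apply: (le_trans (rnD _ _)).
by apply: lerD; apply: sk_le.
Qed.

Lemma sk_tail x m n : rn x <= 1 -> (m <= n)%N ->
  rn (sk x n - sk x m) <= sg (rn x) n - sg (rn x) m.
Proof.
move=> hx mn; rewrite -(subnKC mn); elim: (n - m)%N => [|k ih].
  by rewrite addn0 !subrr rn0.
rewrite addnS; apply: (le_trans (rn_tri _ (sk x (m + k)) _)).
by have := sk_step (m + k) hx; lra.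
Qed.

Lemma sk_cvs x : rn x <= 1 -> exists l, cvs (sk x) l.
Proof.
move=> hx; apply: cauchy_cvs => e e0; have ht : 0 <= rn x <= 1 by rewrite rn_ge0.
have [N hN] := sg_cauchy ht (e := e / 2) ltac:(lra).
exists N => m n hm hn; have := sk_tail hx hm; have := sk_tail hx hn.
have := hN m hm; have := hN n hn; have := rn_tri (sk x m) (sk x N) (sk x n).
by rewrite (rnC (sk x N)); lra.
Qed.

(** For [|x| <= 1], [sqs x] is [1 - sqrt (1 - x)]. *)
Definition sqs x : A := xget 0 [set l | cvs (sk x) l].

Lemma sqsP x : rn x <= 1 -> cvs (sk x) (sqs x).
Proof. by move=> /sk_cvs[l hl]; apply: (@xgetPex _ 0 [set l | cvs (sk x) l]); exists l. Qed.

Lemma cvsM (u v : nat -> A) l m : cvs u l -> cvs v m -> cvs (fun k => u k ** v k) (l ** m).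
Proof.
move=> hu hv e e0; have l1 : 0 < rn l + 1 by have := rn_ge0 l; lra.
have m1 : 0 < rn m + 1 by have := rn_ge0 m; lra.
have [N hN] := hu (Num.min 1 (e / (2 * (rn m + 1))))
  ltac:(by rewrite lt_min ltr01 divr_gt0 //; lra).
have [N' hN'] := hv (e / (2 * (rn l + 1))) ltac:(by rewrite divr_gt0 //; lra).
exists (maxn N N') => k; rewrite geq_max => /andP[/hN + /hN'].
rewrite lt_min => /andP[h1]; rewrite !ltr_pdivlMr; [|lra..] => h2 h3.
have -> : u k ** v k - l ** m = u k ** (v k - m) + (u k - l) ** m.
  by rewrite smBr smBl addrA subrK.
apply: (le_lt_trans (rnD _ _)).
have a1 := rnM_le (u k) (v k - m); have a2 := rnM_le (u k - l) m.
have a3 := rn_leD (u k) l; have := rn_ge0 (v k - m); have := rn_ge0 (u k - l).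
have := rn_ge0 l; have := rn_ge0 m; nra.
Qed.

Lemma cvsZ (V : normedModType R[i]) (u : nat -> V) l c : cvs u l -> cvs (fun k => c *: u k) (c *: l).
Proof. exact: (blin_cvs (blinZ c (blin_id V))). Qed.

(** In other words (1 - s)^2 = 1 - x for [s = sqs x]. Written without the unit, the identity
    survives every homomorphism. *)
Lemma sqs_eq x : rn x <= 1 -> sqs x + sqs x = x + sqs x ** sqs x.
Proof.
move=> hx; have h := sqsP hx.
have h1 : cvs (fun k => sk x k.+1) (hlf *: (x + sqs x ** sqs x)).
  by apply: cvsZ; apply: cvsD; [apply: cvs_cst | apply: cvsM].
have -> : x + sqs x ** sqs x = (1 + 1) *: (hlf *: (x + sqs x ** sqs x)).
  rewrite scalerA (_ : (1 + 1) * hlf = 1) ?scale1r // /hlf.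
  by rewrite -[1 + 1](rmorph_nat (real_complex R) 2) -rmorphM mulfV //= pnatr_eq0.
by rewrite -(cvs_unique (cvs_shift h) h1) scalerDl !scale1r.
Qed.

Lemma sqs_le x : rn x <= 1 -> rn (sqs x) <= 1.
Proof.
move=> hx; apply: (cvs_le (sqsP hx)); exists 0%N => k _.
by apply: (le_trans (sk_le k hx)); have [/andP[]] := @sg_bounds (rn x) k ltac:(by rewrite rn_ge0).
Qed.

Lemma sqs_sub (P : set A) x : rn x <= 1 -> clsub P ->
  (forall a b, P a -> P b -> P (a ** b)) -> P x -> P (sqs x).
Proof. by move=> hx cP mP Px; apply: (cls_cvs cP _ (sqsP hx)) => k; apply: sk_sub. Qed.

Lemma blin_mull (a : A) : blin (fun x => a ** x).
Proof.
split=> [c x y|]; first by rewrite smulDr smulZr.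
by exists (rn a) => // x; exact: rnM_le.
Qed.
Lemma blin_mulr (a : A) : blin (fun x => x ** a).
Proof.
split=> [c x y|]; first by rewrite smulDl smulZl.
by exists (rn a) => // x; rewrite mulrC; exact: rnM_le.
Qed.

Lemma sqs_com x y : rn x <= 1 -> com y x -> com y (sqs x).
Proof.
move=> hx h; apply: (@sqs_sub [set z | y ** z = z ** y] x) => //.
  exact: (clsub_eq (blin_mull y) (blin_mulr y)).
by move=> a b ha hb; apply: (@comM _ _ y a b).
Qed.

Lemma sqs_sa x : rn x <= 1 -> sa x -> sa (sqs x).
Proof.
move=> hx h; apply: (cvs_unique (u := sk x)); last exact: sqsP.
apply: (@cvs_ext _ _ (star \o sk x)); first by move=> k /=; apply: sk_sa.
refine (cvs_comp (f := star) (M := 1) _ (sqsP hx)) => a b.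
by rewrite -stB rn_star mul1r.
Qed.

End SqrtIteration.

Lemma hlfE (R : realType) : hlf R = 2^-1.
Proof. by rewrite /hlf fmorphV rmorph_nat. Qed.

Definition iu (R : realType) : R[i] := 'i%C.
Lemma iu_sq (R : realType) : iu R * iu R = -1. Proof. by rewrite -expr2 sqr_i. Qed.
Lemma iu_conj (R : realType) : (iu R)^* = - iu R.
Proof. by rewrite conjE /iu; simpc. Qed.
Lemma rn_iu (R : realType) : rn (iu R) = 1.
Proof. by rewrite /rn normc_def /= expr0n add0r expr1n sqrtr1. Qed.

Ltac nc R := rewrite ?(smulDl, smulDr, smNl, smNr, smulZl, smulZr, smulA); lmod R;
  rewrite ?hlfE; try (by ring); try (by field).

Section Positivity.
Variables (R : realType) (E : cstarType R) (e : E).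
Hypotheses (el : left_id e smul) (er : right_id e smul).
Implicit Types (a b c d h k x y z : E) (t : R).

Lemma sa_unit : sa e.
Proof. by rewrite /sa -[LHS]el -{1}[e]starK -starM el starK. Qed.

Lemma com_unit x : com x e. Proof. by rewrite /com el er. Qed.

Lemma rn_unit : rn e <= 1.
Proof.
have := rn_starM e; rewrite sa_unit el; have := rn_ge0 e; nra.
Qed.

(** No spectrum is used. The working criterion is metric: for selfadjoint [a] and positive
    [t >= |a|], positivity amounts to |t e - a| <= t, by [posI] and [pos_nearE]. *)
Definition pos a := exists2 h, sa h & a = h ** h.

Lemma pos_sa a : pos a -> sa a. Proof. by case=> h hh ->; apply: sa2. Qed.

Lemma pos0 : pos 0. Proof. by exists 0; rewrite ?sm0l //; apply: sa0. Qed.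

(** [h + i k] is unitary, and [h], [k] are its real and imaginary parts. *)
Lemma unit_pair h k : sa h -> sa k -> com h k -> h ** h + k ** k = e ->
  rn h <= 1 /\ rn k <= 1.
Proof.
move=> sh sk c hk;
pose u := h + iu R *: k; pose v := h - iu R *: k.
have vu : star u = v.
  by rewrite /u starD starZ sh sk /v iu_conj scaleNr.
have uu : v ** u = e.
  rewrite /u /v !smulDr !smBl smulZl !smulZr smulZl scalerA iu_sq scaleN1r opprK.
  by rewrite c -hk; nc R.
have ru : rn u <= 1.
  by have := rn_starM u; rewrite vu uu; have := rn_unit; have := rn_ge0 u; nra.
have rv : rn v <= 1 by rewrite -vu rn_star.
split.
  have -> : h = hlf R *: (u + v) by rewrite /u /v; nc R.
  by rewrite rnZr ?invr_ge0 //; have := rnD u v; lra.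
have -> : k = (- iu R * hlf R) *: (u - v).
  have -> : u - v = (2 * iu R) *: k by rewrite /u /v; nc R.
  have e2 : - iu R * 2^-1 * (2 * iu R) = - (iu R * iu R) by field.
  by rewrite scalerA hlfE e2 iu_sq opprK scale1r.
rewrite rnZ rnM rnN rn_real ger0_norm ?invr_ge0 //.
rewrite rn_iu.
by rewrite mul1r; have := rnD u (- v); rewrite rnN; lra.
Qed.

(** The root is [e - sqs x]. The norm clause records that it stays within 1 of the unit, which is
    what later makes roots themselves positive. *)
Lemma sqrt_sub x : rn x <= 1 -> sa x ->
  exists k, [/\ sa k, k ** k = e - x, forall y, com y x -> com y k & rn (e - k) <= 1].
Proof.
move=> hx sx; exists (e - sqs x); split.
- by apply: saB; [exact: sa_unit | exact: sqs_sa].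
- have := sqs_eq hx; move: (sqs x) => s es; rewrite smBl !smBr !el er.
  have -> : x = s + s - s ** s by rewrite es addrK.
  by nc R.
- by move=> y hy; apply: comB; [exact: com_unit | exact: sqs_com].
- by rewrite opprB addrC subrK sqs_le.
Qed.

Lemma scr (t s : R) x : t%:C%C *: (s%:C%C *: x) = (t * s)%:C%C *: x.
Proof. by rewrite scalerA -rmorphM. Qed.

Lemma pos_near a t : 0 < t -> sa a -> rn (t%:C%C *: e - a) <= t ->
  exists h, [/\ sa h, a = h ** h, forall y, com y a -> com y h
    & rn ((Num.sqrt t)%:C%C *: e - h) <= Num.sqrt t].
Proof.
move=> t0 s_a ha; pose x := e - (t^-1)%:C%C *: a.
have sx : sa x by apply: saB; [exact: sa_unit | exact: saZ].
have tx : x = (t^-1)%:C%C *: (t%:C%C *: e - a).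
  by rewrite scalerBr scr mulVf ?gt_eqF // scale1r.
have hx : rn x <= 1.
  by rewrite tx rnZr ?invr_ge0 ?(ltW t0) // ler_pdivrMl // mulr1.
have [k [sk k2 kc kn]] := sqrt_sub hx sx.
exists ((Num.sqrt t)%:C%C *: k); split.
- exact: saZ.
- rewrite smulZl smulZr k2 /x opprB addrC subrK !scr -expr2 sqr_sqrtr ?(ltW t0) //.
  by rewrite mulfV ?gt_eqF // scale1r.
- move=> y hy; apply: comZ; apply: kc; apply: comB; first exact: com_unit.
  exact: comZ.
- by rewrite -scalerBr rnZr ?sqrtr_ge0 // -[leRHS]mulr1 ler_wpM2l ?sqrtr_ge0.
Qed.

Lemma posI a t : 0 < t -> sa a -> rn (t%:C%C *: e - a) <= t -> pos a.
Proof. by move=> t0 s_a /(pos_near t0 s_a)[h [sh -> _ _]]; exists h. Qed.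

(** With [k] the root of e - h^2 the pair satisfies h^2 + k^2 = e, so |e - h^2| = |k|^2 is at most 1
    by [unit_pair]. *)
Lemma sq_near1 h : sa h -> rn h <= 1 -> rn (e - h ** h) <= 1.
Proof.
move=> sh hh; have h2 : rn (h ** h) <= 1.
  by apply: (le_trans (rnM_le _ _)); have := rn_ge0 h; nra.
have [k [sk k2 kc _]] := sqrt_sub h2 (sa2 sh).
have [] := @unit_pair h k sh sk _ _; last first.
- by rewrite -k2 => _; have := rn_starM k; rewrite sk => ->; have := rn_ge0 k; nra.
- by rewrite k2 addrC subrK.
- by apply: kc; apply: comM.
Qed.

Lemma pos_nearE a t : 0 < t -> pos a -> rn a <= t -> rn (t%:C%C *: e - a) <= t.
Proof.
move=> t0 [h sh ->] ht; pose r := Num.sqrt t.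
have r0 : 0 < r by rewrite sqrtr_gt0.
have rr : r * r = t by rewrite -expr2 sqr_sqrtr // ltW.
have sh' : sa ((r^-1)%:C%C *: h) by exact: saZ.
have rh : rn ((r^-1)%:C%C *: h) <= 1.
  rewrite rnZr ?invr_ge0 ?(ltW r0) // ler_pdivrMl // mulr1.
  rewrite -(@ler_pXn2r _ 2) ?nnegrE ?rn_ge0 ?(ltW r0) // sqr_sqrtr ?(ltW t0) //.
  by rewrite -rn_starM (_ : star h = h).
have := sq_near1 sh' rh; rewrite smulZl smulZr scr -invfM rr => h1.
have -> : t%:C%C *: e - h ** h = t%:C%C *: (e - (t^-1)%:C%C *: (h ** h)).
  by rewrite scalerBr scr mulfV ?gt_eqF // scale1r.
by rewrite rnZr ?(ltW t0) // -[leRHS]mulr1 ler_wpM2l // ltW.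
Qed.

Lemma posZ a t : 0 <= t -> pos a -> pos (t%:C%C *: a).
Proof.
move=> t0 [h sh ->]; exists ((Num.sqrt t)%:C%C *: h); first exact: saZ.
by rewrite smulZl smulZr scr -expr2 sqr_sqrtr.
Qed.

(** The metric criterion is additive: |s e - a| <= s and |t e - b| <= t give the criterion for a + b
    with the constant s + t. *)
Lemma posD a b : pos a -> pos b -> pos (a + b).
Proof.
move=> pa pb; have a0 := rn_ge0 a; have b0 := rn_ge0 b.
have h1 := pos_nearE (t := rn a + 1) ltac:(lra) pa ltac:(lra).
have h2 := pos_nearE (t := rn b + 1) ltac:(lra) pb ltac:(lra).
apply: (@posI _ (rn a + 1 + (rn b + 1))); first lra.
  by apply: saD; apply: pos_sa.
rewrite rmorphD /= scalerDl opprD addrACA; apply: (le_trans (rnD _ _)).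
exact: lerD.
Qed.

Lemma pos_root a : pos a ->
  exists h, [/\ pos h, a = h ** h & forall y, com y a -> com y h].
Proof.
move=> pa; have a0 := rn_ge0 a.
have h1 := pos_nearE (t := rn a + 1) ltac:(lra) pa ltac:(lra).
have [h [sh ah hc hn]] := pos_near (t := rn a + 1) ltac:(lra) (pos_sa pa) h1.
exists h; split => //; apply: posI sh hn; rewrite sqrtr_gt0; lra.
Qed.

(** If a = h^2 and -a = k^2 with [h], [k] commuting, then u = h + i k satisfies [u ** star u = 0],
    so [u] and its real part [h] vanish. *)
Lemma pos_anti a : pos a -> pos (- a) -> a = 0.
Proof.
move=> /pos_root[h [/pos_sa sh ah hc]] [k sk ak].
have hk : com h k.
  apply: comC; apply: hc; rewrite -[a]opprK ak; apply: comN; exact: comM.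
pose u := h + iu R *: k.
have uu : u ** star u = 0.
  rewrite starD starZ sh sk iu_conj /u.
  have -> : (h + iu R *: k) ** (h + - iu R *: k) = h ** h - (iu R * iu R) *: (k ** k).
    by rewrite ?(smulDl, smulDr) ?(smulZl, smulZr) hk; nc R.
  by rewrite iu_sq scaleN1r opprK -ah -ak subrr.
have u0 : u = 0 by apply: (can_inj starK); rewrite st0; apply: star_smul_eq0; rewrite starK.
have v0 : h - iu R *: k = 0.
  have : star u = 0 by rewrite u0 st0.
  by rewrite starD starZ sh sk iu_conj scaleNr.
suff h0 : h = 0 by rewrite ah h0 sm0l.
have : u + (h - iu R *: k) = 0 by rewrite u0 v0 addr0.
rewrite /u addrACA subrr addr0.
move/eqP; rewrite -mulr2n -scaler_nat scaler_eq0 => /orP[|/eqP //].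
by rewrite -(rmorph_nat (real_complex R)) => /eqP/complexI/eqP; rewrite pnatr_eq0.
Qed.

Lemma sq_eq0 h : sa h -> h ** h = 0 -> h = 0.
Proof. by move=> sh hh; apply: star_smul_eq0; rewrite sh. Qed.

(** The sum is twice the sum of the squares of the real and imaginary parts of [z]. *)
Lemma sum_squares z : exists2 p, pos p & z ** star z + star z ** z = p.
Proof.
pose p := hlf R *: (z + star z); pose q := (iu R * hlf R) *: (star z - z).
have cj : (hlf R)^* = hlf R by exact: conjc_real.
have sp : sa p by rewrite /sa /p starZ starD starK cj addrC.
have ci := iu_conj R.
have sq : sa q.
  by rewrite /sa /q starZ rmorphM /= ci cj stB starK mulNr scaleNr -scalerN opprB.
exists ((2 : R)%:C%C *: (p ** p + q ** q)).
  by apply: posZ => //; apply: posD; [exists p | exists q].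
rewrite /p /q !smulZl !smulZr !scalerA.
have -> : iu R * hlf R * (iu R * hlf R) = - (hlf R * hlf R).
  by rewrite mulrACA iu_sq mulN1r.
rewrite scaleNr -scalerBr scalerA.
have -> : (z + star z) ** (z + star z) - (star z - z) ** (star z - z) =
    (2 : R)%:C%C *: (z ** star z + star z ** z).
  by nc R.
have e2 : (2 : R)%:C%C * (hlf R * hlf R) * (2 : R)%:C%C = 1 by rewrite hlfE rmorph_nat; field.
by rewrite scalerA e2 scale1r addrC.
Qed.
End Positivity.

Section Positivity2.
Variables (R : realType) (E : cstarType R) (e : E).
Hypotheses (el : left_id e smul) (er : right_id e smul).
Implicit Types (a b c d h k x y z : E) (t : R).

Let pa_sa a : pos a -> sa a := @pos_sa R E a.

Lemma pos_starM x : pos (star x ** x).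
Proof.
set a := star x ** x; have s_a : sa a by exact: sa_starM.
have [b [pb bb bc]] := pos_root el er (ex_intro2 _ _ a s_a erefl).
have cba : com b a by apply/comC/bc/comM.
have [s [ps ss sc]] := pos_root el er pb.
have csa : com s a by apply/comC/sc/comC.
(* Twice the negative part of [a]; the goal is [d = 0]. *)
pose d := b - a.
have sd : sa d by apply: saB => //; exact: pa_sa.
have csd : com s d by apply: comB => //; apply/comC/sc.
have ad : a ** d = - (b ** d).
  by rewrite /d !smBr opprB -cba bb.
pose c := s ** d.
have s_c : sa c by apply: saM => //; exact: pa_sa.
have cc : c ** c = b ** (d ** d).
  by rewrite /c -smulA (smulA d) -csd -smulA smulA -ss.
pose y := x ** d.
have yy : star y ** y = - (c ** c).
  have -> : star y ** y = d ** (a ** d).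
    by rewrite /y starM sd /a !smulA.
  have cdb : com d b by apply: comC; apply: comB.
  by rewrite ad smNr smulA cdb -smulA cc.
pose z := y ** c.
have zz : star z ** z = - ((c ** c) ** (c ** c)).
  by rewrite /z starM s_c -smulA (smulA (star y)) yy smNl smNr !smulA.
pose w := y ** star y.
have zz' : z ** star z = - (w ** w).
  rewrite /z starM s_c /w smulA -(smulA y c c) -[c ** c]opprK -yy.
  by rewrite smNr smNl !smulA.
have [p pp hp] := sum_squares el er z.
have s_w : sa w by exact: sa_Mstar.
have pw : pos (w ** w) by exists w.
have pc : pos ((c ** c) ** (c ** c)) by exists (c ** c) => //; exact: sa2.
have S0 : w ** w + (c ** c) ** (c ** c) = 0.
  apply: (pos_anti el er); first exact: (posD el er).
  by rewrite opprD -zz -zz' hp.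
have c40 : (c ** c) ** (c ** c) = 0.
  apply: (pos_anti el er) => //; rewrite (_ : - _ = w ** w) //.
  by apply/esym/eqP; rewrite -addr_eq0 S0.
have c0 : c = 0 by apply: sq_eq0 => //; apply: sq_eq0 => //; exact: sa2.
have bd0 : b ** d = 0 by rewrite ss -smulA -/c c0 sm0r.
have d0 : d = 0.
  by apply: sq_eq0 => //; rewrite {1}/d smBl bd0 ad bd0 oppr0 subrr.
by have -> : a = b by apply/esym/eqP; rewrite -subr_eq0 -/d d0.
Qed.

Lemma pos_conj a x : pos a -> pos (star x ** a ** x).
Proof.
case=> h sh ->; have -> : star x ** (h ** h) ** x = star (h ** x) ** (h ** x).
  by rewrite starM sh !smulA.
exact: pos_starM.
Qed.

Lemma pos_mul a b : pos a -> pos b -> com a b -> pos (a ** b).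
Proof.
move=> /(pos_root el er)[h [/pa_sa sh ah hc]] pb cab.
have -> : a ** b = star h ** b ** h.
  by rewrite sh -smulA (hc b (comC cab)) smulA -ah.
exact: pos_conj.
Qed.

(** With h^2 = a / t and k^2 = e - a / t the relation h^2 + k^2 = e bounds |h| by [unit_pair]. *)
Lemma pos_le a t : 0 <= t -> pos a -> pos (t%:C%C *: e - a) -> rn a <= t.
Proof.
move=> t0 pa pb; have [t1|t1] := eqVneq t 0.
  move: pb; rewrite t1 scale0r sub0r => pb.
  by rewrite (pos_anti el er pa pb) rn0.
have tp : 0 < t by rewrite lt_neqAle eq_sym t1.
pose a' := (t^-1)%:C%C *: a.
have pa' : pos a' by apply: posZ => //; rewrite invr_ge0.
have pb' : pos (e - a').
  have -> : e - a' = (t^-1)%:C%C *: (t%:C%C *: e - a).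
    by rewrite scalerBr scr mulVf // scale1r.
  by apply: posZ => //; rewrite invr_ge0.
have [h [/pa_sa sh ah hc]] := pos_root el er pa'.
have [k sk bk] := pb'.
have hk : com h k.
  apply/comC/hc; have -> : a' = e - k ** k by rewrite -bk opprB addrC subrK.
  by apply: comB; [exact: com_unit | exact: comM].
have [hh _] := unit_pair el sh sk hk ltac:(by rewrite -ah -bk addrC subrK).
have : rn a' <= 1.
  by rewrite ah; apply: (le_trans (rnM_le _ _)); have := rn_ge0 h; nra.
by rewrite rnZr ?invr_ge0 // ler_pdivrMl // mulr1.
Qed.

Lemma pos_ge a t : sa a -> rn a <= t -> pos (t%:C%C *: e - a).
Proof.
move=> s_a ht; have [t1|t1] := eqVneq t 0.
  have -> : a = 0 by apply: rn_le0; rewrite -t1.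
  by rewrite t1 scale0r subr0; exact: pos0.
have tp : 0 < t by rewrite lt_neqAle eq_sym t1 (le_trans (rn_ge0 a) ht).
apply: (posI el er tp); last by rewrite opprB addrC subrK.
by apply: saB => //; apply: saZ; exact: sa_unit.
Qed.

Lemma pos_mono a b : pos a -> pos (b - a) -> rn a <= rn b.
Proof.
move=> pa pab; apply: pos_le; rewrite //.
have -> : (rn b)%:C%C *: e - a = ((rn b)%:C%C *: e - b) + (b - a) by rewrite addrA subrK.
apply: (posD el er) => //; apply: pos_ge => //.
by rewrite -[b](subrK a); apply: saD; exact: pa_sa.
Qed.

(** The metric criterion with the fixed constant |l| + 1 is a closed condition. *)
Lemma pos_closed (u : nat -> E) l : (forall n, pos (u n)) -> cvs u l -> pos l.
Proof.
move=> pu hl; have sl : sa l.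
  apply: (cvs_unique (u := u)) => //.
  apply: (@cvs_ext _ _ (star \o u)); first by move=> n; exact: pa_sa.
  refine (cvs_comp (f := star) (M := 1) _ hl) => x y.
  by rewrite -stB rn_star mul1r.
apply: (@posI R E e el er l (rn l + 1)) => //; first by have := rn_ge0 l; lra.
apply: (@cvs_le _ _ (fun n => (rn l + 1)%:C%C *: e - u n)).
  refine (cvs_comp (f := fun x => _ - x) (M := 1) _ hl) => x y.
  by rewrite opprB addrC addrA subrK mul1r rnC.
have [N hN] := hl 1 ltac:(lra); exists N => n /hN hn.
apply: (pos_nearE el er) => //; first by have := rn_ge0 l; lra.
by have := rn_leD (u n) l; lra.
Qed.

(** Every element is a combination of unitaries: for [a] selfadjoint of norm at
    most 1, [a + i sqrt (1 - a^2)] is unitary. *)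
Lemma unitary_span (P : E -> Prop) :
  (forall u, star u ** u = e -> u ** star u = e -> P u) ->
  (forall (c : R[i]) x y, P x -> P y -> P (c *: x + y)) -> forall x, P x.
Proof.
move=> Pu PL.
have P0 : P 0.
  have := PL (-1) e e; rewrite scaleN1r addNr => h; apply: h;
    apply: Pu; rewrite (sa_unit el) el //.
have PZ (c : R[i]) x : P x -> P (c *: x) by move=> h; rewrite -[c *: x]addr0; apply: PL.
have PD x y : P x -> P y -> P (x + y) by move=> h; rewrite -[x]scale1r; apply: PL.
have Psa a : sa a -> rn a <= 1 -> P a.
  move=> s_a ha; have h2 : rn (a ** a) <= 1.
    by apply: (le_trans (rnM_le _ _)); have := rn_ge0 a; nra.
  have [k [sk k2 kc _]] := sqrt_sub el er h2 (sa2 s_a).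
  have ck : com a k by apply: kc; apply: comM.
  pose u := a + iu R *: k.
  have us : star u = a - iu R *: k by rewrite starD starZ s_a sk iu_conj scaleNr.
  have uu : star u ** u = a ** a - (iu R * iu R) *: (k ** k).
    by rewrite us /u ?(smulDl, smulDr, smNl, smNr) ?(smulZl, smulZr) ck; nc R.
  have uu' : u ** star u = a ** a - (iu R * iu R) *: (k ** k).
    by rewrite us /u ?(smulDl, smulDr, smNl, smNr) ?(smulZl, smulZr) ck; nc R.
  have ee : a ** a - (iu R * iu R) *: (k ** k) = e.
    by rewrite iu_sq scaleN1r opprK k2 addrC subrK.
  have -> : a = hlf R *: (u + star u) by rewrite us /u; nc R.
  by apply/PZ/PD; apply: Pu; rewrite ?starK ?uu ?uu' ee.
have Psa' a : sa a -> P a.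
  move=> s_a; have a1 : 0 < rn a + 1 by have := rn_ge0 a; lra.
  have -> : a = (rn a + 1)%:C%C *: (((rn a + 1)^-1)%:C%C *: a).
    by rewrite scr mulfV ?gt_eqF // scale1r.
  apply/PZ/Psa; first exact: saZ.
  by rewrite rnZr ?invr_ge0 ?(ltW a1) // ler_pdivrMl // mulr1; lra.
move=> x; have -> : x = hlf R *: (x + star x) + (iu R * hlf R) *: ((- iu R) *: (x - star x)).
  rewrite scalerA (_ : iu R * hlf R * - iu R = hlf R); last first.
    by rewrite mulrAC mulrN iu_sq opprK mul1r.
  by nc R.
apply: PL; last by apply/PZ/Psa'; rewrite /sa starZ rmorphN /= iu_conj opprK stB starK; nc R.
by apply/Psa'; rewrite /sa starD starK addrC.
Qed.

End Positivity2.

Section Emb.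
Variables (R : realType) (A : cstarType R).
Implicit Types (a b : A) (m n : mult A).

Lemma mone_l : left_id (mone A) smul. Proof. by move=> m; apply: mult_ext. Qed.
Lemma mone_r : right_id (mone A) smul. Proof. by move=> m; apply: mult_ext. Qed.
Lemma emb_lin : linear (@emb R A).
Proof. by move=> c a b; apply: mult_eq => x /=; rewrite smulDl smulZl. Qed.
Lemma embM a b : emb (a ** b) = emb a ** emb b.
Proof. by apply: mult_eq => x /=; rewrite smulA. Qed.
Lemma emb_star a : emb (star a) = star (emb a).
Proof. by apply: mult_eq => x /=; rewrite starM starK. Qed.
Lemma emb_starhom : starhom (@emb R A).
Proof. by split; [exact: emb_lin | exact: embM | exact: emb_star]. Qed.
Lemma emb_inj : injective (@emb R A).
Proof. by move=> a b h; apply: smul_injl => c; have := congr1 (fun m => ml m c) h. Qed.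
Lemma mul_emb m a : m ** emb a = emb (ml m a).
Proof.
by apply: mult_eq => b /=; apply: smul_injr => c; rewrite mlr smulA -mlr smulA.
Qed.
Lemma emb_mul m a : emb a ** m = emb (mr m a).
Proof. by apply: mult_eq => b /=; rewrite mlr. Qed.
Lemma ml_lin m : linear (ml m).
Proof. by move=> c a b; rewrite mlD mlZ. Qed.
Lemma mlM m a b : ml m (a ** b) = ml m a ** b.
Proof. by apply: smul_injr => c; rewrite mlr smulA -mlr smulA. Qed.
Lemma ml_one a : ml (mone A) a = a. Proof. by []. Qed.
Lemma emb0 : emb (0 : A) = 0. Proof. exact: (lin0 emb_lin). Qed.

Lemma rn_emb a : rn (emb a) = rn a.
Proof.
apply/eqP; rewrite eq_le; apply/andP; split.
  by apply: mnorm_le => // b; apply: rnM_le.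
have [->|n0] := eqVneq (rn a) 0; first exact: rn_ge0.
have np : 0 < rn a by rewrite lt_neqAle eq_sym n0 rn_ge0.
have := rn_ml (emb a) (star a); rewrite /= rn_Mstar rn_star expr2.
by rewrite ler_pM2r.
Qed.

Lemma blin_ml m : blin (ml m).
Proof. by split; [exact: ml_lin | exists (rn m); [exact: rn_ge0 | exact: rn_ml]]. Qed.

Lemma blin_emb : blin (@emb R A).
Proof. by split; [exact: emb_lin | exists 1 => // x; rewrite mul1r rn_emb]. Qed.

End Emb.

(** * Approximate units, absolute values and homomorphisms of C*-algebras *)

Section Powers.
Variables (R : realType) (E : cstarType R) (e : E).
Hypotheses (el : left_id e smul) (er : right_id e smul).
Implicit Types (p x y : E).

(** Powers of [e - p]. When [p] and [e - p] are positive, [e - pw p n] acts as an approximate unit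
    for what [p] generates, and the rate n |p (e - p)^n| <= 1 takes the place of functional
    calculus. *)
Fixpoint pw p n : E := if n is n'.+1 then pw p n' ** (e - p) else e.

Lemma pw_com x p n : com x p -> com x (pw p n).
Proof.
move=> h; elim: n => [|n ih] /=; first exact: com_unit.
by apply: comM => //; apply: comB => //; apply: com_unit.
Qed.

Lemma pw_pos p n : pos (e - p) -> pos (pw p n).
Proof.
move=> h; elim: n => [|n ih]; first by exists e; [exact: sa_unit | rewrite el].
apply: (pos_mul el er) => //; apply: comB; first exact: com_unit.
by apply: comC; apply: pw_com.
Qed.

(** From [n] to [n + 1] the expression grows by (n + 1) p^2 (e - p)^n, which is positive. *)
Lemma pw_decay_pos p n : pos p -> pos (e - p) ->
  pos (e - pw p n - n%:R *: (p ** pw p n)).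
Proof.
move=> pp pe; elim: n => [|n ih]; first by rewrite scale0r subr0 subrr; exact: pos0.
have c : com p (pw p n) by apply: pw_com.
have pw2 : pos (p ** (p ** pw p n)).
  rewrite smulA; apply: (pos_mul el er); first by exists p => //; apply: pos_sa.
    exact: pw_pos.
  by apply/comC/comM; apply: comC.
have -> : e - pw p n.+1 - n.+1%:R *: (p ** pw p n.+1) =
    (e - pw p n - n%:R *: (p ** pw p n)) + (n.+1%:R : R)%:C%C *: (p ** (p ** pw p n)).
  rewrite /= !smBr er -c -(rmorph_nat (real_complex R) n.+1) -(natr1 n) rmorphD /= rmorph_nat.
  by lmod R; ring.
by apply: (posD el er) => //; apply: posZ.
Qed.

Lemma pw_le1 p n : pos p -> pos (e - p) -> rn (pw p n) <= 1.
Proof.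
move=> pp pe; apply: (pos_le el er) => //; first exact: pw_pos.
have -> : 1%:C%C *: e - pw p n = e - pw p n - n%:R *: (p ** pw p n) +
    (n%:R : R)%:C%C *: (p ** pw p n) by rewrite rmorph_nat subrK scale1r.
apply: (posD el er); first exact: pw_decay_pos.
by apply: posZ => //; apply: (pos_mul el er) => //; [exact: pw_pos | exact: pw_com].
Qed.

Lemma pw_decay p n : pos p -> pos (e - p) -> n%:R * rn (p ** pw p n) <= 1.
Proof.
move=> pp pe; have ppw : pos (p ** pw p n).
  by apply: (pos_mul el er) => //; [exact: pw_pos | exact: pw_com].
rewrite -(rnZr (p ** pw p n) (ler0n R n)); apply: (pos_le el er) => //; first exact: posZ.
have -> : 1%:C%C *: e - (n%:R : R)%:C%C *: (p ** pw p n) =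
    e - pw p n - n%:R *: (p ** pw p n) + pw p n.
  by rewrite rmorph_nat scale1r; lmod R; ring.
by apply: (posD el er); [exact: pw_decay_pos | exact: pw_pos].
Qed.

(** For q = p - b one has q^2 = 2 p q, so s q s = q^2 / 2 is positive for the root [s] of [p]. The
    elements [v n] are multiples of [s] and an approximate unit for [q]; hence [v n ** q ** v n] is
    positive and tends to [q]. *)
Lemma abs_pos b p : sa b -> pos p -> p ** p = b ** b -> com p b -> pos (p - b).
Proof.
move=> sb pp pb cpb; have [s [ps ss sc]] := pos_root el er pp.
have csb : com s b by apply/comC/sc/comC.
pose q := p - b; have sq : sa q by apply: saB => //; apply: pos_sa.
have cpq : com p q by apply: comB.
have csq : com s q by apply: comB => //; rewrite ss; apply: comM.
have qq : q ** q = (2 : R[i]) *: (p ** q).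
  by rewrite /q !(smBl, smBr) -pb cpb; lmod R; ring.
have spq : pos (s ** q ** s).
  have -> : s ** q ** s = (2^-1 : R)%:C%C *: (q ** q).
    rewrite qq -/(hlf R) hlfE scalerA mulVf ?pnatr_eq0 // scale1r.
    by rewrite -smulA -csq smulA -ss.
  by apply: posZ; [rewrite invr_ge0 | exists q].
have [k k0 kE] : exists2 k : R, 0 < k & k = (rn p + 1)^-1.
  by eexists; last reflexivity; rewrite invr_gt0; have := rn_ge0 p; lra.
have ki : 0 < k^-1 by rewrite invr_gt0.
pose p' := k%:C%C *: p.
have pp' : pos p' by apply: posZ => //; exact: ltW.
have pe' : pos (e - p').
  rewrite -[e]scale1r; apply: (pos_ge el er (t := 1)); first exact: pos_sa.
  rewrite rnZr ?(ltW k0) // mulrC kE ler_pdivrMr ?mul1r; have := rn_ge0 p; lra.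
pose v n := e - pw p' n.
have cspw n : com s (pw p' n).
  by apply: pw_com; apply: comZ; rewrite ss; apply: comM.
have cqpw n : com q (pw p' n) by apply: pw_com; apply: comZ.
(* [v n] is a polynomial in [p'] without constant term, so a factor [s] can be split off. *)
have svE n : exists2 f, sa f & v n = f ** s /\ com s f.
  elim: n => [|n [f sf [vf cf]]].
    by exists 0; [exact: sa0 | rewrite /v /= subrr sm0l; split=> //; exact: com0].
  exists (f + k%:C%C *: (pw p' n ** s)).
    apply: saD => //; apply: saZ; apply: saM; [exact/comC/cspw | | exact: pos_sa].
    by apply: pos_sa; apply: pw_pos.
  split; last by apply: comD => //; apply: comZ; apply: comM.
  rewrite smulDl -vf /v /= smulZl -smulA -ss smBr er /p' smulZr.
  by lmod R; ring.
have vq n : pos (v n ** q ** v n).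
  have [f sf [-> cf]] := svE n.
  have -> : f ** s ** q ** (f ** s) = star f ** (s ** q ** s) ** f.
    by rewrite sf -{2}cf !smulA.
  exact: (pos_conj el er).
apply: (pos_closed el er (u := fun n => v n ** q ** v n)) => // eps eps0.
have q0 := rn_ge0 q.
(* The identity q^2 = 2 p q turns the square of |pw q| into a quantity containing [p' ** pw p' n],
   which decays. *)
have hpw n : rn (pw p' n ** q) ^+ 2 <= 2 * k^-1 * rn q * rn (p' ** pw p' n).
  have spw : sa (pw p' n) by apply: pos_sa; apply: pw_pos.
  rewrite -rn_Mstar starM sq spw smulA -(smulA _ q q) qq smulZr smulZl.
  have -> : pw p' n ** (p ** q) ** pw p' n = (k^-1)%:C%C *: (pw p' n ** q ** (p' ** pw p' n)).
    rewrite /p' smulZl smulZr scr mulVf ?gt_eqF // scale1r.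
    by rewrite !smulA -(smulA _ p q) cpq !smulA.
  rewrite scalerA rnZ rnM rn_real ger0_norm ?invr_ge0 ?(ltW k0) //.
  have -> : rn (2 : R[i]) = 2 by rewrite -(rmorph_nat (real_complex R)) rn_real normr_nat.
  have h : rn (pw p' n ** q ** (p' ** pw p' n)) <= rn q * rn (p' ** pw p' n).
    apply: (le_trans (rnM_le _ _)); apply: ler_wpM2r => //.
    by apply: (le_trans (rnM_le _ _)); have := @pw_le1 p' n pp' pe'; nra.
  have := ler_wpM2l (_ : 0 <= 2 * k^-1) h; rewrite !mulrA; apply.
  by apply: mulr_ge0 => //; rewrite invr_ge0; exact: ltW.
(* The error is at most 3 |pw q|, whose square brings a factor 9, and [hpw] contributes 2 |q| / k;
   this explains 18. *)
have K0 : 0 < eps ^+ 2 / (18 * k^-1 * (rn q + 1)).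
  by apply: divr_gt0; [exact: exprn_gt0 | rewrite !mulr_gt0 //; lra].
have [N hN] := inv_small K0; exists N.+1 => -[//|n] hn.
have hn' := hN n hn.
have -> : v n.+1 ** q ** v n.+1 - q = - (v n.+1 ** (pw p' n.+1 ** q)) - pw p' n.+1 ** q.
  have hc : q ** pw p' n.+1 = pw p' n.+1 ** q := cqpw n.+1.
  rewrite /v; move: (pw p' n.+1) (q) hc => P Q hc; rewrite !(smBl, smBr, el, er).
  by rewrite hc -(smulA P Q P) hc; lmod R; ring.
have vn : rn (v n.+1) <= 2.
  by apply: (le_trans (rnD _ _)); rewrite rnN; have := rn_unit el; have := @pw_le1 p' n.+1 pp' pe'; lra.
apply: (@le_lt_trans _ _ (3 * rn (pw p' n.+1 ** q))).
  apply: (le_trans (rnD _ _)); rewrite !rnN; have := rnM_le (v n.+1) (pw p' n.+1 ** q).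
  have := rn_ge0 (pw p' n.+1 ** q); nra.
have h1 := hpw n.+1; have h2 := @pw_decay p' n.+1 pp' pe'.
rewrite mulrC -ler_pdivlMr ?ltr0Sn // mul1r in h2.
have {h2}h2 := le_lt_trans h2 hn'.
rewrite ltr_pdivlMr in h2; last by rewrite !mulr_gt0 //; lra.
rewrite -(@ltr_pXn2r _ 2) ?nnegrE ?mulr_ge0 ?rn_ge0 ?(ltW eps0) // exprMn.
apply: le_lt_trans h2; apply: (le_trans (ler_wpM2l (sqr_ge0 3) h1)).
have := rn_ge0 (p' ** pw p' n.+1); move: (rn (p' ** _)) => t t0.
have -> : 3 ^+ 2 * (2 * k^-1 * rn q * t) = t * (18 * k^-1 * rn q) by ring.
by rewrite ler_wpM2l // ler_wpM2l ?mulr_ge0 ?(ltW ki) //; lra.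
Qed.
End Powers.

Section Homs.
Variables (R : realType).
Implicit Types (A B : cstarType R).

Lemma hom_lin A B (f : A -> B) : starhom f -> linear f. Proof. by case. Qed.
Lemma homM A B (f : A -> B) : starhom f -> forall x y, f (x ** y) = f x ** f y.
Proof. by case. Qed.
Lemma hom_star A B (f : A -> B) : starhom f -> forall x, f (star x) = star (f x).
Proof. by case. Qed.

Lemma hom_sa A B (f : A -> B) x : starhom f -> sa x -> sa (f x).
Proof. by move=> hf; rewrite /sa -(hom_star hf) => ->. Qed.

Lemma pos_embM A (x : A) : pos (emb (star x ** x)).
Proof. rewrite embM emb_star; apply: (pos_starM (@mone_l R A) (@mone_r R A)). Qed.

(** Nothing but algebra is assumed of [f]. For a = [star x ** x] of norm at most 1 the identity 2 s
    = a + s^2 is preserved, so 1 - f a is the square of 1 - f s, and [pos_le] bounds f a. *)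
Lemma hom_contr A B (f : A -> B) : starhom f -> forall x, rn (f x) <= rn x.
Proof.
move=> hf; have lf := hom_lin hf; have mf := homM hf.
have h1 x : rn x <= 1 -> rn (f x) <= 1.
  move=> hx; pose a := star x ** x.
  have ha : rn a <= 1 by rewrite rn_starM; have := rn_ge0 x; nra.
  have s_a : sa a by exact: sa_starM.
  have := congr1 f (sqs_eq ha); rewrite !(linD lf) mf => es.
  have : rn (emb (f a)) <= 1.
    apply: (pos_le (@mone_l R B) (@mone_r R B)) => //.
      by rewrite /a mf (hom_star hf); exact: pos_embM.
    rewrite scale1r; exists (mone B - emb (f (sqs a))).
      apply: saB; first exact: (sa_unit (@mone_l R B)).
      by apply: (hom_sa (emb_starhom B)); apply: hom_sa => //; apply: sqs_sa.
    rewrite !(smBl, smBr) !mone_l mone_r -embM.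
    have -> : f a = f (sqs a) + f (sqs a) - f (sqs a) ** f (sqs a) by rewrite es addrK.
    rewrite (linB (@emb_lin R B)) (linD (@emb_lin R B)); lmod R; ring.
  rewrite rn_emb /a mf (hom_star hf) rn_starM; have := rn_ge0 (f x); nra.
move=> x; have [->|n0] := eqVneq x 0; first by rewrite (lin0 lf) !rn0.
have np : 0 < rn x.
  by rewrite lt_neqAle rn_ge0 andbT eq_sym; apply: contra n0 => /eqP/rn_eq0 ->.
have := h1 ((rn x)^-1%:C%C *: x).
rewrite (linZ lf) !rnZr ?invr_ge0 // mulVf ?gt_eqF // => /(_ (lexx _)).
by rewrite ler_pdivrMl // mulr1.
Qed.

Lemma hom_blin A B (f : A -> B) : starhom f -> blin f.
Proof.
move=> hf; split; first exact: hom_lin.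
by exists 1 => // x; rewrite mul1r; apply: hom_contr.
Qed.

Lemma hom_comp A B (D : cstarType R) (f : A -> B) (g : B -> D) :
  starhom f -> starhom g -> starhom (g \o f).
Proof.
move=> [l m s] [l' m' s']; split=> [|x y|x] /=; first exact: lin_comp.
- by rewrite m m'.
- by rewrite s s'.
Qed.

Lemma hom_id A : starhom (@id A). Proof. by []. Qed.

Lemma hom_com A B (f : A -> B) x y : starhom f -> com x y -> com (f x) (f y).
Proof. by move=> hf; rewrite /com -!(homM hf) => ->. Qed.

(** The iterates for sqrt c = 1 - sqs (1 - c), rewritten so that the unit cancels and they stay in
    [A] (see [yk_emb]); [sg 1 k] is the iteration for the unit itself. *)
Fixpoint yk A (c : A) k := if k is k'.+1 then
  hlf R *: (c - yk c k' ** yk c k') + (sg 1 k')%:C%C *: yk c k' else 0.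

Lemma yk_emb A (c : A) k :
  emb (yk c k) = (sg 1 k)%:C%C *: mone A - sk (mone A - emb c) k.
Proof.
elim: k => [|k ih]; first by rewrite /= emb0 scale0r subrr.
rewrite [yk c k.+1]/= (linD (@emb_lin R A)) !(linZ (@emb_lin R A)) (linB (@emb_lin R A)).
rewrite embM ih [sk _ k.+1]/=.
have -> : (sg 1 k.+1 : R)%:C%C = hlf R * (1 + (sg 1 k : R)%:C%C ^+ 2).
  by rewrite [sg 1 k.+1]/= rmorphM rmorphD rmorphXn mulrC.
move: (sk _ k) ((sg 1 k)%:C%C) => s t.
by rewrite !(smBl, smBr) ?(smulZl, smulZr) !mone_l ?mone_r; lmod R; rewrite ?hlfE; field.
Qed.

(** For s the value of [sqs] at the unit, 1 - s is selfadjoint with square zero. *)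
Lemma sqs_unit A : sqs (mone A) = mone A.
Proof.
have h1 := rn_unit (@mone_l R A).
apply/esym/eqP; rewrite -subr_eq0; apply/eqP/sq_eq0.
  apply: saB; first exact: (sa_unit (@mone_l R A)).
  by apply: sqs_sa => //; exact: (sa_unit (@mone_l R A)).
have := sqs_eq h1; move: (sqs _) => s es.
rewrite !(smBl, smBr) !mone_l mone_r.
have -> : s ** s = s + s - mone A by rewrite es addrC addKr.
by lmod R; ring.
Qed.

Lemma clsub_range_emb A : clsub (range (@emb R A)).
Proof.
split => [|c _ _ [x _ <-] [y _ <-]|m h].
- by exists 0 => //; rewrite emb0.
- by exists (c *: x + y) => //; rewrite emb_lin.
- have ap n : exists x : A, rn (m - emb x) < n.+1%:R^-1.
    by have [_ [x _ <-] hx] := h _ (inv_gt0 R n); exists x.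
  pose u n := projT1 (cid (ap n)).
  have hu n : rn (m - emb (u n)) < n.+1%:R^-1 by exact: (projT2 (cid (ap n))).
  have cu : cvs (fun n => emb (u n)) m.
    move=> e e0; have [N hN] := inv_small e0; exists N => n /hN; rewrite rnC.
    exact: lt_trans (hu n).
  have [x hx] : exists x, cvs u x.
    apply: cauchy_cvs => e /(cvs_cauchy cu)[N hN]; exists N => p q hp hq.
    by rewrite -rn_emb (linB (@emb_lin R A)); apply: hN.
  by exists x => //; apply: (cvs_unique (blin_cvs (blin_emb A) hx) cu).
Qed.

Lemma yk_cvs A (c : A) : rn (mone A - emb c) <= 1 ->
  exists w, cvs (yk c) w /\ emb w = mone A - sqs (mone A - emb c).
Proof.
move=> hc; have cv : cvs (fun k => emb (yk c k)) (mone A - sqs (mone A - emb c)).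
  apply: (@cvs_ext _ _ (fun k => sk (mone A) k + - sk (mone A - emb c) k)).
    move=> k; rewrite yk_emb; congr (_ - _).
    elim: k => [|k ih]; first by rewrite /= scale0r.
    rewrite /= ih smulZl smulZr mone_l; rewrite !scalerA.
    rewrite -[X in X + _]scale1r -scalerDl scalerA; congr (_ *: _).
    by rewrite -[hlf R]/((2^-1 : R)%:C%C) -!rmorphM -rmorphD -rmorphM expr2 mulrC.
  apply: cvsD; first by rewrite -{2}(sqs_unit A); apply: sqsP; exact: rn_unit (@mone_l R A).
  refine (cvs_comp (f := fun x => - x) (M := 1) _ (sqsP hc)) => x y.
  by rewrite opprK addrC mul1r rnC.
have [w _ ew] : range (@emb R A) (mone A - sqs (mone A - emb c)).
  by apply: (cls_cvs (clsub_range_emb A) _ cv) => k; exists (yk c k).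
exists w; split=> // e e0; move: cv; rewrite -ew => cv.
have [N hN] := cv e e0; exists N => n /hN.
by rewrite -(linB (@emb_lin R A)) rn_emb.
Qed.

Lemma near_posE A (c : A) : pos (emb c) -> rn c <= 1 -> rn (mone A - emb c) <= 1.
Proof.
move=> pc hc; have := pos_nearE (@mone_l R A) (@mone_r R A) ltr01 pc.
by rewrite scale1r rn_emb; apply.
Qed.

Lemma yk_limP A (c w : A) : sa (emb c) -> rn (mone A - emb c) <= 1 -> cvs (yk c) w ->
  [/\ pos (emb w), w ** w = c & forall y, com y c -> com y w].
Proof.
move=> sc hc hw; have [w' [hw' ew]] := yk_cvs hc.
have {hw'} ww : w' = w by exact: (cvs_unique hw' hw).
have u1 := sa_unit (@mone_l R A).
have sx : sa (mone A - emb c) by exact: saB.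
subst w'; split.
- apply: (@posI _ _ _ (@mone_l R A) (@mone_r R A) _ 1) => //.
    by rewrite ew; apply: saB => //; apply: sqs_sa.
  by rewrite ew scale1r opprB addrC subrK sqs_le.
- apply: (@emb_inj R A); rewrite embM ew; have := sqs_eq hc.
  move: (sqs _) => s es; rewrite !(smBl, smBr) !mone_l mone_r.
  have -> : s ** s = s + s - (mone A - emb c) by rewrite es addrC addKr.
  by lmod R; ring.
- move=> y cy; apply: (@emb_inj R A); rewrite !embM ew.
  apply: comB; first exact: (com_unit (@mone_l R A) (@mone_r R A)).
  apply: sqs_com => //; apply: comB; first exact: (com_unit (@mone_l R A) (@mone_r R A)).
  by rewrite /com -!embM cy.
Qed.

Lemma hom_yk A B (f : A -> B) c k : starhom f -> f (yk c k) = yk (f c) k.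
Proof.
move=> hf; elim: k => [|k ih] /=; first by rewrite (lin0 (hom_lin hf)).
by rewrite (linD (hom_lin hf)) !(linZ (hom_lin hf)) (linB (hom_lin hf)) (homM hf) ih.
Qed.

(** The root is a limit of polynomials in b^2 without constant term, so it lies in [A], and a
    homomorphism carries these polynomials to the corresponding ones. This gives the last clause,
    which is not automatic: positivity of [emb p] involves a root among the multipliers, to which
    [f] need not extend. *)
Lemma abs_ex A (b : A) : sa b -> exists p, [/\ pos (emb p), p ** p = b ** b,
  forall y, com y b -> com y p & forall B (f : A -> B), starhom f -> pos (emb (f p))].
Proof.
move=> sb; have [k k0 kE] : exists2 k : R, 0 < k & k = (rn b + 1)^-1.
  by eexists; last reflexivity; rewrite invr_gt0; have := rn_ge0 b; lra.
pose b' := k%:C%C *: b; have sb' : sa b' by exact: saZ.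
have hb' : rn b' <= 1.
  rewrite rnZr ?(ltW k0) // mulrC kE ler_pdivrMr ?mul1r; have := rn_ge0 b; lra.
have key B (f : A -> B) : starhom f -> rn (mone B - emb (f (b' ** b'))) <= 1 /\
    sa (emb (f (b' ** b'))).
  move=> hf; have pb : pos (emb (f (b' ** b'))).
    by rewrite -{1}sb' (homM hf) (hom_star hf); exact: pos_embM.
  split; last exact: pos_sa.
  apply: near_posE => //; apply: (le_trans (hom_contr hf _)).
  by apply: (le_trans (rnM_le _ _)); have := rn_ge0 b'; nra.
have [h1 s1] := key A id (@hom_id A).
have [w [hw _]] := yk_cvs h1.
have [pw ww cw] := yk_limP s1 h1 hw.
have kk : k^-1 * k = 1 by rewrite mulVf // gt_eqF.
exists (k^-1%:C%C *: w); split.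
- by rewrite (linZ (@emb_lin R A)); apply: posZ => //; rewrite invr_ge0 ltW.
- by rewrite smulZl smulZr ww smulZl smulZr !scr -(mulrA k^-1 k^-1) kk mulr1 kk scale1r.
- by move=> y hy; apply/comZ/cw/comM; apply: comZ.
- move=> B f hf; rewrite (linZ (hom_lin hf)) (linZ (@emb_lin R B)).
  apply: posZ; first by rewrite invr_ge0 ltW.
  have [h2 s2] := key B f hf.
  have hw2 : cvs (yk (f (b' ** b'))) (f w).
    apply: (@cvs_ext _ _ (f \o yk (b' ** b'))); first by move=> n; apply: hom_yk.
    by apply: blin_cvs => //; apply: hom_blin.
  by have [] := yk_limP s2 h2 hw2.
Qed.

(** For d = z - w, the relation (z + w) d = 0 makes d z d and d w d positive with sum zero; both
    vanish, and d^3 is their difference. *)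
Lemma pos_uniq (E : cstarType R) (e : E) (el : left_id e smul) (er : right_id e smul)
  (z w : E) : pos z -> pos w -> com z w -> z ** z = w ** w -> z = w.
Proof.
move=> pz pw cz ezw; pose d := z - w.
have sd : sa d by apply: saB; apply: pos_sa.
have d1 : (z + w) ** d = 0 by rewrite /d smulDl !smBr ezw cz; lmod R; ring.
have pa : pos (d ** z ** d) by rewrite -{1}sd; exact: (pos_conj el er).
have pb : pos (d ** w ** d) by rewrite -{1}sd; exact: (pos_conj el er).
have ab : d ** z ** d + d ** w ** d = 0.
  by rewrite -!smulA -smulDr -smulDl d1 sm0r.
have a0 : d ** z ** d = 0.
  apply: (pos_anti el er) => //.
  suff -> : - (d ** z ** d) = d ** w ** d by [].
  by apply/esym/eqP; rewrite -addr_eq0 addrC ab.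
have b0 : d ** w ** d = 0 by rewrite a0 add0r in ab.
have d3 : d ** d ** d = 0.
  by rewrite -[RHS](subr0 0) -{1}a0 -b0 -smBl -smBr.
have d0 : d = 0.
  apply: sq_eq0 => //; apply: sq_eq0; first exact: sa2.
  by rewrite smulA d3 sm0l.
by apply/eqP; rewrite -subr_eq0 -/d d0.
Qed.

(** The element 1 - (1 - c)^n computed without the unit, see [au_emb]. *)
Fixpoint au A (c : A) n := if n is n'.+1 then au c n' + c - au c n' ** c else 0.

Lemma au_emb A (c : A) n : emb (au c n) = mone A - pw (mone A) (emb c) n.
Proof.
elim: n => [|n ih]; first by rewrite /= emb0 subrr.
rewrite [au c n.+1]/= (linB (@emb_lin R A)) (linD (@emb_lin R A)) embM ih /=.
by rewrite !(smBl, smBr) !mone_l mone_r; lmod R; ring.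
Qed.

Lemma au_sub A (P : set A) (c : A) n : clsub P -> (forall x y, P y -> P (x ** y)) ->
  P c -> P (au c n).
Proof.
move=> cP mP Pc; elim: n => [|n ih] /=; first exact: cls0.
by apply: clsB => //; [apply: clsD | apply: mP].
Qed.

Lemma small_scale A (c : A) : pos (emb c) -> exists2 k : R, 0 < k &
  pos (emb (k%:C%C *: c)) /\ pos (mone A - emb (k%:C%C *: c)).
Proof.
move=> pc; exists (rn c + 1)^-1; first by rewrite invr_gt0; have := rn_ge0 c; lra.
have k0 : 0 < (rn c + 1)^-1 by rewrite invr_gt0; have := rn_ge0 c; lra.
rewrite (linZ (@emb_lin R A)); split; first by apply: posZ => //; exact: ltW.
rewrite -[mone A]scale1r; apply: (pos_ge (@mone_l R A) (@mone_r R A) (t := 1)).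
  by apply: saZ; exact: pos_sa.
rewrite rnZr ?(ltW k0) // rn_emb mulrC ler_pdivrMr ?mul1r; have := rn_ge0 c; lra.
Qed.

Lemma quad_bound (y r eps d : R) : 0 < eps -> 0 <= r -> y ^+ 2 <= r * y + d ->
  d <= eps ^+ 2 -> y <= r + eps.
Proof. by move=> e0 r0 h hd; rewrite leNgt; apply/negP => hy; nra. Qed.

(** Let a = [star x ** x] and r = |f x|^2. The image of b = a^2 - r a is the negative element -f a
    (r - f a), so [f] kills |b| + b. Multiplying [x] by 1 - u, with [u] an approximate unit
    generated by |b| + b, changes [x] within the kernel and removes the part of [a] above [r].
    Isometry of injective homomorphisms and closedness of ranges both rest on this. *)
Lemma hom_lift A B (f : A -> B) x (eps : R) : starhom f -> 0 < eps ->
  exists2 x', f x' = f x & rn x' ^+ 2 <= rn (f x) ^+ 2 + eps.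
Proof.
move=> hf eps0; have lf := hom_lin hf; have mf := homM hf.
have el := @mone_l R; have er := @mone_r R.
pose a := star x ** x; have s_a : sa a by exact: sa_starM.
pose r := rn (f x) ^+ 2; have r0 : 0 <= r by exact: sqr_ge0.
have ra : rn (f a) = r by rewrite /a mf (hom_star hf) rn_starM.
pose b := a ** a - r%:C%C *: a.
have sb : sa b by apply: saB; [exact: sa2 | exact: saZ].
have [p [pp pb pc pf]] := abs_ex sb.
have cab : com a b by rewrite /b; apply: comB; [apply: comM | apply: comZ].
have cap : com a p by exact: pc.
have cpb : com p b by apply: comC; apply: pc.
have pfa : pos (emb (f a)) by rewrite /a mf (hom_star hf); exact: pos_embM.
have fc0 : f (p + b) = 0.
  pose z := r%:C%C *: f a - f a ** f a.
  have fb : f b = - z by rewrite /b (linB lf) mf (linZ lf) opprB.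
  have pz : pos (emb z).
    have -> : emb z = emb (f a) ** (r%:C%C *: mone B - emb (f a)).
      by rewrite /z (linB (@emb_lin R B)) (linZ (@emb_lin R B)) embM smBr smulZr er.
    apply: (pos_mul (el B) (er B)) => //.
      by apply: (pos_ge (el B) (er B)); rewrite ?rn_emb ?ra //; exact: pos_sa.
    by apply: comB => //; apply: comZ; apply: (com_unit (el B) (er B)).
  have : emb (f p) = emb z.
    apply: (pos_uniq (el B) (er B)) => //; first exact: pf.
      apply: (hom_com (emb_starhom B)); rewrite -[z]opprK -fb; apply: comN.
      exact: hom_com.
    by rewrite -!embM -mf pb mf fb smNl smNr opprK.
  by move/(@emb_inj R B) => e; rewrite (linD lf) fb e subrr.
pose c0 := (p + b) ** (p + b).
have spb : sa (p + b).
  apply: saD => //; apply: (@emb_inj R A); rewrite emb_star; exact: pos_sa.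
have pc0 : pos (emb c0) by rewrite /c0 -{1}spb; exact: pos_embM.
have ppb' : pos (emb (p + b)).
  have -> : emb (p + b) = emb p - (- emb b) by rewrite opprK (linD (@emb_lin R A)).
  apply: (abs_pos (el A) (er A)) => //.
  - by apply: saN; apply: (hom_sa (emb_starhom A)).
  - by rewrite smNl smNr opprK -!embM pb.
  - by apply: comN; apply: (hom_com (emb_starhom A)).
have [k k0 [pk pk1]] := small_scale ppb'.
pose c := k%:C%C *: (p + b); rewrite -/c in pk pk1.
have fc n : f (au c n) = 0.
  elim: n => [|n ih] /=; first exact: lin0.
  by rewrite (linB lf) (linD lf) mf ih sm0l /c (linZ lf) fc0 scaler0 !addr0 subr0.
have [N hN] := inv_small (e := eps ^+ 2 * k) ltac:(by rewrite mulr_gt0 ?exprn_gt0).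
pose n := N.+1; have [q qE] : exists q, q = pw (mone A) (emb c) n by eexists.
exists (x - x ** au c n); first by rewrite (linB lf) mf fc sm0r subr0.
have cac : com a c by apply: comZ; apply: comD.
have caq : com (emb a) q by rewrite qE; apply: pw_com; [exact: el | exact: er | exact: (hom_com (emb_starhom A))].
have cq : com (emb c) q by rewrite qE; exact: (pw_com (el A) (er A)).
have pq : pos q by rewrite qE; exact: (pw_pos (el A) (er A)).
have sq : sa q := pos_sa pq.
have q1 : rn q <= 1 by rewrite qE; exact: (pw_le1 (el A) (er A)).
pose W := q ** emb a ** q.
have eW : emb (star (x - x ** au c n) ** (x - x ** au c n)) = W.
  have ex : emb (x - x ** au c n) = emb x ** q.
    by rewrite (linB (@emb_lin R A)) embM au_emb -qE smBr er opprB addrC subrK.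
  by rewrite embM emb_star ex starM sq /W /a embM emb_star !smulA.
have -> : rn (x - x ** au c n) ^+ 2 = rn W by rewrite -eW rn_emb rn_starM.
have pa : pos (emb a) by exact: pos_embM.
have pW : pos W by rewrite /W -{1}sq; exact: (pos_conj (el A) (er A)).
(* The square of [W] will be bounded by r |W| + d, a quadratic inequality for |W|. *)
apply: (quad_bound (d := k^-1 * n%:R^-1)) => //; last first.
  rewrite mulrC ler_pdivrMr //; apply: ltW; exact: hN.
pose Q := q ** q; have sQ : sa Q by exact: sa2.
have cAQ : com (emb a) Q by apply: comM.
have WQ : W = emb a ** Q by rewrite /W /Q -caq smulA.
have W2 : W ** W = Q ** emb (a ** a) ** Q.
  by rewrite WQ {1}cAQ embM !smulA.
have sW : sa W := pos_sa pW.
have -> : rn W ^+ 2 = rn (W ** W) by rewrite -rn_starM sW.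
(* The definition of [b] with [p] added and subtracted: the term -p may be dropped in an upper
   bound, and p + b becomes small between two factors [Q]. *)
have eab : emb (a ** a) = r%:C%C *: emb a + emb (p + b) - emb p.
  rewrite -(linZ (@emb_lin R A)) -(linD (@emb_lin R A)) -(linB (@emb_lin R A)).
  by congr emb; rewrite /b; lmod R; ring.
apply: (@le_trans _ _ (rn (r%:C%C *: (Q ** emb a ** Q) + Q ** emb (p + b) ** Q))).
  apply: (pos_mono (el A) (er A)); first by exists W.
  rewrite W2 eab; have -> : r%:C%C *: (Q ** emb a ** Q) + Q ** emb (p + b) ** Q -
    Q ** (r%:C%C *: emb a + emb (p + b) - emb p) ** Q = star Q ** emb p ** Q.
    rewrite sQ !(smulDl, smulDr, smNl, smNr) ?(smulZl, smulZr); lmod R; ring.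
  exact: (pos_conj (el A) (er A)).
have Q1 : rn Q <= 1 by apply: (le_trans (rnM_le _ _)); have := rn_ge0 q; nra.
apply: (le_trans (rnD _ _)); apply: lerD.
  rewrite rnZr // ler_wpM2l //.
  have -> : Q ** emb a ** Q = q ** W ** q by rewrite /Q /W !smulA.
  apply: (le_trans (rnM_le _ _)); have := rnM_le q W.
  by have := rn_ge0 q; have := rn_ge0 W; have := rn_ge0 (q ** W); nra.
have -> : p + b = (k^-1)%:C%C *: c by rewrite scr mulVf ?gt_eqF // scale1r.
rewrite (linZ (@emb_lin R A)) smulZr smulZl rnZr ?invr_ge0 ?(ltW k0) //.
rewrite ler_wpM2l ?invr_ge0 ?(ltW k0) //.
have cQ : com (emb c) Q by apply: comM.
have -> : Q ** emb c ** Q = (emb c ** q) ** (q ** Q) by rewrite -cQ /Q !smulA.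
have hqQ : rn (q ** Q) <= 1.
  by apply: (le_trans (rnM_le _ _)); have := rn_ge0 q; have := rn_ge0 Q; nra.
apply: (le_trans (rnM_le _ _)); rewrite -[leRHS]mulr1.
apply: ler_pM; rewrite //.
have := pw_decay (el A) (er A) n pk pk1; rewrite -qE.
by rewrite mulrC -ler_pdivlMr ?ltr0Sn // mul1r.
Qed.

Lemma hom_iso A B (f : A -> B) : starhom f -> injective f -> forall x, rn (f x) = rn x.
Proof.
move=> hf fi x; apply/eqP; rewrite eq_le hom_contr //=.
rewrite -(@ler_pXn2r _ 2) ?nnegrE //; apply: le_eps => e e0.
by have [x' /fi -> h] := hom_lift x hf e0.
Qed.

(** An approximate preimage is corrected by a lift of small norm from [hom_lift]; the corrections
    are summable, so the preimages converge. *)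
Lemma hom_range_clsub A B (f : A -> B) : starhom f -> clsub (range f).
Proof.
move=> hf; have lf := hom_lin hf.
split => [|c _ _ [x _ <-] [y _ <-]|y h].
- by exists 0 => //; rewrite lin0.
- by exists (c *: x + y) => //; rewrite lf.
pose dl n : R := 2^-1 ^+ n; have dl0 n : 0 < dl n by rewrite exprn_gt0 // invr_gt0.
have dlS n : dl n.+1 = dl n / 2 by rewrite /dl exprS mulrC.
have st n x : rn (y - f x) < dl n ->
    exists x', rn (y - f x') < dl n.+1 /\ rn (x' - x) <= 3 * dl n.
  move=> hx; have [_ [z _ <-] hz] := h _ (dl0 n.+1).
  have e0 : 0 < dl n ^+ 2 by rewrite exprn_gt0.
  have [w fw hw] := hom_lift (z - x) hf e0.
  have fxw : f (x + w) = f z by rewrite (linD lf) fw (linB lf) addrC subrK.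
  exists (x + w); rewrite fxw; split => //; rewrite (addrC x) addrK.
  (* The squared norm of the lift is at most (2 dl n)^2 + (dl n)^2, and 5 <= 3^2. *)
  rewrite -(@ler_pXn2r _ 2) ?nnegrE ?rn_ge0 ?mulr_ge0 ?(ltW (dl0 n)) //.
  apply: (le_trans hw); have : rn (f (z - x)) <= 2 * dl n.
    rewrite (linB lf); have := rn_tri (f z) y (f x); rewrite (rnC (f z) y).
    by move: hz; rewrite dlS; have := dl0 n; lra.
  by have := rn_ge0 (f (z - x)); have := dl0 n; nra.
have [x0 hx0] : exists x0, rn (y - f x0) < dl 0%N by have [_ [z _ <-] hz] := h _ (dl0 0%N); exists z.
pose nx n (s : {x : A | rn (y - f x) < dl n}) : {x : A | rn (y - f x) < dl n.+1} :=
  exist _ (projT1 (cid (st n (sval s) (svalP s)))) (proj1 (projT2 (cid (st n (sval s) (svalP s))))).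
pose s := fix s n : {x : A | rn (y - f x) < dl n} :=
  if n is m.+1 then nx m (s m) else exist _ x0 hx0.
pose u n := sval (s n).
have us n : rn (u n.+1 - u n) <= 3 * dl n.
  exact: (proj2 (projT2 (cid (st n (sval (s n)) (svalP (s n)))))).
have tail n k : rn (u (n + k)%N - u n) <= 6 * dl n - 6 * dl (n + k)%N.
  elim: k => [|k ih]; first by rewrite addn0 !subrr rn0.
  apply: (le_trans (rn_tri _ (u (n + k)%N) _)); rewrite addnS.
  by have := us (n + k)%N; rewrite dlS; lra.
have dls n : dl n <= n.+1%:R^-1.
  rewrite /dl exprVn lef_pV2 ?posrE ?exprn_gt0 ?ltr0Sn //.
  by rewrite -natrX ler_nat ltn_expl.
have [x hx] : exists x, cvs u x.
  apply: cauchy_cvs => e e0; have [N hN] := inv_small (e := e / 12) ltac:(lra).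
  exists N => m n hm hn; have := le_lt_trans (dls N) (hN N (leqnn _)).
  have := tail N (m - N)%N; have := tail N (n - N)%N; rewrite !subnKC //.
  have := dl0 m; have := dl0 n; have := rn_tri (u m) (u N) (u n).
  by rewrite (rnC (u N)); lra.
exists x => //; apply: (cvs_unique (blin_cvs (hom_blin hf) hx)) => e e0.
have [N hN] := inv_small e0; exists N => n /hN hn.
by rewrite rnC; apply: (lt_trans (svalP (s n))); apply: le_lt_trans (dls n) hn.
Qed.

End Homs.

Record clspace (R : realType) (V : completeNormedModType R[i]) :=
  ClSpace { cl_set :> V -> Prop; cl_P : clsub cl_set }.

Section SubSpace.
Variables (R : realType) (V : completeNormedModType R[i]) (S : clspace V).

Record subv := SubV { sv : V; svP : S sv }.

HB.instance Definition _ := gen_eqMixin subv.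
HB.instance Definition _ := gen_choiceMixin subv.

Lemma sv_inj : injective sv.
Proof. by move=> [x p] [y q] /= e; subst; congr SubV; apply: Prop_irrelevance. Qed.

Definition sv_zero := SubV (cls0 (cl_P S)).
Definition sv_add (x y : subv) := SubV (clsD (cl_P S) (svP x) (svP y)).
Definition sv_opp (x : subv) := SubV (clsN (cl_P S) (svP x)).
Definition sv_scale c (x : subv) := SubV (clsZ (cl_P S) c (svP x)).
Definition sv_zmod := @injected_zmod R[i] _ _ sv sv_zero sv_add sv_opp sv_inj erefl
  (fun _ _ => erefl) (fun=> erefl).
HB.instance Definition _ := GRing.isZmodule.Build subv
  sv_zmod.1.1 sv_zmod.1.2 sv_zmod.2.1 sv_zmod.2.2.
Definition sv_lmod := @injected_lmod R[i] _ _ sv sv_scale sv_inj (fun _ _ => erefl)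
  (fun _ _ => erefl).
HB.instance Definition _ := GRing.Zmodule_isLmodule.Build R[i] subv
  sv_lmod.1.1 sv_lmod.1.2 sv_lmod.2.1 sv_lmod.2.2.

Lemma sv_lin : linear sv. Proof. by []. Qed.

Definition sv_norm (x : subv) : R[i] := `|sv x|.
Fact sv_normD x y : sv_norm (x + y) <= sv_norm x + sv_norm y.
Proof. exact: ler_normD. Qed.
Fact sv_normZ c x : sv_norm (c *: x) = `|c| * sv_norm x.
Proof. exact: normrZ. Qed.
Fact sv_norm0 x : sv_norm x = 0 -> x = 0.
Proof. by move=> /eqP; rewrite normr_eq0 => /eqP e; apply: sv_inj. Qed.
HB.instance Definition _ := Lmodule_isNormed.Build R[i] subv sv_normD sv_normZ sv_norm0.

Lemma sv_complete (u : nat -> subv) : cauchys u -> exists l, cvs u l.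
Proof.
move=> hu; have [l hl] : exists l, cvs (sv \o u) l by apply: cauchy_cvs.
have Sl : S l by apply: (cls_cvs (cl_P S) _ hl) => n; exact: svP.
by exists (SubV Sl).
Qed.
HB.instance Definition _ := Uniform_isComplete.Build subv (seq_complete sv_complete).

End SubSpace.

Record cstarsub (R : realType) (A : cstarType R) := CStarSub {
  cs_set :> A -> Prop;
  cs_cl : clsub cs_set;
  cs_mul : forall x y, cs_set x -> cs_set y -> cs_set (x ** y);
  cs_star : forall x, cs_set x -> cs_set (star x)
}.

Section SubAlg.
Variables (R : realType) (A : cstarType R) (S : cstarsub A).

Definition subc : Type := subv (ClSpace (cs_cl S)).
HB.instance Definition _ := CompleteNormedModule.on subc.
Implicit Types x y z : subc.
Definition sc (x : subc) : A := sv x.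
Definition SubC (a : A) (h : S a) : subc := SubV (S := ClSpace (cs_cl S)) h.
Lemma scP x : S (sc x). Proof. exact: (svP x). Qed.
Lemma sc_inj : injective sc. Proof. exact: sv_inj. Qed.
Definition sc_mul x y : subc := SubC (cs_mul (scP x) (scP y)).
Definition sc_star x : subc := SubC (cs_star (scP x)).
Fact sc_mulA x y z : sc_mul x (sc_mul y z) = sc_mul (sc_mul x y) z.
Proof. by apply: sc_inj; apply: smulA. Qed.
Fact sc_mulDl x y z : sc_mul (x + y) z = sc_mul x z + sc_mul y z.
Proof. by apply: sc_inj; apply: smulDl. Qed.
Fact sc_mulDr x y z : sc_mul x (y + z) = sc_mul x y + sc_mul x z.
Proof. by apply: sc_inj; apply: smulDr. Qed.
Fact sc_mulZl c x y : sc_mul (c *: x) y = c *: sc_mul x y.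
Proof. by apply: sc_inj; apply: smulZl. Qed.
Fact sc_mulZr c x y : sc_mul x (c *: y) = c *: sc_mul x y.
Proof. by apply: sc_inj; apply: smulZr. Qed.
Fact sc_starK : involutive sc_star.
Proof. by move=> x; apply: sc_inj; apply: starK. Qed.
Fact sc_starD x y : sc_star (x + y) = sc_star x + sc_star y.
Proof. by apply: sc_inj; apply: starD. Qed.
Fact sc_starZ c x : sc_star (c *: x) = c^* *: sc_star x.
Proof. by apply: sc_inj; apply: starZ. Qed.
Fact sc_starM x y : sc_star (sc_mul x y) = sc_mul (sc_star y) (sc_star x).
Proof. by apply: sc_inj; apply: starM. Qed.
HB.instance Definition _ := Lmodule_isStarAlgebra.Build R[i] subc
  sc_mulA sc_mulDl sc_mulDr sc_mulZl sc_mulZr sc_starK sc_starD sc_starZ sc_starM.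
Fact sc_normM x y : `|x ** y| <= `|x| * `|y|.
Proof. exact: (cstar_normM (sc x) (sc y)). Qed.
Fact sc_normC x : `|star x ** x| = `|x| ^+ 2.
Proof. exact: (cstar_normC (sc x)). Qed.
HB.instance Definition _ := isCStar.Build R subc sc_normM sc_normC.

Lemma sc_hom : starhom sc. Proof. by []. Qed.
Lemma rn_sc x : rn (sc x) = rn x. Proof. by []. Qed.
Lemma sc_SubC a (h : S a) : sc (SubC h) = a. Proof. by []. Qed.

End SubAlg.

Section Factor.
Variables (R : realType).
Implicit Types A B : cstarType R.

Lemma hom_bij_inv A B (f : A -> B) : starhom f -> injective f -> forall g : B -> A,
  cancel g f -> starhom g.
Proof.
move=> [l m s] fi g gK; split=> [c x y|x y|x]; apply: fi.
- by rewrite l !gK.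
- by rewrite m !gK.
- by rewrite s !gK.
Qed.

Lemma hom_factor A B (D : cstarType R) (f : A -> D) (g : B -> D) : starhom f -> starhom g ->
  injective g -> (forall x, range g (f x)) ->
  exists2 h : A -> B, starhom h & forall x, g (h x) = f x.
Proof.
move=> [lf mf sf] [lg mg sg] gi hr.
have ex x : exists y, g y = f x by have [y _ <-] := hr x; exists y.
pose h x := projT1 (cid (ex x)).
have hh x : g (h x) = f x by exact: (projT2 (cid (ex x))).
exists h => //; split=> [c x y|x y|x]; apply: gi.
- by rewrite lg !hh lf.
- by rewrite mg !hh mf.
- by rewrite sg !hh sf.
Qed.

Lemma bij_inverse (T U : Type) (f : T -> U) : bijective f ->
  exists g, cancel f g /\ cancel g f.
Proof. by case=> g h k; exists g. Qed.

Lemma inj_surj_bij (T U : Type) (f : T -> U) : injective f -> range f = setT -> bijective f.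
Proof.
move=> fi fs; have ex y : exists x, f x = y.
  have [x _ <-] : range f y by rewrite fs.
  by exists x.
exists (fun y => projT1 (cid (ex y))) => [x|y]; last exact: (projT2 (cid (ex y))).
by apply: fi; exact: (projT2 (cid (ex (f x)))).
Qed.

(** [u = 1 - (1 - k c^2)^n] is a polynomial in c^2 without constant term, so it belongs to every
    closed left ideal that contains [c]; the decay rate of [pw] bounds |c - c u|^2. *)
Lemma approx_unit A (c : A) (P : set A) (eps : R) : clsub P ->
  (forall x y, P y -> P (x ** y)) -> P c -> sa c -> 0 < eps ->
  exists u, [/\ P u, sa u, rn (c - c ** u) < eps & rn (mone A - emb u) <= 1].
Proof.
move=> cP mP Pc s_c e0; have el := @mone_l R A; have er := @mone_r R A.
pose d := c ** c.
have pd : pos (emb d) by rewrite /d -{1}s_c; exact: pos_embM.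
have [k k0 [pk pk1]] := small_scale pd.
set d' := k%:C%C *: d in pk pk1.
have Pd : P d' by apply: (clsZ cP); apply: mP.
have [N hN] := inv_small (e := eps ^+ 2 * k) ltac:(by rewrite mulr_gt0 ?exprn_gt0).
pose n := N.+1; have [q qE] : exists q, q = pw (mone A) (emb d') n by eexists.
have eu : emb (au d' n) = mone A - q by rewrite au_emb qE.
have pq : pos q by rewrite qE; exact: (pw_pos el er).
have q1 : rn q <= 1 by rewrite qE; exact: (pw_le1 el er).
exists (au d' n); split.
- exact: au_sub.
- apply: (@emb_inj R A); rewrite emb_star; apply: pos_sa; rewrite au_emb.
  have -> : mone A - pw (mone A) (emb d') n = (mone A - pw (mone A) (emb d') n -
     n%:R *: (emb d' ** pw (mone A) (emb d') n)) + (n%:R : R)%:C%C *: (emb d' ** pw (mone A) (emb d') n).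
    by rewrite rmorph_nat subrK.
  apply: (posD el er); first exact: (pw_decay_pos el er).
  by apply: posZ => //; apply: (pos_mul el er) => //; [exact: (pw_pos el er) | exact: (pw_com el er)].
- have e1 : emb (c - c ** au d' n) = emb c ** q.
    by rewrite (linB (@emb_lin R A)) embM eu smBr er opprB addrC subrK.
  rewrite -rn_emb e1 -(@ltr_pXn2r _ 2) ?nnegrE ?rn_ge0 ?(ltW e0) // -rn_starM starM.
  rewrite (pos_sa pq) smulA -(smulA q) -emb_star s_c -embM -/d.
  have -> : d = (k^-1)%:C%C *: d' by rewrite scr mulVf ?gt_eqF // scale1r.
  have cdq : com (emb d') q by rewrite qE; exact: (pw_com el er).
  rewrite (linZ (@emb_lin R A)) smulZr smulZl -cdq rnZr ?invr_ge0 ?(ltW k0) //.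
  rewrite ltr_pdivrMl // mulrC; apply: le_lt_trans (hN N (leqnn _)).
  apply: (le_trans (rnM_le _ _)); have := pw_decay el er n pk pk1; rewrite -qE.
  rewrite mulrC -ler_pdivlMr ?ltr0Sn // mul1r => h.
  by apply: le_trans h; rewrite -[leRHS]mulr1 ler_pM.
- by rewrite eu opprB addrC subrK.
Qed.

End Factor.

(** * Multipliers from unitaries and extension of homomorphisms *)

Section UnitaryMultiplier.
Variables (R : realType).

Lemma rn_lc_gram (D : cstarType R) T (g u : T -> D) s :
  (forall a b, star (u a) ** u b = star (g a) ** g b) -> rn (lc u s) = rn (lc g s).
Proof.
move=> h; suff e : star (lc u s) ** lc u s = star (lc g s) ** lc g s.
  by apply/eqP; rewrite -(@eqrXn2 _ 2) // -!rn_starM e.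
rewrite /lc !st_sum !sm_suml; apply: eq_bigr => p _; rewrite !sm_sumr.
by apply: eq_bigr => q _; rewrite !starZ !smulZl !smulZr h.
Qed.

Lemma clsub_conj (V : normedModType R[i]) (W : normedModType R[i]) (f : V -> W) :
  (forall c x y, f (c *: x + y) = c^* *: f x + f y) ->
  (exists M : R, forall x, rn (f x) <= M * rn x) -> clsub [set x | f x = 0].
Proof.
move=> fL [M hM]; have f0 : f 0 = 0.
  have := fL (-1) 0 0; rewrite scaler0 addr0 rmorphN1 scaleN1r addNr //.
split => [//|c x y /= hx hy|x h /=]; first by rewrite fL hx hy scaler0 addr0.
have fB a b : f (a - b) = f a - f b.
  by rewrite addrC -scaleN1r fL rmorphN1 scaleN1r addrC.
apply: rn_le0; apply: le0_eps => e e0; have M1 : 0 < `|M| + 1 by have := normr_ge0 M; lra.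
have [y /= hy xy] := h (e / (`|M| + 1)) ltac:(by rewrite divr_gt0).
rewrite ltr_pdivlMr // in xy; have := hM (x - y); rewrite fB hy subr0.
have := ler_norm M; have := rn_ge0 (x - y); nra.
Qed.

Lemma dense_sesq (D : cstarType R) T (g : T -> D) (f f' : D -> D) :
  cspan (range g) = setT -> blin f -> blin f' ->
  (forall s t, star (f (g s)) ** g t = star (g s) ** f' (g t)) ->
  forall x y, star (f x) ** y = star x ** f' y.
Proof.
move=> gT bf bf' h x y; apply/eqP; rewrite -subr_eq0; apply/eqP.
move: x; apply: (cspanT_ind gT).
  apply: (@clsub_conj D D (fun x => star (f x) ** y - star x ** f' y)).
    by move=> c u v; rewrite bf.1 !starD !starZ !smulDl !smulZl; lmod R; ring.
  have [M M0 hM] := bf.2; exists (M * rn y + rn (f' y)) => x.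
  apply: (le_trans (rnD _ _)); rewrite rnN mulrDl; apply: lerD.
    apply: (le_trans (rnM_le _ _)); rewrite rn_star mulrAC ler_wpM2r //.
  by apply: (le_trans (rnM_le _ _)); rewrite rn_star mulrC.
move=> _ [s _ <-]; move: y; apply: (cspanT_ind gT).
  apply: clsub_ker; apply: blinB; first exact: blin_mull.
  exact: (blin_comp bf' (blin_mull _)).
by move=> _ [t _ <-] /=; rewrite h subrr.
Qed.

(** Equality of the Gram products makes [g t |-> U t] isometric, so that no norm estimate is needed;
    [U'] prescribes the adjoint. General multipliers are then reached through [unitary_span]. *)
Lemma unitary_mult (D : cstarType R) T (g U U' : T -> D) : cspan (range g) = setT ->
  (forall s t, star (U s) ** U t = star (g s) ** g t) ->
  (forall s t, star (U' s) ** U' t = star (g s) ** g t) ->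
  (forall s t, star (U s) ** g t = star (g s) ** U' t) ->
  exists m : mult D, (forall t, ml m (g t) = U t) /\ forall t, ml (star m) (g t) = U' t.
Proof.
move=> gT hU hU' adj.
have [|F [lF bF FU]] := @blt R D D T g U 1 ler01 gT.
  by move=> s; rewrite mul1r (rn_lc_gram s hU).
have [|F' [lF' bF' FU']] := @blt R D D T g U' 1 ler01 gT.
  by move=> s; rewrite mul1r (rn_lc_gram s hU').
have rel x y : star (F x) ** y = star x ** F' y.
  apply: (dense_sesq gT) => [||s t]; [by split=> //; exists 1 | by split=> //; exists 1 |].
  by rewrite FU FU' adj.
have rel' x y : x ** F y = star (F' (star x)) ** y.
  by apply: (can_inj starK); rewrite !starM starK rel.
exists (Mult rel'); split=> // t /=; rewrite -FU'.
by rewrite !starK.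
Qed.

End UnitaryMultiplier.

Section Extension.
Variables (R : realType) (A B : cstarType R) (f : A -> mult B) (q : mult B).
Hypotheses (hf : starhom f) (sq : sa q) (qq : q ** q = q)
  (qf : forall a, q ** f a = f a)
  (fd : forall P : set B, clsub P -> (forall a b, P (ml (f a) b)) -> forall b, P (ml q b)).

Lemma ext_fq a : f a ** q = f a.
Proof. by rewrite -{1}(starK a) (hom_star hf) -{1}sq -starM qf -(hom_star hf) starK. Qed.

Lemma ext_q_eq n n' : n ** q = n -> n' ** q = n' ->
  (forall a, n ** f a = n' ** f a) -> n = n'.
Proof.
move=> h h' e; rewrite -h -h'; apply: mult_eq => b /=.
apply: (fd (P := [set c | ml n c = ml n' c])).
  exact: (clsub_eq (blin_ml n) (blin_ml n')).
by move=> a c; have := congr1 (fun m => ml m c) (e a).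
Qed.

(** [u] acts by f a b |-> f (u a) b on the range of [q] and as the identity on its complement, the
    second summand of [T]. Both prescriptions preserve [B]-valued inner products. *)
Lemma ext_q_unitary u : star u ** u = mone A -> u ** star u = mone A ->
  exists n : mult B, n ** q = n /\ forall a, n ** f a = f (ml u a).
Proof.
move=> uu uu'; pose T := ((A * B) + B)%type.
pose g (v : mult A) (t : T) : B := match t with
  | inl p => ml (f (ml v p.1)) p.2 | inr b => ml (mone B - q) b end.
have gg v1 v2 v3 v4 s t : star v1 ** v2 = star v3 ** v4 ->
    star (g v1 s) ** g v2 t = star (g v3 s) ** g v4 t.
  move=> vv; have key (m n m' n' : mult B) (b b' : B) : star m ** n = star m' ** n' ->
      star (ml m b) ** ml n b' = star (ml m' b) ** ml n' b'.
    by move=> e; rewrite !ml_adj; have := congr1 (fun k => star b ** ml k b') e.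
  case: s t => [[a b]|b] [[a' b']|b'].
  - apply: (key (f (ml v1 a)) (f (ml v2 a')) (f (ml v3 a)) (f (ml v4 a'))).
    rewrite -!(hom_star hf) -!(homM hf) !ml_adj; congr (f (_ ** _)).
    exact: (congr1 (fun k => ml k a') vv).
  - apply: (key (f (ml v1 a)) _ (f (ml v3 a))).
    by rewrite -!(hom_star hf) !smBr !mone_r !ext_fq !subrr.
  - apply: (key _ (f (ml v2 a')) _ (f (ml v4 a'))).
    by rewrite !stB sq (sa_unit (@mone_l R B)) !smBl !mone_l !qf !subrr.
  - by [].
have [||||m [hm hm']] := @unitary_mult R B T (g (mone A)) (g u) (g (star u)).
- apply: cspan_eqT => P cP hP b; have -> : b = ml q b + ml (mone B - q) b.
    by rewrite /= scaleN1r addrC subrK.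
  apply: (clsD cP); last by apply: hP; exists (inr b).
  by apply: fd => // a c; apply: hP; exists (inl (a, c)).
- by move=> s t; apply: gg; rewrite uu mone_r (sa_unit (@mone_l R A)).
- by move=> s t; apply: gg; rewrite starK uu' mone_r (sa_unit (@mone_l R A)).
- by move=> s t; apply: gg; rewrite mone_r (sa_unit (@mone_l R A)) mone_l.
have mf a : m ** f a = f (ml u a).
  by apply: mult_eq => b; have := hm (inl (a, b)).
exists (m ** q); split; first by rewrite -smulA qq.
by move=> a; rewrite -smulA qf.
Qed.

Lemma ext_q_ex m : exists n : mult B, n ** q = n /\ forall a, n ** f a = f (ml m a).
Proof.
move: m; apply: (unitary_span (@mone_l R A) (@mone_r R A)
  (P := fun m => exists n : mult B, n ** q = n /\ forall a, n ** f a = f (ml m a))) => [u uu uu'|c x y [n [nq hn]] [n' [nq' hn']]].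
  exact: ext_q_unitary.
exists (c *: n + n'); split; first by rewrite smulDl smulZl nq nq'.
by move=> a; rewrite smulDl smulZl hn hn' [ml _ _]/= (linD (hom_lin hf)) (linZ (hom_lin hf)).
Qed.

Lemma ext_q : exists f' : mult A -> mult B,
  [/\ starhom f', forall m a, f' m ** f a = f (ml m a),
      forall m, q ** f' m = f' m /\ f' m ** q = f' m & f' (mone A) = q].
Proof.
pose f' m := projT1 (cid (ext_q_ex m)).
have f'q m : f' m ** q = f' m by exact: (projT2 (cid (ext_q_ex m))).1.
have f'f m a : f' m ** f a = f (ml m a) by exact: ((projT2 (cid (ext_q_ex m))).2 a).
have q0 (Y : mult B) : Y ** q = Y -> (forall a, Y ** f a = 0) -> Y = 0.
  by move=> h k; apply: ext_q_eq => //; [rewrite sm0l | move=> a; rewrite k sm0l].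
have qf' m : q ** f' m = f' m.
  apply/eqP; rewrite -subr_eq0; apply/eqP; apply: q0.
    by rewrite smBl -smulA f'q.
  by move=> a; rewrite smBl -smulA f'f qf subrr.
have sf a m : star (f' m) ** f a = f (ml (star m) a).
  apply/eqP; rewrite -subr_eq0; apply/eqP; apply: (can_inj starK); rewrite st0; apply: q0.
    by rewrite -{1}sq -starM smBr smulA -{1}sq -starM f'q qf.
  move=> b; apply: (can_inj starK); rewrite st0 starM starK smBr -(hom_star hf).
  rewrite smulA -[f (star b) ** _]starK starM starK -(hom_star hf) starK f'f.
  by rewrite -!(hom_star hf) -!(homM hf) ml_adj subrr.
exists f'; split=> //.
- split=> [c m n|m n|m].
  + apply: ext_q_eq; rewrite ?f'q // ?smulDl ?smulZl ?f'q // => a.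
    by rewrite smulDl smulZl !f'f [ml _ _]/= (linD (hom_lin hf)) (linZ (hom_lin hf)).
  + apply: ext_q_eq; rewrite ?f'q // -?smulA ?f'q // => a.
    by rewrite f'f -smulA !f'f.
  + apply: ext_q_eq; rewrite ?f'q //; first by rewrite -{1}sq -starM qf'.
    by move=> a; rewrite f'f sf.
- by apply: ext_q_eq => // a; rewrite f'f qf.
Qed.

End Extension.

Section Nondegenerate.
Variables (R : realType).
Implicit Types (A B D : cstarType R).

Lemma nondegP A B (f : A -> mult B) : nondeg f <->
  forall P : set B, clsub P -> (forall a b, P (ml (f a) b)) -> forall b, P b.
Proof.
split=> [nf P cP hP b|h]; first by apply: (cspanT_ind nf cP) => _ [a [c ->]].
by apply: cspan_eqT => P cP hP; apply: h => // a b; apply: hP; exists a, b.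
Qed.

Lemma nondeg_eq A B (f : A -> mult B) n n' : nondeg f ->
  (forall a, n ** f a = n' ** f a) -> n = n'.
Proof.
move=> /nondegP nf h; apply: mult_eq; apply: nf.
  exact: (clsub_eq (blin_ml n) (blin_ml n')).
by move=> a b; have := congr1 (fun m => ml m b) (h a).
Qed.

Lemma ext_spec A B (f : A -> mult B) : starhom f -> nondeg f ->
  starhom (ext f) /\ (forall m a, ext f m ** f a = f (ml m a)).
Proof.
move=> hf nf.
have [||||f' [hf' f'f f'q f'1]] := @ext_q R A B f (mone B) hf.
- exact: (sa_unit (@mone_l R B)).
- exact: mone_l.
- by move=> a; exact: mone_l.
- by move=> P cP h b; apply: (nondegP f).1 => //.
have e : ext f = f'.
  apply/funext => m; rewrite /ext; apply: xget_unique; first exact: f'f.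
  by move=> n hn; apply: (nondeg_eq nf) => a; rewrite hn f'f.
by rewrite e.
Qed.

Section Ext.
Variables (A B : cstarType R) (f : A -> mult B).
Hypotheses (hf : starhom f) (nf : nondeg f).
Lemma ext_hom : starhom (ext f). Proof. by case: (ext_spec hf nf). Qed.
Lemma extE m a : ext f m ** f a = f (ml m a). Proof. by case: (ext_spec hf nf). Qed.
Lemma ext_uniq m n : (forall a, n ** f a = f (ml m a)) -> n = ext f m.
Proof. by move=> h; apply: (nondeg_eq nf) => a; rewrite h extE. Qed.
Lemma ext_emb a : ext f (emb a) = f a.
Proof. by apply/esym/ext_uniq => b; rewrite -(homM hf). Qed.
Lemma ext_one : ext f (mone A) = mone B.
Proof. by apply/esym/ext_uniq => b; rewrite mone_l. Qed.
Lemma ext_mulr m a : f a ** ext f m = f (mr m a).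
Proof.
by rewrite -!ext_emb -(homM ext_hom) emb_mul.
Qed.
End Ext.

Lemma nondeg_ext_comp A B D (f : A -> mult B) (g : B -> mult D) :
  starhom f -> nondeg f -> starhom g -> nondeg g -> nondeg (ext g \o f).
Proof.
move=> hf nf hg ng; apply/nondegP => P cP hP.
apply: (nondegP g).1 => // b d; move: b; apply: (nondegP f).1 => //.
  apply: (clsub_pre (f := fun b => ml (g b) d)) => //.
  split=> [c x y|]; first by rewrite (hom_lin hg).
  exists (rn d) => // x.
  by apply: (le_trans (rn_ml _ _)); rewrite mulrC ler_wpM2l // hom_contr.
by move=> a b; have := hP a (ml (g b) d); rewrite /= -[ml _ (ml _ _)]/(ml (_ ** _) d) extE.
Qed.

Lemma ext_comp A B D (f : A -> mult B) (g : B -> mult D) m :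
  starhom f -> nondeg f -> starhom g -> nondeg g ->
  ext (ext g \o f) m = ext g (ext f m).
Proof.
move=> hf nf hg ng; apply/esym/ext_uniq.
- exact: (hom_comp hf (ext_hom hg ng)).
- exact: nondeg_ext_comp.
- by move=> a /=; rewrite -(homM (ext_hom hg ng)) extE.
Qed.

(** A selfadjoint [y] is a limit of products [y ** u] with approximate units, and selfadjoint
    elements span. *)
Lemma nondeg_emb A : nondeg (@emb R A).
Proof.
apply/nondegP => P cP hP x.
suff h y : sa y -> P y.
  have -> : x = hlf R *: (x + star x) + (iu R * hlf R) *: ((- iu R) *: (x - star x)).
    rewrite scalerA (_ : iu R * hlf R * - iu R = hlf R); last first.
      by rewrite mulrAC mulrN iu_sq opprK mul1r.
    by nc R.
  apply: (clsL cP); first by apply: h; rewrite /sa starD starK addrC.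
  by apply: (clsZ cP); apply: h; rewrite /sa starZ rmorphN /= iu_conj opprK stB starK; nc R.
move=> sy; apply: (clsC cP) => e e0.
have [u [_ _ hu _]] := @approx_unit R A y setT e (clsubT A) (fun _ _ _ => I) I sy e0.
by exists (y ** u) => //; apply: hP.
Qed.

Lemma ext_embE A m : ext (@emb R A) m = m.
Proof.
by apply/esym/(ext_uniq (emb_starhom A) (nondeg_emb A)) => a; rewrite mul_emb.
Qed.

Lemma nondeg_surj A B (f : A -> B) : starhom f -> range f = setT -> nondeg (@emb R B \o f).
Proof.
move=> hf fs; apply/nondegP => P cP hP; apply: (nondegP _).1 (nondeg_emb B) _ cP _ => b c.
have [a _ <-] : range f b by rewrite fs.
exact: (hP a c).
Qed.

Lemma hom_emb_comp A B (f : A -> B) : starhom f -> starhom (@emb R B \o f).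
Proof. by move=> hf; apply: (hom_comp hf (emb_starhom B)). Qed.

(** The version of extension for degenerate maps that are nondegenerate onto a corner; the two
    cut-down conditions in [cext] give uniqueness. *)
Lemma cext_spec A B (f : A -> B) (p : mult B) : starhom f -> sa p -> p ** p = p ->
  (forall a, ml p (f a) = f a) ->
  (forall P : set B, clsub P -> (forall a b, P (f a ** b)) -> forall b, P (ml p b)) ->
  [/\ starhom (cext p f), forall m a, cext p f m ** emb (f a) = emb (f (ml m a)),
      forall m, p ** cext p f m = cext p f m /\ cext p f m ** p = cext p f m
    & cext p f (mone A) = p].
Proof.
move=> hf sp pp pf fd.
have qf a : p ** emb (f a) = emb (f a) by rewrite mul_emb pf.
have [f' [hf' f'f f'q f'1]] := ext_q (hom_emb_comp hf) sp pp qf fd.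
suff -> : cext p f = f' by [].
apply/funext => m; rewrite /cext; apply: xget_unique.
  by have [h1 h2] := f'q m; split=> // a; exact: f'f.
by move=> n [pn np hn]; apply: (ext_q_eq (f := @emb R B \o f) (q := p)) => //;
  [have [] := f'q m | move=> a; rewrite hn f'f].
Qed.

End Nondegenerate.

(** * Hilbert spaces from positive definite kernels *)

Section ComplexComplete.
Variable R : realType.

Lemma real_cauchy_lim (u : nat -> R) :
  (forall e, 0 < e -> exists N, forall m n, (N <= m)%N -> (N <= n)%N -> `|u m - u n| < e) ->
  exists l, forall e, 0 < e -> exists N, forall n, (N <= n)%N -> `|u n - l| < e.
Proof.
move=> hu; have : cauchy (u @ \oo).
  apply/cauchyP => e e0; have [N hN] := hu e e0; exists (u N); exists N => // n /= Nn.
  by rewrite -ball_normE /=; apply: hN.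
move=> /cauchy_cvg/cvg_ex[l hl]; exists l => e e0.
have /hl[N _ hN] : nbhs l [set y | `|y - l| < e].
  by apply/nbhs_ballP; exists e => // y; rewrite -ball_normE /= distrC.
by exists N => n /hN.
Qed.

Lemma rn_ReIm (z : R[i]) : rn z <= `|Re z| + `|Im z|.
Proof.
case: z => a b /=; have -> : (a +i* b)%C = a%:C%C + iu R * b%:C%C by rewrite /iu; simpc.
by apply: (le_trans (rnD _ _)); rewrite rnM rn_iu mul1r !rn_real.
Qed.
Lemma Re_rn (z : R[i]) : `|Re z| <= rn z.
Proof.
case: z => a b; rewrite /rn normc_def /= -sqrtr_sqr ler_sqrt ?addr_ge0 ?sqr_ge0 //.
by rewrite lerDl sqr_ge0.
Qed.
Lemma Im_rn (z : R[i]) : `|Im z| <= rn z.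
Proof.
case: z => a b; rewrite /rn normc_def /= -sqrtr_sqr ler_sqrt ?addr_ge0 ?sqr_ge0 //.
by rewrite lerDr sqr_ge0.
Qed.

Lemma complex_complete (u : nat -> R[i]^o) : cauchys u -> exists l, cvs u l.
Proof.
move=> hu.
have [|a ha] := @real_cauchy_lim (fun n => Re (u n)).
  move=> e /hu[N hN]; exists N => m n hm hn; apply: le_lt_trans (hN m n hm hn).
  by rewrite -raddfB; exact: Re_rn.
have [|b hb] := @real_cauchy_lim (fun n => Im (u n)).
  move=> e /hu[N hN]; exists N => m n hm hn; apply: le_lt_trans (hN m n hm hn).
  by rewrite -raddfB; exact: Im_rn.
exists (a +i* b)%C => e e0; have [N hN] := ha (e / 2) ltac:(lra).
have [N' hN'] := hb (e / 2) ltac:(lra).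
exists (maxn N N') => n; rewrite geq_max => /andP[/hN h1 /hN' h2].
apply: (le_lt_trans (rn_ReIm _)); move: h1 h2.
by case: (u n) => c d /=; lra.
Qed.

End ComplexComplete.

Section BoundedFunctions.
Variables (R : realType) (X : Type) (w : X -> R).

(** This space of functions dominated by a weight is complete, which lets kernel Hilbert spaces be
    built as closed subspaces of it. *)
Record bfun := BFun { bf : X -> R[i];
  bfP : exists2 M : R, 0 <= M & forall x, rn (bf x) <= M * `|w x| }.
HB.instance Definition _ := gen_eqMixin bfun.
HB.instance Definition _ := gen_choiceMixin bfun.
Implicit Types f g h : bfun.

Lemma bf_eq f g : bf f =1 bf g -> f = g.
Proof.
move=> /funext; case: f g => [f p] [g q] /= e; subst; congr BFun.
exact: Prop_irrelevance.
Qed.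
Definition bf_zero : bfun.
Proof. by exists (fun=> 0); exists 0 => // x; rewrite rn0 mul0r. Defined.
Definition bf_add f g : bfun.
Proof.
exists (fun x => bf f x + bf g x); have [M M0 hM] := bfP f; have [N N0 hN] := bfP g.
exists (M + N) => [|x]; first exact: addr_ge0.
by rewrite mulrDl; apply: (le_trans (rnD _ _)); apply: lerD.
Defined.
Definition bf_scale (c : R[i]) f : bfun.
Proof.
exists (fun x => c * bf f x); have [M M0 hM] := bfP f.
exists (rn c * M) => [|x]; first by rewrite mulr_ge0.
by rewrite rnM -mulrA ler_wpM2l.
Defined.
Fact bf_inj : injective bf. Proof. by move=> f g e; apply: bf_eq => x; rewrite e. Qed.
Definition bf_zmod := @injected_zmod _ (X -> R[i]^o) _ bf bf_zero bf_add (bf_scale (-1))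
  bf_inj erefl (fun _ _ => erefl) (fun f => funext (fun x => mulN1r (bf f x))).
HB.instance Definition _ := GRing.isZmodule.Build bfun
  bf_zmod.1.1 bf_zmod.1.2 bf_zmod.2.1 bf_zmod.2.2.
Definition bf_lmod := @injected_lmod _ (X -> R[i]^o) _ bf bf_scale bf_inj (fun _ _ => erefl)
  (fun _ _ => erefl).
HB.instance Definition _ := GRing.Zmodule_isLmodule.Build R[i] bfun
  bf_lmod.1.1 bf_lmod.1.2 bf_lmod.2.1 bf_lmod.2.2.

Let act (f : bfun) (x : X) : R[i]^o := bf f x.
Let w0 x : 0 <= `|w x|. Proof. exact: normr_ge0. Qed.
Let aL c f g x : act (c *: f + g) x = c *: act f x + act g x. Proof. by []. Qed.
Let aI f : (forall x, act f x = 0) -> f = 0.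
Proof. by move=> h; apply: bf_eq. Qed.
Let aB f : exists2 M : R, 0 <= M & forall x, rn (act f x) <= M * `|w x|.
Proof. exact: bfP. Qed.

HB.instance Definition _ := Lmodule_isNormed.Build R[i] bfun
  (opnCD w0 aL aB) (opnCZ w0 aL aB) (opnC_eq0 w0 aI aB).

Lemma bf_bd f x : rn (bf f x) <= rn f * `|w x|.
Proof. exact: (opn_bd w0 aB). Qed.
Lemma bf_le f (M : R) : 0 <= M -> (forall x, rn (bf f x) <= M * `|w x|) -> rn f <= M.
Proof. exact: (@opn_le R bfun X R[i]^o (fun x => `|w x|) act f M). Qed.

Lemma bf_complete (u : nat -> bfun) : cauchys u -> exists l, cvs u l.
Proof.
apply: (opn_complete w0 aL aB (@complex_complete R)) => v F M M0 hM hF _.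
have h : exists2 M : R, 0 <= M & forall x, rn (F x : R[i]) <= M * `|w x|.
  by exists M => // x; apply: (cvs_le (hF x)); exists 0%N => n _; exact: hM.
by exists (BFun h).
Qed.
HB.instance Definition _ := Uniform_isComplete.Build bfun (seq_complete bf_complete).

End BoundedFunctions.

Lemma cvs_cmul (R : realType) (a : nat -> R[i]) l c : cvs a l -> cvs (fun n => c * a n) (c * l).
Proof. by move=> h; apply: (@cvsZ R R[i]^o). Qed.

Lemma cvsB (R : realType) (V : normedModType R[i]) (a b : nat -> V) l m :
  cvs a l -> cvs b m -> cvs (fun n => a n - b n) (l - m).
Proof.
move=> ha hb; apply: cvsD => //; rewrite -scaleN1r.
by apply: (cvs_ext _ (cvsZ (-1) hb)) => n; rewrite scaleN1r.
Qed.

Section Kernel.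
Variables (R : realType) (T : Type) (K : T -> T -> R[i]).
Hypothesis KH : forall s t, K t s = (K s t)^*.
Local Notation X := (seq (R[i] * T)).

Definition kf (s t : X) : R[i] :=
  \sum_(p <- s) \sum_(q <- t) p.1 * Num.conj q.1 * K p.2 q.2.

Hypothesis Kpos : forall s, 0 <= Re (kf s s).

Definition ksc (c : R[i]) (s : X) : X := [seq (c * p.1, p.2) | p <- s].

Lemma kf_catl s s' t : kf (s ++ s') t = kf s t + kf s' t.
Proof. by rewrite /kf big_cat. Qed.
Lemma kf_scl c s t : kf (ksc c s) t = c * kf s t.
Proof.
rewrite /kf big_map mulr_sumr; apply: eq_bigr => p _; rewrite mulr_sumr.
by apply: eq_bigr => q _ /=; rewrite !mulrA.
Qed.
Lemma kf_conj s t : kf t s = (kf s t)^*.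
Proof.
rewrite /kf exchange_big rmorph_sum; apply: eq_bigr => p _ /=.
rewrite rmorph_sum; apply: eq_bigr => q _ /=.
by rewrite KH !rmorphM /= conjCK [q.1 * _]mulrC.
Qed.
Lemma kf_catr s t t' : kf s (t ++ t') = kf s t + kf s t'.
Proof. by rewrite kf_conj kf_catl rmorphD /= -!kf_conj. Qed.
Lemma kf_scr c s t : kf s (ksc c t) = c^* * kf s t.
Proof. by rewrite kf_conj kf_scl rmorphM /= -kf_conj. Qed.
Lemma kf_real s : kf s s = (Re (kf s s))%:C%C.
Proof.
have := kf_conj s s; rewrite conjE; case: (kf s s) => a b /= [h].
by have -> : b = 0 by lra.
Qed.

Definition kw s : R := Num.sqrt (Re (kf s s)).

Lemma kw_sq s : kw s ^+ 2 = Re (kf s s).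
Proof. exact: sqr_sqrtr. Qed.

Lemma kf_cs s t : rn (kf s t) <= kw s * kw t.
Proof.
rewrite -(@ler_pXn2r _ 2) ?nnegrE ?mulr_ge0 ?sqrtr_ge0 // exprMn !kw_sq.
apply: cs_num => // l; have := Kpos (s ++ ksc (- l) t).
rewrite kf_catl !kf_catr !kf_scl !kf_scr (kf_conj s t) (kf_real s) (kf_real t).
have -> : rn l ^+ 2 = Re (l * l^*) by rewrite -normCK rnE -rmorphXn.
move: (Re (kf s s)) (Re (kf t t)) (kf s t) => a b [p q]; case: l => u v.
rewrite !conjE /= => h; apply: le_trans h _; rewrite le_eqVlt; apply/orP; left; apply/eqP; ring.
Qed.

(** A formal combination [s] becomes the function [t |-> kf s t], whose weighted norm is again
    [kw s] by Cauchy-Schwarz. Null vectors are thereby divided out, and the closure of these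
    functions is the completion. *)
Definition kel (s : X) : bfun kw.
Proof.
exists (kf s); exists (kw s) => [|t]; first exact: sqrtr_ge0.
by rewrite ger0_norm ?sqrtr_ge0 // kf_cs.
Defined.

Lemma kel_cat s t : kel (s ++ t) = kel s + kel t.
Proof. by apply: bf_eq => u /=; rewrite kf_catl. Qed.
Lemma kel_sc c s : kel (ksc c s) = c *: kel s.
Proof. by apply: bf_eq => u /=; rewrite kf_scl. Qed.

Lemma rn_kel s : rn (kel s) = kw s.
Proof.
have w0 : 0 <= kw s by exact: sqrtr_ge0.
apply/eqP; rewrite eq_le; apply/andP; split.
  by apply: bf_le => // t /=; rewrite ger0_norm ?sqrtr_ge0 // kf_cs.
have [->|n0] := eqVneq (kw s) 0; first exact: rn_ge0.
have np : 0 < kw s by rewrite lt_neqAle eq_sym n0.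
have := bf_bd (kel s) s; rewrite /= kf_real rn_real -kw_sq ger0_norm ?sqr_ge0 //.
by rewrite ger0_norm // expr2 ler_pM2r.
Qed.

Definition kspace := subv (ClSpace (cspan_clsub (range kel))).
Implicit Types x y z : kspace.

(** Only the norm passes to the closure by itself; the inner product is recovered from it by
    polarization, and its laws follow from [pol_kin] by continuity. *)
Definition pol (x y : kspace) : R[i] :=
  ((rn (x + y) ^+ 2)%:C%C - (rn (x - y) ^+ 2)%:C%C
   + iu R * (rn (x + iu R *: y) ^+ 2)%:C%C - iu R * (rn (x - iu R *: y) ^+ 2)%:C%C) / 4.

Definition kin (s : X) : kspace.
Proof. by exists (kel s); apply: cspan_sub; exists s. Defined.

Lemma kin_cat s t : kin (s ++ t) = kin s + kin t.
Proof. by apply: sv_inj; exact: kel_cat. Qed.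
Lemma kin_sc c s : kin (ksc c s) = c *: kin s.
Proof. by apply: sv_inj; exact: kel_sc. Qed.
Lemma rn_kin s : rn (kin s) ^+ 2 = Re (kf s s).
Proof. by rewrite -kw_sq; congr (_ ^+ 2); exact: rn_kel. Qed.

Lemma pol_kin s t : pol (kin s) (kin t) = kf s t.
Proof.
rewrite /pol -!scaleNr -[kin t in X in (X - _)]scale1r -[X in kin s - X]scale1r -!scaleNr.
rewrite -!kin_sc -!kin_cat !rn_kin !kf_catl !kf_catr !kf_scl !kf_scr (kf_conj s t).
rewrite (kf_real s) (kf_real t).
have i4 : (4 : R[i])^-1 = ((4^-1 : R)%:C)%C by rewrite fmorphV rmorph_nat.
rewrite i4 /iu !conjE; move: (Re (kf s s)) (Re (kf t t)) (kf s t) => a b [p q] /=.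
by apply/eqP; rewrite eq_complex /=; apply/andP; split; apply/eqP; field.
Qed.

Lemma kin_dense x (e : R) : 0 < e -> exists s, rn (x - kin s) < e.
Proof.
move=> e0; have /cspanP/(_ e e0)[_ [s Ss ->] hs] := svP x.
have [s' hs'] : exists s', lc id s = kel s'.
  elim: s Ss {hs} => [|[c v] s ih] Ss.
    by exists [::]; rewrite lc_nil; apply: bf_eq => u; rewrite /= /kf big_nil.
  have [|s' hs'] := ih; first by move=> q hq; apply: Ss; right.
  have [u _ uv] : range kel v by apply: (Ss (c, v)); left.
  by exists (ksc c u ++ s'); rewrite lc_cons hs' kel_cat kel_sc uv.
by exists s'; rewrite hs' in hs.
Qed.

Lemma kin_seq x : exists s : nat -> X, cvs (kin \o s) x.
Proof.
have ap n : exists s, rn (x - kin s) < n.+1%:R^-1 by apply: kin_dense; exact: inv_gt0.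
exists (fun n => projT1 (cid (ap n))) => e /inv_small[N hN]; exists N => n /hN.
by rewrite rnC; apply: lt_trans; exact: (projT2 (cid (ap n))).
Qed.

Lemma cvs_rn2 (V : normedModType R[i]) (u : nat -> V) l : cvs u l ->
  cvs (fun n => (rn (u n) ^+ 2)%:C%C : R[i]) ((rn l ^+ 2)%:C%C).
Proof.
move=> hu e e0; have l1 : 0 < 2 * rn l + 1 by have := rn_ge0 l; lra.
have [N hN] := hu (Num.min 1 (e / (2 * rn l + 1))) ltac:(by rewrite lt_min ltr01 divr_gt0).
exists N => n /hN; rewrite lt_min ltr_pdivlMr // => /andP[h1 h2].
rewrite -rmorphB rn_real; have a1 := rn_leD (u n) l; have a2 := rn_leD l (u n).
rewrite rnC in a2; have := rn_ge0 (u n); have := rn_ge0 l; have := rn_ge0 (u n - l).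
by rewrite ltr_norml; move=> *; apply/andP; split; nra.
Qed.

Lemma cvs_pol (u v : nat -> kspace) x y : cvs u x -> cvs v y ->
  cvs (fun n => pol (u n) (v n)) (pol x y).
Proof.
move=> hu hv; rewrite /pol.
have cB := cvsB.
apply: (@cvs_ext _ _ (fun n => 4^-1 * _)); first by move=> n; rewrite mulrC.
rewrite [X in cvs _ X]mulrC; apply: cvs_cmul.
apply: (cB R R[i]^o); last by apply/cvs_cmul/cvs_rn2/cB => //; exact: cvsZ.
apply: (@cvsD R R[i]^o); last by apply/cvs_cmul/cvs_rn2/cvsD => //; exact: cvsZ.
by apply: (cB R R[i]^o); apply: cvs_rn2; [apply: cvsD | apply: cB].
Qed.

Fact pol_linear c x y z : pol (c *: x + y) z = c * pol x z + pol y z.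
Proof.
have [s hs] := kin_seq x; have [t ht] := kin_seq y; have [u hu] := kin_seq z.
have h1 : cvs (fun n => c *: kin (s n) + kin (t n)) (c *: x + y).
  by apply: cvsD => //; exact: cvsZ.
apply: (cvs_unique (cvs_pol h1 hu)).
apply: (@cvs_ext _ _ (fun n => c * pol (kin (s n)) (kin (u n)) + pol (kin (t n)) (kin (u n)))).
  by move=> n; rewrite -kin_sc -kin_cat !pol_kin kf_catl kf_scl.
apply: (@cvsD R R[i]^o); last exact: cvs_pol.
exact: (cvs_cmul _ (cvs_pol hs hu)).
Qed.

Fact pol_conj x y : pol y x = (pol x y)^*.
Proof.
have [s hs] := kin_seq x; have [t ht] := kin_seq y.
apply: (cvs_unique (cvs_pol ht hs)).
apply: (@cvs_ext _ _ (fun n => (pol (kin (s n)) (kin (t n)))^*)).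
  by move=> n; rewrite /= !pol_kin -kf_conj.
apply: (@cvs_comp R R[i]^o R[i]^o Num.conj 1 _ _ _ (cvs_pol hs ht)) => a b.
by rewrite -rmorphB rn_conj mul1r.
Qed.

Fact pol_norm x : pol x x = `|x| ^+ 2.
Proof.
have [s hs] := kin_seq x; apply: (cvs_unique (cvs_pol hs hs)).
rewrite rnE -rmorphXn; apply: (@cvs_ext _ _ (fun n => (rn (kin (s n)) ^+ 2)%:C%C)).
  by move=> n; rewrite pol_kin kf_real rn_kin.
exact: cvs_rn2.
Qed.

Definition khilbert : hilbert R := Hilbert pol_linear pol_conj pol_norm.

(** Kolmogorov decomposition. Tensor products, the space with an added vector, GNS spaces and
    induced representations are all instances. *)
Lemma kernel_hilbert : exists (H : hilbert R) (j : T -> H),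
  (forall s t, ip (j s) (j t) = K s t) /\ cspan (range j) = setT.
Proof.
pose j t : khilbert := kin [:: (1, t)]; exists khilbert, j; split.
  move=> s t; apply: etrans (pol_kin _ _) _.
  by rewrite /kf !big_seq1 /= rmorph1 !mul1r.
apply: cspan_eqT => P cP hP x; apply: (clsC cP) => e e0.
have [s hs] := kin_dense x e0; exists (kin s) => //.
elim: s {hs} => [|[c t] s ih].
  have -> : kin [::] = 0 by apply: sv_inj; apply: bf_eq => u; rewrite /= /kf big_nil.
  exact: cls0.
have -> : kin ((c, t) :: s) = c *: (j t : kspace) + kin s.
  by rewrite -kin_sc -kin_cat /= mulr1.
by apply: (clsL cP) => //; apply: hP; exists t.
Qed.

End Kernel.

(** * Operators on Hilbert spaces, compact operators and representations *)

Section HilbertTools.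
Variables (R : realType) (H : hilbert R).
Implicit Types (x y z : H) (S : bop H).

(** Hellinger-Toeplitz, from [adjoint_bounded] with the inner product as pairing. *)
Lemma adjoint_bop (f f' : H -> H) :
  (forall x y, ip (f x) y = ip x (f' y)) -> exists S : bop H, S =1 f.
Proof.
move=> h; have [M M0 hM] : exists2 M : R, 0 <= M & forall x, rn (f x) <= M * rn x.
  apply: (@adjoint_bounded R H R[i]^o (fun x y => ip y x) f' f).
  - exact: cauchy_cvs.
  - by move=> x y z; rewrite ipDl.
  - by move=> c x y; rewrite ipZl.
  - by move=> x y; rewrite mulrC; apply: ip_cs.
  - by move=> x; rewrite /= ip_rn rn_real ger0_norm // sqr_ge0.
  - by move=> x y; rewrite ip_conj -h -ip_conj.
by exists (BOp h (ex_intro2 _ _ M M0 hM)).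
Qed.

Lemma ip_lc T T' (u : T -> H) (v : T' -> H) s t : ip (lc u s) (lc v t) =
  \sum_(p <- s) \sum_(q <- t) p.1 * Num.conj q.1 * ip (u p.2) (v q.2).
Proof.
elim: s => [|p s ih]; first by rewrite lc_nil ip0l big_nil.
rewrite lc_cons big_cons ipDl ih ipZl; congr (_ + _).
elim: t {ih} => [|q t ih]; first by rewrite lc_nil ip0r big_nil mulr0.
rewrite lc_cons big_cons ipDr mulrDr ih ipZr; congr (_ + _); ring.
Qed.

Lemma rn_lc_ip T (u v : T -> H) s : (forall a b, ip (u a) (u b) = ip (v a) (v b)) ->
  rn (lc u s) = rn (lc v s).
Proof.
move=> h; apply/eqP; rewrite -(@eqrXn2 _ 2) // !rn_ipE !ip_lc; apply/eqP.
by congr Re; apply: eq_bigr => p _; apply: eq_bigr => q _; rewrite h.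
Qed.

Lemma adj_dense T (j : T -> H) (f f' : H -> H) : cspan (range j) = setT ->
  blin f -> blin f' -> (forall s t, ip (f (j s)) (j t) = ip (j s) (f' (j t))) ->
  forall x y, ip (f x) y = ip x (f' y).
Proof.
move=> jT bf bf' h x y.
have bi g z : blin g -> blin (fun x => ip (g x : H) z : R[i]^o).
  by move=> bg; exact: (blin_comp bg (blin_ipl z)).
apply: (cspanT_ind jT (clsub_eq (bi _ y bf) (blin_ipl (f' y)))) => _ [s _ <-].
suff : ip y (f (j s)) = ip (f' y) (j s).
  by move=> /(congr1 Num.conj); rewrite -!ip_conj.
apply: (cspanT_ind jT (clsub_eq (blin_ipl _) (bi _ (j s) bf'))) => _ [t _ <-].
by rewrite /= ip_conj h -ip_conj.
Qed.

Lemma total_bop T (j U U' : T -> H) (M : R) : 0 <= M -> cspan (range j) = setT ->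
  (forall s t, ip (U s) (j t) = ip (j s) (U' t)) ->
  (forall s, rn (lc U s) <= M * rn (lc j s)) ->
  (forall s, rn (lc U' s) <= M * rn (lc j s)) ->
  exists S : bop H, (forall t, S (j t) = U t) /\ forall t, star S (j t) = U' t.
Proof.
move=> M0 jT h hU hU'; have [F [lF bF FU]] := blt M0 jT hU.
have [F' [lF' bF' FU']] := blt M0 jT hU'.
have b : blin F by split=> //; exists M.
have b' : blin F' by split=> //; exists M.
have hF : forall x y, ip (F x) y = ip x (F' y).
  by apply: (adj_dense jT b b') => s t; rewrite FU FU' h.
exists (BOp hF (ex_intro2 _ _ M M0 bF)); split => //.
Qed.

Lemma bop_dense T (j : T -> H) S S' : cspan (range j) = setT ->
  (forall t, S (j t) = S' (j t)) -> S = S'.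
Proof.
move=> jT h; apply: bop_eq => x.
have b U : blin (U : bop H) by split; [exact: bop_lin | exact: bab].
by apply: (cspanT_ind jT (clsub_eq (b S) (b S'))) => _ [t _ <-]; exact: h.
Qed.

Lemma blin_bop S : blin S.
Proof. by split; [exact: bop_lin | exact: bab]. Qed.

Lemma blin_bopv x : blin (fun S : bop H => S x).
Proof. by split=> //; exists (rn x) => [|S]; rewrite // mulrC rn_bop. Qed.

Section Projection.
Variables (P : set H) (cP : clsub P).

(** Nearest point: the parallelogram law makes a minimizing sequence Cauchy. *)
Lemma proj_ex x : exists2 y, P y & forall z, P z -> ip (x - y) z = 0.
Proof.
pose D := [set rn (x - y) | y in P]; pose d := inf D.
have D0 : D !=set0 by exists (rn (x - 0)); exists 0 => //; exact: cls0.
have Dl : has_lbound D by exists 0 => _ [y _ <-]; exact: rn_ge0.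
have dle y : P y -> d <= rn (x - y) by move=> Py; apply: ge_inf => //; exists y.
have d0 : 0 <= d by apply: lb_le_inf => // _ [y _ <-]; exact: rn_ge0.
have ap n : exists y, P y /\ rn (x - y) < d + n.+1%:R^-1.
  have [||_ [y Py <-] hy] := @inf_adherent _ D n.+1%:R^-1; [exact: inv_gt0 | by split|].
  by exists y.
pose u n := projT1 (cid (ap n)).
have Pu n : P (u n) by exact: (projT2 (cid (ap n))).1.
have hu n : rn (x - u n) < d + n.+1%:R^-1 by exact: (projT2 (cid (ap n))).2.
have key (e : R) y z : 0 < e -> P y -> P z -> rn (x - y) <= d + e -> rn (x - z) <= d + e ->
    rn (z - y) ^+ 2 <= 8 * d * e + 4 * e ^+ 2.
  move=> e0 Py Pz hy hz; have := parallelogram (x - y) (x - z).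
  have -> : x - y - (x - z) = z - y by lmod R; ring.
  have -> : x - y + (x - z) = (2%:R : R)%:C%C *: (x - hlf R *: (y + z)).
    by rewrite hlfE; lmod R; field.
  rewrite rnZr // exprMn.
  have h1 : d <= rn (x - hlf R *: (y + z)) by apply/dle/(clsZ cP)/(clsD cP).
  have h2 : d ^+ 2 <= rn (x - hlf R *: (y + z)) ^+ 2 by apply: lerXn2r; rewrite ?nnegrE.
  have h3 : rn (x - y) ^+ 2 <= (d + e) ^+ 2 by apply: lerXn2r; rewrite ?nnegrE // addr_ge0 // ltW.
  have h4 : rn (x - z) ^+ 2 <= (d + e) ^+ 2 by apply: lerXn2r; rewrite ?nnegrE // addr_ge0 // ltW.
  move: h2 h3 h4; rewrite !expr2; nra.
have cu : cauchys u.
  move=> e e0; pose e' := Num.min 1 (e ^+ 2 / (8 * d + 8)).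
  have d8 : 0 < 8 * d + 8 by lra.
  have e'0 : 0 < e' by rewrite lt_min ltr01 divr_gt0 // exprn_gt0.
  have [N hN] := inv_small e'0; exists N => m n hm hn.
  have hh k : (N <= k)%N -> rn (x - u k) <= d + e'.
    by move=> /hN h; apply/ltW/(lt_trans (hu k)); rewrite ltrD2l.
  have := key e' (u n) (u m) e'0 (Pu n) (Pu m) (hh n hn) (hh m hm).
  have : e' <= 1 by rewrite ge_min lexx.
  have : e' * (8 * d + 8) <= e ^+ 2 by rewrite -ler_pdivlMr // ge_min lexx orbT.
  have r0 := rn_ge0 (u m - u n) => q1 q2 q3.
  rewrite -(@ltr_pXn2r _ 2) ?nnegrE ?(ltW e0) //; move: q1 q2 q3; rewrite !expr2; nra.
have [y hy] := cauchy_cvs cu; exists y; first exact: (cls_cvs cP Pu hy).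
have Py : P y by exact: (cls_cvs cP Pu hy).
have yd : rn (x - y) <= d.
  apply: le_eps => e e0; have [N1 h1] := hy (e / 2) ltac:(lra).
  have [N2 h2] : exists N, forall n, (N <= n)%N -> n.+1%:R^-1 < e / 2 by apply: inv_small; lra.
  pose N := maxn N1 N2; have := rn_tri x (u N) y.
  have := h1 N (leq_maxl _ _); have := h2 N (leq_maxr _ _); have := hu N.
  move: (N.+1%:R^-1) => i; lra.
(* [cs_num] with [a = 0]: minimality of the distance says that the quadratic in [l] is
   nonnegative. *)
move=> z Pz; apply: rn_eq0; apply/eqP; rewrite -sqrf_eq0 eq_le sqr_ge0 andbT.
rewrite -[0](mul0r (rn z ^+ 2)); apply: cs_num => //; first exact: sqr_ge0.
move=> l; rewrite sub0r; have h1 : d <= rn (x - y - l *: z).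
  by rewrite -addrA -opprD; apply: dle; apply: clsD => //; exact: clsZ.
have h2 : d ^+ 2 <= rn (x - y - l *: z) ^+ 2 by apply: lerXn2r; rewrite ?nnegrE.
have h3 : rn (x - y) ^+ 2 <= d ^+ 2 by apply: lerXn2r; rewrite ?nnegrE.
move: h2; rewrite rn_sqrB; lra.
Qed.

Lemma proj_op : exists E : bop H, [/\ forall x, P (E x), forall x, P x -> E x = x,
  star E = E & E ** E = E].
Proof.
pose f x := projT1 (cid2 (proj_ex x)).
have fP x : P (f x) by exact: s2valP.
have fO x z : P z -> ip (x - f x) z = 0 by rewrite /f; case: cid2 => y /= _; apply.
have adj x y : ip (f x) y = ip x (f y).
  have h1 := fO x (f y) (fP y); have h2 := fO y (f x) (fP x).
  move/eqP: h1; rewrite ipBl subr_eq0 => /eqP ->.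
  by move/eqP: h2; rewrite ipBl subr_eq0 => /eqP h; rewrite ip_conj h -ip_conj.
have [E hE] := adjoint_bop adj; exists E; have fid x : P x -> f x = x.
  move=> Px; have : rn (x - f x) = 0.
    apply/eqP; rewrite -sqrf_eq0 rn_ipE fO //.
    by apply: clsB.
  by move/rn_eq0/eqP; rewrite subr_eq0 => /eqP.
split=> [x|x Px||]; rewrite ?hE //; first exact: fid.
  by apply: bop_eq => x; apply: ip_injr => y; rewrite -bop_adj !hE adj.
by apply: bop_eq => x; rewrite /smul /= !hE fid.
Qed.

End Projection.

Lemma riesz (f : H -> R[i]^o) : blin f -> exists z, forall x, f x = ip x z.
Proof.
move=> bf; have [E [EP Ei Es _]] := proj_op (clsub_ker bf).
have [[x0 hx0]|h0] := pselect (exists x, f x <> 0); last first.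
  exists 0 => x; rewrite ip0r; apply: contrapT => hx; apply: h0; by exists x.
pose z := x0 - E x0; have lf := bf.1.
have fz : f z = f x0 by rewrite /z (linB lf) EP subr0.
have fz0 : f z != 0 by rewrite fz; apply/eqP.
have kz k : f k = 0 -> ip k z = 0.
  by move=> fk; rewrite /z ipBr -[X in ip X x0](Ei k fk) bop_adj Es subrr.
have zz0 : ip z z != 0.
  apply/eqP => h; move/eqP: fz0; apply; have -> : z = 0; last exact: (lin0 lf).
  by apply: ip_inj => y; rewrite ip0l; apply: rn_le0; rewrite (le_trans (ip_cs _ _)) //
    (_ : rn z = 0) ?mul0r //; apply/eqP; rewrite -sqrf_eq0 rn_ipE h.
exists ((f z / ip z z)^* *: z) => x; rewrite ipZr conjCK.
have := kz (x - (f x / f z) *: z); rewrite (linB lf) (linZ lf) ipBl ipZl.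
rewrite /GRing.scale /= divfK // subrr => /(_ erefl)/eqP; rewrite subr_eq0 => /eqP ->.
by field; apply/andP; split.
Qed.

Definition rk x y : bop H.
Proof.
refine (@BOp R H (fun h => ip h y *: x) (fun h => ip h x *: y) _ _).
  by move=> h k; rewrite ipZl ipZr -ip_conj mulrC.
exists (rn y * rn x) => [|h]; first by rewrite mulr_ge0.
by rewrite rnZ mulrAC ler_wpM2r // mulrC; exact: ip_cs.
Defined.

Lemma rk_mull S x y : S ** rk x y = rk (S x) y.
Proof. by apply: bop_eq => h; exact: (linZ (bop_lin S)). Qed.
Lemma rk_star x y : star (rk x y) = rk y x.
Proof. exact: bop_eq. Qed.

Definition rks : set (bop H) := cspan [set T | exists x y, T = rk x y].

Lemma rks_mull S T : rks T -> rks (S ** T).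
Proof.
apply: (cspan_ind (P := [set T | rks (S ** T)])).
  exact: (clsub_pre (blin_mull S) (cspan_clsub _)).
by move=> _ [x [y ->]] /=; rewrite rk_mull; apply: cspan_sub; exists (S x), y.
Qed.

Lemma rks_star T : rks T -> rks (star T).
Proof.
move=> hT; apply: (clsC (cspan_clsub _)) => e e0.
have /cspanP/(_ e e0)[_ [s hs ->] h] := hT.
exists (star (lc id s)); last by rewrite -stB rn_star.
elim: s hs {h} => [|p s ih] hs; first by rewrite lc_nil st0; exact: cls0 (cspan_clsub _).
rewrite lc_cons starD starZ; apply: (clsL (cspan_clsub _)); last first.
  by apply: ih => q hq; apply: hs; right.
have [x [y ->]] := hs p (or_introl erefl).
by rewrite rk_star; apply: cspan_sub; exists y, x.
Qed.

Definition rkalg : cstarsub (bop H) :=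
  CStarSub (cspan_clsub _) (fun S T _ => @rks_mull S T) rks_star.

End HilbertTools.

Section Reps.
Variables (R : realType).
Implicit Types (A B E : cstarType R) (H : hilbert R).

Lemma rep_hom A H (p : A -> H -> H) : is_rep p ->
  exists2 h : A -> bop H, starhom h & forall a x, h a x = p a x.
Proof.
move=> [pl pL pM ps]; have ex a : exists S : bop H, S =1 p a by apply: adjoint_bop (ps a).
exists (fun a => projT1 (cid (ex a))) => [|a x]; last exact: (projT2 (cid (ex a))).
have hE a x : projT1 (cid (ex a)) x = p a x by exact: (projT2 (cid (ex a))).
split=> [c a b|a b|a]; apply: bop_eq => x.
- by rewrite hE pL -!hE.
- by rewrite hE pM -!hE.
- by apply: ip_injr => y; rewrite -bop_adj !hE ps.
Qed.

Lemma hom_rep A H (h : A -> bop H) : starhom h -> is_rep (fun a x => h a x).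
Proof.
move=> hh; split=> [a|c a b x|a b x|a x y].
- exact: bop_lin.
- by rewrite (hom_lin hh).
- by rewrite (homM hh).
- by rewrite bop_adj -(hom_star hh).
Qed.

(** [E] acts on [A] from the left through [f]; the right half of each centralizer is obtained by
    taking adjoints. *)
Lemma ideal_mult A E (f : A -> E) : starhom f -> injective f ->
  (forall e a, range f (e ** f a)) ->
  exists2 m : E -> mult A, starhom m & forall e a, f (ml (m e) a) = e ** f a.
Proof.
move=> hf fi hr; pose L e a := projT1 (cid2 (hr e a)).
have LE e a : f (L e a) = e ** f a by rewrite /L; case: cid2.
have hlr e a b : a ** L e b = star (L (star e) (star a)) ** b.
  by apply: fi; rewrite !(homM hf) (hom_star hf) !LE (hom_star hf) starM !starK smulA.
pose m e := Mult (hlr e).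
have mE e a : f (ml (m e) a) = e ** f a by exact: LE.
exists m => //; split=> [c x y|x y|x]; apply: mult_eq => a; apply: fi; rewrite ?mE.
- by rewrite /= (hom_lin hf) !LE smulDl smulZl.
- by rewrite smulA.
- by rewrite /= !starK LE.
Qed.

End Reps.

Section CompactOps.
Variables (R : realType) (H : hilbert R).

Definition kops : compact_ops H.
Proof.
refine (@CompactOps R H (subc (rkalg H)) (fun k h => sc k h) _ _ _ _).
- exact: (hom_rep (sc_hom _)).
- by move=> a h; apply: sc_inj; apply: bop_eq => x; exact: h.
- move=> x y; have h : rkalg H (rk x y) by apply: cspan_sub; exists x, y.
  by exists (SubC h) => z; rewrite sc_SubC.
- apply: cspan_eqT => P cP hP k; apply: (clsC cP) => e e0.
  have /cspanP/(_ e e0)[_ [s hs ->] h] := scP k.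
  have [k' Pk' hk'] : exists2 k', P k' & sc k' = lc id s.
    elim: s hs {h} => [|p s ih] hs; first by exists 0; [exact: cls0 | rewrite lc_nil].
    have [|k' Pk' hk'] := ih; first by move=> q hq; apply: hs; right.
    have [x [y pE]] := hs p (or_introl erefl).
    have hr : rkalg H (rk x y) by apply: cspan_sub; exists x, y.
    exists (p.1 *: SubC hr + k').
      by apply: (clsL cP) => //; apply: hP; exists x, y => z; rewrite sc_SubC.
    rewrite lc_cons pE -hk'; apply: etrans (hom_lin (sc_hom (rkalg H)) _ _ _) _.
    by rewrite sc_SubC.
  by exists k' => //; rewrite -rn_sc (linB (hom_lin (sc_hom _))) hk'.
Defined.

Variable K : compact_ops H.

Lemma ko_ex : exists h : K -> bop H, [/\ starhom h, forall k x, h k x = ko_act k x,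
  injective h & range h = rks (H := H)].
Proof.
have [h hh hE] := rep_hom (ko_rep K).
have hi : injective h.
  apply: (lin_inj (hom_lin hh)) => k hk; apply: (@ko_faithful _ _ K) => x.
  by rewrite -hE hk.
exists h; split=> //; apply/seteqP; split=> [_ [k _ <-]|T].
  apply: (cspanT_ind (ko_dense K) (clsub_pre (hom_blin hh) (cspan_clsub _))).
  by move=> k' [x [y hk]]; apply: cspan_sub; exists x, y; apply: bop_eq => z; rewrite hE hk.
apply: (cspan_ind (hom_range_clsub hh)) => _ [x [y ->]].
by have [k hk] := ko_rank1 K x y; exists k => //; apply: bop_eq => z; rewrite hE hk.
Qed.

Definition kob : K -> bop H := projT1 (cid ko_ex).
Lemma kob_hom : starhom kob. Proof. by case: (projT2 (cid ko_ex)). Qed.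
Lemma kobE k x : kob k x = ko_act k x. Proof. by case: (projT2 (cid ko_ex)). Qed.
Lemma kob_inj : injective kob. Proof. by case: (projT2 (cid ko_ex)). Qed.
Lemma kob_range : range kob = rks (H := H). Proof. by case: (projT2 (cid ko_ex)). Qed.

Lemma kob_ideal S k : range kob (S ** kob k).
Proof. by rewrite kob_range; apply: rks_mull; rewrite -kob_range; exists k. Qed.

(** Universal properties are stated with multiplier algebras; a representation on [H] enters them as
    a homomorphism into the multipliers of the compact operators. *)
Definition opm : bop H -> mult K :=
  projT1 (cid2 (ideal_mult kob_hom kob_inj kob_ideal)).
Lemma opm_hom : starhom opm. Proof. by rewrite /opm; case: cid2. Qed.
Lemma opmE S k : kob (ml (opm S) k) = S ** kob k.
Proof. by rewrite /opm; case: cid2. Qed.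

Lemma opm_kob k : opm (kob k) = emb k.
Proof. by apply: mult_eq => k'; apply: kob_inj; rewrite opmE (homM kob_hom). Qed.

Lemma opm_one : opm (bone H) = mone K.
Proof. by apply: mult_eq => k'; apply: kob_inj; rewrite opmE; exact: bop_eq. Qed.

Definition rko x y : K := projT1 (cid (ko_rank1 K x y)).
Lemma kob_rko x y : kob (rko x y) = rk x y.
Proof. by apply: bop_eq => z; rewrite kobE (projT2 (cid (ko_rank1 K x y))). Qed.

Lemma rko_dense : cspan [set k | exists x y, k = rko x y] = setT.
Proof.
apply: cspan_eqT => P cP hP k; apply: (cspanT_ind (ko_dense K) cP) => k' [x [y hk]].
by apply: hP; exists x, y; apply: kob_inj; apply: bop_eq => z; rewrite kob_rko kobE hk.
Qed.

Lemma opm_inj : injective opm.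
Proof.
apply: (lin_inj (hom_lin opm_hom)) => S hS; apply: bop_eq => x.
have := opmE S (rko x x); rewrite hS /= (lin0 (hom_lin kob_hom)) kob_rko rk_mull.
move=> /(congr1 (fun T : bop H => T x)) /= /esym.
have [->|x0] := eqVneq x 0; first by rewrite !(lin0 (bop_lin S)).
have [x1|x1] := eqVneq (ip x x) 0.
  by case/eqP: x0; apply: rn_eq0; apply/eqP; rewrite -sqrf_eq0 rn_ipE x1.
move=> h; apply/eqP; have/eqP := h; rewrite /= scaler_eq0 (negbTE x1) /=; exact.
Qed.

Lemma opm_nondeg (A : cstarType R) (h : A -> bop H) (hh : starhom (h : A -> bop H)) :
  cspan [set y | exists a x, y = h a x] = setT -> nondeg (opm \o h).
Proof.
move=> hd; apply/nondegP => P cP hP k; apply: (cspanT_ind rko_dense cP) => _ [x [y ->]].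
have b : blin (fun x => rko x y).
  have l : linear (fun x => rko x y).
    move=> c u v; apply: kob_inj; rewrite (hom_lin kob_hom) !kob_rko.
    apply: bop_eq => z; rewrite /= scalerDr !scalerA; congr (_ + _); congr (_ *: _); ring.
  split=> //; exists (rn y) => // u.
  rewrite -(hom_iso kob_hom kob_inj) kob_rko; apply: rn_bop_le => [|z].
    by rewrite mulr_ge0.
  by rewrite /= rnZ mulrAC ler_wpM2r // mulrC; exact: ip_cs.
apply: (cspanT_ind hd (clsub_pre b cP)) => _ [a [u ->]] /=.
have -> : rko (h a u) y = ml (opm (h a)) (rko u y); last exact: hP.
by apply: kob_inj; rewrite opmE !kob_rko rk_mull.
Qed.

End CompactOps.

Section SubHilbert.
Variables (R : realType) (H : hilbert R) (P : clspace H).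

Definition subh : hilbert R.
Proof.
refine (@Hilbert R (subv P) (fun x y => ip (sv x) (sv y)) _ _ _).
- by move=> c x y z; rewrite sv_lin ip_linear.
- by move=> x y; exact: ip_conj.
- by move=> x; rewrite ip_norm.
Defined.

End SubHilbert.

Section Continuity.
Variables (R : realType) (T : topologicalType).
Implicit Types (V W : normedModType R[i]).

Lemma cont_epsP V (f : T -> V) : continuous f <->
  forall s (e : R), 0 < e -> \forall t \near s, rn (f s - f t) < e.
Proof.
split=> h s; first by move=> e e0; apply: (h s [set y | rn (f s - y) < e]); apply/near_ball; exists e.
by move=> A /near_ball[e e0 hA]; apply: filterS (h s e e0) => t; exact: hA.
Qed.

Lemma cont_dense V W (F : T -> V -> W) (S : set V) : cspan S = setT ->
  (forall s, linear (F s)) -> (forall s x, rn (F s x) <= rn x) ->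
  (forall x, S x -> continuous (F^~ x)) -> forall x, continuous (F^~ x).
Proof.
move=> ST lF bF hS; apply: (cspanT_ind ST) => //; split => /=.
- by apply/cont_epsP => s e e0; near=> t; rewrite !(lin0 (lF _)) subr0 rn0.
- move=> c x y /cont_epsP hx /cont_epsP hy; apply/cont_epsP => s e e0.
  have c0 := rn_ge0 c; have e1 : 0 < e / 2 / (rn c + 1) by rewrite !divr_gt0 //; lra.
  have e2 : 0 < e / 2 by lra.
  apply: filterS2 (hx s _ e1) (hy s _ e2) => t h1 h2; rewrite !lF.
  have -> : c *: F s x + F s y - (c *: F t x + F t y) = c *: (F s x - F t x) + (F s y - F t y).
    by lmod R; ring.
  apply: (le_lt_trans (rnD _ _)); rewrite rnZ; move: h1; rewrite ltr_pdivlMr; last lra.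
  have := rn_ge0 (F s x - F t x); nra.
- move=> x hx; apply/cont_epsP => s e e0; have [y hy xy] := hx (e / 4) ltac:(lra).
  have e4 : 0 < e / 2 by lra.
  apply: filterS ((cont_epsP _).1 hy s _ e4) => t ht.
  have h1 : rn (F s x - F s y) < e / 4 by rewrite -(linB (lF _)); apply: le_lt_trans (bF _ _) xy.
  have h2 : rn (F t y - F t x) < e / 4 by rewrite rnC -(linB (lF _)); apply: le_lt_trans (bF _ _) xy.
  have := rn_tri (F s x) (F s y) (F t x); have := rn_tri (F s y) (F t y) (F t x); lra.
Unshelve. all: by end_near.
Qed.

End Continuity.

(** * Tensor products of Hilbert spaces and the sum with a line *)

Section HilbertTensor.
Variables (R : realType) (H K : hilbert R).

Definition sch (s : seq (H * K)) : R[i] :=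
  \sum_(p <- s) \sum_(q <- s) ip p.1 q.1 * ip p.2 q.2.

Lemma ip_ge0 (L : hilbert R) (x : L) : 0 <= ip x x.
Proof. by rewrite ip_norm exprn_ge0. Qed.

(** Schur's product theorem: split off the component along the first vector and
    induct. *)
Lemma sch_ge0 n s : (size s <= n)%N -> 0 <= sch s.
Proof.
elim: n s => [|n ih] [|[x0 y0] s'] // hs; try by rewrite /sch big_nil.
(* For [x0 = 0] the quotient is 0 by convention, and the identities below remain true. *)
set s := (x0, y0) :: s'; pose a (p : H * K) := ip p.1 x0 / ip x0 x0.
pose x' p := p.1 - a p *: x0.
have x0E : ip x0 x0 = 0 -> x0 = 0.
  by move=> h; apply: rn_eq0; apply/eqP; rewrite -sqrf_eq0 rn_ipE h.
have x'0 p : ip (x' p) x0 = 0.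
  rewrite /x' ipBl ipZl /a; have [h|h] := eqVneq (ip x0 x0) 0.
    by rewrite (x0E h) !ip0r mulr0 subr0.
  by rewrite divfK // subrr.
have dec p q : ip p.1 q.1 = a p * (a q)^* * ip x0 x0 + ip (x' p) (x' q).
  have -> : ip p.1 q.1 = ip (x' p + a p *: x0) (x' q + a q *: x0) by rewrite !subrK.
  move: (x'0 p) (x'0 q); move: (x' p) (x' q) => y z hy hz.
  rewrite ipDl !ipDr !ipZl !ipZr hy (ip_conj z x0) hz rmorph0; ring.
pose u := lc id [seq (a p, p.2) | p <- s].
have -> : sch s = ip x0 x0 * ip u u + sch [seq (x' p, p.2) | p <- s].
  rewrite /u ip_lc /sch !big_map mulr_sumr -big_split; apply: eq_bigr => p _.
  rewrite !big_map mulr_sumr -big_split; apply: eq_bigr => q _ /=.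
  by rewrite dec; ring.
apply: addr_ge0; first by apply: mulr_ge0; exact: ip_ge0.
have z0 : x' (x0, y0) = 0.
  rewrite /x' /a /=; have [h|h] := eqVneq (ip x0 x0) 0.
    by rewrite (x0E h) scaler0 subr0.
  by rewrite divff // scale1r subrr.
rewrite /sch /= big_cons z0 big1 ?add0r; last by move=> q _; rewrite ip0l mul0r.
under eq_bigr => p _ do rewrite big_cons /= ip0r mul0r add0r.
by apply: ih; rewrite size_map.
Qed.

Lemma tensor_exists : exists (L : hilbert R) (t : H -> K -> L), is_hilbert_tensor t.
Proof.
pose k (p q : H * K) := ip p.1 q.1 * ip p.2 q.2.
have [||L [j [hj jT]]] := @kernel_hilbert R (H * K)%type k.
- by move=> p q; rewrite /k rmorphM /= -!ip_conj.
- move=> s; have : 0 <= kf k s s.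
    have := @sch_ge0 _ [seq (p.2.1, p.1 *: p.2.2) | p <- s] (leqnn _).
    rewrite /sch big_map /kf; congr (_ <= _); apply: eq_bigr => p _.
    by rewrite big_map; apply: eq_bigr => q _ /=; rewrite ipZl ipZr /k; ring.
  by case: (kf k s s) => u v; rewrite lecE /= => /andP[].
exists L, (fun x y => j (x, y)); split=> [x y x' y'|]; first by rewrite hj.
rewrite -jT; congr cspan; apply/seteqP; split => [z [x [y ->]]|_ [[x y] _ <-]].
  by exists (x, y).
by exists x, y.
Qed.

Lemma tensor_zero (L : hilbert R) (t : H -> K -> L) (th : is_hilbert_tensor t) x y :
  t x y = 0 -> x = 0 \/ y = 0.
Proof.
move=> h; have := th.1 x y x y; rewrite h ip0l => /esym/eqP; rewrite mulf_eq0.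
by case/orP=> /eqP e; [left|right]; apply: rn_eq0; apply/eqP; rewrite -sqrf_eq0 rn_ipE e.
Qed.

End HilbertTensor.

Section AddVector.
Variables (R : realType) (H : hilbert R).

(** The orthogonal sum with a line, given by its properties. Operators are extended by zero, so that
    [hpw] spans a corner of its own in the compact operators. *)
Record hilbert_plus := HilbertPlus {
  hp :> hilbert R; hpV : H -> hp; hpw : hp;
  hp_lin : linear hpV;
  hp_ip : forall x y, ip (hpV x) (hpV y) = ip x y;
  hp_orth : forall x, ip (hpV x) hpw = 0;
  hp_unit : ip hpw hpw = 1;
  hp_dense : cspan [set z | z = hpw \/ exists x, z = hpV x] = setT;
  hp_op : bop H -> bop hp;
  hp_op_hom : starhom hp_op;
  hp_opV : forall S x, hp_op S (hpV x) = hpV (S x);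
  hp_opw : forall S, hp_op S hpw = 0
}.

Lemma hilbert_plus_ex : inhabited hilbert_plus.
Proof.
pose v (o : option H) : H := odflt 0 o.
pose n (o : option H) : R[i] := if o is Some _ then 0 else 1.
pose k (o o' : option H) : R[i] := ip (v o) (v o') + n o * (n o')^*.
pose sn (s : seq (R[i] * option H)) := \sum_(p <- s) p.1 * n p.2.
have kfE s : kf k s s = ip (lc v s) (lc v s) + sn s * (sn s)^*.
  rewrite /kf ip_lc /sn rmorph_sum mulr_suml -big_split; apply: eq_bigr => p _ /=.
  rewrite mulr_sumr -big_split; apply: eq_bigr => q _ /=; rewrite /k rmorphM /=; ring.
have kfn s : kf k s s = (rn (lc v s) ^+ 2 + rn (sn s) ^+ 2)%:C%C.
  by rewrite kfE ip_rn -normCK rnE -rmorphXn -rmorphD.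
have [||L [j [hj jT]]] := @kernel_hilbert R (option H) k.
- move=> p q; rewrite /k rmorphD rmorphM /= conjCK -ip_conj; ring.
- by move=> s; rewrite kfn /= addr_ge0 ?sqr_ge0.
have lcn s : rn (lc j s) ^+ 2 = rn (lc v s) ^+ 2 + rn (sn s) ^+ 2.
  rewrite rn_ipE ip_lc -[RHS]/(Re (_%:C)%C) -kfn; congr Re.
  by apply: eq_bigr => p _; apply: eq_bigr => q _; rewrite hj.
pose V x := j (Some x); pose w := j None.
have lV : linear V.
  move=> c x y; apply: (ip_dense jT) => _ [t _ <-].
  rewrite ip_linear !hj /k /= !mul0r !addr0; exact: ip_linear.
have Vip x y : ip (V x) (V y) = ip x y by rewrite hj /k /= mul0r addr0.
have Vw x : ip (V x) w = 0 by rewrite hj /k /= mul0r addr0 ip0r.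
have ww : ip w w = 1 by rewrite hj /k /= ip0l rmorph1 mulr1 add0r.
have rV x : rn (V x) = rn x by apply/eqP; rewrite -(@eqrXn2 _ 2) // !rn_ipE Vip.
have op (S : bop H) : exists T : bop L, (forall t, T (j t) = V (S (v t))) /\
    forall t, star T (j t) = V (star S (v t)).
  have bd (S' : bop H) s : rn (lc (fun t => V (S' (v t))) s) <= rn S' * rn (lc j s).
    have -> : lc (fun t => V (S' (v t))) s = V (S' (lc v s)).
      by rewrite (lin_lc _ _ (bop_lin S')) (lin_lc _ _ lV).
    rewrite rV; apply: (le_trans (rn_bop _ _)); rewrite ler_wpM2l //.
    by rewrite -(@ler_pXn2r _ 2) ?nnegrE // lcn lerDl sqr_ge0.
  apply: (total_bop (M := rn S)) => //.
    by move=> s t; rewrite !hj /k /= mul0r addr0 rmorph0 mulr0 addr0 bop_adj.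
  by move=> s; rewrite -(rn_star S); exact: bd.
pose I S := projT1 (cid (op S)).
have IE S t : I S (j t) = V (S (v t)) by exact: (projT2 (cid (op S))).1.
have IE' S t : star (I S) (j t) = V (star S (v t)) by exact: (projT2 (cid (op S))).2.
have hI : starhom I.
  split=> [c S T|S T|S]; apply: (bop_dense jT) => t.
  - by transitivity (c *: I S (j t) + I T (j t)) => //; rewrite !IE -lV.
  - by rewrite IE; transitivity (I S (I T (j t))) => //; rewrite (IE T); symmetry; exact: (IE S (Some (T (v t)))).
  - by rewrite IE IE'.
constructor; refine (@HilbertPlus L V w lV Vip Vw ww _ I hI _ _).
- rewrite -jT; congr cspan; apply/seteqP; split=> [z [->|[x ->]]|_ [[x|] _ <-]].
  + by exists None.
  + by exists (Some x).
  + by right; exists x.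
  + by left.
- by move=> S x; exact: IE.
- by move=> S; rewrite IE /= (lin0 (bop_lin _)) (lin0 lV).
Qed.

End AddVector.

(** * Hahn-Banach, positive functionals and the GNS construction *)

Section HahnBanach.
Variables (R : realType) (V : lmodType R[i]) (p : V -> R).
Hypotheses (pD : forall x y, p (x + y) <= p x + p y)
  (pZ : forall (t : R) x, 0 <= t -> p (t%:C%C *: x) = t * p x).

Let rlin (G : set (V * R)) := forall (t : R) u v, G u -> G v ->
  G (t%:C%C *: u.1 + v.1, t * u.2 + v.2).
Let dom (G : set (V * R)) := forall u, G u -> u.2 <= p u.1.

Lemma hahn_banach x0 : exists f : V -> R, [/\ forall x y, f (x + y) = f x + f y,
  forall (t : R) x, f (t%:C%C *: x) = t * f x, forall x, f x <= p x & f x0 = p x0].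
Proof.
have p0 : p 0 = 0 by rewrite -[0 : V](scale0r 0) -[0 : R[i]]/((0 : R)%:C)%C pZ // mul0r.
pose P (G : set (V * R)) := G = set0 \/ [/\ G (x0, p x0), rlin G & dom G].
have [F FP Ftot|G [PG Gmax]] := @Zorn_bigcup _ P.
  have [[G0 FG0 G00]|none] := pselect (exists2 G, F G & G <> set0); last first.
    left; apply/seteqP; split => // u [G FG Gu]; case: none; exists G => // G0.
    by rewrite G0 in Gu.
  have good G u : F G -> G u -> [/\ G (x0, p x0), rlin G & dom G].
    by move=> /FP[->|//].
  right; split.
  - by exists G0 => //; case: (FP _ FG0) => [//|[]].
  - move=> t u v [G1 F1 u1] [G2 F2 v2].
    have [h|h] := Ftot _ _ F1 F2.
      by exists G2 => //; have [_ + _] := good _ _ F2 v2; apply => //; exact: h.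
    by exists G1 => //; have [_ + _] := good _ _ F1 u1; apply => //; exact: h.
  - by move=> u [G FG Gu]; have [_ _] := good _ _ FG Gu; apply.
have G0P : P [set u | exists t : R, u = (t%:C%C *: x0, t * p x0)].
  right; split.
  - by exists 1; rewrite scale1r mul1r.
  - move=> t _ _ [a ->] [b ->]; exists (t * a + b) => /=.
    by rewrite scalerA -scalerDl mulrDl mulrA rmorphD rmorphM.
  - move=> _ [t ->] /=; have [t0|t0] := leP 0 t; first by rewrite pZ.
    have := pD (t%:C%C *: x0) ((- t)%:C%C *: x0).
    have -> : p ((- t)%:C%C *: x0) = - t * p x0 by rewrite pZ // oppr_ge0 ltW.
    by rewrite -scalerDl -rmorphD subrr rmorph0 scale0r p0; lra.
have {PG} [Gx0 GL Gd] : [/\ G (x0, p x0), rlin G & dom G].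
  case: PG => // G0; case: (Gmax _ _ G0P); rewrite G0; split => // h.
  by have := h (x0, p x0); apply; exists 1; rewrite scale1r mul1r.
have G00 : G (0, 0).
  by have := GL (-1) _ _ Gx0 Gx0; rewrite /= rmorphN1 scaleN1r mulN1r !addNr.
have GZ (t : R) u : G u -> G (t%:C%C *: u.1, t * u.2).
  by move=> /(GL t)/(_ G00) /=; rewrite !addr0.
have full y : exists r, G (y, r).
  pose A := [set u.2 - p (u.1 - y) | u in G].
  have ub v : G v -> forall a, A a -> a <= p (v.1 + y) - v.2.
    move=> Gv _ [u Gu <-]; have := Gd _ (GL 1 _ _ Gu Gv).
    rewrite /= scale1r mul1r; have := pD (u.1 - y) (v.1 + y).
    by rewrite addrACA addNr addr0; lra.
  have A0 : A !=set0 by exists (0 - p (0 - y)); exists (0, 0).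
  have Ab : has_ubound A by exists (p (0 + y) - 0) => a; exact: (ub (0, 0)).
  (* Any value between the bounds [r1] and [r2] extends the functional to [y]. *)
  pose r := sup A.
  have r1 u : G u -> u.2 - p (u.1 - y) <= r by move=> Gu; apply: ub_le_sup => //; exists u.
  have r2 v : G v -> r <= p (v.1 + y) - v.2 by move=> Gv; apply: ge_sup => // a; exact: ub.
  pose G' := [set w | exists u (t : R), G u /\ w = (u.1 + t%:C%C *: y, u.2 + t * r)].
  have GG' : G `<=` G'.
    by move=> [x b] Gu; exists (x, b), 0; split => //=; rewrite scale0r mul0r !addr0.
  have PG' : P G'.
    right; split; first exact: GG'.
    - move=> t _ _ [u [a [Gu ->]]] [v [b [Gv ->]]] /=.
      exists (t%:C%C *: u.1 + v.1, t * u.2 + v.2), (t * a + b); split; first exact: GL.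
      rewrite /=; congr pair; last by ring.
      by rewrite rmorphD rmorphM; lmod R; ring.
    - move=> _ [u [t [Gu ->]]] /=; have [t0|t0|->] := ltgtP t 0; last first.
      + by rewrite scale0r mul0r !addr0; exact: Gd.
      + have := r2 _ (GZ t^-1 _ Gu).
        rewrite /= -(ler_pM2l t0) mulrBr mulrA mulfV ?gt_eqF // mul1r -(pZ _ (ltW t0)).
        rewrite scalerDr scalerA -rmorphM mulfV ?gt_eqF // scale1r; lra.
      + have nt0 : 0 < - t by lra.
        have := r1 _ (GZ (- t)^-1 _ Gu).
        rewrite /= -(ler_pM2l nt0) mulrBr mulrA mulfV ?gt_eqF // mul1r -(pZ _ (ltW nt0)).
        rewrite scalerBr scalerA -rmorphM mulfV ?gt_eqF // scale1r rmorphN scaleNr opprK; lra.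
  exists r; apply: contrapT => nG; apply: (Gmax G') => //; split=> // h.
  by apply: nG; apply: h; exists (0, 0), 1; split=> //=; rewrite scale1r mul1r !add0r.
have fun0 r : G (0, r) -> r = 0.
  move=> Gr; apply/eqP; rewrite eq_le; have := Gd _ Gr; rewrite /= p0 => ->.
  have := Gd _ (GZ (-1) _ Gr); rewrite /= scaler0 p0; lra.
have funU x r r' : G (x, r) -> G (x, r') -> r = r'.
  move=> h h'; have := GL (-1) _ _ h h'; rewrite /= rmorphN1 scaleN1r addNr => /fun0; lra.
pose f x := projT1 (cid (full x)).
have fG x : G (x, f x) by exact: (projT2 (cid (full x))).
exists f; split=> [x y|t x|x|].
- by apply: (funU (x + y)) => //; have := GL 1 _ _ (fG x) (fG y); rewrite /= scale1r mul1r.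
- by apply: (funU (t%:C%C *: x)) => //; exact: (GZ t _ (fG x)).
- exact: (Gd _ (fG x)).
- exact: (funU x0).
Qed.

End HahnBanach.

Section CStarMore.
Variables (R : realType).
Implicit Types (A D : cstarType R).

(** For an approximate unit [u] of c = [star x ** x] the element x u lies in [N], and |x - x u|^2 is
    at most |c - c u|. *)
Lemma ideal_root D (N : set D) x : clsub N -> (forall d n, N n -> N (d ** n)) ->
  N (star x ** x) -> N x.
Proof.
move=> cN lN Nx; apply: (clsC cN) => e e0.
have [u [Nu su hu u1]] := approx_unit (eps := e ^+ 2) cN lN Nx (sa_starM x) ltac:(by rewrite exprn_gt0).
exists (x ** u); first exact: lN.
rewrite -(@ltr_pXn2r _ 2) ?nnegrE ?rn_ge0 ?(ltW e0) // -rn_starM.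
rewrite (_ : star _ ** _ = ml (mone D - emb u) (star x ** x - star x ** x ** u)); last first.
  by rewrite starB starM su !(smBl, smBr) /= scaleN1r !smBr !smulA; lmod R; ring.
apply: le_lt_trans hu; apply: (le_trans (rn_ml _ _)).
by rewrite -[leRHS]mul1r ler_wpM2r.
Qed.

Lemma prod_dense A : cspan [set x : A | exists a b, x = a ** b] = setT.
Proof. exact: (@nondeg_emb R A). Qed.

Lemma prod_ind A (P : set A) : clsub P -> (forall a b, P (a ** b)) -> forall x, P x.
Proof. by move=> cP hP; apply: (cspanT_ind (prod_dense A) cP) => _ [a [b ->]]. Qed.

Lemma cge0 (z : R[i]) : 0 <= z -> Im z = 0 /\ 0 <= Re z.
Proof. by case: z => a b; rewrite lecE /= => /andP[/eqP]. Qed.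

Lemma complexify (V : lmodType R[i]) (f : V -> R) :
  (forall x y, f (x + y) = f x + f y) -> (forall (t : R) x, f (t%:C%C *: x) = t * f x) ->
  linear (fun a => (f a +i* - f (iu R *: a))%C : R[i]^o).
Proof.
move=> fD fZ c a b; case: c => u v.
have fC u' v' z : f ((u' +i* v')%C *: z) = u' * f z + v' * f (iu R *: z).
  rewrite -!fZ -fD; congr f; rewrite scalerA -scalerDl; congr (_ *: _).
  by rewrite /iu; simpc.
have e2 : iu R *: ((u +i* v)%C *: a + b) = ((- v) +i* u)%C *: a + iu R *: b.
  by rewrite scalerDr scalerA; congr (_ *: _ + _); rewrite /iu; simpc.
rewrite /= e2 !fD (fC u v) (fC (- v) u); move: (f a) (f b) (f (iu R *: a)) (f (iu R *: b)) => p1 q1 p2 q2.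
rewrite -[X in _ = X + _]/((u +i* v)%C * (p1 +i* - p2)%C).
by apply/eqP; rewrite eq_complex /=; apply/andP; split; apply/eqP; ring.
Qed.

Definition posfun D (f : mult D -> R[i]^o) :=
  linear f /\ forall x, 0 <= f (star x ** x).

Lemma posfun_pos D f (a : mult D) : posfun f -> pos a -> 0 <= f a.
Proof. by move=> [_ h] [k sk ->]; rewrite -{1}sk. Qed.

(** [f] is real on [star y ** y] for y = 1 + l x; the values [l = 1] and [l = i] give the two parts
    of the identity. *)
Lemma posfun_star D (f : mult D -> R[i]^o) x : posfun f -> f (star x) = (f x)^*.
Proof.
move=> [lf pf]; have h (l : R[i]) : 0 <= f (star (mone D + l *: x) ** (mone D + l *: x)) by [].
have e (l : R[i]) : f (star (mone D + l *: x) ** (mone D + l *: x)) =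
    f (mone D) + (l * f x + (l^* * f (star x) + (l^* * l) * f (star x ** x))).
  have -> : star (mone D + l *: x) ** (mone D + l *: x) =
    mone D + (l *: x + (l^* *: star x + (l^* * l) *: (star x ** x))).
    rewrite starD starZ smulDl !smulDr !smulZl !smulZr !(sa_unit (@mone_l R D)) !mone_l !mone_r.
    by lmod R; ring.
  by rewrite !(linD lf) !(linZ lf).
have p1 : 0 <= f (mone D) by have := pf (mone D); rewrite mone_r (sa_unit (@mone_l R D)).
have p2 := pf x; have h1 := h 1; have h2 := h (iu R); move: h1 h2; rewrite !e.
move: p1 p2 => /cge0[]; case: (f (mone D)) => a b /= b0 _ /cge0[].
case: (f (star x ** x)) => c d /= d0 _; case: (f x) => p q; case: (f (star x)) => p' q'.
move=> /cge0[+ _] /cge0[+ _]; rewrite rmorph1 !mul1r /iu !conjE.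
rewrite /= => h1 h2.
by congr (_ +i* _)%C; lra.
Qed.

Lemma posfun_cs D (f : mult D -> R[i]^o) x : posfun f ->
  rn (f x) ^+ 2 <= Re (f (mone D)) * Re (f (star x ** x)).
Proof.
move=> hf; have [lf pf] := hf.
have p1 : 0 <= f (mone D) by have := pf (mone D); rewrite mone_r (sa_unit (@mone_l R D)).
have p2 := pf x; apply: cs_num; [exact: (cge0 p1).2 | exact: (cge0 p2).2 |].
move=> l; have := pf (mone D - l^* *: x).
have -> : star (mone D - l^* *: x) ** (mone D - l^* *: x) =
  mone D - (l^* *: x + (l *: star x - (l^* * l) *: (star x ** x))).
  rewrite starB starZ conjCK !(smBl, smBr) !(smulZl, smulZr) !(sa_unit (@mone_l R D)) !mone_l !mone_r.
  by lmod R; ring.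
rewrite !(linB lf, linD lf, linZ lf) (posfun_star _ hf).
have -> : rn l ^+ 2 = Re (l^* * l) by rewrite mulrC -normCK rnE -rmorphXn.
rewrite /GRing.scale /=; move: p1 p2 => /cge0[].
case: (f (mone D)) => a b /= -> _ /cge0[]; case: (f (star x ** x)) => c d /= -> _.
by case: (f x) => p q; case: l => u v; rewrite !conjE; move=> /cge0[_] /=; lra.
Qed.

(** Hahn-Banach for the sublinear map [p], where [p a] is the infimum of all [t >= 0] with Re a <= t
    + k for some selfadjoint [k] in [N]. It vanishes on negative elements, which makes dominated
    functionals positive, and on [star n ** n] for [n] in [N]. *)
Lemma state_sep D (N : set D) x : clsub N -> (forall d n, N n -> N (d ** n)) -> ~ N x ->
  exists f : mult D -> R[i]^o, [/\ posfun f, forall n, N n -> f (emb (star n ** n)) = 0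
    & f (emb (star x ** x)) <> 0].
Proof.
move=> cN lN Nx; have el := @mone_l R D; have er := @mone_r R D.
pose re (a : mult D) := hlf R *: (a + star a).
have reD a b : re (a + b) = re a + re b by rewrite /re starD; lmod R; ring.
have reZ (t : R) a : re (t%:C%C *: a) = t%:C%C *: re a.
  by rewrite /re starZ conjE conjc_real; lmod R; ring.
have re_sa a : sa a -> re a = a by move=> h; rewrite /re (h : star a = a) hlfE; lmod R; field.
pose A a := [set t : R | 0 <= t /\ exists k, [/\ N k, sa k & pos (t%:C%C *: mone D + emb k - re a)]].
pose p a := inf (A a).
have re_sa' a : sa (re a).
  by rewrite /sa /re starZ starD starK addrC /hlf conjE conjc_real.
have A0 a : A a !=set0.
  exists (rn (re a)); split=> //.
  exists 0; split; [exact: cls0 | exact: st0 |].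
  by rewrite emb0 addr0; apply: (pos_ge el er).
have Ab a : has_lbound (A a) by exists 0 => t [].
have ple a t : A a t -> p a <= t by move=> h; apply: ge_inf.
have p0 a : 0 <= p a by apply: lb_le_inf => // t [].
have pap a (e : R) : 0 < e -> exists2 t, A a t & t < p a + e.
  by move=> e0; have [|t At h] := @inf_adherent _ (A a) e e0; [split | exists t].
have pD a b : p (a + b) <= p a + p b.
  apply: le_eps => e e0; have [t [t0 [k [Nk sk hk]]] ht] := pap a (e / 2) ltac:(lra).
  have [u [u0 [l [Nl sl hl]]] hu] := pap b (e / 2) ltac:(lra).
  apply: (@le_trans _ _ (t + u)); last by lra.
  apply: ple; split; first exact: addr_ge0.
  exists (k + l); split; [exact: clsD | exact: saD |].
  have := posD el er hk hl; rewrite reD (linD (@emb_lin R D)) rmorphD.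
  by congr pos; lmod R; ring.
have pZle (t : R) a : 0 < t -> p (t%:C%C *: a) <= t * p a.
  move=> t0; apply: le_eps => e e0.
  have [u [u0 [k [Nk sk hk]]] hu] := pap a (e / t) ltac:(by rewrite divr_gt0).
  apply: (@le_trans _ _ (t * u)); last first.
    move: hu; rewrite -(ltr_pM2l t0) mulrDr mulrCA divff ?gt_eqF // mulr1; exact: ltW.
  apply: ple; split; first by rewrite mulr_ge0 // ltW.
  exists (t%:C%C *: k); split; [exact: clsZ | exact: saZ |].
  have := posZ (ltW t0) hk; rewrite reZ (linZ (@emb_lin R D)) rmorphM.
  by congr pos; lmod R; ring.
have pneg a : pos (- re a) -> p a = 0.
  move=> h; apply/eqP; rewrite eq_le p0 andbT; apply: ple; split => //.
  by exists 0; split; [exact: cls0 | exact: st0 | rewrite scale0r emb0 !add0r].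
have pZ (t : R) a : 0 <= t -> p (t%:C%C *: a) = t * p a.
  rewrite le_eqVlt => /orP[/eqP <-|t0].
    rewrite mul0r scale0r; apply: pneg.
    by rewrite /re st0 addr0 scaler0 oppr0; exact: pos0.
  apply/eqP; rewrite eq_le pZle //= -ler_pdivlMl //.
  have := pZle t^-1 (t%:C%C *: a); rewrite invr_gt0 => /(_ t0).
  by rewrite scalerA -rmorphM mulVf ?gt_eqF // scale1r.
pose c := star x ** x; have sc : sa c by exact: sa_starM.
(* If [p] vanished here, compressing [c <= t + k] by 1 - u, with [u] an approximate unit for [k],
   would bring [x] within [e] of [N]. *)
have pc0 : p (emb c) <> 0.
  move=> pc; apply: Nx; apply: (clsC cN) => e e0; pose e' := e ^+ 2 / 2.
  have e'0 : 0 < e' by rewrite divr_gt0 // exprn_gt0.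
  have [t [t0 [k [Nk sk hk]]] ht] := pap (emb c) e' e'0.
  have [u [Nu su hu u1]] := approx_unit cN lN Nk sk e'0.
  exists (x ** u); first exact: lN.
  have [w wE] : exists w, w = mone D - emb u by eexists.
  have sw : sa w by rewrite wE; apply: saB; [exact: sa_unit el | rewrite /sa -emb_star su].
  have s_c : sa (emb c) by rewrite /sa -emb_star sc.
  have e1 : emb (star (x - x ** u) ** (x - x ** u)) = star w ** emb c ** w.
    rewrite embM emb_star; suff -> : emb (x - x ** u) = emb x ** w.
      by rewrite starM /c embM emb_star !smulA.
    by rewrite (linB (@emb_lin R D)) embM wE smBr er.
  rewrite -(@ltr_pXn2r _ 2) ?nnegrE ?rn_ge0 ?(ltW e0) // -rn_starM -rn_emb e1.
  have pc' : pos (emb c) by exact: pos_embM.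
  have hk' := pos_conj el er w hk.
  have := pos_mono el er (pos_conj el er w pc') (b := star w ** (t%:C%C *: mone D + emb k) ** w).
  rewrite -smBl -smBr -[X in _ - X](re_sa _ s_c) => /(_ hk') h; apply: le_lt_trans h _.
  rewrite smulDr smulDl sw smulZr smulZl er -smulA.
  have -> : emb k ** w = emb (k - k ** u).
    by rewrite wE smBr er (linB (@emb_lin R D)) embM.
  have w1 : rn w <= 1 by rewrite wE.
  apply: (le_lt_trans (rnD _ _)); rewrite rnZr //.
  have h1 : rn (w ** w) <= 1.
    by apply: (le_trans (rnM_le _ _)); rewrite -[leRHS]mulr1 ler_pM.
  have h2 : rn (w ** emb (k - k ** u)) <= rn (k - k ** u).
    by apply: (le_trans (rnM_le _ _)); rewrite rn_emb -[leRHS]mul1r ler_wpM2r.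
  move: ht; rewrite pc add0r => ht; have : t * rn (w ** w) <= t by rewrite -[leRHS]mulr1 ler_wpM2l.
  by move: hu ht; rewrite /e'; lra.
have [f [fD fZ fp fc]] := hahn_banach pD pZ (emb c).
have fN a : f (- a) = - f a.
  by rewrite -scaleN1r -(rmorphN1 (real_complex R)) fZ mulN1r.
have f0 a : re a = 0 -> f a = 0.
  move=> ra; have h1 := fp a; have h2 := fp (- a).
  have rNa : re (- a) = 0.
    by rewrite -scaleN1r -(rmorphN1 (real_complex R)) reZ ra scaler0.
  rewrite pneg ?ra ?oppr0 in h1; last exact: pos0.
  rewrite pneg ?rNa ?oppr0 ?fN in h2; last exact: pos0.
  by apply/eqP; rewrite eq_le h1 -oppr_le0 h2.
(* The complex functional with real part [f]; on selfadjoint elements its imaginary part vanishes by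
   [f0]. *)
pose F (a : mult D) : R[i]^o := (f a +i* - f (iu R *: a))%C.
have Fsa a : sa a -> F a = (f a)%:C%C.
  move=> s_a; rewrite /F (f0 (iu R *: a)) ?oppr0 //.
  by rewrite /re starZ s_a iu_conj; lmod R; ring.
have fpos a : pos a -> 0 <= f a.
  move=> h; rewrite -oppr_le0 -fN; apply: (le_trans (fp _)).
  have s_a := pos_sa h; rewrite pneg // (re_sa (- a)); last exact: saN.
  by rewrite opprK.
exists F; split.
- split=> [|a]; first exact: complexify.
  rewrite Fsa; last exact: sa_starM.
  by rewrite lecR fpos //; exact: (pos_starM el er).
- move=> n Nn; have sn : sa (star n ** n) by exact: sa_starM.
  have sn' : sa (emb (star n ** n)) by rewrite /sa -emb_star sn.
  rewrite Fsa //; suff -> : f (emb (star n ** n)) = 0 by [].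
  apply/eqP; rewrite eq_le fpos ?andbT; last exact: pos_embM.
  apply: (le_trans (fp _)); apply: ple; split=> //; exists (star n ** n).
  by split=> //; [exact: lN | rewrite scale0r add0r re_sa // subrr; exact: pos0].
- have s_c : sa (emb c) by rewrite /sa -emb_star sc.
  rewrite Fsa // fc => /(congr1 (@Re R)) /= h; exact: pc0.
Qed.

End CStarMore.

Section KernelGNS.
Variables (R : realType) (D : cstarType R) (I : Type) (L : I -> I -> D -> R[i]^o).
Definition lker (s t : I * D) : R[i] := L s.1 t.1 (star t.2 ** s.2).
Hypotheses (lL : forall i i', linear (L i i'))
  (lstar : forall i i' a, L i' i (star a) = (L i i' a)^*)
  (lker_ge0 : forall s, 0 <= kf lker s s)
  (lbd : forall i, exists2 M : R, 0 <= M & forall a, Re (L i i (star a ** a)) <= M * rn a ^+ 2).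

(** GNS for a family of functionals [L i i'] that is positive as a kernel. A diagonal family gives a
    direct sum of GNS representations, Haar integrals give induced ones. *)
Lemma gns_kernel : exists (H : hilbert R) (j : I * D -> H) (pi : mult D -> bop H),
  [/\ cspan (range j) = setT, starhom pi, forall x i a, pi x (j (i, a)) = j (i, ml x a),
    forall s t, ip (j s) (j t) = lker s t &
    (forall i, linear (fun a => j (i, a))) /\
    cspan [set y | exists a x, y = pi (emb a) x] = setT].
Proof.
have el := @mone_l R D; have er := @mone_r R D.
have [||H [j [hj jT]]] := @kernel_hilbert R (I * D)%type lker.
- by move=> [i a] [i' b]; rewrite /lker /= -lstar starM starK.
- by move=> s; exact: (cge0 (lker_ge0 s)).2.
pose ac x (t : I * D) := (t.1, ml x t.2).
have adj x s t : ip (j (ac x s)) (j t) = ip (j s) (j (ac (star x) t)).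
  by rewrite !hj /lker /= starK mlr.
have bd x s : rn (lc (j \o ac x) s) <= rn x * rn (lc j s).
  rewrite -(@ler_pXn2r _ 2) ?nnegrE ?mulr_ge0 // exprMn !rn_ipE !ip_lc.
  (* |x|^2 - [star x ** x] has a root [h] among the multipliers; positivity of the kernel on vectors
     moved by [h] is the wanted bound. *)
  have : rn (star x ** x) <= rn x ^+ 2 by rewrite rn_starM.
  move=> /(pos_ge el er (sa_starM x)) [h sh hE].
  have : 0 <= kf lker [seq (p.1, ac h p.2) | p <- s] [seq (p.1, ac h p.2) | p <- s].
    exact: lker_ge0.
  have -> : kf lker [seq (p.1, ac h p.2) | p <- s] [seq (p.1, ac h p.2) | p <- s] =
      (rn x ^+ 2)%:C%C * (\sum_(p <- s) \sum_(q <- s) p.1 * Num.conj q.1 * ip (j p.2) (j q.2))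
      - \sum_(p <- s) \sum_(q <- s) p.1 * Num.conj q.1 * ip ((j \o ac x) p.2) ((j \o ac x) q.2).
    rewrite /kf big_map mulr_sumr -sumrB; apply: eq_bigr => p _.
    rewrite big_map mulr_sumr -sumrB; apply: eq_bigr => q _ /=.
    rewrite -hj !adj !hj /lker /=.
    have -> : star (ml (star h) (ml h q.2.2)) ** p.2.2 =
      (rn x ^+ 2)%:C%C *: (star q.2.2 ** p.2.2) - star (ml (star x) (ml x q.2.2)) ** p.2.2.
      have -> : ml (star h) (ml h q.2.2) = (rn x ^+ 2)%:C%C *: q.2.2 - ml (star x) (ml x q.2.2).
        rewrite sh; transitivity (ml (h ** h) q.2.2) => //; rewrite -hE /=.
        by rewrite scaleN1r.
      by rewrite starB starZ conjE conjc_real smBl smulZl.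
    rewrite (linB (lL _ _)) (linZ (lL _ _)) /GRing.scale /=; ring.
  move: (\sum_(p <- s) _) (\sum_(p <- s) _) => [a b] [c d] /cge0[_] /=; lra.
have op x : exists T : bop H, (forall t, T (j t) = j (ac x t)) /\
    forall t, star T (j t) = j (ac (star x) t).
  apply: (@total_bop R H _ j (j \o ac x) (j \o ac (star x)) (rn x)); [exact: rn_ge0 | exact: jT | exact: adj | exact: bd |].
  by move=> s; rewrite -(rn_star x); exact: bd.
pose pi x := projT1 (cid (op x)).
have piE x i a : pi x (j (i, a)) = j (i, ml x a) by exact: (projT2 (cid (op x))).1.
have piS x i a : star (pi x) (j (i, a)) = j (i, ml (star x) a) by exact: (projT2 (cid (op x))).2.
have jl i : linear (fun a => j (i, a)).
  move=> c a b; apply: (ip_dense jT) => _ [[k d] _ <-].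
  by rewrite ip_linear !hj /lker /= smulDr smulZr lL.
exists H, j, pi; split=> //.
  split=> [c x y|x y|x]; apply: (bop_dense jT) => -[i a].
  - by transitivity (c *: pi x (j (i, a)) + pi y (j (i, a))) => //; rewrite !piE -jl.
  - by transitivity (pi x (pi y (j (i, a)))) => //; rewrite !piE.
  - by rewrite piE piS.
split=> //; apply: cspan_eqT => P cP hP.
apply: (cspanT_ind jT cP) => _ [[i a] _ <-].
have bj : blin (fun a => j (i, a)).
  split=> //; have [M M0 hM] := lbd i.
  exists (Num.sqrt M) => [|b]; first exact: sqrtr_ge0.
  rewrite -(@ler_pXn2r _ 2) ?nnegrE ?mulr_ge0 ?rn_ge0 ?sqrtr_ge0 // exprMn sqr_sqrtr //.
  by rewrite rn_ipE hj; exact: hM.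
apply: (prod_ind (clsub_pre bj cP)) => b c /=.
by apply: hP; exists b, (j (i, c)); rewrite piE.
Qed.

End KernelGNS.

Section GNS.
Variables (R : realType) (D : cstarType R) (I : Type) (phi : I -> mult D -> R[i]^o).
Hypothesis hphi : forall i, posfun (phi i).

(** Different labels are orthogonal, so the space is the direct sum of the GNS spaces of all
    [phi i]. *)
Definition gns_ker (s t : I * D) : R[i] :=
  if `[< s.1 = t.1 >] then phi s.1 (emb (star t.2 ** s.2)) else 0.
Local Notation gk := (kf gns_ker).

(** The vectors carrying the label of the first one contribute [phi i] of a square; the others are
    fewer and orthogonal to them. *)
Lemma gns_ker_ge0 s : 0 <= gk s s.
Proof.
elim: {s}(size s) {-2}s (leqnn (size s)) => [|n ih] [|p s'] // hs; try by rewrite /kf big_nil.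
set s := p :: s'; pose i := p.2.1; pose P (q : R[i] * (I * D)) := `[< q.2.1 = i >].
have z q r : P q != P r -> gns_ker q.2 r.2 = 0.
  move=> h; rewrite /gns_ker asboolF // => e; case/eqP: h; rewrite /P.
  by rewrite e.
pose g := \sum_(q <- [seq q <- s | P q]) q.1 *: q.2.2.
have -> : gk s s = phi i (star (emb g) ** emb g) + gk [seq q <- s | ~~ P q] [seq q <- s | ~~ P q].
  have lp := (hphi i).1.
  have e (F : R[i] * (I * D) -> R[i]) :
    \sum_(q <- s) F q = \sum_(q <- s | P q) F q + \sum_(q <- s | ~~ P q) F q by exact: bigID.
  rewrite /kf e !big_filter; congr (_ + _).
    rewrite -emb_star -embM /g st_sum sm_sumr (lin_sum (@emb_lin R D)).
    rewrite (lin_sum lp) big_filter; apply: eq_bigr => q Pq.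
    rewrite e [X in _ + X]big1 ?addr0; last first.
      by move=> r nP; rewrite z ?mulr0 // Pq; case: (P r) nP.
    rewrite sm_suml (lin_sum (@emb_lin R D)) (lin_sum lp) big_filter; apply: eq_bigr => r Pr.
    rewrite starZ smulZl smulZr !(linZ (@emb_lin R D)) !(linZ lp) /gns_ker asboolT; last first.
      by rewrite (asboolW Pq) (asboolW Pr).
    by rewrite (asboolW Pq) /GRing.scale /=; ring.
  apply: eq_bigr => q Pq; rewrite big_filter e big1 ?add0r // => r Pr.
  by rewrite z ?mulr0 // Pr; case: (P q) Pq.
apply: addr_ge0; first exact: (hphi i).2.
have Pp : P p by apply/asboolP.
have hs' : (size s' <= n)%N by exact: hs.
have sE : [seq q <- s | ~~ P q] = [seq q <- s' | ~~ P q] by rewrite /s /= Pp.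
by rewrite sE; apply: ih; rewrite size_filter; apply: leq_trans hs'; exact: count_size.
Qed.

Lemma posfun_bd (f : mult D -> R[i]^o) a : posfun f ->
  Re (f (emb (star a ** a))) <= Re (f (mone D)) * rn a ^+ 2.
Proof.
move=> pf; have := pos_ge (@mone_l R D) (@mone_r R D) (sa_starM (emb a)) (lexx (rn _)).
move=> /(posfun_pos pf); rewrite (linB pf.1) (linZ pf.1) rn_starM rn_emb.
rewrite -emb_star -embM; case: (f (mone D)) => u v; case: (f _) => u' v'.
by rewrite /GRing.scale /= => /cge0[_] /=; lra.
Qed.

Lemma posfun_one (f : mult D -> R[i]^o) : posfun f -> 0 <= Re (f (mone D)).
Proof.
move=> pf; have := pf.2 (mone D).
by rewrite mone_r (sa_unit (@mone_l R D)) => /cge0[].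
Qed.

Lemma gns : exists (H : hilbert R) (j : I * D -> H) (pi : mult D -> bop H),
  [/\ cspan (range j) = setT, starhom pi, forall x i a, pi x (j (i, a)) = j (i, ml x a),
    forall s t, ip (j s) (j t) = gns_ker s t &
    (forall i, linear (fun a => j (i, a))) /\
    cspan [set y | exists a x, y = pi (emb a) x] = setT].
Proof.
pose L i i' a : R[i]^o := if `[< i = i' >] then phi i (emb a) else 0.
apply: (@gns_kernel R D I L) => [i i' c a b|i i' a|s|i]; last first.
- exists (Re (phi i (mone D))); first exact: posfun_one.
  by move=> a; rewrite /L asboolT //; exact: posfun_bd.
- exact: gns_ker_ge0.
- rewrite /L; have [e|e] := pselect (i = i'); last by rewrite !asboolF ?rmorph0 // => h; apply: e.
  by rewrite !asboolT // -e -(posfun_star _ (hphi _)) emb_star.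
- rewrite /L; case: asbool; last by rewrite scaler0 addr0.
  by rewrite (@emb_lin R D) (hphi i).1.
Qed.

End GNS.

Section Representations.
Variables (R : realType) (D : cstarType R).
Implicit Types a : D.

Definition nondeg_rep (H : hilbert R) (pi : mult D -> bop H) :=
  starhom pi /\ cspan [set y | exists (a : D) x, y = pi (emb a) x] = setT.

(** All positive functionals are summed at once, with the functionals themselves as labels;
    [state_sep] for the zero ideal shows that every nonzero element is detected. *)
Lemma faithful_rep : exists (H : hilbert R) (pi : mult D -> bop H),
  nondeg_rep pi /\ forall a : D, pi (emb a) = 0 -> a = 0.
Proof.
pose phi (f : {f : mult D -> R[i]^o | posfun f}) := projT1 f.
have [H [j [pi [jT hp pj jj [jl nd]]]]] := @gns R D _ phi (fun f => projT2 f).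
exists H, pi; split=> // a pa; apply: smul_injl => b; rewrite smul0r.
apply: contrapT => nab.
have [|||f [pf _ h]] := @state_sep R D [set 0] (a ** b).
- exact: clsub0.
- by move=> d n ->; rewrite smulr0.
- exact: nab.
apply: h; have := jj (exist _ f pf, a ** b) (exist _ f pf, a ** b).
rewrite /gns_ker asboolT //= /phi /= => <-.
by have := pj (emb a) (exist _ f pf) b; rewrite pa /= => <-; rewrite ip0l.
Qed.

(** The algebra need not have a unit, so the cyclic vector [xi] comes from the Riesz lemma: [f] is
    bounded for the GNS norm by [posfun_cs]. It satisfies [pi (emb a) xi = J a]. *)
Lemma left_rep (N : set D) (x : D) : clsub N -> (forall d n, N n -> N (d ** n)) -> ~ N x ->
  exists (H : hilbert R) (pi : mult D -> bop H) (xi : H), [/\ nondeg_rep pi,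
    forall n, N n -> pi (emb n) xi = 0 & pi (emb x) xi <> 0].
Proof.
move=> cN lN Nx; have [f [pf fN fx]] := state_sep cN lN Nx.
have [H [j [pi [jT hp pj jj [jl nd]]]]] := @gns R D unit (fun=> f) (fun=> pf).
pose J a := j (tt, a); have JJ a b : ip (J a) (J b) = f (emb (star b ** a)).
  by rewrite jj /gns_ker asboolT.
have JT : cspan (range J) = setT.
  by rewrite -jT; congr cspan; apply/seteqP; split=> [_ [a _ <-]|_ [[[] a] _ <-]]; [exists (tt, a) | exists a].
have lf : linear (fun a => f (emb a)) by move=> c a b; rewrite (@emb_lin R D) pf.1.
have p1 : 0 <= Re (f (mone D)).
  by have := pf.2 (mone D); rewrite mone_r (sa_unit (@mone_l R D)) => /cge0[].
(* Scalars as functions on a point, which form the complete target that [blt] asks for. *)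
pose C := bfun ((fun=> 1) : unit -> R).
pose v (z : C) : R[i]^o := bf z tt.
have vl : linear v by [].
have vn (z : C) (M : R) : 0 <= M -> rn (v z) <= M -> rn z <= M.
  by move=> M0 h; apply: bf_le => // -[]; rewrite normr1 mulr1.
have mk (a : D) : exists z : C, v z = f (emb a).
  have h : exists2 M : R, 0 <= M & forall x : unit, rn (f (emb a)) <= M * `|1|.
    by exists (rn (f (emb a))) => [|_]; rewrite // normr1 mulr1.
  by exists (BFun h).
pose u a := projT1 (cid (mk a)); have uE a : v (u a) = f (emb a) by exact: (projT2 (cid (mk a))).
have [||l [ll bl lE]] := @blt R H C D J u (Num.sqrt (Re (f (mone D)))) _ JT.
- exact: sqrtr_ge0.
- move=> s; apply: vn; first by rewrite mulr_ge0 ?sqrtr_ge0.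
  rewrite (lin_lc _ _ vl) -[lc J s](lin_lc id s (jl tt)).
  have -> : lc (v \o u) s = f (emb (lc id s)).
    rewrite (lin_lc id s lf) /lc; apply: eq_bigr => p _; congr (_ *: _); exact: uE.
  rewrite -(@ler_pXn2r _ 2) ?nnegrE ?mulr_ge0 ?rn_ge0 ?sqrtr_ge0 // exprMn sqr_sqrtr //.
  by rewrite rn_ipE JJ embM emb_star; exact: posfun_cs.
have [xi hxi] : exists z, forall x, v (l x) = ip x z.
  apply: riesz; split; first exact: (lin_comp ll vl).
  exists (Num.sqrt (Re (f (mone D)))) => [|y]; first exact: sqrtr_ge0.
  by apply: le_trans (bl y); have := bf_bd (l y) tt; rewrite normr1 mulr1.
have pxi a : pi (emb a) xi = J a.
  apply/esym; apply: (ip_dense JT) => _ [b _ <-].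
  have e : star (pi (emb a)) (J b) = J (star a ** b).
    by rewrite -(hom_star hp) -emb_star /J pj.
  rewrite JJ bop_adj e ip_conj -hxi lE uE -(posfun_star _ pf) -emb_star starM starK.
  by [].
exists H, pi, xi; split=> // [n Nn|].
  by rewrite pxi; apply: rn_eq0; apply/eqP; rewrite -sqrf_eq0 rn_ipE JJ fN.
by rewrite pxi => h; apply: fx; rewrite -JJ h ip0l.
Qed.

Lemma ideal_star (J : set D) : clsub J -> (forall d n, J n -> J (d ** n)) ->
  (forall d n, J n -> J (n ** d)) -> forall n, J n -> J (star n).
Proof.
move=> cJ lJ rJ n Jn; apply: (ideal_root cJ lJ); rewrite starK; exact: rJ.
Qed.

(** [x ** star x] also lies outside [J], so a functional that separates it detects [x] on the vector
    of [star x]. *)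
Lemma ideal_rep (J : set D) (x : D) : clsub J -> (forall d n, J n -> J (d ** n)) ->
  (forall d n, J n -> J (n ** d)) -> ~ J x ->
  exists (H : hilbert R) (pi : mult D -> bop H), [/\ nondeg_rep pi,
    forall n, J n -> pi (emb n) = 0 & pi (emb x) <> 0].
Proof.
move=> cJ lJ rJ Jx; have sJ := ideal_star cJ lJ rJ.
have Jy : ~ J (x ** star x).
  move=> h; apply: Jx; rewrite -[x]starK; apply: sJ; apply: (ideal_root cJ lJ).
  by rewrite starK.
have [f [pf fN fx]] := state_sep cJ lJ Jy.
have [H [j [pi [jT hp pj jj [jl nd]]]]] := @gns R D unit (fun=> f) (fun=> pf).
have jn s : rn (j s) ^+ 2 = Re (f (emb (star s.2 ** s.2))).
  by rewrite rn_ipE jj /gns_ker asboolT.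
exists H, pi; split=> // [n Jn|h].
  apply: (bop_dense jT) => -[i a]; rewrite pj; apply: rn_eq0; apply/eqP.
  by rewrite -sqrf_eq0 jn fN //; exact: rJ.
have := pj (emb x) tt (star x); rewrite h /= => h0; apply: fx.
have := jj (tt, x ** star x) (tt, x ** star x); rewrite -h0 ip0l /gns_ker asboolT //=.
Qed.

End Representations.

(** * Minimal tensor products, their multipliers and their homomorphisms *)

Section TensorBasics.
Variables (R : realType) (G : lcGroupType) (S : setting R G).
Implicit Types A B C D E : cstarType R.
Local Notation "a '\ox' b" := (tp S a b).

Lemma tp_linl A B (b : B) : linear (fun a : A => a \ox b). Proof. exact: mt_linl. Qed.
Lemma tp_linr A B (a : A) : linear (fun b : B => a \ox b). Proof. exact: mt_linr. Qed.
Lemma tpM A B (a a' : A) (b b' : B) : (a \ox b) ** (a' \ox b') = (a ** a') \ox (b ** b').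
Proof. exact: mt_mul. Qed.
Lemma tp_star A B (a : A) (b : B) : star (a \ox b) = star a \ox star b.
Proof. exact: mt_star. Qed.

Definition tpg A B (p : A * B) : tens S A B := p.1 \ox p.2.
Lemma tp_dense A B : cspan (range (@tpg A B)) = setT.
Proof.
rewrite -(mt_dense (tens S A B)); congr cspan.
by apply/seteqP; split=> [_ [[a b] _ <-]|_ [a [b ->]]]; [exists a, b | exists (a, b)].
Qed.

Lemma tp_ind A B (P : set (tens S A B)) : clsub P -> (forall a b, P (a \ox b)) ->
  forall z, P z.
Proof. by move=> cP hP; apply: (cspanT_ind (mt_dense (tens S A B)) cP) => _ [a [b ->]]; exact: hP. Qed.

Lemma blin_eq A B (V : normedModType R[i]) (f g : tens S A B -> V) : blin f -> blin g ->
  (forall a b, f (a \ox b) = g (a \ox b)) -> f =1 g.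
Proof. by move=> bf bg h; apply: (tp_ind (clsub_eq bf bg)). Qed.

Lemma mtp_unitary A B (u : mult A) (v : mult B) : star u ** u = mone A -> u ** star u = mone A ->
  star v ** v = mone B -> v ** star v = mone B ->
  exists p : mult (tens S A B), forall a b, ml p (a \ox b) = ml u a \ox ml v b.
Proof.
move=> u1 u2 v1 v2.
have gram (C : cstarType R) (w : mult C) : star w ** w = mone C ->
    forall x y, star (ml w x) ** ml w y = star x ** y.
  by move=> h x y; rewrite ml_adj; congr (_ ** _); transitivity (ml (star w ** w) y) => //; rewrite h.
pose U (p : A * B) := ml u p.1 \ox ml v p.2.
pose U' (p : A * B) := ml (star u) p.1 \ox ml (star v) p.2.
have [|||p [hp _]] := @unitary_mult R (tens S A B) _ (@tpg A B) U U' (tp_dense A B).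
- by move=> [a b] [a' b']; rewrite !tp_star !tpM !gram.
- by move=> [a b] [a' b']; rewrite !tp_star !tpM !gram ?starK.
- by move=> [a b] [a' b']; rewrite !tp_star !tpM /= !ml_adj.
by exists p => a b; exact: (hp (a, b)).
Qed.

(** Both factors are reduced to unitaries by [unitary_span]; for these the Gram products on simple
    tensors agree, which gives boundedness. *)
Lemma mtp_ex A B (m : mult A) (n : mult B) :
  exists p : mult (tens S A B), forall a b, ml p (a \ox b) = ml m a \ox ml n b.
Proof.
move: m n; apply: (unitary_span (@mone_l R A) (@mone_r R A)) => [u u1 u2|c m m' hm hm' n].
  apply: (unitary_span (@mone_l R B) (@mone_r R B)) => [v v1 v2|c n n' [p hp] [p' hp']].
    exact: mtp_unitary.
  by exists (c *: p + p') => a b; rewrite /= hp hp' (@tp_linr A B (ml u a)).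
have [p hp] := hm n; have [p' hp'] := hm' n.
by exists (c *: p + p') => a b; rewrite /= hp hp' (@tp_linl A B (ml n b)).
Qed.

Lemma mtpE A B (m : mult A) (n : mult B) a b :
  ml (mtp S m n) (a \ox b) = ml m a \ox ml n b.
Proof. by move: a b; rewrite /mtp; case: xgetP => [p -> //|h]; case: (mtp_ex m n) => p /h. Qed.

Lemma mtp_uniq A B (m : mult A) (n : mult B) p :
  (forall a b, ml p (a \ox b) = ml m a \ox ml n b) -> p = mtp S m n.
Proof. by move=> h; apply: mult_eq; apply: blin_eq => [||a b]; rewrite ?h ?mtpE //; exact: blin_ml. Qed.

Lemma mtpM A B (m m' : mult A) (n n' : mult B) :
  mtp S m n ** mtp S m' n' = mtp S (m ** m') (n ** n').
Proof. by apply: mtp_uniq => a b; rewrite /= !mtpE. Qed.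

Lemma mtp_star A B (m : mult A) (n : mult B) : star (mtp S m n) = mtp S (star m) (star n).
Proof.
apply: mtp_uniq => a b; apply: (can_inj starK); apply: smul_injl.
apply: blin_eq => [||a' b']; [exact: blin_mull | exact: blin_mull |].
apply: (can_inj starK); rewrite !starM !starK -ml_adj mtpE !tp_star !tpM.
by rewrite !ml_adj.
Qed.

Lemma mtp_linl A B (n : mult B) : linear (fun m : mult A => mtp S m n).
Proof. by move=> c m m'; symmetry; apply: mtp_uniq => a b; rewrite /= !mtpE (@tp_linl A B (ml n b)). Qed.
Lemma mtp_linr A B (m : mult A) : linear (fun n : mult B => mtp S m n).
Proof. by move=> c n n'; symmetry; apply: mtp_uniq => a b; rewrite /= !mtpE (@tp_linr A B (ml m a)). Qed.
Lemma mtp_one A B : mtp S (mone A) (mone B) = mone (tens S A B).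
Proof. by symmetry; apply: mtp_uniq. Qed.
Lemma mtp_emb A B (a : A) (b : B) : mtp S (emb a) (emb b) = emb (a \ox b).
Proof. by symmetry; apply: mtp_uniq => a' b' /=; rewrite tpM. Qed.
Lemma mone_star A : star (mone A) = mone A. Proof. exact: (sa_unit (@mone_l R A)). Qed.

Lemma mtp_homl A B : starhom (fun m : mult A => mtp S m (mone B)).
Proof.
by split=> [|m m'|m]; [exact: mtp_linl | rewrite mtpM mone_l | rewrite mtp_star mone_star].
Qed.
Lemma mtp_homr A B : starhom (fun n : mult B => mtp S (mone A) n).
Proof.
by split=> [|m m'|m]; [exact: mtp_linr | rewrite mtpM mone_l | rewrite mtp_star mone_star].
Qed.
Lemma mtp_split A B (m : mult A) (n : mult B) :
  mtp S m n = mtp S m (mone B) ** mtp S (mone A) n.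
Proof. by rewrite mtpM mone_l mone_r. Qed.
Lemma mtp_com A B (m : mult A) (n : mult B) :
  mtp S (mone A) n ** mtp S m (mone B) = mtp S m n.
Proof. by rewrite mtpM mone_l mone_r. Qed.

(** [m |-> m (x) 1] and [n |-> 1 (x) n] are homomorphisms, hence contractive. *)
Lemma rn_mtp A B (m : mult A) (n : mult B) : rn (mtp S m n) <= rn m * rn n.
Proof.
rewrite mtp_split; apply: (le_trans (rnM_le _ _)); apply: ler_pM; rewrite //.
  exact: (hom_contr (mtp_homl A B)).
exact: (hom_contr (mtp_homr A B)).
Qed.
Lemma rn_tp A B (a : A) (b : B) : rn (a \ox b) <= rn a * rn b.
Proof. by rewrite -rn_emb -mtp_emb -(rn_emb a) -(rn_emb b); exact: rn_mtp. Qed.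
Lemma blin_tpl A B (b : B) : blin (fun a : A => a \ox b).
Proof.
split; first exact: tp_linl; exists (rn b) => // a.
by rewrite mulrC; exact: rn_tp.
Qed.
Lemma blin_tpr A B (a : A) : blin (fun b : B => a \ox b).
Proof.
by split; [exact: tp_linr | exists (rn a) => // b; exact: rn_tp].
Qed.

Lemma tens_ind A B (S1 : set A) (S2 : set B) (P : set (tens S A B)) : cspan S1 = setT ->
  cspan S2 = setT -> clsub P -> (forall a b, S1 a -> S2 b -> P (a \ox b)) -> forall z, P z.
Proof.
move=> h1 h2 cP hP; apply: (tp_ind cP) => a b.
apply: (cspanT_ind h1 (clsub_pre (@blin_tpl A B b) cP)) => a' Sa'.
by apply: (cspanT_ind h2 (clsub_pre (@blin_tpr A B a') cP)) => b' Sb'; exact: hP.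
Qed.

End TensorBasics.

Section HilbertTensorMore.
Variables (R : realType) (H K L : hilbert R) (t : H -> K -> L).
Hypothesis ht : is_hilbert_tensor t.

Definition tpair (p : H * K) : L := t p.1 p.2.
Lemma ht_dense : cspan (range tpair) = setT.
Proof.
rewrite -ht.2; congr cspan.
by apply/seteqP; split=> [_ [[a b] _ <-]|_ [a [b ->]]]; [exists a, b | exists (a, b)].
Qed.
Lemma ht_linl y : linear (fun x => t x y).
Proof.
move=> c x x'; apply: (ip_dense ht_dense) => _ [[u v] _ <-] /=.
by rewrite ip_linear !ht.1 ip_linear mulrDl mulrA.
Qed.
Lemma ht_linr x : linear (t x).
Proof.
move=> c y y'; apply: (ip_dense ht_dense) => _ [[u v] _ <-] /=.
by rewrite ip_linear !ht.1 ip_linear mulrDr mulrCA.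
Qed.
Lemma rn_ht x y : rn (t x y) = rn x * rn y.
Proof.
apply/eqP; rewrite -(@eqrXn2 _ 2) ?mulr_ge0 // exprMn rn_ipE ht.1 !ip_rn.
by rewrite -rmorphM.
Qed.
Lemma blin_htl y : blin (fun x => t x y).
Proof.
split; first exact: ht_linl; exists (rn y) => // x.
by rewrite rn_ht mulrC.
Qed.
Lemma blin_htr x : blin (t x).
Proof.
by split; [exact: ht_linr | exists (rn x) => // y; rewrite rn_ht].
Qed.
End HilbertTensorMore.

Section TensorMaps.
Variables (R : realType) (G : lcGroupType) (S : setting R G).
Implicit Types A B C D E : cstarType R.
Local Notation "a '\ox' b" := (tp S a b).

(** One faithful [W] on the multipliers of D (x) E serves all pairs [f], [g]: the spatial property
    of A (x) B, applied to the composed representations, gives a [V] whose values on simple tensors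
    lie in the range of [W]. As that range is closed, [V] factors through [W] in [htp_ex]. *)
Lemma spatial_rep D E : exists (L : hilbert R) (W : mult (tens S D E) -> mult (kops L)),
  [/\ starhom W, injective W &
  forall A B (f : A -> mult D) (g : B -> mult E), starhom f -> starhom g ->
    exists V : tens S A B -> mult (kops L), [/\ starhom V,
      forall a b, V (a \ox b) = W (mtp S (f a) (g b)) &
      injective f -> injective g -> injective V]].
Proof.
have [H [p [[hp np] fp]]] := faithful_rep D; have [K [r [[hr nr] fr]]] := faithful_rep E.
have [L [t ht]] := tensor_exists H K.
have inj1 (X : cstarType R) (Y : hilbert R) (s : mult X -> bop Y) : starhom s ->
    (forall x, s (emb x) = 0 -> x = 0) -> forall x, s x = 0 -> x = 0.
  move=> hs hi x sx; apply: mult_eq => a; apply: hi.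
  by rewrite -mul_emb (homM hs) sx sm0l.
have rp (X : cstarType R) (f : X -> mult D) : starhom f -> is_rep (fun a x => p (f a) x).
  by move=> hf; exact: (hom_rep (hom_comp hf hp)).
have rr (X : cstarType R) (f : X -> mult E) : starhom f -> is_rep (fun a x => r (f a) x).
  by move=> hf; exact: (hom_rep (hom_comp hf hr)).
have key A B (f : A -> mult D) (g : B -> mult E) : starhom f -> starhom g ->
    exists V : tens S A B -> bop L, [/\ starhom V,
      forall a b x y, V (a \ox b) (t x y) = t (p (f a) x) (r (g b) y) &
      injective f -> injective g -> injective V].
  move=> hf hg; have [w [rw wE wf]] := @mt_spatial R A B (tens S A B) H K L t _ _ ht (rp _ _ hf) (rr _ _ hg).
  have [V hV VE] := rep_hom rw; exists V; split=> // [a b x y|fi gi].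
    by rewrite VE; exact: wE.
  apply: (lin_inj (hom_lin hV)) => z Vz; apply: wf => [a ha|b hb|x]; last by rewrite -VE Vz.
    by apply: fi; rewrite (lin0 (hom_lin hf)); apply: (inj1 _ _ _ hp fp); exact: bop_eq.
  by apply: gi; rewrite (lin0 (hom_lin hg)); apply: (inj1 _ _ _ hr fr); exact: bop_eq.
have [V0 [hV0 V0E V0i]] := key D E _ _ (@emb_starhom R D) (@emb_starhom R E).
have {}V0i : injective V0 by apply: V0i; exact: emb_inj.
have oh := opm_hom (kops L).
pose X := @opm R L (kops L) \o V0.
have hX : starhom X by exact: hom_comp.
have nX : nondeg X.
  apply: (opm_nondeg (kops L) hV0); apply: cspan_eqT => P cP hP.
  apply: (cspanT_ind ht.2 cP) => _ [x [y ->]].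
  apply: (cspanT_ind np (clsub_pre (blin_htl ht y) cP)) => _ [d [x' ->]] /=.
  apply: (cspanT_ind nr (clsub_pre (blin_htr ht _) cP)) => _ [e [y' ->]] /=.
  by apply: hP; exists (d \ox e), (t x' y'); rewrite V0E.
exists L, (ext X); split; first exact: ext_hom.
  apply: (lin_inj (hom_lin (ext_hom hX nX))) => m hm; apply: mult_eq => z.
  apply: V0i; apply: (@opm_inj R L (kops L)).
  by rewrite -[LHS](extE hX nX m z) hm sm0l (lin0 (hom_lin hV0)) (lin0 (hom_lin oh)).
move=> A B f g hf hg; have [V [hV VE Vi]] := key A B f g hf hg.
exists (@opm R L (kops L) \o V); split; first exact: hom_comp.
  move=> a b; apply: (ext_uniq hX nX); apply: blin_eq => [||d e].
  - exact: (blin_comp (hom_blin hX) (blin_mull _)).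
  - exact: (blin_comp (blin_ml _) (hom_blin hX)).
  have e0 : V (a \ox b) ** V0 (d \ox e) = V0 (ml (f a) d \ox ml (g b) e).
    apply: (bop_dense (ht_dense ht)) => -[x y].
    transitivity (V (a \ox b) (V0 (d \ox e) (t x y))) => //.
    by rewrite /tpair /= !V0E VE -!mul_emb (homM hp) (homM hr).
  rewrite mtpE /X /= -e0; symmetry; exact: (homM oh).
by move=> fi gi; apply: inj_comp; [exact: opm_inj | exact: Vi].
Qed.

Section Htp.
Variables (A B D E : cstarType R) (f : A -> mult D) (g : B -> mult E).
Hypotheses (hf : starhom f) (hg : starhom g).

Lemma htp_ex : exists h : tens S A B -> mult (tens S D E), [/\ starhom h,
  forall a b, h (a \ox b) = mtp S (f a) (g b) & injective f -> injective g -> injective h].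
Proof.
have [L [W [hW Wi key]]] := spatial_rep D E; have [V [hV VE Vi]] := key A B f g hf hg.
have [x|h hh hE] := hom_factor hV hW Wi.
  apply: (tp_ind (clsub_pre (hom_blin hV) (hom_range_clsub hW))) => a b /=.
  by rewrite VE; exists (mtp S (f a) (g b)).
exists h; split=> // [a b|fi gi x y hxy]; first by apply: Wi; rewrite hE VE.
by apply: (Vi fi gi); rewrite -!hE hxy.
Qed.

Lemma htpP : starhom (htp (S:=S) f g) /\ forall a b, htp (S:=S) f g (a \ox b) = mtp S (f a) (g b).
Proof.
by rewrite /htp; case: xgetP => [h _ //|nh]; case: htp_ex => h [h1 h2 _]; case: (nh h).
Qed.
Lemma htp_hom : starhom (htp (S:=S) f g). Proof. by case: htpP. Qed.
Lemma htpE a b : htp (S:=S) f g (a \ox b) = mtp S (f a) (g b). Proof. by case: htpP. Qed.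

Lemma htp_uniq h : starhom h -> (forall a b, h (a \ox b) = mtp S (f a) (g b)) ->
  h =1 htp (S:=S) f g.
Proof.
move=> hh hE; apply: blin_eq => [||a b]; [exact: hom_blin | exact: (hom_blin htp_hom) |].
by rewrite hE htpE.
Qed.

Lemma htp_inj : injective f -> injective g -> injective (htp (S:=S) f g).
Proof.
move=> fi gi; have [h [hh hE hi]] := htp_ex.
by move=> x y; rewrite -!(htp_uniq hh hE); exact: hi.
Qed.

Lemma htp_nondeg : nondeg f -> nondeg g -> nondeg (htp (S:=S) f g).
Proof.
move=> nf ng; apply/nondegP => P cP hP; apply: (tens_ind nf ng cP) => _ _ [a [d ->]] [b [e ->]].
by rewrite -mtpE -htpE; exact: hP.
Qed.

Hypotheses (nf : nondeg f) (ng : nondeg g).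
Lemma ext_htp_mtp m n : ext (htp (S:=S) f g) (mtp S m n) = mtp S (ext f m) (ext g n).
Proof.
symmetry; apply: (ext_uniq htp_hom (htp_nondeg nf ng)); apply: blin_eq => [||a b].
- exact: (blin_comp (hom_blin htp_hom) (blin_mull _)).
- exact: (blin_comp (blin_ml _) (hom_blin htp_hom)).
by rewrite mtpE !htpE mtpM !extE.
Qed.
End Htp.

Section Tmap.
Variables (A B D E : cstarType R) (f : A -> D) (g : B -> E).
Hypotheses (hf : starhom f) (hg : starhom g).

Lemma tmapP : starhom (tmap (S := S) f g) /\ forall a b, tmap (S := S) f g (a \ox b) = f a \ox g b.
Proof.
rewrite /tmap; case: xgetP => [h _ //|nh].
have ef := hom_emb_comp hf; have eg := hom_emb_comp hg.
have hh := htp_hom ef eg; have ei := @emb_inj R (tens S D E).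
have [z|h h1 h2] := hom_factor hh (@emb_starhom R (tens S D E)) ei.
  apply: (tp_ind (clsub_pre (hom_blin hh) (hom_range_clsub (@emb_starhom R _)))) => a b /=.
  by rewrite htpE // mtp_emb; exists (f a \ox g b).
by case: (nh h); split=> // a b; apply: ei; rewrite h2 htpE // mtp_emb.
Qed.
Lemma tmap_hom : starhom (tmap (S := S) f g). Proof. by case: tmapP. Qed.
Lemma tmapE a b : tmap (S := S) f g (a \ox b) = f a \ox g b. Proof. by case: tmapP. Qed.
Lemma emb_tmap z : emb (tmap f g z) = htp (S:=S) (@emb R D \o f) (@emb R E \o g) z.
Proof.
move: z; apply: htp_uniq; [exact: hom_emb_comp | exact: hom_emb_comp | |].
  exact: (hom_emb_comp tmap_hom).
by move=> a b /=; rewrite tmapE mtp_emb.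
Qed.
Lemma tmap_inj : injective f -> injective g -> injective (tmap (S := S) f g).
Proof.
move=> fi gi x y /(congr1 (@emb R _)); rewrite !emb_tmap; apply: htp_inj.
- exact: hom_emb_comp.
- exact: hom_emb_comp.
- by move=> a b /emb_inj /fi.
- by move=> a b /emb_inj /gi.
Qed.
Lemma tmap_surj : range f = setT -> range g = setT -> range (tmap (S := S) f g) = setT.
Proof.
move=> fs gs; apply/seteqP; split=> // z _; move: z.
apply: (tp_ind (hom_range_clsub tmap_hom)) => d e.
have [a _ <-] : range f d by rewrite fs. have [b _ <-] : range g e by rewrite gs.
by exists (a \ox b) => //; rewrite tmapE.
Qed.
End Tmap.

Lemma tmap_comp A B D E A' B' (f : A -> D) (g : B -> E) (f' : D -> A') (g' : E -> B') z :
  starhom f -> starhom g -> starhom f' -> starhom g' ->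
  tmap (S := S) f' g' (tmap (S := S) f g z) = tmap (S := S) (f' \o f) (g' \o g) z.
Proof.
move=> hf hg hf' hg'; move: z; apply: blin_eq => [||a b].
- exact: (blin_comp (hom_blin (tmap_hom hf hg)) (hom_blin (tmap_hom hf' hg'))).
- exact: (hom_blin (tmap_hom (hom_comp hf hf') (hom_comp hg hg'))).
by rewrite !tmapE //; exact: hom_comp.
Qed.

Lemma tp_eq0 A B (a : A) (b : B) : a \ox b = 0 -> b <> 0 -> a = 0.
Proof.
move=> h b0; have [H [p [[hp np] fp]]] := faithful_rep A; have [K [r [[hr nr] fr]]] := faithful_rep B.
have [L [t ht]] := tensor_exists H K.
have [w [rw wE _]] := @mt_spatial R A B (tens S A B) H K L t _ _ ht
  (hom_rep (hom_comp (@emb_starhom R A) hp)) (hom_rep (hom_comp (@emb_starhom R B) hr)).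
have [V hV VE] := rep_hom rw.
have z x y : t (p (emb a) x) (r (emb b) y) = 0.
  by have := wE a b x y; rewrite -VE -/(tp S a b) h (lin0 (hom_lin hV)) /= => <-.
apply: fp; apply: bop_eq => x; apply: contrapT => nx; apply: b0; apply: fr.
by apply: bop_eq => y; case: (tensor_zero ht (z x y)).
Qed.

End TensorMaps.

Section RightMultipliers.
Variables (R : realType).
Implicit Types A : cstarType R.

Lemma mr_lin A (m : mult A) : linear (mr m).
Proof. by move=> c x y; rewrite mrD mrZ. Qed.
Lemma blin_mr A (m : mult A) : blin (mr m).
Proof.
split; first exact: mr_lin; exists (rn m) => // a.
by rewrite mr_star rn_star; apply: (le_trans (rn_ml _ _)); rewrite !rn_star.
Qed.
Lemma ml_mr A (m n : mult A) a : ml m (mr n a) = mr n (ml m a).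
Proof. by apply: (@emb_inj R A); rewrite -mul_emb -!emb_mul smulA mul_emb. Qed.
Lemma blin_mlv A (a : A) : blin (fun m : mult A => ml m a).
Proof. by split=> //; exists (rn a) => // m; rewrite mulrC rn_ml. Qed.

End RightMultipliers.

(** * Tensor products with the compact operators: nuclearity and exactness *)

Section UnitVector.
Variables (R : realType) (H : hilbert R) (K : compact_ops H).

Lemma unit_vector : (forall x : H, x = 0) \/ exists w : H, ip w w = 1.
Proof.
have [h|h] := pselect (forall x : H, x = 0); [by left | right].
have [x x0] : exists x : H, x <> 0 by apply: contrapT => n; apply: h => x; apply: contrapT => ?; apply: n; exists x.
have rx : rn x != 0 by apply/eqP => /rn_eq0.
exists ((rn x)^-1%:C%C *: x); rewrite ipZl ipZr ip_rn conjE conjc_real -!rmorphM /=.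
by rewrite mulrA -expr2 -exprMn mulVf // expr1n.
Qed.

Lemma ko_zero (k : K) : (forall x : H, x = 0) -> k = 0.
Proof. by move=> h; apply: (@ko_faithful _ _ K) => x; exact: h. Qed.

Lemma rkoM x y x' y' : rko K x y ** rko K x' y' = ip x' y *: rko K x y'.
Proof.
apply: (@kob_inj R H K); rewrite (homM (kob_hom K)) (linZ (hom_lin (kob_hom K))) !kob_rko.
rewrite rk_mull; apply: bop_eq => z /=; rewrite !scalerA; congr (_ *: _).
by rewrite mulrC.
Qed.
Lemma rko_star x y : star (rko K x y) = rko K y x.
Proof. by apply: (@kob_inj R H K); rewrite (hom_star (kob_hom K)) !kob_rko rk_star. Qed.
Lemma rko_mull k x y : k ** rko K x y = rko K (ko_act k x) y.
Proof. by apply: (@kob_inj R H K); rewrite (homM (kob_hom K)) !kob_rko rk_mull kobE. Qed.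
Lemma rko_neq0 w : ip w w = 1 -> rko K w w <> 0.
Proof.
move=> h /(congr1 (fun k => kob k w)); rewrite kob_rko (lin0 (hom_lin (kob_hom K))) /= h scale1r.
by move=> w0; move: h; rewrite w0 ip0l => /esym/eqP; rewrite oner_eq0.
Qed.

Lemma ko_ind (P : set K) : clsub P -> (forall x y, P (rko K x y)) -> forall k, P k.
Proof. by move=> cP hP; apply: (cspanT_ind (rko_dense K) cP) => _ [x [y ->]]. Qed.

End UnitVector.

Section Nuclear.
Variables (R : realType) (G : lcGroupType) (S : setting R G) (C D : cstarType R).
Variables (H : hilbert R) (K : compact_ops H) (rho : C -> mult D) (kappa : K -> mult D).
Hypotheses (hr : starhom rho) (hk : starhom kappa) (nk : nondeg kappa).
Hypothesis rk_com : forall c k, rho c ** kappa k = kappa k ** rho c.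
Local Notation "a '\ox' b" := (tp S a b).

(** With [w] a unit vector, the space of the representation splits as the range
    of the minimal projection [kappa |w><w|] tensor [H]. *)
Lemma nuclear : exists Psi : tens S C K -> mult D,
  starhom Psi /\ forall c k, Psi (c \ox k) = rho c ** kappa k.
Proof.
case: (unit_vector H) => [H0|[w ww]].
  exists (fun=> 0); split; first by split=> [c x y|x y|x]; rewrite ?sm0l ?st0 // scaler0 addr0.
  by move=> c k; rewrite (ko_zero k H0) (lin0 (hom_lin hk)) sm0r.
have [L [p [[hp np] fp]]] := faithful_rep D.
pose T x : bop L := p (kappa (rko K x w)); pose e := p (kappa (rko K w w)).
have pk k k' : p (kappa k) ** p (kappa k') = p (kappa (k ** k')) by rewrite (homM hk) (homM hp).
have pks k : star (p (kappa k)) = p (kappa (star k)) by rewrite (hom_star hk) (hom_star hp).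
have appM (U V : bop L) x : (U ** V) x = U (V x) by [].
(* On the range of the projection [e] the operators [T x] multiply inner products, so eta (x) x |->
   T x eta is a tensor decomposition of the space. *)
have TT x y eta zeta : e eta = eta -> ip (T x eta) (T y zeta) = ip eta zeta * ip x y.
  move=> he; rewrite -[T y]starK -bop_adj -appM pks rko_star pk rkoM.
  rewrite (linZ (hom_lin hk)) (linZ (hom_lin hp)).
  transitivity (ip (ip x y *: e eta) zeta) => //; by rewrite ipZl he mulrC.
have cP : clsub [set eta | e eta = eta] by exact: (clsub_eq (blin_bop e) (blin_id L)).
pose L0 := subh (ClSpace cP); pose t (eta : L0) x := T x (sv eta).
have ht : is_hilbert_tensor t.
  split=> [eta x zeta y|]; first exact: (TT x y _ _ (svP eta)).
  apply: cspan_eqT => P cPP hP; apply: (cspanT_ind np cPP) => _ [d [xi ->]].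
  have b1 : blin (fun d : D => p (emb d) xi).
    exact: (blin_comp (blin_comp (@blin_emb R D) (hom_blin hp)) (blin_bopv xi)).
  apply: (cspanT_ind nk (clsub_pre b1 cPP)) => _ [k [d' ->]] /=.
  rewrite -mul_emb (homM hp) appM; move: (p (emb d') xi) => {xi b1} xi.
  have b2 : blin (fun k : K => p (kappa k) xi).
    exact: (blin_comp (blin_comp (hom_blin hk) (hom_blin hp)) (blin_bopv xi)).
  apply: (ko_ind (clsub_pre b2 cPP)) => x y /=.
  have h0 : e (p (kappa (rko K w y)) xi) = p (kappa (rko K w y)) xi.
    by rewrite -appM pk rkoM ww scale1r.
  apply: hP; exists (SubV (S := ClSpace cP) h0), x.
  by rewrite /t /T /= -appM pk rkoM ww scale1r.
(* [rho] commutes with [e], so it acts on the first tensor factor. *)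
have inv c (eta : L0) : e (p (rho c) (sv eta)) = p (rho c) (sv eta).
  by rewrite -appM -(homM hp) -rk_com (homM hp) appM (svP eta).
pose r c (eta : L0) : L0 := SubV (S := ClSpace cP) (inv c eta).
have rr : is_rep r.
  split=> [a c x y|c a b x|a b x|a x y].
  - by apply: sv_inj; exact: (bop_lin (p (rho a))).
  - by apply: sv_inj; rewrite /= (hom_lin hr) (hom_lin hp).
  - by apply: sv_inj; rewrite /= (homM hr) (homM hp).
  - by rewrite /= bop_adj -(hom_star hp) -(hom_star hr).
have [v [rv vE _]] := @mt_spatial R C K (tens S C K) L0 H L t _ _ ht rr (ko_rep K).
have [V hV VE] := rep_hom rv.
(* The spatial representation agrees with the product of [rho] and [kappa], which therefore extends
   to the minimal tensor product. *)
have VE' c k : V (c \ox k) = p (rho c ** kappa k).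
  apply: (bop_dense (ht_dense ht)) => -[eta x]; rewrite VE /tpair /=.
  apply: etrans (vE c k eta x) _; rewrite /t /T /= rk_com (homM hp) appM.
  rewrite -rko_mull -pk.
  transitivity ((p (kappa k) ** (p (kappa (rko K x w)) ** p (rho c))) (sv eta)) => //.
  by rewrite -(homM hp) -rk_com (homM hp).
have pi : injective p.
  apply: (lin_inj (hom_lin hp)) => m hm; apply: mult_eq => a; apply: fp.
  by rewrite -mul_emb (homM hp) hm sm0l.
have [z|h hh hE] := hom_factor hV hp pi.
  apply: (tp_ind (clsub_pre (hom_blin hV) (hom_range_clsub hp))) => c k /=.
  by rewrite VE'; exists (rho c ** kappa k).
by exists h; split=> // c k; apply: pi; rewrite hE VE'.
Qed.

End Nuclear.

Section Slices.
Variables (R : realType) (G : lcGroupType) (S : setting R G) (A B : cstarType R).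
Variables (H : hilbert R) (K : compact_ops H) (q : A -> B).
Hypothesis hq : starhom q.
Local Notation "a '\ox' b" := (tp S a b).

Let M (X : cstarType R) (k : K) : tens S X K -> tens S X K := ml (mtp S (mone X) (emb k)).
Let N (X : cstarType R) (k : K) : tens S X K -> tens S X K := mr (mtp S (mone X) (emb k)).

Lemma mtp_mr (X Y : cstarType R) (m : mult X) (n : mult Y) a b :
  mr (mtp S m n) (a \ox b) = mr m a \ox mr n b.
Proof. by rewrite mr_star mtp_star tp_star mtpE tp_star -!mr_star. Qed.

Definition tker : set (tens S A K) := cspan [set w | exists c k, q c = 0 /\ w = c \ox k].

Let cJ : clsub tker. Proof. exact: cspan_clsub. Qed.
Let lJ w z : tker z -> tker (w ** z).
Proof.
move=> Jz; move: w; apply: (tp_ind (clsub_pre (blin_mulr z) cJ)) => a k /=; move: z Jz.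
apply: (cspan_ind (clsub_pre (blin_mull _) cJ)) => _ [c [k' [qc ->]]] /=.
rewrite tpM; apply: cspan_sub; exists (a ** c), (k ** k'); split=> //.
by rewrite (homM hq) qc sm0r.
Qed.
Let rJ w z : tker z -> tker (z ** w).
Proof.
move=> Jz; move: w; apply: (tp_ind (clsub_pre (blin_mull z) cJ)) => a k /=; move: z Jz.
apply: (cspan_ind (clsub_pre (blin_mulr _) cJ)) => _ [c [k' [qc ->]]] /=.
rewrite tpM; apply: cspan_sub; exists (c ** a), (k' ** k); split=> //.
by rewrite (homM hq) qc sm0l.
Qed.

(** With a unit vector [w], the compression of [z] by |w><x| and |y><w| is c (x) e for some [c] that
    [q] kills. Matrix units then place every two-sided compression of [z] in the ideal [tker], and
    [ideal_root] removes the compressions. *)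
Lemma ker_tmap z : tmap (S := S) q (@id K) z = 0 -> tker z.
Proof.
move=> tz; case: (unit_vector H) => [H0|[w ww]].
  apply: (tp_ind cJ) => a k; rewrite (ko_zero k H0) (lin0 (@tp_linr R G S A K a)).
  exact: cls0 cJ.
pose e := rko K w w; have ht := tmap_hom S hq (@hom_id R K).
have hf : starhom (fun c : A => c \ox e).
  split=> [|x y|x]; first exact: tp_linl.
    by rewrite tpM /e rkoM ww scale1r.
  by rewrite tp_star /e rko_star.
have bM (X : cstarType R) k : blin (M (X := X) k) by exact: blin_ml.
have bN (X : cstarType R) k : blin (N (X := X) k) by exact: blin_mr.
have ME (X : cstarType R) k (a : X) k' : M k (a \ox k') = a \ox (k ** k') by rewrite /M mtpE.
have NE (X : cstarType R) k (a : X) k' : N k (a \ox k') = a \ox (k' ** k) by rewrite /N mtp_mr.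
have MM (X : cstarType R) k k' (y : tens S X K) : M k (M k' y) = M (k ** k') y.
  by rewrite /M embM -[mone X in RHS]mone_l -mtpM.
have NN (X : cstarType R) k k' (y : tens S X K) : N k (N k' y) = N (k' ** k) y.
  by rewrite /N embM -[mone X in RHS]mone_l -mtpM.
have MN (X : cstarType R) k k' (y : tens S X K) : M k (N k' y) = N k' (M k y) by exact: ml_mr.
have tM k y : tmap (S := S) q id (M k y) = M k (tmap (S := S) q id y).
  move: y; apply: blin_eq => [||a k'].
  - exact: (blin_comp (bM _ _) (hom_blin ht)).
  - exact: (blin_comp (hom_blin ht) (bM _ _)).
  by rewrite ME !(tmapE S hq (@hom_id R K)) ME.
have tN k y : tmap (S := S) q id (N k y) = N k (tmap (S := S) q id y).
  move: y; apply: blin_eq => [||a k'].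
  - exact: (blin_comp (bN _ _) (hom_blin ht)).
  - exact: (blin_comp (hom_blin ht) (bN _ _)).
  by rewrite NE !(tmapE S hq (@hom_id R K)) NE.
have slice x y : exists2 c, q c = 0 & M (rko K w x) (N (rko K y w) z) = c \ox e.
  have [c _ hc] : range (fun c : A => c \ox e) (M (rko K w x) (N (rko K y w) z)).
    move: {tz} z; apply: (tp_ind (clsub_pre (blin_comp (bN _ _) (bM _ _)) (hom_range_clsub hf))).
    move=> a k /=; rewrite NE ME rko_mull.
    have -> : rko K w x ** rko K (ko_act k y) w = ip (ko_act k y) x *: e by rewrite rkoM.
    exists (ip (ko_act k y) x *: a) => //=.
    by rewrite (linZ (@tp_linl R G S A K e)) (linZ (@tp_linr R G S A K a)).
  exists c => //; apply: (tp_eq0 (S := S) (b := e)); last exact: rko_neq0.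
  rewrite -(tmapE S hq (@hom_id R K)) hc tM tN tz.
  by rewrite (lin0 (bN _ _).1) (lin0 (bM _ _).1).
have bMv (X : cstarType R) (y : tens S X K) : blin (fun k => M k y).
  exact: (blin_comp (blin_comp (@blin_emb R K) (hom_blin (mtp_homr S X K))) (blin_mlv y)).
have bNv (X : cstarType R) (y : tens S X K) : blin (fun k => N k y).
  split=> [c k k'|]; first by rewrite /N (@emb_lin R K) mtp_linr.
  exists (rn y) => // k.
  rewrite /N mr_star rn_star; apply: (le_trans (rn_ml _ _)); rewrite !rn_star mulrC.
  rewrite ler_wpM2l // -(rn_emb k); exact: (hom_contr (mtp_homr S X K)).
have JMN k k' : tker (M k (N k' z)).
  move: k; apply: (ko_ind (clsub_pre (bMv _ _) cJ)) => x x' /=; rewrite MN.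
  move: k'; apply: (ko_ind (clsub_pre (bNv _ _) cJ)) => y' y /=; rewrite -MN.
  have [c qc hc] := slice x' y'.
  have -> : M (rko K x x') (N (rko K y' y) z) = c \ox rko K x y.
    have ex : rko K x x' = rko K x w ** rko K w x' by rewrite rkoM ww scale1r.
    have ey : rko K y' y = rko K y' w ** rko K w y by rewrite rkoM ww scale1r.
    rewrite ex ey -NN -MM (MN _ (rko K w x')) hc NE ME /e.
    by rewrite (rkoM K w w) ww scale1r rkoM ww scale1r.
  by apply: cspan_sub; exists c, (rko K x y).
have sJ := ideal_star cJ (fun d n => @lJ d n) (fun d n => @rJ d n).
(* The right compression is removed by multiplying with the adjoint; the left one goes in the same
   way at the end. *)
have JM k : tker (M k z).
  have h v : tker (M k z ** v).
    have bl := clsub_pre (blin_mull (M k z)) cJ; move: v; apply: (tp_ind bl) => a k'.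
    apply: (prod_ind (clsub_pre (@blin_tpr R G S A K a) bl)) => k1 k2 /=.
    rewrite -ME; have -> : M k z ** M k1 (a \ox k2) = N k1 (M k z) ** (a \ox k2) by exact: mlr.
    by apply: rJ; rewrite -MN.
  rewrite -[M k z]starK; apply: sJ; apply: (ideal_root cJ lJ); rewrite starK; exact: h.
apply: (ideal_root cJ lJ); move: (star z) => v.
have bl := clsub_pre (blin_mulr z) cJ; move: v; apply: (tp_ind bl) => a k'.
apply: (prod_ind (clsub_pre (@blin_tpr R G S A K a) bl)) => k1 k2 /=.
rewrite -NE; have -> : N k2 (a \ox k1) ** z = (a \ox k1) ** M k2 z by symmetry; exact: mlr.
exact: lJ.
Qed.

End Slices.

(** * Unitary representations of the group and their integrated forms *)

Section Unireps.
Variables (R : realType) (G : lcGroupType).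
Implicit Types (D E : cstarType R).

Lemma unirep_rn D (v : G -> mult D) s : is_unirep v -> rn (v s) <= 1.
Proof.
move=> [v1 vM vs _]; rewrite -(@ler_pXn2r _ 2) ?nnegrE // expr1n -rn_starM.
by rewrite vs -vM mulVg v1; exact: (rn_unit (@mone_l R D)).
Qed.

Lemma unirep_ext D E (f : D -> mult E) (v : G -> mult D) : starhom f -> nondeg f ->
  is_unirep v -> is_unirep (fun s => ext f (v s)).
Proof.
move=> hf nf uv; have [v1 vM vs vc] := uv; have he := ext_hom hf nf; split.
- by rewrite v1 ext_one.
- by move=> s t; rewrite vM (homM he).
- by move=> s; rewrite -(hom_star he) vs.
have n1 s m : rn (ml (ext f (v s)) m) <= rn m.
  apply: (le_trans (rn_ml _ _)); rewrite -[leRHS]mul1r ler_wpM2r //.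
  by apply: (le_trans (hom_contr he _)); exact: unirep_rn.
apply: (cont_dense nf) => [s|s x|_ [d [e ->]]]; [exact: ml_lin | exact: n1 |].
have -> : (fun s => ml (ext f (v s)) (ml (f d) e)) = (fun s => ml (f (ml (v s) d)) e).
  by apply/funext => s; rewrite -(extE hf nf).
have bl : blin (fun d => ml (f d) e) by exact: (blin_comp (hom_blin hf) (blin_mlv e)).
have [M hM] := blin_lip bl.
have M1 : 0 < `|M| + 1 by have := normr_ge0 M; lra.
apply/cont_epsP => s eps e0; have e1 : 0 < eps / (`|M| + 1) by rewrite divr_gt0.
apply: filterS ((cont_epsP _).1 (vc d) s _ e1) => t ht.
apply: (le_lt_trans (hM _ _)); move: ht; rewrite ltr_pdivlMr //.
by have := ler_norm M; have := rn_ge0 (ml (v s) d - ml (v t) d); nra.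
Qed.

Lemma unirep_tp (S : setting R G) D E (v : G -> mult D) (w : G -> mult E) :
  is_unirep v -> is_unirep w -> is_unirep (fun s => mtp S (v s) (w s)).
Proof.
move=> uv uw; have [v1 vM vs vc] := uv; have [w1 wM ws wc] := uw; split.
- by rewrite v1 w1 mtp_one.
- by move=> s t; rewrite vM wM mtpM.
- by move=> s; rewrite mtp_star vs ws.
apply: (cont_dense (tp_dense S D E)) => [s|s x|_ [[d e] _ <-]]; first exact: ml_lin.
  apply: (le_trans (rn_ml _ _)); rewrite -[leRHS]mul1r ler_wpM2r //.
  apply: (le_trans (rn_mtp _ _ _)); rewrite -[leRHS]mulr1.
  by apply: ler_pM; rewrite //; exact: unirep_rn.
apply/cont_epsP => s eps e0; rewrite /tpg /=.
have d1 : 0 < rn d + 1 by have := rn_ge0 d; lra.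
have d2 : 0 < rn e + 1 by have := rn_ge0 e; lra.
have e1 : 0 < eps / 2 / (rn e + 1) by rewrite !divr_gt0.
have e2 : 0 < eps / 2 / (rn d + 1) by rewrite !divr_gt0.
apply: filterS2 ((cont_epsP _).1 (vc d) s _ e1) ((cont_epsP _).1 (wc e) s _ e2) => t h1 h2.
rewrite !mtpE; have -> : tp S (ml (v s) d) (ml (w s) e) - tp S (ml (v t) d) (ml (w t) e) =
    tp S (ml (v s) d - ml (v t) d) (ml (w s) e) + tp S (ml (v t) d) (ml (w s) e - ml (w t) e).
  by rewrite (linB (@tp_linl R G S D E _)) (linB (@tp_linr R G S D E _)) addrA subrK.
apply: (le_lt_trans (rnD _ _)).
have h3 := rn_tp S (ml (v s) d - ml (v t) d) (ml (w s) e).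
have h4 := rn_tp S (ml (v t) d) (ml (w s) e - ml (w t) e).
have h5 : rn (ml (w s) e) <= rn e.
  by apply: (le_trans (rn_ml _ _)); rewrite -[leRHS]mul1r ler_wpM2r // unirep_rn.
have h6 : rn (ml (v t) d) <= rn d.
  by apply: (le_trans (rn_ml _ _)); rewrite -[leRHS]mul1r ler_wpM2r // unirep_rn.
move: h1 h2; rewrite !ltr_pdivlMr //.
move: h3 h4 h5 h6 (rn_ge0 (ml (v s) d - ml (v t) d)) (rn_ge0 (ml (w s) e - ml (w t) e)) (rn_ge0 d) (rn_ge0 e).
move: (rn (ml (v s) d - ml (v t) d)) (rn (ml (w s) e - ml (w t) e)) (rn (ml (w s) e)) (rn (ml (v t) d)) (rn d) (rn e).
by move: (rn (tp S _ _)) (rn (tp S _ _)) => a b x y z u p q; nra.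
Qed.

End Unireps.

Section Integration.
Variables (R : realType) (G : lcGroupType) (C : group_cstar R G).
Implicit Types (A B D : cstarType R).

Lemma blin_rko (H : hilbert R) (K : compact_ops H) y : blin (fun x => rko K x y).
Proof.
split=> [c u v|].
  apply: (@kob_inj R H K); rewrite (hom_lin (kob_hom K)) !kob_rko.
  by apply: bop_eq => z; rewrite /= scalerDr !scalerA; congr (_ + _); congr (_ *: _); rewrite mulrC.
exists (rn y) => // u.
rewrite -(hom_iso (kob_hom K) (@kob_inj R H K)) kob_rko; apply: rn_bop_le => [|z].
  by rewrite mulr_ge0.
by rewrite /= rnZ mulrAC ler_wpM2r // mulrC; exact: ip_cs.
Qed.

(** Conjugating by the symmetry [2 q - 1] does not change the group, hence not
    the integrated form. *)
Lemma com_integ_unitary B (g : C -> mult B) (u : mult B) : starhom g -> nondeg g ->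
  star u ** u = mone B -> u ** star u = mone B ->
  (forall s, com u (ext g (gc_u C s))) -> forall c, com u (g c).
Proof.
move=> hg ng uu uu' hu c; pose k c := u ** g c ** star u.
have uM x y : u ** x ** star u ** (u ** y ** star u) = u ** (x ** y) ** star u.
  by rewrite -!smulA (smulA (star u) u) uu mone_l.
have hk : starhom k.
  split=> [a x y|x y|x]; rewrite /k.
  - by rewrite (hom_lin hg) smulDr smulDl smulZr smulZl.
  - by rewrite (homM hg) uM.
  - by rewrite (hom_star hg) !starM starK smulA.
have nk : nondeg k.
  apply/nondegP => P cP hP b; rewrite -[b]ml_one -uu' -[ml _ b]/(ml u (ml (star u) b)).
  apply: (cspanT_ind ng (clsub_pre (blin_ml u) cP)) => _ [a [d ->]].
  by rewrite -[d]ml_one -uu; exact: (hP a (ml u d)).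
have e s : ext k (gc_u C s) = u ** ext g (gc_u C s) ** star u.
  by symmetry; apply: ext_uniq => // a; rewrite /k uM extE.
have gk : g =1 k by apply: gc_uniq => // s; rewrite e (hu s) -smulA uu' mone_r.
by rewrite /com {2}gk /k -!smulA uu mone_r.
Qed.

Lemma com_integ B (g : C -> mult B) (q : mult B) : starhom g -> nondeg g ->
  sa q -> q ** q = q -> (forall s, com q (ext g (gc_u C s))) -> forall c, com q (g c).
Proof.
move=> hg ng sq qq hq c; have [u uE] : exists u, u = q + q - mone B by eexists.
have su : sa u by rewrite uE; apply: saB; [exact: saD | exact: mone_star].
have uu : u ** u = mone B.
  by rewrite uE !(smBl, smBr, smulDl, smulDr) !mone_l !mone_r qq; lmod R; ring.
have cg : com u (g c).
  apply: com_integ_unitary => // [||s]; rewrite ?su //.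
  by rewrite uE; apply: comC; apply: comB; [apply: comD; exact: comC | exact: (com_unit (@mone_l R B) (@mone_r R B))].
have -> : q = hlf R *: (u + mone B) by rewrite uE hlfE; lmod R; field.
apply: comC; apply: comZ; apply: comD; first exact: comC.
exact: (com_unit (@mone_l R B) (@mone_r R B)).
Qed.

Lemma proj_com (H : hilbert R) (P : set H) (E U : bop H) : (forall x, P (E x)) ->
  (forall x, P x -> E x = x) -> star E = E -> (forall x, P x -> P (U x)) ->
  (forall x, P x -> P (star U x)) -> com E U.
Proof.
move=> EP Ei sE hU hU'; have h (V : bop H) : (forall x, P x -> P (V x)) -> E ** V ** E = V ** E.
  by move=> hV; apply: bop_eq => x; apply: Ei; exact/hV/EP.
have h1 := h U hU; have := h _ hU'; move/(congr1 star); rewrite !starM starK sE => h2.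
by rewrite /com -h2 smulA h1.
Qed.

Lemma ext_opm D (H : hilbert R) (pi : mult D -> bop H) : nondeg_rep pi ->
  let th := @opm R H (kops H) \o (pi \o @emb R D) in
  [/\ starhom th, nondeg th & forall m, ext th m = opm (kops H) (pi m)].
Proof.
move=> [hp np] th; have hpe : starhom (pi \o @emb R D) by exact: (hom_comp (@emb_starhom R D) hp).
have hth : starhom th by apply: hom_comp => //; exact: opm_hom.
have nth : nondeg th by exact: (opm_nondeg (kops H) hpe).
split=> // m; symmetry; apply: ext_uniq => // a.
transitivity (opm (kops H) (pi m ** pi (emb a))); first by rewrite (homM (opm_hom (kops H))).
by rewrite -(homM hp) mul_emb.
Qed.

(** Suppose [ml (h c) y] left [Y]. Then [left_rep] gives a vector killed by the adjoints of all
    elements of [Y] but not by the adjoint of [ml (h c) y]. The projection onto the vectors so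
    killed commutes with the group, hence with the integrated form by [com_integ], which is a
    contradiction. *)
Lemma inv_integ D (h : C -> mult D) (Y : set D) : starhom h -> nondeg h -> clsub Y ->
  (forall y d, Y y -> Y (y ** d)) -> (forall s y, Y y -> Y (ml (ext h (gc_u C s)) y)) ->
  forall c y, Y y -> Y (ml (h c) y).
Proof.
move=> hh nh cY rY vY c y Yy; apply: contrapT => nY.
pose N := [set n | Y (star n)].
have cN : clsub N.
  split=> [|a n m Nn Nm|n hn].
  - by rewrite /N /= st0; exact: cls0 cY.
  - by rewrite /N /= starD starZ; exact: (clsL cY).
  - apply: (clsC cY) => e /hn[m Nm nm]; exists (star m) => //.
    by rewrite -starB rn_star.
have lN d n : N n -> N (d ** n) by rewrite /N /= starM; exact: rY.
have [|H [pi [xi [np pN px]]]] := @left_rep R D N (star (ml (h c) y)) cN lN.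
  by rewrite /N /= starK.
have [hp _] := np; have [hth nth thE] := ext_opm np.
pose P0 := [set eta : H | forall n, N n -> pi (emb n) eta = 0].
have cP : clsub P0.
  have -> : P0 = [set eta : H | forall p : {n | N n}, pi (emb (projT1 p)) eta = 0].
    by apply/seteqP; split=> [eta h' [n Nn]|eta h' n Nn]; [exact: h' | exact: (h' (exist _ n Nn))].
  by apply: clsubI => p; exact: (clsub_ker (blin_bop _)).
have [E [EP Ei sE EE]] := proj_op cP.
set v := fun s => ext h (gc_u C s).
have uv : is_unirep v by apply: unirep_ext => //; exact: gc_unirep.
have [_ _ vs _] := uv.
have vP s eta : P0 eta -> P0 (pi (v s) eta).
  move=> h0 n Nn; transitivity ((pi (emb n) ** pi (v s)) eta) => //.
  rewrite -(homM hp) emb_mul; apply: h0; rewrite /N /= mr_star starK vs.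
  exact: vY.
pose K := kops H; pose g := ext (@opm R H K \o (pi \o @emb R D)) \o h.
have hg : starhom g by exact: (hom_comp hh (ext_hom hth nth)).
have ng : nondeg g by exact: nondeg_ext_comp.
have oh := opm_hom K.
have sq : sa (opm K E) by rewrite /sa -(hom_star oh) sE.
have qq : opm K E ** opm K E = opm K E by rewrite -(homM oh) EE.
have cq s : com (opm K E) (ext g (gc_u C s)).
  rewrite ext_comp // thE; apply: hom_com => //.
  apply: (proj_com EP Ei sE); first exact: vP.
  by rewrite -(hom_star hp) vs; exact: vP.
have := com_integ hg ng sq qq cq (star c); rewrite /com /g /= thE -!(homM oh) => /(@opm_inj R H K) cE.
have xi0 : P0 xi by exact: pN.
apply: px; rewrite -[emb _]starK -emb_star starK -mul_emb starM (homM hp) -emb_star -(hom_star hh).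
have : P0 (pi (h (star c)) xi).
  have -> : pi (h (star c)) xi = E (pi (h (star c)) xi); last exact: EP.
  have e1 := congr1 (fun U : bop H => U xi) cE.
  by rewrite -[RHS]/((E ** _) xi) e1 /smul /= Ei.
by apply; rewrite /N /= starK.
Qed.

(** Restrict a faithful representation of [B] to the space on
    which [T] is nondegenerate, where the two integrated forms agree. *)
Lemma integ_intertwine A B (T : A -> B) (W : C -> mult A) (W' : C -> mult B) :
  starhom T -> starhom W -> nondeg W -> starhom W' -> nondeg W' ->
  (forall s z, T (ml (ext W (gc_u C s)) z) = ml (ext W' (gc_u C s)) (T z)) ->
  forall c z, T (ml (W c) z) = ml (W' c) (T z).
Proof.
move=> hT hW nW hW' nW' hs c z.
have [H [pi [np fp]]] := faithful_rep B; have [hp _] := np.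
have [hth nth thE] := ext_opm np.
pose TP := [set x : H | exists a xi, x = pi (emb (T a)) xi].
have cP : clsub (cspan TP) by exact: cspan_clsub.
have [E [EP Ei sE EE]] := proj_op cP.
have appM (U V : bop H) x : (U ** V) x = U (V x) by [].
set v := fun s => ext W' (gc_u C s).
have uv : is_unirep v by apply: unirep_ext => //; exact: gc_unirep.
have [_ _ vs _] := uv.
have vP s eta : cspan TP eta -> cspan TP (pi (v s) eta).
  apply: (cspan_ind (clsub_pre (blin_bop _) cP)) => _ [a [xi ->]] /=.
  by rewrite -appM -(homM hp) mul_emb -hs; apply: cspan_sub; exists (ml (ext W (gc_u C s)) a), xi.
pose K := kops H; pose g := ext (@opm R H K \o (pi \o @emb R B)) \o W'.
have hg : starhom g by exact: (hom_comp hW' (ext_hom hth nth)).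
have ng : nondeg g by exact: nondeg_ext_comp.
have oh := opm_hom K.
have sq : sa (opm K E) by rewrite /sa -(hom_star oh) sE.
have qq : opm K E ** opm K E = opm K E by rewrite -(homM oh) EE.
have cq s : com (opm K E) (ext g (gc_u C s)).
  rewrite ext_comp // thE; apply: hom_com => //.
  apply: (proj_com EP Ei sE); first exact: vP.
  by rewrite -(hom_star hp) vs; exact: vP.
(* The closed span of the range of [T] acting on [H] is invariant under the group, so its projection
   commutes with the integrated form by [com_integ]. *)
have cE b : E ** pi (W' b) = pi (W' b) ** E.
  by have := com_integ hg ng sq qq cq b; rewrite /com /g /= thE -!(homM oh) => /(@opm_inj R H K).
have wP b eta : cspan TP eta -> cspan TP (pi (W' b) eta).
  move=> h0; have -> : pi (W' b) eta = E (pi (W' b) eta); last exact: EP.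
  by rewrite -[RHS]appM cE appM (Ei _ h0).
have tP a eta : cspan TP (pi (emb (T a)) eta) by apply: cspan_sub; exists a, eta.
pose H1 := subh (ClSpace cP).
pose h1 b (eta : H1) : H1 := SubV (S := ClSpace cP) (wP b _ (svP eta)).
pose k1 a (eta : H1) : H1 := SubV (S := ClSpace cP) (tP a (sv eta)).
pose u1 s (eta : H1) : H1 := SubV (S := ClSpace cP) (vP s _ (svP eta)).
have rep1 (X : cstarType R) (f : X -> mult B) (F : X -> H1 -> H1) : starhom f ->
    (forall x eta, sv (F x eta) = pi (f x) (sv eta)) -> is_rep F.
  move=> hf hF; split=> [x c' y y'|c' x y eta|x y eta|x eta eta'].
  - by apply: sv_inj; rewrite sv_lin !hF sv_lin; exact: (bop_lin (pi (f x))).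
  - by apply: sv_inj; rewrite sv_lin !hF (hom_lin hf) (hom_lin hp).
  - by apply: sv_inj; rewrite !hF (homM hf) (homM hp).
  - by rewrite /= !hF bop_adj -(hom_star hp) -(hom_star hf).
have [h hh hE] := rep_hom (rep1 C W' h1 hW' (fun _ _ => erefl)).
have [k hk kE] := rep_hom (rep1 A (@emb R B \o T) k1 (hom_emb_comp hT) (fun _ _ => erefl)).
pose K1 := kops H1; have o1 := opm_hom K1.
have sub1 (P : set H1) : clsub P -> (forall a xi, P (SubV (S := ClSpace cP) (tP a xi))) -> forall eta, P eta.
  move=> cPP hP eta; pose P' := [set x | exists hx : cspan TP x, P (SubV (S := ClSpace cP) hx)].
  suff : P' (sv eta) by case=> hx; congr P; exact: sv_inj.
  apply: (cspan_ind _ _ (svP eta)) => [|_ [a [xi ->]]]; last by exists (tP a xi).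
  split=> [|c' x y [hx Px] [hy Py]|x hx].
  - exists (cls0 cP); have -> : SubV (S := ClSpace cP) (cls0 cP) = 0 by exact: sv_inj.
    exact: cls0 cPP.
  - exists (clsL cP c' hx hy); have -> : SubV (S := ClSpace cP) (clsL cP c' hx hy) =
      c' *: SubV (S := ClSpace cP) hx + SubV (S := ClSpace cP) hy by exact: sv_inj.
    exact: (clsL cPP).
  - have Tx : cspan TP x by apply: (clsC cP) => e /hx[y [hy _] xy]; exists y.
    exists Tx; apply: (clsC cPP) => e /hx[y [hy Py] xy]; exists (SubV (S := ClSpace cP) hy) => //.
pose th1 := @opm R H1 K1 \o k.
have hth1 : starhom th1 by exact: hom_comp.
have nth1 : nondeg th1.
  apply: opm_nondeg => //; apply: cspan_eqT => P cPP hP; apply: sub1 => // a xi.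
  have bl : blin (fun a => SubV (S := ClSpace cP) (tP a xi) : H1).
    have [l [M M0 hM]] := blin_comp (hom_blin (hom_comp (hom_emb_comp hT) hp)) (blin_bopv xi).
    split=> [c' x y|]; first by apply: sv_inj; exact: l.
    by exists M => // x; exact: hM.
  apply: (prod_ind (clsub_pre bl cPP)) => x y /=; apply: hP.
  exists x, (SubV (S := ClSpace cP) (tP y xi)); rewrite kE; apply: sv_inj => /=.
  by rewrite (homM hT) embM (homM hp).
pose g1 := ext th1 \o W; pose g2 := @opm R H1 K1 \o h.
have hg1 : starhom g1 by exact: (hom_comp hW (ext_hom hth1 nth1)).
have ng1 : nondeg g1 by exact: nondeg_ext_comp.
have hg2 : starhom g2 by exact: hom_comp.
have ng2 : nondeg g2.
  apply: opm_nondeg => //; apply: cspan_eqT => P cPP hP; apply: sub1 => // a xi.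
  have bl : blin (fun b : B => SubV (S := ClSpace cP) (EP (pi (emb b) xi)) : H1).
    have [l [M M0 hM]] := blin_comp (blin_comp (@blin_emb R B) (hom_blin hp)) (blin_comp (blin_bopv xi) (blin_bop E)).
    split=> [c' x y|]; first by apply: sv_inj; exact: l.
    by exists M => // x; exact: hM.
  have -> : SubV (S := ClSpace cP) (tP a xi) = SubV (S := ClSpace cP) (EP (pi (emb (T a)) xi)).
    by apply: sv_inj; rewrite /= Ei.
  apply: (cspanT_ind nW' (clsub_pre bl cPP)) => _ [b [d ->]] /=.
  apply: hP; exists b, (SubV (S := ClSpace cP) (EP (pi (emb d) xi))); rewrite hE; apply: sv_inj => /=.
  by rewrite -mul_emb (homM hp) -appM smulA cE.
(* On the restricted space both integrated forms come from the same unitaries [U], so [gc_uniq]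
   identifies them. *)
have hs12 s : ext g1 (gc_u C s) = ext g2 (gc_u C s).
  rewrite ext_comp //.
  have [U UE] : exists U : bop H1, U =1 u1 s.
    apply: (@adjoint_bop R H1 (u1 s) (u1 (s^-1)%g)) => x y /=.
    by rewrite bop_adj -(hom_star hp) vs.
  transitivity (opm K1 U).
    symmetry; apply: ext_uniq => // a.
    have e : U ** k a = k (ml (ext W (gc_u C s)) a).
      apply: bop_eq => x; rewrite -[LHS]/(U (k a x)) UE !kE; apply: sv_inj => /=.
      by rewrite -appM -(homM hp) mul_emb hs.
    transitivity (opm K1 (U ** k a)); first by rewrite (homM o1).
    by rewrite e.
  apply: ext_uniq => // b.
  have e : U ** h b = h (ml (gc_u C s) b).
    apply: bop_eq => x; rewrite -[LHS]/(U (h b x)) UE !hE; apply: sv_inj => /=.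
    by rewrite -appM -(homM hp) extE.
  transitivity (opm K1 (U ** h b)); first by rewrite (homM o1).
  by rewrite e.
have g12 := gc_uniq hg1 ng1 hg2 ng2 hs12 c.
have e1 : k (ml (W c) z) = h c ** k z.
  apply: (@opm_inj R H1 K1); rewrite (homM o1) -[opm K1 (h c)]/(g2 c) -g12 /g1 /=.
  by rewrite -[opm K1 (k z)]/(th1 z) extE.
(* [pi (emb (T a))] vanishes off the restricted space, so the identity proved there is enough. *)
have piE a : pi (emb (T a)) = pi (emb (T a)) ** E.
  rewrite -[RHS]starK starM sE -(hom_star hp) -emb_star -(hom_star hT).
  have -> : E ** pi (emb (T (star a))) = pi (emb (T (star a))).
    by apply: bop_eq => x; apply: Ei; exact: tP.
  by rewrite -(hom_star hp) -emb_star -(hom_star hT) starK.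
have pinj : injective pi.
  apply: (lin_inj (hom_lin hp)) => m hm; apply: mult_eq => a; apply: fp.
  by rewrite -mul_emb (homM hp) hm sm0l.
apply: (@emb_inj R B); rewrite -mul_emb; apply: pinj; rewrite (homM hp) piE (piE z) smulA.
apply: bop_eq => x; rewrite !appM.
pose x1 : H1 := SubV (S := ClSpace cP) (EP x).
have := congr1 (fun U : bop H1 => sv (U x1)) e1; rewrite kE /=.
by rewrite hE kE.
Qed.

End Integration.

Section Generalities.
Variables (R : realType).
Implicit Types (A B D : cstarType R).

Lemma hom_descend A B D (g : A -> B) (p : A -> D) : starhom g -> starhom p ->
  range g = setT -> (forall x, g x = 0 -> p x = 0) ->
  exists2 p' : B -> D, starhom p' & forall x, p' (g x) = p x.
Proof.
move=> hg hp gs gp; have ex b : exists a, g a = b.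
  have [a _ <-] : range g b by rewrite gs.
  by exists a.
pose r b := projT1 (cid (ex b)); have rE b : g (r b) = b by exact: (projT2 (cid (ex b))).
have pE x y : g x = g y -> p x = p y.
  move=> e; apply/eqP; rewrite -subr_eq0 -(linB (hom_lin hp)); apply/eqP/gp.
  by rewrite (linB (hom_lin hg)) e subrr.
exists (p \o r) => [|x]; last by apply: pE; exact: rE.
split=> [c x y|x y|x] /=.
- by rewrite -(hom_lin hp); apply: pE; rewrite (hom_lin hg) !rE.
- by rewrite -(homM hp); apply: pE; rewrite (homM hg) !rE.
- by rewrite -(hom_star hp); apply: pE; rewrite (hom_star hg) !rE.
Qed.

Lemma subv_ind (V : completeNormedModType R[i]) (Q : clspace V) (TP : set V) (P : set (subv Q)) :
  Q `<=` cspan TP -> clsub P -> (forall x, TP x -> exists h : Q x, P (SubV h)) ->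
  forall x, P x.
Proof.
move=> QT cP hP x; pose P' := [set x | exists h : Q x, P (SubV h)].
suff : P' (sv x) by case=> h; congr P; exact: sv_inj.
have cQ := cl_P Q; apply: (cspan_ind _ hP (QT _ (svP x))); split=> [|c u v [hu Pu] [hv Pv]|u hu].
- exists (cls0 cQ); have -> : SubV (cls0 cQ) = 0 by exact: sv_inj.
  exact: cls0 cP.
- exists (clsL cQ c hu hv); have -> : SubV (clsL cQ c hu hv) = c *: SubV hu + SubV hv by exact: sv_inj.
  exact: (clsL cP).
- have Qu : Q u by apply: (clsC cQ) => e /hu[v [hv _] uv]; exists v.
  by exists Qu; apply: (clsC cP) => e /hu[v [hv Pv] uv]; exists (SubV hv).
Qed.

Lemma star_ideal D (Y : set D) : clsub Y -> (forall y d, Y y -> Y (y ** d)) ->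
  clsub [set n | Y (star n)] /\ forall d n, Y (star n) -> Y (star (d ** n)).
Proof.
move=> cY rY; split=> [|d n h]; last by rewrite starM; exact: rY.
split=> [|a n m Nn Nm|n hn].
- by rewrite /= st0; exact: cls0 cY.
- by rewrite /= starD starZ; exact: (clsL cY).
- apply: (clsC cY) => e /hn[m Nm nm]; exists (star m) => //.
  by rewrite -starB rn_star.
Qed.

(** The square of [ml m y] is [star y] times an element of [D], hence in [J]; then [ideal_root]
    applies. *)
Lemma ideal_mulm D (J : set D) (m : mult D) y : clsub J -> (forall d n, J n -> J (d ** n)) ->
  (forall d n, J n -> J (n ** d)) -> J y -> J (ml m y).
Proof.
move=> cJ lJ rJ Jy; apply: (ideal_root cJ lJ); rewrite ml_adj.
by apply: (rJ); exact: (ideal_star cJ lJ rJ).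
Qed.

Lemma ideal_restr D (Q : cstarsub D) : (forall d n, Q n -> Q (d ** n)) ->
  (forall d n, Q n -> Q (n ** d)) ->
  exists2 r : mult D -> mult (subc Q), starhom r & forall m y, sc (ml (r m) y) = ml m (sc y).
Proof.
move=> lQ rQ; have he := hom_comp (sc_hom Q) (@emb_starhom R D).
have [|m a|r hr rE] := @ideal_mult R (subc Q) (mult D) (@emb R D \o @sc R D Q) he.
- by move=> x y /(@emb_inj R D) /sc_inj.
- have h : Q (ml m (sc a)) by apply: ideal_mulm => //; [exact: cs_cl | exact: scP].
  by exists (SubC h) => //; rewrite /= mul_emb.
exists r => // m y; apply: (@emb_inj R D); by rewrite -mul_emb; exact: rE.
Qed.

End Generalities.

(** * Full crossed products by actions: dual coactions, ideals and exactness *)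

Section FullCrossed.
Variables (R : realType) (G : lcGroupType) (S : setting R G).
Implicit Types (al be : action R G).

Section One.
Variables (al : action R G) (F : full_cp S al).

Lemma iA_hom : starhom (iA F). Proof. by case: (fc_cov F). Qed.
Lemma iA_nondeg : nondeg (iA F). Proof. by case: (fc_cov F). Qed.
Definition fv s : mult F := ext (iG F) (gu S s).
Lemma fv_unirep : is_unirep fv. Proof. by case: (fc_cov F). Qed.
Lemma fv_iA s a : fv s ** iA F a = iA F (ac s a) ** fv s.
Proof.
have [_ _ [v1 vM vs _] cov] := fc_cov F; rewrite cov -smulA.
have -> : star (fv s) ** fv s = mone F by rewrite vs -vM mulVg v1.
by rewrite mone_r.
Qed.

Definition fcm a c : F := projT1 (cid (fc_prod F a c)).
Lemma fcmE a c : emb (fcm a c) = iA F a ** iG F c.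
Proof. exact: (projT2 (cid (fc_prod F a c))). Qed.
Lemma fcm_ind (P : set F) : clsub P -> (forall a c, P (fcm a c)) -> forall x, P x.
Proof.
move=> cP hP; apply: (cspanT_ind (fc_dense F) cP) => x [a [c h]].
suff -> : x = fcm a c by exact: hP.
by apply: (@emb_inj R F); rewrite h fcmE.
Qed.
Lemma blin_fcml c : blin (fun a => fcm a c).
Proof.
split=> [k a b|].
  apply: (@emb_inj R F); rewrite (@emb_lin R F) !fcmE (hom_lin iA_hom).
  by rewrite smulDl smulZl.
exists (rn c) => // a.
rewrite -(rn_emb (fcm a c)) fcmE mulrC; apply: (le_trans (rnM_le _ _)).
by apply: ler_pM; rewrite //; [exact: (hom_contr iA_hom) | exact: (hom_contr (iG_hom F))].
Qed.
Lemma ml_iA b a c : ml (iA F b) (fcm a c) = fcm (b ** a) c.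
Proof. by apply: (@emb_inj R F); rewrite -mul_emb !fcmE (homM iA_hom) smulA. Qed.
Lemma iG_gu s c : fv s ** iG F c = iG F (ml (gu S s) c).
Proof. exact: (extE (iG_hom F) (iG_nondeg F)). Qed.
Lemma ml_fv s a c : ml (fv s) (fcm a c) = fcm (ac s a) (ml (gu S s) c).
Proof. by apply: (@emb_inj R F); rewrite -mul_emb !fcmE smulA fv_iA -smulA iG_gu. Qed.

(** The last clause computes [h] on generators: by [gc_uniq] the integrated form of [v] is any [w]
    with the same values on the group. *)
Lemma fc_hom_ex (D : cstarType R) (p : al -> mult D) (v : G -> mult D) : act_covariant p v ->
  exists h : F -> mult D, [/\ starhom h, nondeg h, forall a, ext h (iA F a) = p a,
    forall s, ext h (fv s) = v s &
    forall w : CG S -> mult D, starhom w -> nondeg w -> (forall s, ext w (gu S s) = v s) ->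
      forall a c, h (fcm a c) = p a ** w c].
Proof.
move=> cov; have [h [hh nh hA hG]] := fc_univ F cov; exists h; split=> // w hw nw ws a c.
rewrite -(ext_emb hh nh) fcmE (homM (ext_hom hh nh)) hA; congr (_ ** _).
pose k := ext h \o iG F; have hk : starhom k by exact: (hom_comp (iG_hom F) (ext_hom hh nh)).
have nk : nondeg k by apply: nondeg_ext_comp => //; [exact: iG_hom | exact: iG_nondeg].
apply: (@gc_uniq _ _ (CG S) D k w hk nk hw nw) => s.
by rewrite ext_comp ?hG ?ws //; [exact: iG_hom | exact: iG_nondeg].
Qed.

Lemma fcm_eq (D : cstarType R) (h k : F -> D) : starhom h -> starhom k ->
  (forall a c, h (fcm a c) = k (fcm a c)) -> h =1 k.
Proof. by move=> hh hk; apply: fcm_ind; exact: (clsub_eq (hom_blin hh) (hom_blin hk)). Qed.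

End One.

Lemma integP (D : cstarType R) (v : G -> mult D) : is_unirep v ->
  [/\ starhom (integ (S := S) v), nondeg (integ (S := S) v)
    & forall s, ext (integ (S := S) v) (gu S s) = v s].
Proof.
move=> uv; rewrite /integ; case: xgetP => [h _ //|nh].
by have [h hP] := gc_univ (CG S) uv; case: (nh h).
Qed.

Section Comor.
Variables (al be : action R G) (F : full_cp S al) (F' : full_cp S be) (f : al -> be).
Variables (phi : F -> F').
Hypotheses (fE : is_acmor f) (hphi : starhom phi)
  (phiE : forall a c, phi (fcm F a c) = fcm F' (f a) c).

(** The group part of the dual coaction, that is, the integrated form of [s |-> fv s (x) gu s]. *)
Definition fW (ga : action R G) (E : full_cp S ga) : CG S -> mult (tens S E (CG S)) :=
  ext (htp (S := S) (iG E) (@emb R (CG S))) \o @deltaG R G S.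

Lemma fWP (ga : action R G) (E : full_cp S ga) : [/\ starhom (fW E), nondeg (fW E)
  & forall s, ext (fW E) (gu S s) = mtp S (fv E s) (gu S s)].
Proof.
have ug : is_unirep (gu S) by exact: gc_unirep.
have [h1 n1 e1] := integP (unirep_tp S ug ug).
have h2 := htp_hom S (iG_hom E) (@emb_starhom R (CG S)).
have n2 := htp_nondeg S (iG_hom E) (@emb_starhom R (CG S)) (iG_nondeg E) (@nondeg_emb R (CG S)).
split; first exact: (hom_comp h1 (ext_hom h2 n2)).
  exact: nondeg_ext_comp.
move=> s; rewrite ext_comp // e1 ext_htp_mtp ?ext_embE //.
- exact: iG_hom.
- exact: emb_starhom.
- exact: iG_nondeg.
- exact: nondeg_emb.
Qed.

Lemma phi_iA a x : phi (ml (iA F a) x) = ml (iA F' (f a)) (phi x).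
Proof.
move: x; apply: fcm_ind => [|b c /=].
  exact: (clsub_eq (blin_comp (blin_ml _) (hom_blin hphi)) (blin_comp (hom_blin hphi) (blin_ml _))).
by rewrite ml_iA !phiE ml_iA (homM fE.1).
Qed.
Lemma phi_fv s x : phi (ml (fv F s) x) = ml (fv F' s) (phi x).
Proof.
move: x; apply: fcm_ind => [|b c /=].
  exact: (clsub_eq (blin_comp (blin_ml _) (hom_blin hphi)) (blin_comp (hom_blin hphi) (blin_ml _))).
by rewrite ml_fv !phiE ml_fv fE.2.
Qed.

Local Notation T := (tmap (S := S) phi (@id (CG S))).
Let hT : starhom T. Proof. exact: (tmap_hom S hphi (@hom_id R (CG S))). Qed.
Let TE x c : T (tp S x c) = tp S (phi x) c.
Proof. exact: (tmapE S hphi (@hom_id R (CG S))). Qed.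

Lemma T_mtp (m : mult F) (m' : mult F') (n : mult (CG S)) z :
  (forall x, phi (ml m x) = ml m' (phi x)) -> T (ml (mtp S m n) z) = ml (mtp S m' n) (T z).
Proof.
move=> h; move: z; apply: blin_eq => [||x c].
- exact: (blin_comp (blin_ml _) (hom_blin hT)).
- exact: (blin_comp (hom_blin hT) (blin_ml _)).
by rewrite mtpE !TE mtpE h.
Qed.

Lemma T_co x z : T (ml (fc_co x) z) = ml (fc_co (phi x)) (T z).
Proof.
have [h1 n1 e1] := fWP F; have [h2 n2 e2] := fWP F'.
have hc := coa_hom (fc_coP F); have hc' := coa_hom (fc_coP F').
move: x; apply: fcm_ind => [|a c /=].
  apply: clsub_eq.
    exact: (blin_comp (blin_comp (hom_blin hc) (blin_mlv z)) (hom_blin hT)).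
  exact: (blin_comp (blin_comp (hom_blin hphi) (hom_blin hc')) (blin_mlv _)).
rewrite (fc_coE (fcmE F a c)) phiE (fc_coE (fcmE F' (f a) c)) /=.
rewrite (T_mtp _ _ (phi_iA a)); congr (ml _ _).
apply: (@integ_intertwine R G (CG S) _ _ T (fW F) (fW F')) => // s w.
by rewrite -/(gu S s) e1 e2 (@T_mtp _ (fv F' s)) //; exact: phi_fv.
Qed.

(** [T_co] compares both sides on the range of [T] only, which may be degenerate. The difference [u]
    kills the closed right ideal [Q] generated by that range, and the adjoint of [x'] lies in [Q];
    since [u = T y - x'], this gives [u ** star u = 0]. *)
Lemma cp_comor : is_comor (A := Coaction (fc_coP F)) (B := Coaction (fc_coP F')) phi.
Proof.
split=> // x c y yE /=; rewrite /= in yE.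
have [x' x'E] := ((coa_tilde (fc_coP F')) (phi x) c).1; rewrite x'E; congr emb.
have [h2 n2 e2] := fWP F'; have hc' := coa_hom (fc_coP F').
pose Q := cspan [set w | exists x1 d (c1 : CG S), w = tp S (phi x1 ** d) c1].
have cQ : clsub Q by exact: cspan_clsub.
have rQ w z : Q w -> Q (w ** z).
  apply: (cspan_ind (clsub_pre (blin_mulr z) cQ)) => _ [x1 [d [c1 ->]]] /=; move: z.
  apply: (tp_ind (clsub_pre (blin_mull _) cQ)) => d' c' /=.
  by rewrite tpM; apply: cspan_sub; exists x1, (d ** d'), (c1 ** c'); rewrite smulA.
pose u := T y - x'.
have uT z : u ** T z = 0.
  apply/eqP; rewrite /u smBl subr_eq0 -(homM hT); apply/eqP.
  have -> : y ** z = ml (fc_co x) (ml (mtp S (mone F) (emb c)) z).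
    by rewrite -[LHS]/(ml (emb y) z) yE.
  rewrite T_co (@T_mtp _ (mone F')) //.
  by rewrite -[RHS]/(ml (emb x') (T z)) -x'E.
have uQ w : Q w -> u ** w = 0.
  apply: (cspan_ind (clsub_ker (blin_mull u))) => _ [x1 [d [c1 ->]]] /=.
  apply: (prod_ind (clsub_pre (@blin_tpr R G S F' (CG S) _) (clsub_ker (blin_mull u)))) => c2 c3 /=.
  by rewrite -tpM -TE smulA uT sm0l.
have iAQ a (c1 : CG S) w : Q (ml (mtp S (iA F' (f a)) (emb c1)) w).
  move: w; apply: (tp_ind (clsub_pre (blin_ml _) cQ)) => d c2 /=; rewrite mtpE.
  have bl := blin_comp (blin_ml (iA F' (f a))) (@blin_tpl R G S F' (CG S) (ml (emb c1) c2)).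
  apply: (cspanT_ind (iG_nondeg F') (clsub_pre bl cQ)) => _ [c5 [d' ->]] /=.
  apply: cspan_sub; exists (fcm F a c5), d', (c1 ** c2); congr (tp _ _ _).
  by rewrite phiE -[RHS]/(ml (emb _) d') fcmE.
have x'Q z : Q (star x' ** z).
  rewrite -[star x' ** z]/(ml (emb (star x')) z) emb_star -x'E starM mtp_star mone_star -emb_star.
  rewrite -(hom_star hc') -(hom_star hphi) /=; move: (star x).
  apply: fcm_ind => [|a c0 /=].
    apply: (clsub_pre _ cQ).
    exact: (blin_comp (blin_comp (blin_comp (hom_blin hphi) (hom_blin hc')) (blin_mlv z)) (blin_ml _)).
  rewrite phiE (fc_coE (fcmE F' (f a) c0)) /=; move: (ml _ z) => w.
  rewrite -[ml _ (ml _ w)]/(ml (_ ** _) w) mtpM mone_l mone_r; exact: iAQ.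
have [cN lN] := star_ideal cQ rQ.
have Nx' : Q (star x').
  by apply: (ideal_root cN lN); rewrite /= (sa_starM x'); exact: x'Q.
suff : u = 0 by move/eqP; rewrite subr_eq0 => /eqP.
apply: (can_inj starK); rewrite st0; apply: star_smul_eq0.
by rewrite starK {2}/u starB -(hom_star hT) smBr uT (uQ _ Nx') subr0.
Qed.

End Comor.

Section Ideal.
Variables (al be : action R G) (F : full_cp S al) (F' : full_cp S be) (f : al -> be).
Hypotheses (fE : is_acmor f) (fI : forall a b, range f (b ** f a)).

(** The crossed product of the ideal [f al], seen inside [F']. It is a right ideal by construction;
    invariance under [iA F'] and the group, with [inv_integ], makes it a left ideal. *)
Definition fcJ : set F' := cspan [set w | exists a d, w = ml (iA F' (f a)) d].
Lemma fcJ_cl : clsub fcJ. Proof. exact: cspan_clsub. Qed.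
Lemma fcJr y d : fcJ y -> fcJ (y ** d).
Proof.
apply: (cspan_ind (clsub_pre (blin_mulr d) fcJ_cl)) => _ [a [d' ->]] /=.
by apply: cspan_sub; exists a, (d' ** d); rewrite -mlM.
Qed.
Let iAJ b y : fcJ y -> fcJ (ml (iA F' b) y).
Proof.
apply: (cspan_ind (clsub_pre (blin_ml _) fcJ_cl)) => _ [a [d' ->]] /=.
have [a' _ e] := fI a b; apply: cspan_sub; exists a', d'; rewrite e.
by rewrite (homM (iA_hom F')).
Qed.
Let iGJ c y : fcJ y -> fcJ (ml (iG F' c) y).
Proof.
apply: (@inv_integ R G (CG S) F' (iG F') fcJ) => //.
- exact: iG_hom.
- exact: iG_nondeg.
- exact: fcJ_cl.
- exact: fcJr.
move=> s z; apply: (cspan_ind (clsub_pre (blin_ml _) fcJ_cl)) => _ [a [d ->]] /=.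
apply: cspan_sub; exists (ac s a), (ml (fv F' s) d); rewrite fE.2.
by rewrite -[LHS]/(ml (fv F' s ** iA F' (f a)) d) fv_iA.
Qed.
Lemma fcJl d y : fcJ y -> fcJ (d ** y).
Proof.
move=> Jy; move: d; apply: (fcm_ind (clsub_pre (blin_mulr y) fcJ_cl)) => a c /=.
by rewrite -[fcm F' a c ** y]/(ml (emb (fcm F' a c)) y) fcmE; apply/iAJ/iGJ.
Qed.

Lemma fcJ_fcm a c : fcJ (fcm F' (f a) c).
Proof.
have bl := blin_comp (hom_blin fE.1) (blin_fcml F' c).
apply: (prod_ind (clsub_pre bl fcJ_cl)) => a1 a2 /=.
by rewrite (homM fE.1) -ml_iA; apply: cspan_sub; exists a1, (fcm F' (f a2) c).
Qed.

(** The pair formed by [iA F' \o f] and the group may be degenerate on [F'], so the universal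
    property is applied in the multipliers of the ideal [fcJ], to which multipliers of [F']
    restrict. *)
Lemma cp_ideal : exists phi : F -> F', [/\ starhom phi,
  forall a c, phi (fcm F a c) = fcm F' (f a) c & range phi = fcJ].
Proof.
pose Q := CStarSub fcJ_cl (fun x y _ Jy => @fcJl x y Jy) (fun x => @ideal_star R F' fcJ fcJ_cl (fun d n => @fcJl d n) (fun d n => @fcJr n d) x).
have [r hr rE] := @ideal_restr R F' Q (fun d n => @fcJl d n) (fun d n => @fcJr n d).
have r1 : r (mone F') = mone (subc Q) by apply: mult_eq => y; apply: sc_inj; rewrite rE.
have nr (B : cstarType R) (w : B -> mult F') : starhom w -> nondeg w -> nondeg (r \o w).
  move=> hw nw; apply/nondegP => P cP hP; apply: (prod_ind cP) => y z.
  have bl : blin (fun d : F' => SubC (S := Q) (@fcJl d _ (scP z))).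
    have [l [M M0 hM]] := blin_mulr (sc z).
    by split=> [k a b|]; [apply: sv_inj; exact: l | exists M].
  have -> : y ** z = SubC (S := Q) (@fcJl (sc y) _ (scP z)) by exact: sc_inj.
  apply: (cspanT_ind nw (clsub_pre bl cP)) => _ [b [d ->]] /=.
  have -> : SubC (S := Q) (@fcJl (ml (w b) d) _ (scP z)) = ml (r (w b)) (SubC (S := Q) (@fcJl d _ (scP z))).
    by apply: sc_inj; rewrite rE /sc /= mlM.
  exact: hP.
have hA := hom_comp fE.1 (iA_hom F').
have np : nondeg (r \o (iA F' \o f)).
  apply/nondegP => P cP hP.
  apply: (@subv_ind R _ _ [set w | exists a d, w = ml (iA F' (f a)) d] P) => // _ [a [d ->]].
  have hin x : fcJ (ml (iA F' (f x)) d) by apply: cspan_sub; exists x, d.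
  exists (hin a).
  have bl : blin (fun a => SubC (S := Q) (hin a)).
    have [l [M M0 hM]] := blin_comp (hom_blin hA) (blin_mlv d).
    by split=> [k x y|]; [apply: sv_inj; exact: l | exists M].
  apply: (prod_ind (clsub_pre bl cP)) => a1 a2 /=.
  have -> : SubC (S := Q) (hin (a1 ** a2)) = ml (r (iA F' (f a1))) (SubC (S := Q) (hin a2)).
    by apply: sc_inj; rewrite rE /sc /= (homM fE.1) (homM (iA_hom F')).
  exact: hP.
have [v1 vM vs vc] := fv_unirep F'.
have cov : act_covariant (al := al) (r \o (iA F' \o f)) (r \o fv F').
  split=> //; first exact: (hom_comp hA hr).
  - split=> /= [|s t|s|y].
    + by rewrite v1.
    + by rewrite vM (homM hr).
    + by rewrite -(hom_star hr) vs.
    + apply/cont_epsP => s e e0; apply: filterS ((cont_epsP _).1 (vc (sc y)) s e e0) => t.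
      by rewrite -rn_sc (linB (hom_lin (sc_hom Q))) !rE.
  - by move=> s a; rewrite /= fE.2 -(hom_star hr) -!(homM hr); case: (fc_cov F') => _ _ _ ->.
have [h [hh nh _ _ hE]] := fc_hom_ex F cov.
have {hE} hE a c : h (fcm F a c) = @emb R (subc Q) (SubC (S := Q) (@fcJ_fcm a c)).
  rewrite (hE (r \o iG F')).
  - transitivity (r (emb (fcm F' (f a) c))); first by rewrite fcmE (homM hr).
    by apply: mult_eq => y; apply: sc_inj; rewrite rE.
  - exact: (hom_comp (iG_hom F') hr).
  - by apply: nr; [exact: iG_hom | exact: iG_nondeg].
  move=> s; symmetry; apply: ext_uniq.
  - exact: (hom_comp (iG_hom F') hr).
  - by apply: nr; [exact: iG_hom | exact: iG_nondeg].
  by move=> c'; rewrite /= -(homM hr) iG_gu.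
have [x|k hk kE] := hom_factor hh (@emb_starhom R (subc Q)) (@emb_inj R (subc Q)).
  apply: (fcm_ind (clsub_pre (hom_blin hh) (hom_range_clsub (@emb_starhom R (subc Q))))) => a c /=.
  by rewrite hE; exists (SubC (S := Q) (@fcJ_fcm a c)).
have kf a c : sc (k (fcm F a c)) = fcm F' (f a) c.
  by have -> : k (fcm F a c) = SubC (S := Q) (@fcJ_fcm a c) by apply: (@emb_inj R (subc Q)); rewrite kE hE.
have hsk : starhom (@sc R F' Q \o k) by exact: (hom_comp hk (sc_hom Q)).
exists (@sc R F' Q \o k); split=> //.
apply/seteqP; split=> [_ [x _ <-]|]; first exact: (scP (k x)).
apply: (cspan_ind (hom_range_clsub hsk)) => _ [a [d ->]].
apply: (fcm_ind (clsub_pre (blin_ml (iA F' (f a))) (hom_range_clsub hsk))) => b c /=.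
rewrite ml_iA; have [a' _ e] : range f (f a ** b).
  rewrite -[f a ** b]starK starM -(hom_star fE.1).
  have [a' _ <-] := fI (star a) (star b); exists (star a') => //.
  by rewrite (hom_star fE.1).
by exists (fcm F a' c) => //=; rewrite kf e.
Qed.

Hypothesis fi : injective f.
(** [be] acts on the ideal by multipliers, which gives it a covariant pair in the multipliers of
    [F]; its integrated form [k] inverts [phi] from the left, up to [emb]. *)
Lemma cp_ideal_inj (phi : F -> F') : starhom phi ->
  (forall a c, phi (fcm F a c) = fcm F' (f a) c) -> injective phi.
Proof.
move=> hphi phiE.
have [rh hrh rhE] := ideal_mult fE.1 fi (fun b a => fI a b).
have hA := iA_hom F; have nA := iA_nondeg F.
pose p b := ext (iA F) (rh b).
have pf a : p (f a) = iA F a.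
  rewrite /p; have -> : rh (f a) = emb a; last exact: ext_emb.
  by apply: mult_eq => b; apply: fi; rewrite rhE /= (homM fE.1).
have [v1 vM vs vc] := fv_unirep F.
have vV s : star (fv F s) ** fv F s = mone F by rewrite vs -vM mulVg v1.
have hp : starhom p by exact: (hom_comp hrh (ext_hom hA nA)).
have np : nondeg p.
  apply/nondegP => P cP hP; have /nondegP := nA; apply => // a b.
  by rewrite -pf; exact: hP.
have ac_inv s (b : be) : ac s (ac s^-1%g b) = b.
  by rewrite -(actM (acP be)) mulgV (act1 (acP be)).
have cov : act_covariant (al := be) p (fv F).
  split=> //.
  move=> s b; symmetry; apply: ext_uniq => // a.
  have al_inv : ac s (ac s^-1%g a) = a by rewrite -(actM (acP al)) mulgV (act1 (acP al)).
  have e1 : ml (rh (ac s b)) a = ac s (ml (rh b) (ac s^-1%g a)).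
    apply: fi; rewrite rhE fE.2 rhE (homM (act_hom (acP be) s)) fE.2 ac_inv //.
  have covF t x : iA F (ac t x) = fv F t ** iA F x ** star (fv F t) by case: (fc_cov F).
  rewrite e1 covF -(extE hA nA) -/(p b) -!smulA; congr (_ ** (_ ** _)).
  rewrite -{1}al_inv covF !smulA vV mone_l //.
have [k [hk nk kA ks kE]] := fc_hom_ex F' cov.
have kphi x : k (phi x) = emb x.
  move: x; apply: fcm_ind => [|a c /=].
    exact: (clsub_eq (hom_blin (hom_comp hphi hk)) (@blin_emb R F)).
  by rewrite phiE (kE (iG F)) ?pf ?fcmE //; [exact: iG_hom | exact: iG_nondeg].
by move=> x y e; apply: (@emb_inj R F); rewrite -!kphi e.
Qed.

End Ideal.

Section Quotient.
Variables (al be ga : action R G) (F : full_cp S al) (F' : full_cp S be) (F'' : full_cp S ga).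
Variables (f : al -> be) (g : be -> ga) (phi : F -> F') (psi : F' -> F'').
Hypotheses (fE : is_acmor f) (gE : is_acmor g) (sx : short_exact f g).
Hypotheses (hphi : starhom phi) (phiE : forall a c, phi (fcm F a c) = fcm F' (f a) c).
Hypotheses (hpsi : starhom psi) (psiE : forall a c, psi (fcm F' a c) = fcm F'' (g a) c).

Let fI a b : range f (b ** f a).
Proof.
have [_ fk _] := sx; rewrite fk /= (homM gE.1).
have -> : g (f a) = 0; last by rewrite sm0r.
by have : range f (f a) by [exists a]; rewrite fk.
Qed.

(** In the middle: a representation that kills [fcJ] but not [x] also kills [iA] on the range of
    [f], so it descends to the quotient action and factors through [psi]; then [psi x = 0] is
    impossible. *)
Lemma cp_exact_seq : short_exact phi psi.
Proof.
have [fi fk gs] := sx; have [k0 [hk0 k0E k0r]] := cp_ideal F F' fE fI.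
have pk : phi = k0 by apply/funext; apply: (fcm_eq hphi hk0) => a c; rewrite phiE k0E.
have gf a : g (f a) = 0 by have : range f (f a) by [exists a]; rewrite fk.
split; first exact: (cp_ideal_inj fE fI fi hphi phiE).
- rewrite pk k0r; apply/seteqP; split=> [x|x /= px].
    rewrite -k0r => -[y _ <-]; move: y; apply: fcm_ind => [|a c /=].
      exact: (clsub_ker (hom_blin (hom_comp hk0 hpsi))).
    by rewrite k0E psiE gf (lin0 (blin_fcml F'' c).1).
  apply: contrapT => nJ.
  have [H [pi [np pJ px0]]] := ideal_rep (@fcJ_cl _ _ F' f) (fun d n => @fcJl _ _ F' f fE fI d n)
    (fun d n => @fcJr _ _ F' f n d) nJ.
  have [hth nth thE] := ext_opm np; have [hp nd] := np.
  set th := (opm _ \o _) in hth nth thE.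
  have hA := hom_comp (iA_hom F') (ext_hom hth nth).
  have kill b : g b = 0 -> ext th (iA F' b) = 0.
    move=> gb; have [a _ <-] : range f b by rewrite fk.
    rewrite thE; have -> : pi (iA F' (f a)) = 0; last exact: (lin0 (hom_lin (opm_hom _))).
    apply: bop_eq => y; apply: (cspanT_ind nd (clsub_ker (blin_bop _))) => _ [d [xi ->]] /=.
    transitivity ((pi (iA F' (f a)) ** pi (emb d)) xi) => //.
    rewrite -(homM hp) mul_emb pJ //; apply: cspan_sub; by exists a, d.
  have [p hp' pE] := hom_descend gE.1 hA gs kill.
  have ut : is_unirep (fun s => ext th (fv F' s)) by apply: unirep_ext => //; exact: fv_unirep.
  have cov : act_covariant (al := ga) p (fun s => ext th (fv F' s)).
    split=> //.
    - have /nondegP nn := nondeg_ext_comp (iA_hom F') (iA_nondeg F') hth nth.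
      by apply/nondegP => P cP hP; apply: nn => // b y; rewrite -pE; exact: hP.
    - move=> s c; have [b _ <-] : range g c by rewrite gs.
      rewrite -gE.2 !pE /= -(hom_star (ext_hom hth nth)) -!(homM (ext_hom hth nth)).
      by case: (fc_cov F') => _ _ _ ->.
  have [k [hk nk kA ks kE]] := fc_hom_ex F'' cov.
  have kpsi y : k (psi y) = th y.
    move: y; apply: fcm_ind => [|b c /=].
      exact: (clsub_eq (hom_blin (hom_comp hpsi hk)) (hom_blin hth)).
    rewrite psiE (kE (ext th \o iG F')).
    - by rewrite pE /= -(homM (ext_hom hth nth)) -fcmE ext_emb.
    - exact: (hom_comp (iG_hom F') (ext_hom hth nth)).
    - by apply: nondeg_ext_comp => //; [exact: iG_hom | exact: iG_nondeg].
    - by move=> s; rewrite ext_comp //; [exact: iG_hom | exact: iG_nondeg].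
  apply: px0; apply: (@opm_inj R H (kops H)).
  by rewrite -[LHS]/(th x) -kpsi px (lin0 (hom_lin hk)) (lin0 (hom_lin (opm_hom _))).
- apply/seteqP; split=> // z _; move: z; apply: (fcm_ind (hom_range_clsub hpsi)) => c d.
  by have [b _ <-] : range g c by [rewrite gs]; exists (fcm F' b d).
Qed.

End Quotient.

End FullCrossed.

(** * The Haar integral and continuity of unitary representations *)

Section ContinuousCalculus.
Variables (R : realType) (T : topologicalType).
Implicit Types (V W : normedModType R[i]).

Lemma cont_lip V W (f : T -> V) (h : V -> W) (M : R) : continuous f ->
  (forall x y, rn (h x - h y) <= M * rn (x - y)) -> continuous (h \o f).
Proof.
move=> /cont_epsP hf hh; apply/cont_epsP => s e e0.
have M1 : 0 < `|M| + 1 by have := normr_ge0 M; lra.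
apply: filterS (hf s (e / (`|M| + 1)) _) => [t|]; last by rewrite divr_gt0.
rewrite ltr_pdivlMr // => h1; apply: (le_lt_trans (hh _ _)).
by have := ler_norm M; have := rn_ge0 (f s - f t); nra.
Qed.

Lemma cont_blin V W (f : T -> V) (h : V -> W) : continuous f -> blin h -> continuous (h \o f).
Proof. by move=> hf /blin_lip[M hM]; exact: cont_lip hf hM. Qed.

Definition ceps (f : T -> R[i]) := forall s (e : R), 0 < e -> \forall t \near s, rn (f s - f t) < e.

Lemma cepsP (f : T -> R[i]) : continuous (f : T -> R[i]^o) <-> ceps f.
Proof. exact: (@cont_epsP R T R[i]^o f). Qed.

Lemma ceps_cst c : ceps (fun=> c).
Proof. by move=> s e e0; apply: nearW => t; rewrite subrr rn0. Qed.

Lemma cepsD (f g : T -> R[i]) : ceps f -> ceps g -> ceps (fun t => f t + g t).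
Proof.
move=> hf hg s e e0; have e2 : 0 < e / 2 by lra.
apply: filterS2 (hf s _ e2) (hg s _ e2) => t h1 h2; rewrite opprD addrACA.
by apply: (le_lt_trans (rnD _ _)); lra.
Qed.

Lemma ceps_lip (f : T -> R[i]) (h : R[i] -> R[i]) (M : R) : ceps f ->
  (forall x y, rn (h x - h y) <= M * rn (x - y)) -> ceps (fun t => h (f t)).
Proof.
move=> hf hh s e e0; have M1 : 0 < `|M| + 1 by have := normr_ge0 M; lra.
apply: filterS (hf s (e / (`|M| + 1)) _) => [t|]; last by rewrite divr_gt0.
rewrite ltr_pdivlMr // => h1; apply: (le_lt_trans (hh _ _)).
by have := ler_norm M; have := rn_ge0 (f s - f t); nra.
Qed.

Lemma cepsM (f g : T -> R[i]) : ceps f -> ceps g -> ceps (fun t => f t * g t).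
Proof.
move=> hf hg s e e0; have f0 := rn_ge0 (f s); have g0 := rn_ge0 (g s).
have d2 : 0 < e / 2 / (rn (f s) + 1) by rewrite !divr_gt0 //; lra.
have [d3 [d30 d31 d32]] : exists d : R, [/\ 0 < d, d <= 1 & d <= e / 2 / (rn (f s) + 1)].
  exists (Num.min 1 (e / 2 / (rn (f s) + 1))).
  by rewrite lt_min ltr01 d2 !ge_min !lexx orbT.
have d1 : 0 < e / 2 / (rn (g s) + 1 + 1) by rewrite !divr_gt0 //; lra.
apply: filterS2 (hf s _ d1) (hg s _ d30) => t h1 h2.
move: h1 d32; rewrite ltr_pdivlMr; last lra.
rewrite ler_pdivlMr; last lra.
have -> : f s * g s - f t * g t = f s * (g s - g t) + (f s - f t) * g t by ring.
move=> h1 d32; apply: (le_lt_trans (rnD _ _)); rewrite !rnM.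
have h5 : rn (g t) <= rn (g s) + 1.
  by have := rn_leD (g t) (g s); rewrite [rn (g t - g s)]rnC; lra.
have := rn_ge0 (f s - f t); have := rn_ge0 (g s - g t); have := rn_ge0 (g t).
move: h1 h2 h5 d32 d31; move: (rn (f s - f t)) (rn (g s - g t)) (rn (g t)) (rn (g s)) (rn (f s)) f0 g0 => x y z u v.
clear; nra.
Qed.
End ContinuousCalculus.

Section Haar.
Variables (R : realType) (G : lcGroupType) (mu : haar R G).
Implicit Types (f g : G -> R[i]) (s t : G).
Local Notation "\int f" := (hr_int mu f) (at level 10).

Lemma cont_mull (V : normedModType R[i]) (f : G -> V) s : continuous f ->
  continuous (fun t => f (s * t)%g).
Proof.
move=> hf t; apply: (@continuous_comp _ _ _ (fun t => (s * t)%g) f); last exact: hf.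
apply: (@continuous_comp _ _ _ (fun t => (s, t)) (fun x : G * G => (x.1 * x.2)%g)).
  by apply: cvg_pair; [exact: cvg_cst | exact: cvg_id].
exact: mulg_cont.
Qed.

Lemma ccP f : cc f <-> ceps f /\ exists2 K : set G, compact K & forall s, ~ K s -> f s = 0.
Proof. by rewrite /cc; split=> -[/cepsP ? ?]. Qed.

Lemma cc_lin (c : R[i]) f g : cc f -> cc g -> cc (fun t => c * f t + g t).
Proof.
move=> /ccP[hf [K cK Kf]] /ccP[hg [L cL Lg]]; apply/ccP; split.
  by apply: cepsD => //; apply: cepsM => //; exact: ceps_cst.
exists (K `|` L) => [|t /not_orP[/Kf -> /Lg ->]]; first exact: compactU.
by rewrite mulr0 addr0.
Qed.
Lemma cc0 : cc (fun _ : G => 0 : R[i]).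
Proof. by apply/ccP; split; [exact: ceps_cst | exists set0 => //; exact: compact0]. Qed.
Lemma ccM f (h : G -> R[i]) : cc f -> ceps h -> cc (fun t => f t * h t).
Proof.
move=> /ccP[hf [K cK Kf]] hh; apply/ccP; split; first exact: cepsM.
by exists K => // t /Kf ->; rewrite mul0r.
Qed.
Lemma cc_lip f (h : R[i] -> R[i]) (M : R) : cc f -> h 0 = 0 ->
  (forall x y, rn (h x - h y) <= M * rn (x - y)) -> cc (fun t => h (f t)).
Proof.
move=> /ccP[hf [K cK Kf]] h0 hh; apply/ccP; split; first exact: ceps_lip hf hh.
by exists K => // t /Kf ->.
Qed.
Lemma cc_conj f : cc f -> cc (fun t => (f t)^*).
Proof.
move=> hf; apply: (@cc_lip f Num.conj 1) => //; first exact: rmorph0.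
by move=> x y; rewrite -rmorphB rn_conj mul1r.
Qed.
Lemma cc_re f : cc f -> cc (fun t => (Re (f t))%:C%C).
Proof.
move=> hf; apply: (@cc_lip f (fun z => (Re z)%:C%C) 1) => // x y.
by rewrite -rmorphB rn_real mul1r -raddfB; exact: Re_rn.
Qed.
Lemma cc_im f : cc f -> cc (fun t => (Im (f t))%:C%C).
Proof.
move=> hf; apply: (@cc_lip f (fun z => (Im z)%:C%C) 1) => // x y.
by rewrite -rmorphB rn_real mul1r -raddfB; exact: Im_rn.
Qed.
Lemma cc_abs f : cc f -> cc (fun t => (rn (f t))%:C%C).
Proof.
move=> hf; apply: (@cc_lip f (fun z => (rn z)%:C%C) 1) => [//||x y]; first by rewrite rn0.
rewrite -rmorphB rn_real mul1r; have := rn_leD x y; have := rn_leD y x.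
by rewrite [rn (y - x)]rnC ler_norml => h1 h2; apply/andP; split; lra.
Qed.
Lemma cc_transl f s : cc f -> cc (fun t => f (s * t)%g).
Proof.
move=> [hf [K cK Kf]]; split; first exact: (@cont_mull R[i]^o).
exists ((fun t => s^-1 * t)%g @` K).
  apply: continuous_compact => //; apply: continuous_subspaceT => t.
  apply: (@continuous_comp _ _ _ (fun t => (s^-1, t)%g) (fun x : G * G => (x.1 * x.2)%g)).
    by apply: cvg_pair; [exact: cvg_cst | exact: cvg_id].
  exact: mulg_cont.
by move=> t h; apply: Kf => Kt; apply: h; exists (s * t)%g => //; rewrite mulgA mulVg mul1g.
Qed.

Lemma int0 : \int (fun=> 0) = 0.
Proof.
have := hr_lin mu 1 cc0 cc0; rewrite [X in _ = X + _]mul1r.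
have -> : (fun t : G => 1 * 0 + 0) = (fun=> 0 : R[i]) by apply/funext => t; rewrite mulr0 addr0.
by move/eqP; rewrite -subr_eq0 opprD addrA subrr sub0r oppr_eq0 => /eqP.
Qed.
Lemma intZ c f : cc f -> \int (fun t => c * f t) = c * \int f.
Proof.
move=> hf; have := hr_lin mu c hf cc0; rewrite int0 addr0 => <-; congr hr_int.
by apply/funext => t; rewrite addr0.
Qed.
Lemma intB f g : cc f -> cc g -> \int (fun t => f t - g t) = \int f - \int g.
Proof.
move=> hf hg; have := hr_lin mu (-1) hg hf; rewrite mulN1r addrC => <-; congr hr_int.
by apply/funext => t; rewrite mulN1r addrC.
Qed.
Lemma intD f g : cc f -> cc g -> \int (fun t => f t + g t) = \int f + \int g.
Proof.
move=> hf hg; have := hr_lin mu 1 hf hg; rewrite mul1r => <-; congr hr_int.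
by apply/funext => t; rewrite mul1r.
Qed.
Lemma int_sum T (F : T -> G -> R[i]) (s : seq T) : (forall p, cc (F p)) ->
  cc (fun t => \sum_(p <- s) F p t) /\ \int (fun t => \sum_(p <- s) F p t) = \sum_(p <- s) \int (F p).
Proof.
move=> hF; elim: s => [|p s [ih1 ih2]].
  have -> : (fun t : G => \sum_(p <- [::]) F p t) = (fun=> 0 : R[i]) by apply/funext => t; rewrite big_nil.
  by rewrite big_nil int0; split=> //; exact: cc0.
have -> : (fun t : G => \sum_(q <- p :: s) F q t) = (fun t => F p t + \sum_(q <- s) F q t).
  by apply/funext => t; rewrite big_cons.
rewrite big_cons intD // ih2; split=> //.
have -> : (fun t : G => F p t + \sum_(q <- s) F q t) = (fun t => 1 * F p t + \sum_(q <- s) F q t).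
  by apply/funext => t; rewrite mul1r.
exact: cc_lin.
Qed.

Lemma int_le f g : cc f -> cc g -> (forall t, f t <= g t) -> \int f <= \int g.
Proof.
move=> hf hg h; rewrite -subr_ge0 -intB //; apply: hr_pos => [|t]; last by rewrite subr_ge0.
have -> : (fun t => g t - f t) = (fun t => (-1) * f t + g t) by apply/funext => t; rewrite mulN1r addrC.
exact: cc_lin.
Qed.

(** Reality of the integral is not an axiom. It comes from comparing the function with its absolute
    value in the order of [R[i]], where comparable elements have equal imaginary parts. *)
Lemma int_real (f : G -> R) : cc (fun t => (f t)%:C%C : R[i]) ->
  \int (fun t => (f t)%:C%C) = (Re (\int (fun t => (f t)%:C%C)))%:C%C.
Proof.
move=> hf; have ha := cc_abs hf.
have h1 : 0 <= \int (fun t => (rn ((f t)%:C%C : R[i]))%:C%C).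
  by apply: hr_pos => // t; rewrite lecR rn_ge0.
have h2 := int_le hf ha _; have {h2} : \int (fun t => (f t)%:C%C) <= \int (fun t => (rn ((f t)%:C%C : R[i]))%:C%C).
  by apply: h2 => t; rewrite rn_real lecR ler_norm.
move: h1 => /cge0[]; case: (\int _) => a b /= -> _; case: (\int _) => c d.
by rewrite lecE /= => /andP[/eqP <-].
Qed.

Lemma int_ReIm f : cc f -> \int f =
  (Re (\int (fun t => (Re (f t))%:C%C)) +i* Re (\int (fun t => (Im (f t))%:C%C)))%C.
Proof.
move=> hf; have h1 := cc_re hf.
have h2 := cc_im hf.
have e : f = (fun t => iu R * (Im (f t))%:C%C + (Re (f t))%:C%C).
  by apply/funext => t; case: (f t) => a b; rewrite /iu; simpc.
rewrite {1}e hr_lin // (int_real h1) (int_real h2) /= /iu.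
by simpc.
Qed.

Lemma int_conj f : cc f -> \int (fun t => (f t)^*) = (\int f)^*.
Proof.
move=> hf; rewrite (int_ReIm hf) (int_ReIm (cc_conj hf)) !conjE /=; congr (_ +i* _)%C.
  by congr (Re (hr_int mu _)); apply/funext => t; rewrite conjE; case: (f t).
have h2 := cc_im hf.
have -> : (fun t => (Im (Num.conj (f t)))%:C%C : R[i]) = (fun t => (-1) * (Im (f t))%:C%C).
  by apply/funext => t; rewrite conjE; case: (f t) => a b /=; rewrite mulN1r -rmorphN.
by rewrite intZ // mulN1r; case: (\int _).
Qed.

Lemma int_re f : cc f -> Re (\int f) = Re (\int (fun t => (Re (f t))%:C%C)).
Proof. by move=> hf; rewrite {1}(int_ReIm hf). Qed.

Lemma rn_int_re f (g : G -> R) : cc f -> cc (fun t => (g t)%:C%C : R[i]) -> (forall t, rn (f t) <= g t) ->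
  `|Re (\int f)| <= Re (\int (fun t => (g t)%:C%C)).
Proof.
move=> hf hg h; rewrite (int_re hf); have hr := cc_re hf.
have le1 : Re (\int (fun t => (Re (f t))%:C%C)) <= Re (\int (fun t => (g t)%:C%C)).
  have : \int (fun t => (Re (f t))%:C%C) <= \int (fun t => (g t)%:C%C).
    apply: int_le => // t; rewrite lecR; apply: le_trans (h t).
    by apply: le_trans (Re_rn _); exact: ler_norm.
  by case: (\int _) => a b; case: (\int _) => c d; rewrite lecE /= => /andP[].
have le2 : - Re (\int (fun t => (Re (f t))%:C%C)) <= Re (\int (fun t => (g t)%:C%C)).
  have : \int (fun t => (-1) * (Re (f t))%:C%C) <= \int (fun t => (g t)%:C%C).
    apply: int_le => [|//|t].
      have := cc_lin (-1) hr cc0; congr cc; apply/funext => t; exact: addr0.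
    rewrite mulN1r -rmorphN lecR; apply: le_trans (h t).
    by apply: le_trans (Re_rn _); rewrite -normrN; exact: ler_norm.
  rewrite intZ // mulN1r; case: (\int _) => a b; case: (\int _) => c d.
  by rewrite lecE /= => /andP[].
by rewrite ler_norml le1 -lerN2 opprK le2.
Qed.

Lemma cc_bounded f : cc f -> exists2 M : R, 0 < M & forall t, rn (f t) <= M.
Proof.
move=> /ccP[hf [K cK Kf]].
have h : \forall n \near \oo, K `<=` [set t | rn (f t) <= n%:R].
  apply: (compact_near_coveringP _).1 cK nat \oo (fun n t => rn (f t) <= n%:R) _ _ => t _.
  have h1 := hf t 1 ltr01.
  have h2 : \forall n \near \oo, rn (f t) + 1 <= n%:R by exact: nbhs_infty_ger.
  near=> u n => /=.
  have a1 : rn (f t - f u) < 1 by near: u.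
  have a2 : rn (f t) + 1 <= n%:R by near: n.
  by have := rn_leD (f u) (f t); rewrite rnC; lra.
have [n hn] := filter_ex h; exists (n%:R + 1) => [|t]; first by have := ler0n R n; lra.
have [/hn/= |/Kf ->] := pselect (K t); first by have := ler0n R n; lra.
by rewrite rn0; have := ler0n R n; lra.
Unshelve. all: by end_near.
Qed.

(** The support of any function is covered by finitely many translates of the
    set where [f] is large, so [f] integrates to [0] only if everything does. *)
Lemma int_pos f s0 : cc f -> (forall t, 0 <= f t) -> f s0 <> 0 -> \int f <> 0.
Proof.
move=> hf f0 fs0 If; have [g hg Ig] := hr_neq0 mu.
pose r t : R := Re (f t); have fr t : f t = (r t)%:C%C.
  by have := cge0 (f0 t); rewrite /r; case: (f t) => a b /= [-> _].
have r0 t : 0 <= r t by exact: (cge0 (f0 t)).2.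
pose c := r s0 / 2; have c0 : 0 < c.
  rewrite divr_gt0 // lt_neqAle r0 andbT; apply/eqP => e; apply: fs0.
  by rewrite fr -e.
pose Fs (l : seq G) t := \sum_(x <- l) f (x^-1 * t)%g.
have ccF l : cc (Fs l) /\ \int (Fs l) = 0.
  have [h1 h2] := int_sum l (fun x => cc_transl x^-1%g hf).
  by split=> //; rewrite h2 big1_seq // => x _; rewrite hr_inv.
have F0 l t : 0 <= Fs l t by apply: sumr_ge0.
have [_ [K cK Kg]] := hg.
have [l hl] : exists l, forall t, K t -> c%:C%C <= Fs l t.
  (* The filter of lists containing a given list: the near-covering form of compactness then
     delivers one finite family of translates. *)
  pose FF : set_system (seq G) := [set A | exists l0, forall l, (forall x, List.In x l0 -> List.In x l) -> A l].
  have Ff : Filter FF.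
    split=> [|A B [l1 h1] [l2 h2]|A B AB [l1 h1]].
    - by exists [::].
    - exists (l1 ++ l2) => l h; split; [apply: h1 => x hx | apply: h2 => x hx].
        by apply: h; apply/List.in_or_app; left.
      by apply: h; apply/List.in_or_app; right.
    - by exists l1 => l /h1; exact: AB.
  have [t _|l0 /(_ l0) hl0] := (compact_near_coveringP _).1 cK _ FF (fun l t => c%:C%C <= Fs l t) Ff.
    pose x := (t * s0^-1)%g; have [hc _] := (ccP _).1 (cc_transl x^-1%g hf).
    have h1 := hc t c c0.
    exists ([set u | rn (f (x^-1 * t)%g - f (x^-1 * u)%g) < c], [set l | List.In x l]).
      by split=> //=; exists [:: x] => l; apply; left.
    move=> [u l] [/= hu xl].
    have hx : c%:C%C <= f (x^-1 * u)%g.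
      have e : (x^-1 * t)%g = s0 by rewrite /x invgF mulgVK.
      move: hu; rewrite e !fr -rmorphB rn_real lecR => hu.
      by have := ler_norm (r s0 - r (x^-1 * u)%g); move: hu; rewrite /c; lra.
    rewrite /Fs; elim: l xl => // y l ih [->|/ih h]; rewrite big_cons.
      by apply: (le_trans hx); rewrite lerDl; apply: sumr_ge0.
    by apply: (le_trans h); rewrite lerDr.
  by exists l0 => t Kt; apply: hl0.
(* A real function supported in [K] is dominated by a multiple of [Fs l], whose integral
   vanishes. *)
have key (h : G -> R) : cc (fun t => (h t)%:C%C : R[i]) -> (forall t, ~ K t -> h t = 0) ->
    \int (fun t => (h t)%:C%C) = 0.
  move=> ch hK; have [M M0 hM] := cc_bounded ch; have [cF IF] := ccF l.
  have bd (e : R[i]) : e = 1 \/ e = -1 -> 0 <= e * \int (fun t => (h t)%:C%C).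
    move=> he; have ce : cc (fun t => e * (h t)%:C%C).
      have := cc_lin e ch cc0; congr cc; apply/funext => t; exact: addr0.
    suff : 0 <= \int (fun t => (M / c)%:C%C * Fs l t + e * (h t)%:C%C).
      by rewrite hr_lin // IF mulr0 add0r intZ.
    apply: hr_pos => [|t]; first exact: cc_lin.
    have Mc : 0 < M / c by exact: divr_gt0.
    have [Kt|/hK ->] := pselect (K t); last first.
      by rewrite mulr0 addr0 mulr_ge0 // lecR ltW.
    have h1 : M%:C%C <= (M / c)%:C%C * Fs l t.
      have -> : M%:C%C = (M / c)%:C%C * c%:C%C :> R[i] by rewrite -rmorphM /= divfK // gt_eqF.
      by rewrite ler_pM2l ?hl // ltcR.
    have h2 : - M%:C%C <= e * (h t)%:C%C :> R[i].
      have := hM t; rewrite rn_real ler_norml => /andP[h3 h4].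
      by case: he => ->; rewrite ?mul1r ?mulN1r -!rmorphN lecR //; lra.
    by rewrite -(addrN M%:C%C); exact: lerD.
  have b1 := bd 1 (or_introl erefl); have b2 := bd (-1) (or_intror erefl).
  by apply/eqP; rewrite eq_le -oppr_ge0 -mulN1r b2 -[X in 0 <= X]mul1r b1.
have kr : \int (fun t => (Re (g t))%:C%C) = 0.
  by apply: key => [|t /Kg ->]; first exact: cc_re.
have ki : \int (fun t => (Im (g t))%:C%C) = 0.
  by apply: key => [|t /Kg ->]; first exact: cc_im.
by apply: Ig; rewrite (int_ReIm hg) kr ki.
Qed.

(** Tube lemma: continuity at the points (1, t) is made uniform over the compact set. *)
Lemma cc_tube (h : G -> G -> R[i]) (K : set G) (e : R) : compact K -> 0 < e ->
  ceps (fun p : G * G => h p.1 p.2) ->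
  \forall s \near (1%g : G), forall t, K t -> rn (h s t - h 1%g t) < e.
Proof.
move=> cK e0 hc.
apply: (compact_near_coveringP _).1 cK _ (nbhs (1%g : G)) (fun s t => rn (h s t - h 1%g t) < e) _ _ => t _.
have e2 : 0 < e / 2 by lra.
have h1 := hc (1%g, t) _ e2.
have [[A B] [/= nA nB] hAB] := h1.
exists (B, A) => //= -[u s] [/= Bu As].
have a1 := hAB (s, u) (conj As Bu); have a2 := hAB (1%g, u) (conj (nbhs_singleton nA) Bu).
rewrite /= in a1 a2; have := rn_tri (h s u) (h 1%g t) (h 1%g u).
by rewrite [rn (h s u - h 1%g t)]rnC; lra.
Qed.

End Haar.

Section UnitaryGroups.
Variables (R : realType) (G : lcGroupType).

Lemma near_translate (P : set G) s0 : (\forall s \near (1%g : G), P s) ->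
  \forall s \near s0, P (s0^-1 * s)%g.
Proof.
move=> h; have hc : (fun t : G => (s0^-1 * t)%g) @ s0 --> (s0^-1 * s0)%g.
  apply: (@continuous_comp _ _ _ (fun t : G => (s0^-1, t)%g) (fun x : G * G => (x.1 * x.2)%g)).
    by apply: cvg_pair; [exact: cvg_cst | exact: cvg_id].
  exact: mulg_cont.
by apply: hc; rewrite mulVg.
Qed.

Definition bop_unirep (H : hilbert R) (U : G -> bop H) :=
  [/\ U 1%g = bone H, forall s t, U (s * t)%g = U s ** U t,
    forall s, star (U s) = U s^-1%g & forall x, continuous (fun s => U s x)].

Lemma rn_bop_unirep (H : hilbert R) (U : G -> bop H) s x : U 1%g = bone H ->
  (forall s t, U (s * t)%g = U s ** U t) -> (forall s, star (U s) = U s^-1%g) -> rn (U s x) = rn x.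
Proof.
move=> U1 UM Us; apply/eqP; rewrite -(@eqrXn2 _ 2) // !rn_ipE bop_adj Us.
by rewrite -[U _ (U s x)]/((U s^-1%g ** U s) x) -UM mulVg U1.
Qed.

Lemma bop_unirepP (H : hilbert R) (U : G -> bop H) T (j : T -> H) :
  cspan (range j) = setT -> U 1%g = bone H -> (forall s t, U (s * t)%g = U s ** U t) ->
  (forall s, star (U s) = U s^-1%g) ->
  (forall t (e : R), 0 < e -> \forall s \near (1%g : G), rn (U s (j t) - j t) < e) ->
  bop_unirep U.
Proof.
move=> jT U1 UM Us Uc; have Un s x := rn_bop_unirep s x U1 UM Us; split=> //.
apply: (cont_dense jT) => [s|s x|_ [t _ <-]]; first exact: bop_lin.
  by rewrite Un.
apply/cont_epsP => s e e0; apply: filterS (near_translate s (Uc t e e0)) => u /=.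
rewrite UM -[(U s^-1%g ** U u) (j t)]/(U s^-1%g (U u (j t))).
have Uss x : U s (U s^-1%g x) = x by rewrite -[LHS]/((U s ** U s^-1%g) x) -UM mulgV U1.
by move=> h; rewrite -[U u (j t)]Uss -(linB (bop_lin _)) Un rnC.
Qed.

Lemma opm_unirep (H : hilbert R) (K : compact_ops H) (U : G -> bop H) :
  bop_unirep U -> is_unirep (fun s => opm K (U s)).
Proof.
move=> [U1 UM Us con]; have oh := opm_hom K; split=> [|s t|s|].
- by rewrite U1 opm_one.
- by rewrite UM (homM oh).
- by rewrite -(hom_star oh) Us.
apply: (cont_dense (rko_dense K)) => [s|s k|_ [x [y ->]]]; first exact: ml_lin.
  apply: (le_trans (rn_ml _ _)); rewrite -[leRHS]mul1r ler_wpM2r //.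
  apply: (le_trans (hom_contr oh _)); apply: rn_bop_le => // z.
  by rewrite rn_bop_unirep ?mul1r.
have -> : (fun s => ml (opm K (U s)) (rko K x y)) = (fun s => rko K (U s x) y).
  by apply/funext => s; apply: (@kob_inj R H K); rewrite opmE !kob_rko rk_mull.
exact: (@cont_blin R G _ _ _ (fun x => rko K x y) (con x) (blin_rko K y)).
Qed.

Lemma total_unitary (H : hilbert R) T (j U U' : T -> H) : cspan (range j) = setT ->
  (forall s t, ip (U s) (U t) = ip (j s) (j t)) ->
  (forall s t, ip (U' s) (U' t) = ip (j s) (j t)) ->
  (forall s t, ip (U s) (j t) = ip (j s) (U' t)) ->
  exists W : bop H, (forall t, W (j t) = U t) /\ forall t, star W (j t) = U' t.
Proof.
move=> jT h1 h2 h3; apply: (@total_bop R H T j U U' 1) => //.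
  by move=> s; rewrite mul1r (rn_lc_ip s h1).
by move=> s; rewrite mul1r (rn_lc_ip s h2).
Qed.

(** Between vectors of equal norm weak closeness is strong closeness, so continuity of unitary
    representations only requires estimates of coefficients. *)
Lemma rn_unitary_sub (H : hilbert R) (x y : H) : rn x = rn y ->
  rn (x - y) ^+ 2 = 2 * Re (ip y y - ip x y).
Proof.
move=> e; have := rn_sqrB x y 1; rewrite scale1r => ->.
rewrite rmorph1 mul1r rn1 e ip_rn; case: (ip x y) => a b /=; ring.
Qed.

End UnitaryGroups.

Section WeakContinuity.
Variables (R : realType) (G : lcGroupType) (mu : haar R G).
Implicit Types f : G -> R[i].

Lemma cc_shift f : cc f -> ceps (fun p : G * G => f (p.1^-1 * p.2)%g).
Proof.
move=> /(ccP f)[hf _]; apply/cepsP => p.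
apply: (@continuous_comp _ _ _ (fun p : G * G => (p.1^-1 * p.2)%g) (f : G -> R[i]^o)); last first.
  by apply: ((cepsP f).2 hf).
apply: (@continuous_comp _ _ _ (fun p : G * G => (p.1^-1, p.2)%g) (fun x : G * G => (x.1 * x.2)%g)); last exact: mulg_cont.
apply: cvg_pair; last exact: cvg_snd.
apply: (@continuous_comp _ _ _ (fun p : G * G => p.1) (fun x : G => x^-1)%g); first exact: cvg_fst.
exact: invg_cont.
Qed.

Lemma ceps_slice (k : G -> G -> R[i]) s : ceps (fun p : G * G => k p.1 p.2) -> ceps (k s).
Proof.
move=> h t e /(h (s, t)) [[A B] [/= nA nB] hAB]; apply: filterS nB => u Bu.
exact: (hAB (s, u) (conj (nbhs_singleton nA) Bu)).
Qed.

(** [k s t] stands for the value at [t] of a vector moved by [s]. It converges uniformly on the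
    support of [f], and [I1] is the integral of |f|. *)
Lemma weak_unitary f (k : G -> G -> R[i]) (e : R) : cc f -> ceps (fun p : G * G => k p.1 p.2) -> 0 < e ->
  \forall s \near (1%g : G),
    Re (hr_int mu (fun t => k 1%g t * (f t)^*) - hr_int mu (fun t => k s t * (f t)^*)) < e.
Proof.
move=> cf hk e0; pose I1 := Re (hr_int mu (fun t => (rn (f t))%:C%C)).
have I10 : 0 <= I1.
  have : 0 <= hr_int mu (fun t => (rn (f t))%:C%C).
    by apply: hr_pos => [|t]; [exact: cc_abs | rewrite lecR rn_ge0].
  by case/cge0.
have [hf [K cK Kf]] := (ccP f).1 cf.
pose d := e / (I1 + 1); have d0 : 0 < d by rewrite divr_gt0 //; lra.
apply: filterS (@cc_tube R G k K d cK d0 hk) => s hs.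
have ck u : cc (fun t => k u t * (f t)^*).
  have := ccM (cc_conj cf) (ceps_slice u hk); congr cc; apply/funext => t; exact: mulrC.
rewrite -intB //.
have cd : cc (fun t => k 1%g t * (f t)^* - k s t * (f t)^*).
  have := cc_lin (-1) (ck s) (ck 1%g); congr cc; apply/funext => t; ring.
have bd t : rn (k 1%g t * (f t)^* - k s t * (f t)^*) <= d * rn (f t).
  rewrite -mulrBl rnM rn_conj; have [Kt|/Kf ->] := pselect (K t); last by rewrite rn0 !mulr0.
  by rewrite ler_wpM2r // rnC; apply: ltW; exact: hs.
have cg : cc (fun t => (d * rn (f t))%:C%C : R[i]).
  have := cc_lin d%:C%C (cc_abs cf) (@cc0 R G); congr cc; apply/funext => t.
  by rewrite addr0 -rmorphM.
have := rn_int_re mu cd cg bd; have -> : (fun t => (d * rn (f t))%:C%C : R[i]) = (fun t => d%:C%C * (rn (f t))%:C%C).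
  by apply/funext => t; rewrite -rmorphM.
rewrite intZ; last exact: cc_abs.
have -> : Re (d%:C%C * hr_int mu (fun t => (rn (f t))%:C%C)) = d * I1.
  by rewrite /I1; case: (hr_int _ _) => a b /=; ring.
move=> /(le_trans (ler_norm _)) h; apply: (le_lt_trans h).
have I11 : I1 + 1 != 0 by apply: lt0r_neq0; lra.
have <- : d * (I1 + 1) = e by rewrite /d -mulrA mulVf // mulr1.
by nra.
Qed.

End WeakContinuity.

(** * The left regular representation *)

Section LeftRegular.
Variables (R : realType) (G : lcGroupType) (S : setting R G).
Local Notation mu := (hmu S).
Local Notation L2 := (L2G S).

Lemma l2_total : cspan (range (fun f : {f : G -> R[i] | cc f} => l2_of L2 (projT1 f))) = setT.
Proof.
apply: cspan_eqT => P cP hP x; apply: (clsC cP) => e e0.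
have : closure [set l2_of L2 f | f in [set f | cc f]] x by rewrite l2_dense.
move=> /closureP/(_ e e0)[_ [f cf <-] xf]; exists (l2_of L2 f) => //.
by apply: hP; exists (exist _ f cf).
Qed.

(** Both operators are continuous and agree on the dense image of C_c(G); the existence of [W]
    excludes the default value in [l2_op]. *)
Lemma l2_opE (T : (G -> R[i]) -> (G -> R[i])) (W : bop L2) :
  (forall f, cc f -> W (l2_of L2 f) = l2_of L2 (T f)) -> l2_op (S := S) T =1 W.
Proof.
move=> hW; rewrite /l2_op; case: xgetP => [F _ [lF cF FE]|nF]; last first.
  case: (nF W); split=> //; first exact: bop_lin.
  have [M hM] := blin_lip (blin_bop W).
  have M1 : 0 < `|M| + 1 by have := normr_ge0 M; lra.
  apply/cont_epsP => s e e0; apply/near_ball; exists (e / (`|M| + 1)); first exact: divr_gt0.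
  move=> y; rewrite ltr_pdivlMr // => h; apply: (le_lt_trans (hM _ _)).
  by have := ler_norm M; have := rn_ge0 (s - y); nra.
move=> x; apply/eqP; rewrite -subr_eq0; apply/eqP; apply: rn_le0; apply: le0_eps => e e0.
have e2 : 0 < e / 2 by lra.
have /near_ball[d1 d10 h1] := (cont_epsP _).1 cF x _ e2.
have [M hM] := blin_lip (blin_bop W).
have M1 : 0 < `|M| + 1 by have := normr_ge0 M; lra.
have d0 : 0 < Num.min d1 (e / 2 / (`|M| + 1)) by rewrite lt_min d10 divr_gt0.
have : closure [set l2_of L2 f | f in [set f | cc f]] x by rewrite l2_dense.
move=> /closureP/(_ _ d0)[_ [f cf <-]]; rewrite lt_min ltr_pdivlMr // => /andP[/h1 a1 a2].
have a3 := hM x (l2_of L2 f); rewrite FE // in a1; rewrite (hW f cf) in a3.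
have := rn_tri (F x) (l2_of L2 (T f)) (W x); rewrite [rn (l2_of _ _ - W x)]rnC.
by have := ler_norm M; have := rn_ge0 (x - l2_of L2 f); nra.
Qed.

Lemma op_multE (F : L2 -> L2) (W : bop L2) : F =1 W -> op_mult (S := S) F = opm (KG S) W.
Proof.
move=> FW; have hE k x : ko_act (ml (opm (KG S) W) k) x = F (ko_act k x).
  by rewrite -!kobE opmE FW.
rewrite /op_mult; case: xgetP => [m _ mE|/(_ (opm (KG S) W))[]//].
apply: mult_eq => k; apply: (@kob_inj R L2 (KG S)); apply: bop_eq => x.
by rewrite !kobE hE mE.
Qed.

Lemma lam_ex s : exists W : bop L2,
  (forall f, cc f -> W (l2_of L2 f) = l2_of L2 (fun t => f (s^-1 * t)%g)) /\
  (forall f, cc f -> star W (l2_of L2 f) = l2_of L2 (fun t => f (s * t)%g)).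
Proof.
pose U (u : G) (f : {f : G -> R[i] | cc f}) := l2_of L2 (fun t => projT1 f (u * t)%g).
have ipU u (f g : {f : G -> R[i] | cc f}) : ip (U u f) (U u g) = ip (l2_of L2 (projT1 f)) (l2_of L2 (projT1 g)).
  have cf := projT2 f; have cg := projT2 g.
  rewrite !l2_ip //; try exact: cc_transl.
  apply: (@hr_inv R G mu (fun t => projT1 f t * (projT1 g t)^*) u).
  by apply: ccM => //; exact: ((ccP _).1 (cc_conj cg)).1.
have [||s1 s2|W [h1 h2]] := @total_unitary R L2 _ _ (U s^-1%g) (U s) l2_total.
- exact: ipU.
- exact: ipU.
- pose g : {f : G -> R[i] | cc f} := exist _ _ (cc_transl s^-1%g (projT2 s1)).
  transitivity (ip (U s g) (U s s2)); first by rewrite ipU.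
  congr ip; rewrite /U /=; congr l2_of; apply/funext => t.
  by rewrite mulgA mulVg mul1g.
by exists W; split=> f cf; [exact: (h1 (exist _ f cf)) | exact: (h2 (exist _ f cf))].
Qed.

Definition lamU s : bop L2 := projT1 (cid (lam_ex s)).
Lemma lamUE s f : cc f -> lamU s (l2_of L2 f) = l2_of L2 (fun t => f (s^-1 * t)%g).
Proof. by case: (projT2 (cid (lam_ex s))) => h _; exact: h. Qed.
Lemma lamUs s f : cc f -> star (lamU s) (l2_of L2 f) = l2_of L2 (fun t => f (s * t)%g).
Proof. by case: (projT2 (cid (lam_ex s))) => _ h; exact: h. Qed.

Lemma lamGE s : lamG S s = opm (KG S) (lamU s).
Proof. by apply: op_multE; apply: l2_opE => f; exact: lamUE. Qed.

Lemma lamU_unirep : bop_unirep lamU.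
Proof.
apply: (bop_unirepP l2_total) => [|s t|s|[f cf] e e0 /=].
- apply: (bop_dense l2_total) => -[f cf] /=; rewrite lamUE //; congr l2_of.
  by apply/funext => t; rewrite invg1 mul1g.
- apply: (bop_dense l2_total) => -[f cf] /=.
  transitivity (lamU s (lamU t (l2_of L2 f))) => //; rewrite !lamUE //; last exact: cc_transl.
  by congr l2_of; apply/funext => u; rewrite invgM mulgA.
- apply: (bop_dense l2_total) => -[f cf]; apply: (etrans (lamUs s cf)).
  by rewrite (lamUE _ cf) invgK.
apply: filterS (@weak_unitary R G mu f (fun s t => f (s^-1 * t)%g) (e ^+ 2 / 2) cf (cc_shift cf) _) => [s|]; last by rewrite divr_gt0 // exprn_gt0.
have es : rn (lamU s (l2_of L2 f)) = rn (l2_of L2 f).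
  apply/eqP; rewrite -(@eqrXn2 _ 2) // !rn_ipE bop_adj lamUE // lamUs; last exact: cc_transl.
  apply/eqP; congr (Re (ip _ (l2_of _ _))); apply/funext => t.
  by rewrite mulgA mulVg mul1g.
move=> h; rewrite -(@ltr_pXn2r _ 2) ?nnegrE ?rn_ge0 ?(ltW e0) // rn_unitary_sub // lamUE //.
rewrite !l2_ip //; last exact: cc_transl.
move: h; have -> : (fun t => f (1^-1 * t)%g * (f t)^*) = (fun t => f t * (f t)^*).
  by apply/funext => t; rewrite invg1 mul1g.
by move=> h; lra.
Qed.

Lemma lamG_unirep : is_unirep (lamG S).
Proof.
have -> : lamG S = fun s => opm (KG S) (lamU s) by apply/funext => s; exact: lamGE.
exact: opm_unirep lamU_unirep.
Qed.

Lemma lamCP : [/\ starhom (@lamC R G S), nondeg (@lamC R G S)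
  & forall s, ext (@lamC R G S) (gu S s) = lamG S s].
Proof. exact: integP lamG_unirep. Qed.

End LeftRegular.

(** * Induced representations and faithfulness of A in the full crossed product *)

Section JointContinuity.
Variables (R : realType) (T : topologicalType) (V W : normedModType R[i]).

Lemma cont_app (F : T -> V -> W) (y : T -> V) : (forall s, linear (F s)) ->
  (forall s x, rn (F s x) <= rn x) -> (forall x, continuous (F^~ x)) -> continuous y ->
  continuous (fun s => F s (y s)).
Proof.
move=> lF cF hF hy; apply/cont_epsP => s e e0; have e2 : 0 < e / 2 by lra.
apply: filterS2 ((cont_epsP _).1 (hF (y s)) s _ e2) ((cont_epsP _).1 hy s _ e2) => t h1 h2.
have := cF t (y s - y t); rewrite (linB (lF t)).
have := rn_tri (F s (y s)) (F t (y s)) (F t (y t)).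
by move: h1 h2 => /=; lra.
Qed.

End JointContinuity.

Section PosfunMore.
Variables (R : realType) (D : cstarType R) (f : mult D -> R[i]^o).
Hypothesis pf : posfun f.

Lemma posfun_lip a : rn (f (emb a)) <= Re (f (mone D)) * rn a.
Proof.
have p1 := posfun_one pf.
rewrite -(@ler_pXn2r _ 2) ?nnegrE ?mulr_ge0 //; apply: (le_trans (posfun_cs _ pf)).
by rewrite exprMn expr2 -mulrA ler_wpM2l // -emb_star -embM; exact: posfun_bd.
Qed.

Lemma ceps_posfun (T : topologicalType) (x : T -> D) : continuous x -> ceps (fun t => f (emb (x t))).
Proof.
move=> hx t e e0; have p1 := posfun_one pf; pose M := Re (f (mone D)) + 1.
have M0 : 0 < M by rewrite /M; lra.
have d0 : 0 < e / M by exact: divr_gt0.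
apply: filterS ((cont_epsP x).1 hx t _ d0) => u; rewrite ltr_pdivlMr // => h.
rewrite -(linB pf.1) -(linB (@emb_lin R D)); apply: (le_lt_trans (posfun_lip _)).
by have := rn_ge0 (x t - x u); move: h; rewrite /M; nra.
Qed.

End PosfunMore.

Section Faithful.
Variables (R : realType) (G : lcGroupType) (S : setting R G) (al : action R G).
Local Notation mu := (hmu S).

Lemma rn_ac (s : G) (a : al) : rn (ac s a) <= rn a.
Proof. exact: hom_contr (act_hom (acP al) s) a. Qed.

Lemma acV s (a : al) : ac (s^-1)%g (ac s a) = a.
Proof. by rewrite -(actM (acP al)) mulVg (act1 (acP al)). Qed.

Lemma ac_cont2 (y : G -> al) : continuous y -> continuous (fun p : G * G => ac (p.2^-1)%g (y p.1)).
Proof.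
move=> hy; apply: (@cont_app R _ al al (fun p : G * G => ac (p.2^-1)%g)) => [p|p|x p|p].
- exact: (hom_lin (act_hom (acP al) _)).
- exact: rn_ac.
- apply: (@continuous_comp _ _ _ (fun q : G * G => (q.2^-1)%g) (fun s : G => ac s x)).
    apply: (@continuous_comp _ _ _ (fun p : G * G => p.2) (fun x : G => x^-1)%g); first exact: cvg_snd.
    exact: invg_cont.
  exact: (act_cont (acP al)).
apply: (@continuous_comp _ _ _ (fun q : G * G => q.1) y); first exact: cvg_fst.
exact: hy.
Qed.

Section Kernel.
Variable phi : mult al -> R[i]^o.
Hypothesis pf : posfun phi.

Definition ccf := {f : G -> R[i] | cc f}.
Definition cshift s (f : ccf) : ccf := exist _ _ (cc_transl s (projT2 f)).
Lemma ccf_eq (f g : ccf) : projT1 f =1 projT1 g -> f = g.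
Proof.
case: f g => [f hf] [g hg] /= /funext e; subst g.
by congr exist; exact: Prop_irrelevance.
Qed.

(** The inner product of f (x) a and g (x) b in the induced representation is
    [iaL f g (b^* a)]. *)
Definition iaF (f g : ccf) (a : al) t : R[i] :=
  projT1 f t * (projT1 g t)^* * phi (emb (ac (t^-1)%g a)).
Definition iaL (f g : ccf) (a : al) : R[i]^o := hr_int mu (iaF f g a).

Lemma iaF_cc f g a : cc (iaF f g a).
Proof.
apply: ccM; first by apply: ccM; [exact: projT2 f | exact: ((ccP _).1 (cc_conj (projT2 g))).1].
apply: (@ceps_slice R G (fun _ t => phi (emb (ac (t^-1)%g a))) 1%g).
by apply: (ceps_posfun pf (@ac_cont2 (fun=> a) _)) => s; exact: cvg_cst.
Qed.

Lemma iaF_lin f g c a b t : iaF f g (c *: a + b) t = c * iaF f g a t + iaF f g b t.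
Proof.
rewrite /iaF (hom_lin (act_hom (acP al) _)) (@emb_lin R al) pf.1 /GRing.scale /=; ring.
Qed.

Lemma iaF_pos s t : 0 <= \sum_(p <- s) \sum_(q <- s)
  p.1 * Num.conj q.1 * iaF p.2.1 q.2.1 (star q.2.2 ** p.2.2) t.
Proof.
(* At each [t] the integrand is [phi] of a square, so positivity holds before integration. *)
pose y := \sum_(p <- s) (p.1 * projT1 p.2.1 t) *: ac (t^-1)%g p.2.2.
suff -> : \sum_(p <- s) \sum_(q <- s) p.1 * Num.conj q.1 * iaF p.2.1 q.2.1 (star q.2.2 ** p.2.2) t =
  phi (star (emb y) ** emb y) by exact: pf.2.
have hac := act_hom (acP al) (t^-1)%g.
rewrite -emb_star -embM /y st_sum sm_sumr (lin_sum (@emb_lin R al)) (lin_sum pf.1).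
apply: eq_bigr => p _; rewrite sm_suml (lin_sum (@emb_lin R al)) (lin_sum pf.1); apply: eq_bigr => q _.
rewrite starZ smulZl smulZr !(linZ (@emb_lin R al)) !(linZ pf.1) /iaF (homM hac) (hom_star hac).
rewrite rmorphM /GRing.scale /=; ring.
Qed.

Lemma induced : exists (H : hilbert R) (j : ccf * al -> H) (pi : mult al -> bop H),
  [/\ cspan (range j) = setT, starhom pi, forall x f a, pi x (j (f, a)) = j (f, ml x a),
    forall s t, ip (j s) (j t) = lker iaL s t &
    (forall f, linear (fun a => j (f, a))) /\
    cspan [set y | exists a x, y = pi (emb a) x] = setT].
Proof.
apply: gns_kernel => [f g c a b|f g a|s|f].
- rewrite /iaL -(hr_lin mu c (iaF_cc f g a) (iaF_cc f g b)); congr hr_int.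
  by apply/funext => t; exact: iaF_lin.
- rewrite /iaL -(int_conj mu (iaF_cc f g a)); congr hr_int; apply/funext => t.
  rewrite /iaF (hom_star (act_hom (acP al) _)) emb_star (posfun_star _ pf).
  by rewrite !rmorphM /= conjCK; ring.
- pose FF p q t := p.1 * Num.conj q.1 * iaF p.2.1 q.2.1 (star q.2.2 ** p.2.2) t.
  have cF p q : cc (FF p q).
    have := cc_lin (p.1 * Num.conj q.1) (iaF_cc p.2.1 q.2.1 (star q.2.2 ** p.2.2)) (@cc0 R G).
    by congr cc; apply/funext => t; rewrite addr0.
  have c2 p := int_sum mu s (cF p); have c3 := int_sum mu s (fun p => (c2 p).1).
  suff -> : kf (lker iaL) s s = hr_int mu (fun t => \sum_(p <- s) \sum_(q <- s) FF p q t).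
    by apply: hr_pos => [|t]; [exact: c3.1 | exact: iaF_pos].
  rewrite c3.2 /kf; apply: eq_bigr => p _; rewrite (c2 p).2; apply: eq_bigr => q _.
  by rewrite /FF intZ //; exact: iaF_cc.
have p1 := posfun_one pf; pose c1 := Re (phi (mone al)).
have cr : cc (fun t => (rn (projT1 f t) * rn (projT1 f t))%:C%C : R[i]).
  have := ccM (cc_abs (projT2 f)) ((ccP _).1 (cc_abs (projT2 f))).1; congr cc; apply/funext => t.
  by rewrite -rmorphM.
have I0 : 0 <= Re (hr_int mu (fun t => (rn (projT1 f t) * rn (projT1 f t))%:C%C)).
  have : 0 <= hr_int mu (fun t => (rn (projT1 f t) * rn (projT1 f t))%:C%C).
    by apply: hr_pos => // t; rewrite lecR mulr_ge0.
  by case/cge0.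
exists (c1 * Re (hr_int mu (fun t => (rn (projT1 f t) * rn (projT1 f t))%:C%C))) => [|a].
  exact: mulr_ge0.
have cg : cc (fun t => (c1 * rn a ^+ 2 * (rn (projT1 f t) * rn (projT1 f t)))%:C%C : R[i]).
  have := cc_lin (c1 * rn a ^+ 2)%:C%C cr (@cc0 R G); congr cc; apply/funext => t.
  by rewrite addr0 -rmorphM.
have bd t : rn (iaF f f (star a ** a) t) <= c1 * rn a ^+ 2 * (rn (projT1 f t) * rn (projT1 f t)).
  rewrite /iaF !rnM rn_conj mulrC ler_wpM2r ?mulr_ge0 //.
  apply: (le_trans (posfun_lip pf _)); rewrite ler_wpM2l // -rn_starM.
  exact: rn_ac.
have := rn_int_re mu (iaF_cc f f (star a ** a)) cg bd.
have -> : (fun t => (c1 * rn a ^+ 2 * (rn (projT1 f t) * rn (projT1 f t)))%:C%C : R[i]) =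
  (fun t => (c1 * rn a ^+ 2)%:C%C * (rn (projT1 f t) * rn (projT1 f t))%:C%C).
  by apply/funext => t; rewrite -rmorphM.
rewrite intZ // => /(le_trans (ler_norm _)); rewrite /iaL.
by case: (hr_int _ (fun t => (rn _ * _)%:C%C)) => u v /=; lra.
Qed.

(** The twist by the action sits in the inner product [iaL], so [A] acts by plain multiplication
    while the group translates the function and moves the algebra element. *)
Lemma induced_rep : exists (H : hilbert R) (j : ccf * al -> H) (pi : al -> bop H) (W : G -> bop H),
  [/\ act_covariant (@opm R H (kops H) \o pi) (fun s => opm (kops H) (W s)),
    forall s t, ip (j s) (j t) = lker iaL s t & forall a f b, pi a (j (f, b)) = j (f, a ** b)].
Proof.
have [H [j [pi [jT hpi piE jE [jl nd]]]]] := induced.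
pose U s (p : ccf * al) := j (cshift (s^-1)%g p.1, ac s p.2).
have ipU s p q : ip (U s p) (U s q) = ip (j p) (j q).
  rewrite !jE /lker /iaL /U /= -(hr_inv mu (s^-1)%g (iaF_cc p.1 q.1 (star q.2 ** p.2))).
  congr hr_int; apply/funext => t; have hs := act_hom (acP al) s.
  by rewrite /iaF /= -(hom_star hs) -(homM hs) -(actM (acP al)) invgM invgK.
have shK s f : cshift (s^-1)%g (cshift s f) = f.
  by apply: ccf_eq => t /=; rewrite mulgA mulgV mul1g.
have UV s p : U s (cshift s p.1, ac (s^-1)%g p.2) = j p.
  by rewrite /U /= shK -{1}[s]invgK acV; case: p.
have exW s : exists W : bop H, (forall p, W (j p) = U s p) /\ forall p, star W (j p) = U (s^-1)%g p.
  apply: (total_unitary jT) => [p q|p q|p q]; [exact: ipU | exact: ipU |].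
  by rewrite -(UV s q) ipU /U /= invgK.
pose W s := projT1 (cid (exW s)).
have WE s p : W s (j p) = U s p by exact: (projT2 (cid (exW s))).1.
have Ws s p : star (W s) (j p) = U (s^-1)%g p by exact: (projT2 (cid (exW s))).2.
have hp : starhom (pi \o @emb R al) := hom_comp (@emb_starhom R al) hpi.
exists H, j, (pi \o @emb R al), W; split; [split| exact: jE | by move=> a f b; exact: piE].
- exact: (hom_comp hp (opm_hom (kops H))).
- exact: (opm_nondeg _ hp nd).
- apply: opm_unirep; apply: (bop_unirepP jT) => [|s t|s|[f a] e e0].
  + apply: (bop_dense jT) => -[f a]; rewrite WE /U /= (act1 (acP al)); congr (j (_, _)).
    by apply: ccf_eq => t /=; rewrite invg1 mul1g.
  + apply: (bop_dense jT) => -[f a]; transitivity (W s (W t (j (f, a)))) => //; rewrite !WE /U /=.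
    rewrite (actM (acP al)); congr (j (_, _)).
    by apply: ccf_eq => u /=; rewrite invgM mulgA.
  + by apply: (bop_dense jT) => p; rewrite WE Ws.
  (* Times the conjugate of [f] this is the integrand of a matrix coefficient; it is jointly
     continuous in [s] and [t], as [weak_unitary] requires. *)
  pose k s t : R[i] := projT1 f (s^-1 * t)%g * phi (emb (ac (t^-1)%g (star a ** ac s a))).
  have ck : ceps (fun p : G * G => k p.1 p.2).
    apply: cepsM; first exact: (cc_shift (projT2 f)).
    apply: (ceps_posfun pf (ac_cont2 (y := fun s => star a ** ac s a) _)) => s.
    apply: (@cont_blin R G _ _ (fun s : G => ac s a) (fun x => star a ** x)); first exact: (act_cont (acP al)).
    exact: (blin_ml (emb (star a))).
  have e2 : 0 < e ^+ 2 / 2 by rewrite divr_gt0 // exprn_gt0.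
  apply: filterS (@weak_unitary R G mu _ k _ (projT2 f) ck e2) => s h.
  have es : rn (W s (j (f, a))) = rn (j (f, a)).
    by apply/eqP; rewrite -(@eqrXn2 _ 2) // !rn_ipE WE ipU.
  rewrite -(@ltr_pXn2r _ 2) ?nnegrE ?rn_ge0 ?(ltW e0) // rn_unitary_sub // WE /U !jE /lker /iaL /=.
  have kE u : (fun t => k u t * (projT1 f t)^*) = iaF (cshift (u^-1)%g f) f (star a ** ac u a).
    by apply/funext => t; rewrite /k /iaF /=; ring.
  have k1 : (fun t => k 1%g t * (projT1 f t)^*) = iaF f f (star a ** a).
    rewrite kE (act1 (acP al)); congr (iaF _ _ _); apply: ccf_eq => t.
    by rewrite /= invg1 mul1g.
  by move: h; rewrite k1 kE; lra.
move=> s a; have oh := opm_hom (kops H); rewrite -(hom_star oh) -!(homM oh); congr (opm (kops H) _).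
apply: (bop_dense jT) => -[f b].
transitivity (W s (pi (emb a) (star (W s) (j (f, b))))) => //.
rewrite Ws piE /U piE WE /U /= invgK shK (homM (act_hom (acP al) s)).
by rewrite -{3}[s]invgK acV.
Qed.

End Kernel.

Lemma cc_at1 : exists f : ccf, projT1 f 1%g <> 0.
Proof.
have [f cf If] := hr_neq0 mu.
have [[t ft]|h] := pselect (exists t, f t <> 0).
  by exists (cshift t (exist _ f cf)); rewrite /= mulg1.
case: If; have -> : f = (fun=> 0); last exact: int0.
by apply/funext => t; apply: contrapT => ft; apply: h; exists t.
Qed.

(** An element killed by [iA] acts as zero in every induced representation. The squared norm of the
    vector f (x) a b would then be a vanishing integral of a nonnegative function that is nonzero at
    1, against [int_pos]. *)
Lemma iA_inj (F : full_cp S al) : injective (iA F).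
Proof.
apply: (lin_inj (hom_lin (iA_hom F))) => a ia0; apply: contrapT => a0.
have [b ab0] : exists b, a ** b <> 0.
  apply: contrapT => h; apply: a0; apply: smul_injl => b; rewrite smul0r.
  by apply: contrapT => ab; apply: h; exists b.
have [] := @state_sep R al [set (0 : al)] (a ** b) (@clsub0 R al).
- by move=> d n ->; exact: smulr0.
- exact: ab0.
move=> phi [pf _ px]; have [H [j [pi [W [cov jE piE]]]]] := induced_rep pf.
have [h [hh nh hA _ _]] := fc_hom_ex F cov.
have pi0 : pi a = 0.
  apply: (@opm_inj R H (kops H)); rewrite (lin0 (hom_lin (opm_hom _))).
  by rewrite -[LHS](hA a) ia0 (lin0 (hom_lin (ext_hom hh nh))).
have [f f1] := cc_at1.
have : ip (j (f, a ** b)) (j (f, a ** b)) = 0.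
  by rewrite -piE pi0; exact: ip0l.
rewrite jE /lker /iaL /=; apply: (int_pos (s0 := 1%g)); first exact: iaF_cc.
  move=> t; have := iaF_pos pf [:: (1, (f, a ** b))] t.
  by rewrite !big_seq1 /= rmorph1 !mul1r.
rewrite /iaF invg1 (act1 (acP al)) => /eqP; rewrite !mulf_eq0 conjC_eq0.
by move=> /orP[/orP[]|] /eqP.
Qed.

End Faithful.

(** * The unwinding isomorphism for stabilized actions *)

Section IsoOfMult.
Variables (R : realType) (X Y : cstarType R) (h : X -> mult Y) (g : Y -> mult X).
Hypotheses (hh : starhom h) (nh : nondeg h) (hg : starhom g) (ng : nondeg g).
Hypotheses (gh : forall x, ext g (h x) = emb x) (hgE : forall y, ext h (g y) = emb y).

(** Nondegeneracy of [h] and the relation of [ext h] with [g] put [Y] inside the range of [h], and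
    symmetrically for [g]; combining the two, [h] takes its values in [Y]. *)
Lemma iso_of_mult : exists Th : X -> Y,
  [/\ starhom Th, bijective Th & forall x, emb (Th x) = h x].
Proof.
have sub (A B : cstarType R) (f : A -> mult B) (k : B -> mult A) : starhom f -> nondeg f ->
    (forall y, ext f (k y) = emb y) -> forall y, range f (emb y).
  move=> hf nf fk; have cl := clsub_pre (blin_emb B) (hom_range_clsub hf).
  suff hP a b : range f (emb (ml (f a) b)) by apply: (cspanT_ind nf cl) => _ [a [b ->]]; exact: hP.
  by exists (mr (k b) a) => //; rewrite -(ext_mulr hf nf) fk mul_emb.
have hE y := sub _ _ _ _ hh nh hgE y; have gE x := sub _ _ _ _ hg ng gh x.
have ex x : exists y, emb y = h x.
  have [y _ e] := gE x; exists y; rewrite -hgE e; exact: ext_emb.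
exists (fun x => projT1 (cid (ex x))); have TE x : emb (projT1 (cid (ex x))) = h x by exact: projT2 (cid (ex x)).
have hT : starhom (fun x => projT1 (cid (ex x))).
  split=> [c x y|x y|x]; apply: emb_inj; rewrite TE.
  - by rewrite (hom_lin hh) (@emb_lin R Y) !TE.
  - by rewrite (homM hh) embM !TE.
  - by rewrite (hom_star hh) emb_star TE.
split=> //; apply: inj_surj_bij.
  by move=> x y /(congr1 (@emb R Y)); rewrite !TE => /(congr1 (ext g)); rewrite !gh => /emb_inj.
apply/seteqP; split=> // y _; have [x _ e] := hE y; exists x => //.
by apply: emb_inj; rewrite TE.
Qed.

End IsoOfMult.

Section Unwinding.
Variables (R : realType) (G : lcGroupType) (S : setting R G).
Implicit Types D : cstarType R.
Local Notation "a '\ox' b" := (tp S a b).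

Lemma fc_uniq (al : action R G) (F : full_cp S al) D (h k : F -> mult D) : starhom h -> nondeg h -> starhom k -> nondeg k ->
  (forall a, ext h (iA F a) = ext k (iA F a)) -> (forall s, ext h (fv F s) = ext k (fv F s)) -> h =1 k.
Proof.
move=> hh nh hk nk hA hG.
have e c : ext h (iG F c) = ext k (iG F c).
  have hi := iG_hom F; have ni := iG_nondeg F.
  apply: (@gc_uniq _ _ (CG S) D (ext h \o iG F) (ext k \o iG F)) => [||||s].
  - exact: (hom_comp hi (ext_hom hh nh)).
  - exact: nondeg_ext_comp.
  - exact: (hom_comp hi (ext_hom hk nk)).
  - exact: nondeg_ext_comp.
  by rewrite !ext_comp //; exact: hG.
apply: fcm_ind; first exact: (clsub_eq (hom_blin hh) (hom_blin hk)).
move=> a c; rewrite -(ext_emb hh nh) -(ext_emb hk nk) fcmE (homM (ext_hom hh nh)) (homM (ext_hom hk nk)).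
by rewrite hA e.
Qed.

Variables (al : action R G) (F : full_cp S al) (H : hilbert R) (K : compact_ops H) (v : G -> mult K).
Hypothesis uv : is_unirep v.

Definition adk s (k : K) : K := ml (v s) (mr (star (v s)) k).
Lemma adkE s k : emb (adk s k) = v s ** emb k ** star (v s).
Proof. by rewrite -smulA emb_mul mul_emb. Qed.

Let vv s : star (v s) ** v s = mone K.
Proof. by have [v1 vM vs _] := uv; rewrite vs -vM mulVg v1. Qed.
Let vv' s : v s ** star (v s) = mone K.
Proof. by have [v1 vM vs _] := uv; rewrite vs -vM mulgV v1. Qed.

Lemma adk_hom s : starhom (adk s).
Proof.
split=> [c x y|x y|x]; rewrite /adk.
- by rewrite (mr_lin (star (v s))) (ml_lin (v s)).
- by apply: emb_inj; rewrite embM !adkE embM -!smulA (smulA _ (v s)) vv mone_l.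
- by apply: emb_inj; rewrite emb_star !adkE emb_star !starM starK smulA.
Qed.

Lemma stabilization : exists b : G -> tens S al K -> tens S al K,
  is_action b /\ forall s a k, b s (a \ox k) = ac s a \ox adk s k.
Proof.
have [v1 vM vs vc] := uv.
have ha s := act_hom (acP al) s; have hb s := @tmap_hom R G S _ _ _ _ _ _ (ha s) (adk_hom s).
have bE s (a : al) k : tmap (S := S) (ac s) (adk s) (a \ox k) = ac s a \ox adk s k.
  exact: (@tmapE R G S _ _ _ _ _ _ (ha s) (adk_hom s)).
exists (fun s => tmap (S := S) (ac s) (adk s)); split=> //; split=> //.
- apply: (blin_eq (hom_blin (hb 1%g)) (@blin_id _ _)) => a k; rewrite bE (act1 (acP al)).
  by congr tp; apply: emb_inj; rewrite adkE v1 mone_star mone_l mone_r.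
- move=> s t; apply: (blin_eq (hom_blin (hb _)) (blin_comp (hom_blin (hb t)) (hom_blin (hb s)))) => a k.
  rewrite /= !bE (actM (acP al)); congr tp; apply: emb_inj.
  by rewrite !adkE vM starM !smulA.
(* On a product x y the factor [v s] meets [x] and its adjoint meets [y]; strict continuity controls
   each of them, and products are total. *)
have ck k : continuous (adk^~ k).
  move: k; apply: (cont_dense (prod_dense K)) => [s|s x|_ [x [y ->]]].
  - exact: (hom_lin (adk_hom s)).
  - exact: (hom_contr (adk_hom s)).
  have -> : (fun s => adk s (x ** y)) = (fun s => ml (emb (ml (v s) x)) (star (ml (v s) (star y)))).
    apply/funext => s; rewrite /adk -[mr _ _]/(mr (star (v s)) (x ** y)).
    have -> : mr (star (v s)) (x ** y) = x ** star (ml (v s) (star y)).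
      by apply: emb_inj; rewrite -emb_mul !embM emb_star -mul_emb starM emb_star starK smulA.
    exact: mlM.
  have cst : continuous (fun s => star (ml (v s) (star y))).
    apply: (cont_lip (M := 1) (h := star) (vc (star y))) => p q.
    by rewrite mul1r -starB rn_star.
  have [M M0 hM] : exists2 M : R, 0 < M & rn x <= M by exists (rn x + 1); have := rn_ge0 x; lra.
  apply/cont_epsP => s e e0.
  pose N := rn (star (ml (v s) (star y))) + 1; have N0 : 0 < N by have := rn_ge0 (star (ml (v s) (star y))); rewrite /N; lra.
  have e1 : 0 < e / 2 / N by rewrite !divr_gt0.
  have e2 : 0 < e / 2 / M by rewrite !divr_gt0.
  apply: filterS2 ((cont_epsP _).1 (vc x) s _ e1) ((cont_epsP _).1 cst s _ e2) => t /=.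
  rewrite !ltr_pdivlMr //; set p := ml (v s) x; set q := ml (v t) x; set c := star _; set d := star _ => h1 h2.
  have -> : p ** c - q ** d = (p - q) ** c + q ** (c - d) by rewrite smBl smBr; lmod R; ring.
  apply: (le_lt_trans (rnD _ _)); have h3 := rnM_le (p - q) c; have h4 := rnM_le q (c - d).
  have h5 : rn q <= M.
    apply: le_trans hM; apply: (le_trans (rn_ml _ _)); rewrite -[leRHS]mul1r ler_wpM2r //.
    exact: unirep_rn.
  move: h1 h2 h3 h4 h5 (rn_ge0 (p - q)) (rn_ge0 (c - d)); rewrite /N -/c; nra.
apply: (cont_dense (tp_dense S al K)) => [s|s x|_ [[a k] _ <-]].
- exact: (hom_lin (hb s)).
- exact: (hom_contr (hb s)).
have -> : (fun s => tmap (S := S) (ac s) (adk s) (tpg S (a, k))) = (fun s => ac s a \ox adk s k).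
  by apply/funext => s; exact: bE.
apply/cont_epsP => s e e0; pose N := rn (ac s a) + 1.
have N0 : 0 < N by have := rn_ge0 (ac s a); rewrite /N; lra.
have K0 : 0 < rn k + 1 by have := rn_ge0 k; lra.
have e1 : 0 < e / 2 / N by rewrite !divr_gt0.
have e2 : 0 < e / 2 / (rn k + 1) by rewrite !divr_gt0.
have c1 := (cont_epsP (fun s => ac s a)).1 (@act_cont _ _ _ _ (acP al) a) s _ e2.
apply: filterS2 c1 ((cont_epsP (fun s => adk s k)).1 (ck k) s _ e1) => t.
rewrite !ltr_pdivlMr // => h1 h2.
have -> : ac s a \ox adk s k - ac t a \ox adk t k =
    ac s a \ox (adk s k - adk t k) + (ac s a - ac t a) \ox adk t k.
  rewrite (linB (@tp_linr R G S al K _)) (linB (@tp_linl R G S al K _)); lmod R; ring.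
apply: (le_lt_trans (rnD _ _)).
have h3 := rn_tp S (ac s a) (adk s k - adk t k); have h4 := rn_tp S (ac s a - ac t a) (adk t k).
have h5 := hom_contr (adk_hom t) k.
move: h1 h2 h3 h4 h5 (rn_ge0 (ac s a - ac t a)) (rn_ge0 (adk s k - adk t k)); rewrite /N; nra.
Qed.

Variables (b : G -> tens S al K -> tens S al K) (bP : is_action b).
Hypothesis bE : forall s a k, b s (a \ox k) = ac s a \ox adk s k.
Variable F' : full_cp S (Action bP).

(** [h] comes from the covariant pair in M(F (x) K). For the inverse, [iA F'] splits into commuting
    copies [ia] of A and [ka] of M(K). Stripping the group of its inner part leaves [v2], which
    forms with [ia] a covariant pair commuting with [ka], and [nuclear] assembles the two into
    [Psi]. *)
Lemma unwinding : exists Th : F' -> tens S F K, [/\ starhom Th, bijective Th,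
  forall a k, ext (@emb R _ \o Th) (iA F' (a \ox k)) = mtp S (iA F a) (emb k) &
  forall s, ext (@emb R _ \o Th) (fv F' s) = mtp S (fv F s) (v s)].
Proof.
have [v1 vM vs vc] := uv.
pose p : tens S al K -> mult (tens S F K) := htp (S := S) (iA F) (@emb R K).
have hi := iA_hom F; have ni := iA_nondeg F; have he := @emb_starhom R K; have ne := @nondeg_emb R K.
have hp : starhom p by exact: htp_hom.
have np : nondeg p by exact: htp_nondeg.
have pE a k : p (a \ox k) = mtp S (iA F a) (emb k) by exact: htpE.
have uu := unirep_tp S (fv_unirep F) uv.
have cov : act_covariant (al := Action bP) p (fun s => mtp S (fv F s) (v s)).
  split=> // s x; have [_ _ _ cF] := fc_cov F.
  have bl : blin (fun x => mtp S (fv F s) (v s) ** p x ** star (mtp S (fv F s) (v s))).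
    exact: (blin_comp (hom_blin hp) (blin_comp (blin_mull _) (blin_mulr _))).
  have bb : blin (b s) by exact: (hom_blin (act_hom bP s)).
  apply: (blin_eq (blin_comp bb (hom_blin hp)) bl) => a k /=.
  by rewrite bE !pE mtp_star !mtpM -adkE cF.
have [h [hh nh hA hG _]] := fc_hom_ex F' cov.
have hi' := iA_hom F'; have ni' := iA_nondeg F'; have hx := ext_hom hi' ni'.
pose ka (m : mult K) := ext (iA F') (mtp S (mone al) m).
pose ia (a : al) := ext (iA F') (mtp S (emb a) (mone K)).
have hka : starhom ka by exact: (hom_comp (@mtp_homr R G S al K) hx).
have hia : starhom ia.
  exact: (hom_comp (@emb_starhom R al) (hom_comp (@mtp_homl R G S al K) hx)).
have iaka a k : ia a ** ka (emb k) = iA F' (a \ox k).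
  by rewrite -(homM hx) -mtp_split mtp_emb ext_emb.
have com_ik a m : ia a ** ka m = ka m ** ia a.
  by rewrite -!(homM hx) mtp_com -mtp_split.
have nka : nondeg (ka \o @emb R K).
  apply/nondegP => P cP hP; apply: (cspanT_ind ni' cP) => _ [z [d ->]].
  move: z; apply: tp_ind; first exact: (clsub_pre (blin_comp (hom_blin hi') (blin_mlv d)) cP).
  by move=> a k; rewrite -iaka com_ik; exact: (hP k (ml (ia a) d)).
have nia : nondeg ia.
  apply/nondegP => P cP hP; apply: (cspanT_ind ni' cP) => _ [z [d ->]].
  move: z; apply: tp_ind; first exact: (clsub_pre (blin_comp (hom_blin hi') (blin_mlv d)) cP).
  by move=> a k; rewrite -iaka; exact: (hP a (ml (ka (emb k)) d)).
have fvx s m m' : (forall z, b s (ml m z) = ml m' (b s z)) -> fv F' s ** ext (iA F') m = ext (iA F') m' ** fv F' s.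
  move=> hm; apply: (nondeg_eq ni') => z.
  have e (t : tens S al K) : fv F' s ** iA F' t = iA F' (b s t) ** fv F' s by exact: (fv_iA F' s t).
  by rewrite -!smulA extE // !e hm smulA extE.
have bl s : blin (b s) by exact: (hom_blin (act_hom bP s)).
have fvk s m : fv F' s ** ka m = ka (v s ** m ** star (v s)) ** fv F' s.
  apply: fvx; apply: (blin_eq (blin_comp (blin_ml _) (bl s)) (blin_comp (bl s) (blin_ml _))) => a k /=.
  rewrite mtpE bE bE mtpE; congr tp; apply: emb_inj.
  by rewrite -mul_emb !adkE -mul_emb -!smulA (smulA (star (v s)) (v s)) vv mone_l.
have fva s a : fv F' s ** ia a = ia (ac s a) ** fv F' s.
  apply: fvx; apply: (blin_eq (blin_comp (blin_ml _) (bl s)) (blin_comp (bl s) (blin_ml _))) => a' k /=.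
  by rewrite mtpE bE bE mtpE /= (homM (act_hom (acP al) s)).
have [w1 wM ws wc] := fv_unirep F'.
pose v2 s := fv F' s ** ka (star (v s)).
have kaV s t : ka (star (v s)) ** fv F' t = fv F' t ** ka (star (v t) ** star (v s) ** v t).
  by rewrite fvk !smulA vv' mone_l -smulA vv' mone_r.
have uv2 : is_unirep v2.
  split=> [|s t|s|d].
  - by rewrite /v2 w1 v1 mone_star /ka mtp_one ext_one // mone_l.
  - rewrite /v2 wM vM starM -!smulA; congr (_ ** _); rewrite !smulA kaV -!smulA; congr (_ ** _).
    by rewrite -(homM hka) -!smulA vv' mone_r.
  - rewrite /v2 starM ws -(hom_star hka) starK fvk vs; congr (ka _ ** _).
    by rewrite invgK -vs vv mone_l.
  apply: (cont_app (fun s => ml_lin (fv F' s)) _ wc (y := fun s => ml (ka (star (v s))) d)).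
    move=> s x; apply: (le_trans (rn_ml _ _)); rewrite -[leRHS]mul1r ler_wpM2r //.
    exact: unirep_rn (fv_unirep F').
  have hke := hom_comp (@emb_starhom R K) hka; have kE m : ext (ka \o @emb R K) m = ka m.
    by symmetry; apply: (ext_uniq hke nka) => k; rewrite /= -(homM hka) mul_emb.
  have [_ _ ks kc] := unirep_ext hke nka uv.
  have -> : (fun s => ml (ka (star (v s))) d) = (fun s => ml (ext (ka \o @emb R K) (v (s^-1)%g)) d).
    by apply/funext => s; rewrite kE -vs.
  by move=> s; apply: (@continuous_comp _ _ _ (fun s => s^-1)%g (fun s => ml (ext (ka \o @emb R K) (v s)) d)); [exact: invg_cont | exact: kc].
have cov2 : act_covariant ia v2.
  split=> // s a; rewrite /v2 starM -(hom_star hka) starK -!smulA (smulA (ka (star (v s)))) -com_ik.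
  rewrite -!smulA (smulA (ka (star (v s)))) -(homM hka) vv /ka mtp_one ext_one // mone_l.
  rewrite smulA fva -smulA ws -wM mulgV w1 mone_r //.
have [rho [hr nr rA rG rw]] := fc_hom_ex F cov2.
have hw := @integP R G S F' v2 uv2; have [hw1 hw2 hw3] := hw.
have com_v2 s m : com (ka m) (v2 s).
  by rewrite /com /v2 -smulA -(homM hka) !fvk smulA -(homM hka) !smulA vv' !mone_l -(smulA m) vv' mone_r.
(* For unitary multipliers commutation passes from group elements to the integrated form;
   [unitary_span] extends it to all multipliers. *)
have com_w m c : com (ka m) (integ (S := S) v2 c).
  move: m c; apply: (unitary_span (@mone_l R K) (@mone_r R K)) => [u u1 u2|c x y cx cy d].
    have k1 : ka (mone K) = mone F' by rewrite /ka mtp_one ext_one.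
    apply: (com_integ_unitary hw1 hw2) => [||s]; rewrite -?(hom_star hka) -?(homM hka) ?u1 ?u2 //.
    by rewrite hw3; exact: com_v2.
  by rewrite (hom_lin hka); apply: comC; apply: comD; [apply: comZ; apply: comC; exact: cx | apply: comC; exact: cy].
have com_rk x k : rho x ** (ka \o @emb R K) k = (ka \o @emb R K) k ** rho x.
  move: x; apply: fcm_ind => [|a c].
    exact: (clsub_eq (blin_comp (hom_blin hr) (blin_mulr _)) (blin_comp (hom_blin hr) (blin_mull _))).
  rewrite (rw _ hw1 hw2 hw3) /= -smulA -(com_w (emb k) c) !smulA; congr (_ ** _).
  exact: com_ik.
have hke : starhom (ka \o @emb R K) by exact: (hom_comp (@emb_starhom R K) hka).
have [Psi [hP PE]] := @nuclear R G S F F' H K rho (ka \o @emb R K) hr hke nka com_rk.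
have nP : nondeg Psi.
  apply/nondegP => P cP hPP; apply: (cspanT_ind nr cP) => _ [x [d ->]].
  move: d; apply: (cspanT_ind nka (clsub_pre (blin_ml _) cP)) => _ [k [d ->]].
  by have := hPP (tp S x k) d; rewrite PE.
have com_rm x m : rho x ** ka m = ka m ** rho x.
  apply: (nondeg_eq nka) => k /=; transitivity (rho x ** ka (emb (ml m k))).
    by rewrite -smulA -(homM hka) mul_emb.
  rewrite [LHS](com_rk x (ml m k)) /= -mul_emb (homM hka) -!smulA; congr (_ ** _).
  by rewrite [RHS](com_rk x k).
have extP m n : ext Psi (mtp S m n) = ext rho m ** ka n.
  symmetry; apply: (ext_uniq hP nP); apply: tp_ind.
    exact: (clsub_eq (blin_comp (hom_blin hP) (blin_mull _)) (blin_comp (blin_ml _) (hom_blin hP))).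
  move=> x k; rewrite mtpE !PE /= -[LHS]smulA (smulA (ka n) (rho x)) -(com_rm x n).
  by rewrite -(smulA (rho x)) -(homM hka) mul_emb smulA (extE hr nr).
have hpA : ext h \o iA F' = p by apply/funext => z; exact: hA.
have gh x : ext Psi (h x) = emb x.
  rewrite -[LHS]/((ext Psi \o h) x).
  have n1 : nondeg (ext Psi \o h) by exact: nondeg_ext_comp.
  apply: (fc_uniq (F := F') (hom_comp hh (ext_hom hP nP)) n1 (@emb_starhom R F') (@nondeg_emb R F')) => [z|s].
    rewrite ext_comp // hA ext_embE -[LHS]/((ext Psi \o p) z) -[RHS]/(iA F' z).
    move: z; apply: (blin_eq (blin_comp (hom_blin hp) (hom_blin (ext_hom hP nP))) (hom_blin hi')) => a k.
    by rewrite /= pE extP rA iaka.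
  rewrite ext_comp // hG ext_embE extP rG /v2 -smulA -(homM hka) vv.
  by rewrite /ka mtp_one ext_one // mone_r.
have hkaE m : ext h (ka m) = mtp S (mone F) m.
  by rewrite -[LHS]/(ext h (ext (iA F') _)) -(ext_comp _ hi' ni' hh nh) hpA ext_htp_mtp // ext_one // ext_embE.
have hiaE a : ext h (ia a) = mtp S (iA F a) (mone K).
  by rewrite -[LHS]/(ext h (ext (iA F') _)) -(ext_comp _ hi' ni' hh nh) hpA ext_htp_mtp // ext_emb // ext_embE.
have hg y : ext h (Psi y) = emb y.
  rewrite -[LHS]/((ext h \o Psi) y); move: y.
  apply: (blin_eq (blin_comp (hom_blin hP) (hom_blin (ext_hom hh nh))) (blin_emb _)) => x k.
  rewrite /= PE (homM (ext_hom hh nh)) /= hkaE -mtp_emb [RHS]mtp_split; congr (_ ** _).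
  have h1 : starhom (fun x : F => mtp S (emb x) (mone K)) by exact: (hom_comp (@emb_starhom R F) (@mtp_homl R G S F K)).
  have E1 m (x' : F) : mtp S m (mone K) ** mtp S (emb x') (mone K) = mtp S (emb (ml m x')) (mone K).
    by rewrite mtpM mul_emb mone_l.
  have n1 : nondeg (fun x : F => mtp S (emb x) (mone K)).
    apply/nondegP => P cP hPP; apply: tp_ind => // x' k'; move: x'.
    apply: (prod_ind (clsub_pre (@blin_tpl R G S F K k') cP)) => x1 x2.
    by have := hPP x1 (tp S x2 k'); rewrite mtpE ml_one.
  have e1 m : ext (fun x : F => mtp S (emb x) (mone K)) m = mtp S m (mone K).
    by symmetry; apply: (ext_uniq h1 n1) => x'; exact: E1.
  rewrite -[LHS]/((ext h \o rho) x).
  have n2 : nondeg (ext h \o rho) by exact: nondeg_ext_comp.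
  apply: (fc_uniq (F := F) (hom_comp hr (ext_hom hh nh)) n2 h1 n1) => [a|s]; rewrite ext_comp // e1.
    by rewrite rA hiaE.
  by rewrite rG /v2 (homM (ext_hom hh nh)) hG hkaE mtpM mone_r vv'.
have [Th [hT bT TE]] := iso_of_mult hh nh hP nP gh hg.
have eT : @emb R (tens S F K) \o Th = h by apply/funext => x; exact: TE.
by exists Th; rewrite eT; split=> // a k; rewrite hA pE.
Qed.

End Unwinding.

(** * Crossed products by coactions and Katayama duality *)

Section SurjectiveExtension.
Variables (R : realType).
Implicit Types (A B D : cstarType R).

(** For a surjection the abstract extension is an intertwining relation, the form in which it is
    used. *)
Lemma ext_surjP A B (f : A -> B) m n : starhom f -> range f = setT ->
  ext (@emb R B \o f) m = n <-> forall x, f (ml m x) = ml n (f x).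
Proof.
move=> hf sf; have hx := hom_emb_comp hf; have nx := nondeg_surj hf sf.
split=> [<- x|h]; first by apply: emb_inj; rewrite -mul_emb -[emb (f x)]/((@emb R B \o f) x) extE.
by symmetry; apply: ext_uniq => // x; rewrite /= h mul_emb.
Qed.

Lemma bij_surj (T U : Type) (f : T -> U) : bijective f -> range f = setT.
Proof. by case=> g fK gK; apply/seteqP; split=> // y _; exists (g y). Qed.

Lemma mult_triv D (m n : mult D) : (forall z : D, z = 0) -> m = n.
Proof. by move=> h; apply: mult_ext => a; rewrite [LHS]h [RHS]h. Qed.

Lemma zero_hom A B : starhom (fun _ : A => 0 : B).
Proof. by split=> [c x y|x y|x]; rewrite ?sm0l ?st0 // scaler0 addr0. Qed.

End SurjectiveExtension.

Section CrossedFunctors.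
Variables (R : realType) (G : lcGroupType) (S : setting R G) (X : crossed S).
Implicit Types (A B : coaction S) (al be : action R G).
Local Notation "a '\ox' b" := (tp S a b).
Local Notation K := (KG S).

Lemma cpmapP al be (f : al -> be) (h : cp X al -> cp X be) : starhom h ->
  (forall a c, h (fcm (cp X al) a c) = fcm (cp X be) (f a) c) -> cpmap f =1 h.
Proof.
move=> hh hE; rewrite /cpmap; case: xgetP => [k _ [hk kE]|/(_ h)[]]; last first.
  split=> // a c x; rewrite -fcmE => /emb_inj ->; by rewrite hE fcmE.
apply: (fcm_eq hk hh) => a c; rewrite hE; apply: emb_inj.
by rewrite (kE a c) ?fcmE.
Qed.

Section One.
Variable A : coaction S.

Definition jm (a : A) (g : C0G S) : ccp X A := projT1 (cid (cc_prod (ccp X A) a g)).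
Lemma jmE a g : emb (jm a g) = jA (ccp X A) a ** jG (ccp X A) g.
Proof. exact: projT2 (cid (cc_prod (ccp X A) a g)). Qed.

Lemma jA_hom : starhom (jA (ccp X A)). Proof. by case: (cc_cov (ccp X A)). Qed.
Lemma jA_nondeg : nondeg (jA (ccp X A)). Proof. by case: (cc_cov (ccp X A)). Qed.
Lemma jG_hom : starhom (jG (ccp X A)). Proof. by case: (cc_cov (ccp X A)). Qed.

Lemma jm_ind (P : set (ccp X A)) : clsub P -> (forall a g, P (jm a g)) -> forall x, P x.
Proof.
move=> cP h; apply: (cspanT_ind (cc_dense (ccp X A)) cP) => x [a [g e]].
have -> : x = jm a g; last exact: h.
by apply: emb_inj; rewrite jmE.
Qed.

Lemma ml_jA b a g : ml (jA (ccp X A) b) (jm a g) = jm (b ** a) g.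
Proof. by apply: emb_inj; rewrite -mul_emb !jmE smulA (homM jA_hom). Qed.
Lemma mr_jG h a g : mr (jG (ccp X A) h) (jm a g) = jm a (g ** h).
Proof. by apply: emb_inj; rewrite -emb_mul !jmE -smulA (homM jG_hom). Qed.

Lemma transl_ex s (f : C0G S) : exists g : C0G S, forall t, c0_ev g t = c0_ev f (t * s)%g.
Proof.
have [hc hv] := (@c0_range R G (C0G S) (c0_ev f)).1 (ex_intro _ f erefl).
have ct (u : G) : continuous (fun t : G => (t * u)%g).
  move=> t; apply: (@continuous_comp _ _ _ (fun t : G => (t, u)%g) (fun x : G * G => (x.1 * x.2)%g)).
    by apply: cvg_pair; [exact: cvg_id | exact: cvg_cst].
  exact: mulg_cont.
suff [g gE] : exists g : C0G S, c0_ev g = fun t => c0_ev f (t * s)%g by exists g => t; rewrite gE.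
apply: (@c0_range R G (C0G S) _).2; split; last first.
  move=> e e0; have -> : [set t | e <= `|c0_ev f (t * s)%g|] = (fun t => (t * s^-1)%g) @` [set t | e <= `|c0_ev f t|].
    apply/seteqP; split=> [t /= h|_ [t /= h <-] /=]; last by rewrite -mulgA mulVg mulg1.
    by exists (t * s)%g => //; rewrite -mulgA mulgV mulg1.
  by apply: continuous_compact (hv e e0); apply: continuous_subspaceT; exact: ct.
by move=> t; apply: (@continuous_comp _ _ _ (fun t : G => (t * s)%g) (c0_ev f : G -> R[i]^o)); [exact: ct | exact: hc].
Qed.

Definition ctr s f : C0G S := projT1 (cid (transl_ex s f)).

Lemma cac_jm s a g : ac (a := dual_ac X A) s (jm a g) = jm a (ctr s g).
Proof.
have aP := cc_acP (ccp X A); have hs := act_hom aP s.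
have sf : range (cc_ac (c := ccp X A) s) = setT.
  apply/seteqP; split=> // y _; exists (cc_ac (s^-1)%g y) => //.
  by rewrite -(actM aP) mulgV (act1 aP).
have hx := hom_emb_comp hs; have nx := nondeg_surj hs sf.
apply: emb_inj; rewrite -[LHS](ext_emb hx nx) jmE (homM (ext_hom hx nx)) cc_acA jmE; congr (_ ** _).
by apply: cc_acG => t; rewrite (projT2 (cid (transl_ex s g))).
Qed.

End One.

Lemma jm_eq A (D : cstarType R) (h k : ccp X A -> D) : starhom h -> starhom k ->
  (forall a g, h (jm a g) = k (jm a g)) -> h =1 k.
Proof. by move=> hh hk; apply: jm_ind; exact: (clsub_eq (hom_blin hh) (hom_blin hk)). Qed.

Lemma ccpmapP A B (f : A -> B) (h : ccp X A -> ccp X B) : starhom h ->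
  (forall a g, h (jm a g) = jm (f a) g) -> ccpmap f =1 h.
Proof.
move=> hh hE; rewrite /ccpmap; case: xgetP => [k _ [hk kE]|/(_ h)[]]; last first.
  split=> // a c x; rewrite -jmE => /emb_inj ->; by rewrite hE jmE.
apply: (jm_eq hk hh) => a c; rewrite hE; apply: emb_inj.
by rewrite (kE a c) ?jmE.
Qed.

(** Bijectivity excludes the default value of [xget] unless the target is zero, and there all
    equations hold. *)
Lemma ccpmap_bij A B (f : A -> B) : bijective (ccpmap (X := X) f) ->
  starhom (ccpmap (X := X) f) /\ forall a g, ccpmap f (jm a g) = jm (f a) g.
Proof.
rewrite /ccpmap; case: xgetP => [k _ [hk kE] _|nk bij].
  by split=> // a g; apply: emb_inj; rewrite jmE (kE a g) ?jmE.
have z (y : ccp X B) : y = 0 by have [g _ gK] := bij; rewrite -(gK y).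
split=> [|a g]; first exact: zero_hom.
by rewrite [LHS]z [RHS]z.
Qed.

(** [(id (x) lambda) o delta] in the notation of the paper. *)
Definition dlam A (a : A) : mult (tens S A K) :=
  ext (htp (S := S) (@emb R A) (@lamC R G S)) (co a).

(** Katayama duality in abstract form: the canonical maps of a maximal coaction are one instance,
    and others arise by transport along an isomorphism. *)
Record dual_pair A (PA : ccp X A -> mult (tens S A K)) (P : dcp X A -> tens S A K) := DualPair {
  dp_hom : starhom PA; dp_nondeg : nondeg PA; dp_inj : injective PA;
  dp_A : forall a x, PA (ml (jA (ccp X A) a) x) = dlam a ** PA x;
  dp_G : forall g x, PA (ml (jG (ccp X A) g) x) = mtp S (mone _) (MG g) ** PA x;
  dp_P : starhom P; dp_bij : bijective P;
  dp_PA : forall x z, P (ml (iA (dcp X A) x) z) = ml (PA x) (P z);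
  dp_PG : forall c z, P (ml (iG (dcp X A) c) z) = ml (mtp S (mone _) (rhoC c)) (P z)
}.

(** [maximal] says that the chosen map [Phi] is bijective. If its defining conditions had no
    solution, the default zero map would be bijective and the algebra zero, so the conditions hold
    in any case. *)
Lemma max_dual A : maximal X A -> dual_pair (PhiA (A := A)) (Phi (A := A)).
Proof.
rewrite /maximal => bij; have sP := bij_surj bij.
have [hP PA PG] : [/\ starhom (Phi (X := X) (A := A)),
    forall x, ext (@emb R _ \o Phi (A := A)) (iA (dcp X A) x) = PhiA x
  & forall c, ext (@emb R _ \o Phi (A := A)) (iG (dcp X A) c) = mtp S (mone _) (rhoC c)].
  move: bij sP; rewrite /Phi; case: xgetP => [//|nP bij sP].
  have z (y : tens S A K) : y = 0 by have [g _ gK] := bij; rewrite -(gK y).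
  split; first exact: zero_hom.
    by move=> x; apply: mult_triv.
  by move=> c; apply: mult_triv.
have hx := hom_emb_comp hP; have nx := nondeg_surj hP sP.
have Pi : injective (Phi (X := X) (A := A)) by exact: bij_inj bij.
have xi : injective (ext (@emb R _ \o Phi (X := X) (A := A))).
  apply: (lin_inj (hom_lin (ext_hom hx nx))) => m /(ext_surjP _ _ hP sP) h.
  apply: mult_ext => a; last first.
    apply: smul_injl => b; rewrite -mlr smul0r; apply: Pi.
    by rewrite (homM hP) h sm0r (lin0 (hom_lin hP)).
  by apply: Pi; rewrite h (lin0 (hom_lin hP)).
have eA : PhiA (A := A) = ext (@emb R _ \o Phi (X := X) (A := A)) \o iA (dcp X A).
  by apply/funext => x; rewrite /= PA.
(* [PhiA] is [iA] followed by an injective extension; here faithfulness of the algebra in its full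
   crossed product enters. *)
have inj : injective (PhiA (X := X) (A := A)).
  by rewrite eA; apply: inj_comp => //; exact: iA_inj.
have hA : starhom (PhiA (X := X) (A := A)).
  by rewrite eA; exact: (hom_comp (iA_hom _) (ext_hom hx nx)).
have nA : nondeg (PhiA (X := X) (A := A)).
  by rewrite eA; exact: (nondeg_ext_comp (iA_hom (dcp X A)) (iA_nondeg _) hx nx).
have [sA sG] : (forall a, ext (PhiA (A := A)) (jA (ccp X A) a) = dlam a) /\
    (forall g, ext (PhiA (A := A)) (jG (ccp X A) g) = mtp S (mone _) (MG g)).
  move: inj; rewrite /PhiA; case: xgetP => [h _ [//]|nh] inj.
  have z (y : tens S A K) : y = 0.
    have [g _ gK] := bij; rewrite -(gK y) -(lin0 (hom_lin hP)); congr (Phi _).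
    move: (g y); apply: fcm_ind; first exact: clsub0.
    move=> a c; have -> : a = 0 by apply: inj.
    exact: (lin0 (blin_fcml (dcp X A) c).1).
  by split=> ?; apply: mult_triv.
split=> //.
- by move=> a x; rewrite -(extE hA nA) sA.
- by move=> g x; rewrite -(extE hA nA) sG.
- by move=> x z; apply/(ext_surjP _ _ hP sP): z.
- by move=> c z; apply/(ext_surjP _ _ hP sP): z.
Qed.

Section Dual.
Variables (A : coaction S) (PA : ccp X A -> mult (tens S A K)) (P : dcp X A -> tens S A K).
Hypothesis dp : dual_pair PA P.

Lemma dp_jm a g : PA (jm a g) = dlam a ** mtp S (mone _) (MG g).
Proof.
apply: (nondeg_eq (dp_nondeg dp)) => x; rewrite -(homM (dp_hom dp)).
have -> : jm a g ** x = ml (jA (ccp X A) a) (ml (jG (ccp X A) g) x).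
  by rewrite -[LHS]/(ml (emb (jm a g)) x) jmE.
by rewrite (dp_A dp) (dp_G dp) smulA.
Qed.

Lemma dp_surj : range P = setT. Proof. exact: bij_surj (dp_bij dp). Qed.

Lemma dp_fcm x c : emb (P (fcm (dcp X A) x c)) = PA x ** mtp S (mone _) (rhoC c).
Proof.
apply: (nondeg_eq (@nondeg_emb R _)) => w.
have /(_ w I) [z _ <-] : forall w, setT w -> range P w by rewrite dp_surj.
rewrite -embM -(homM (dp_P dp)) mul_emb; congr emb.
have -> : fcm (dcp X A) x c ** z = ml (iA (dcp X A) x) (ml (iG (dcp X A) c) z).
  by rewrite -[LHS]/(ml (emb (fcm (dcp X A) x c)) z) fcmE.
by rewrite (dp_PA dp) (dp_PG dp).
Qed.

End Dual.

Lemma lamC_hom : starhom (@lamC R G S). Proof. by case: (lamCP S). Qed.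
Lemma lamC_nondeg : nondeg (@lamC R G S). Proof. by case: (lamCP S). Qed.

Definition hl A := htp (S := S) (@emb R A) (@lamC R G S).
Arguments hl A : clear implicits.
Lemma hl_hom A : starhom (hl A). Proof. exact: htp_hom (@emb_starhom R A) lamC_hom. Qed.
Lemma hl_nondeg A : nondeg (hl A).
Proof. exact: htp_nondeg (@emb_starhom R A) lamC_hom (@nondeg_emb R A) lamC_nondeg. Qed.
Lemma ext_hl A (m : mult A) c : ext (hl A) (mtp S m (emb c)) = mtp S m (lamC c).
Proof.
rewrite ext_htp_mtp ?ext_embE ?ext_emb //; try exact: lamC_hom; try exact: lamC_nondeg.
  exact: emb_starhom.
exact: nondeg_emb.
Qed.

Lemma dlam_hom A : starhom (@dlam A).
Proof. exact: (hom_comp (coa_hom (coP A)) (ext_hom (hl_hom A) (hl_nondeg A))). Qed.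
Lemma dlam_nondeg A : nondeg (@dlam A).
Proof. exact: nondeg_ext_comp (coa_hom (coP A)) (coa_nondeg (coP A)) (hl_hom A) (hl_nondeg A). Qed.

Section Map.
Variables (A B : coaction S) (f : A -> B).
Hypothesis cf : is_comor f.
Let hf : starhom f. Proof. by case: cf. Qed.
Local Notation T := (tmap (S := S) f (@id K)).
Let hT : starhom T. Proof. exact: tmap_hom hf (@hom_id R _). Qed.
Let TE a k : T (a \ox k) = f a \ox k. Proof. exact: (@tmapE R G S _ _ _ _ _ _ hf (@hom_id R _)). Qed.

Lemma tmap_mtp (m : mult A) (m' : mult B) (n : mult K) z :
  (forall x, f (ml m x) = ml m' (f x)) -> T (ml (mtp S m n) z) = ml (mtp S m' n) (T z).
Proof.
move=> h; move: z.
apply: (blin_eq (blin_comp (blin_ml _) (hom_blin hT)) (blin_comp (hom_blin hT) (blin_ml _))) => a k /=.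
by rewrite mtpE !TE mtpE h.
Qed.

Lemma tmap_one (n : mult K) z : T (ml (mtp S (mone A) n) z) = ml (mtp S (mone B) n) (T z).
Proof. exact: tmap_mtp. Qed.

Lemma tmap_hl x z : T (ml (hl A x) z) = ml (hl B (tmap (S := S) f id x)) (T z).
Proof.
have hi := @tmap_hom R G S _ _ _ _ _ _ hf (@hom_id R (CG S)).
move: x; apply: tp_ind => [|a c].
  apply: clsub_eq; first exact: (blin_comp (blin_comp (hom_blin (hl_hom A)) (blin_mlv z)) (hom_blin hT)).
  exact: (blin_comp (blin_comp (hom_blin hi) (hom_blin (hl_hom B))) (blin_mlv (T z))).
rewrite (@tmapE R G S _ _ _ _ _ _ hf (@hom_id R (CG S))) /hl !htpE; try exact: emb_starhom; try exact: lamC_hom.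
by apply: tmap_mtp => x; exact: (homM hf).
Qed.

Lemma dlam_T a z : T (ml (dlam a) z) = ml (dlam (f a)) (T z).
Proof.
move: z; apply: tens_ind (prod_dense A) lamC_nondeg _ _.
  exact: (clsub_eq (blin_comp (blin_ml _) (hom_blin hT)) (blin_comp (hom_blin hT) (blin_ml _))).
move=> a' k' _ [c [k ->]]; have [[x xE] _] := coa_tilde (coP A) a c.
have e := cf.2 a c x (esym xE).
have d (E : coaction S) (b : E) y : emb y = co b ** @onec R G S E c -> dlam b ** mtp S (mone E) (lamC c) = hl E y.
  by move=> h; rewrite -ext_hl -(homM (ext_hom (hl_hom E) (hl_nondeg E))) -h ext_emb //; [exact: hl_hom | exact: hl_nondeg].
have -> : a' \ox ml (lamC c) k = ml (mtp S (mone A) (lamC c)) (a' \ox k) by rewrite mtpE ml_one.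
rewrite tmap_one -[LHS]/(T (ml (dlam a ** mtp S (mone A) (lamC c)) (a' \ox k))) (d _ _ _ (esym xE)).
by rewrite tmap_hl -(d _ _ _ e).
Qed.

End Map.

End CrossedFunctors.

Section Transport.
Variables (R : realType) (G : lcGroupType) (S : setting R G) (X : crossed S).
Local Notation K := (KG S).
Variables (A B : coaction S) (f : A -> B).
Variables (PA : ccp X A -> mult (tens S A K)) (P : dcp X A -> tens S A K).
Hypotheses (dp : dual_pair PA P) (cf : is_comor f).
Local Notation T := (tmap (S := S) f (@id K)).

(** Serves coactions isomorphic to their maximalization, dual coactions in particular: duality is
    available for the maximalization and is carried over along the isomorphism. *)
Lemma dual_transport : bijective f -> bijective (ccpmap (X := X) f) -> exists PB P',
  @dual_pair R G S X B PB P' /\ forall x, P' (dcpmap f x) = T (P x).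
Proof.
move=> bf bc; have [hf _] := cf; have [hc cE] := ccpmap_bij bc.
have [f' fK f'K] := bf; have [c' cK c'K] := bc; set c := ccpmap f in bc hc cE cK c'K.
have hT : starhom T by exact: tmap_hom hf (@hom_id R _).
have Ti : injective T by apply: tmap_inj => //; exact: bij_inj.
have sT : range T = setT.
  apply: tmap_surj => //; first exact: bij_surj.
  by apply/seteqP; split=> // k _; exists k.
have bT : bijective T by exact: inj_surj_bij.
have hac s (E : coaction S) : starhom (ac (a := dual_ac X E) s) by exact: act_hom (acP (dual_ac X E)) s.
have ce : is_acmor (al := dual_ac X A) (be := dual_ac X B) c.
  split=> // s; apply: (jm_eq (hom_comp (hac s A) hc) (hom_comp hc (hac s B))) => a g.
  transitivity (c (jm X a (ctr s g))); first by congr c; exact: cac_jm.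
  rewrite cE; transitivity (ac (a := dual_ac X B) s (jm X (f a) g)); first by rewrite cac_jm.
  by rewrite -cE.
(* The range of the bijection [c] is trivially an ideal, so the results on ideals give bijectivity
   of the second crossed product. *)
have cI (x : dual_ac X A) (y : dual_ac X B) : range c (y ** c x) by exists (c' (y ** c x)).
have [d [hd dE dR]] := cp_ideal (dcp X A) (dcp X B) ce cI.
have di : injective d by apply: (cp_ideal_inj ce cI) => //; exact: bij_inj.
have ds : range d = setT.
  rewrite dR -(iA_nondeg (dcp X B)); congr cspan; apply/seteqP; split=> w [x [z ->]].
    by exists (c x), z.
  by exists (c' x), z; rewrite c'K.
have bd : bijective d by exact: inj_surj_bij.
have dcE : dcpmap f =1 d by exact: cpmapP.
have [d' dK d'K] := bd; have hd' := hom_bij_inv hd di d'K.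
have hc' := hom_bij_inv hc (bij_inj bc) c'K.
have cA a x : c (ml (jA (ccp X A) a) x) = ml (jA (ccp X B) (f a)) (c x).
  move: x; apply: jm_ind; first exact: (clsub_eq (blin_comp (blin_ml _) (hom_blin hc)) (blin_comp (hom_blin hc) (blin_ml _))).
  by move=> a' g; rewrite ml_jA !cE ml_jA (homM hf).
(* On generators [jG] multiplies from the right; the left version follows by taking adjoints. *)
have cG g x : c (ml (jG (ccp X A) g) x) = ml (jG (ccp X B) g) (c x).
  have r h y : c (mr (jG (ccp X A) h) y) = mr (jG (ccp X B) h) (c y).
    move: y; apply: jm_ind; first exact: (clsub_eq (blin_comp (blin_mr _) (hom_blin hc)) (blin_comp (hom_blin hc) (blin_mr _))).
    by move=> a' g'; rewrite mr_jG !cE mr_jG.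
  have mlE D (m : mult D) (y : D) : ml m y = star (mr (star m) (star y)) by rewrite /= !starK.
  by rewrite mlE (hom_star hc) -(hom_star (jG_hom X A)) r mlE -(hom_star (jG_hom X B)) (hom_star hc).
have nT := nondeg_surj hT sT.
pose Tb := ext (@emb R _ \o T).
have hTb : starhom Tb by exact: ext_hom (hom_emb_comp hT) nT.
have TbE m z : T (ml m z) = ml (Tb m) (T z) by apply/(ext_surjP _ _ hT sT): z.
have Tbd a : Tb (dlam a) = dlam (f a) by apply/(ext_surjP _ _ hT sT) => z; exact: dlam_T.
have Tb1 n : Tb (mtp S (mone A) n) = mtp S (mone B) n.
  by apply/(ext_surjP _ _ hT sT) => z; exact: tmap_one.
exists (fun y => Tb (PA (c' y))), (fun w => T (P (d' w))); split; last by move=> x; rewrite dcE dK.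
split.
- exact: (hom_comp hc' (hom_comp (dp_hom dp) hTb)).
- have n0 := nondeg_ext_comp (dp_hom dp) (dp_nondeg dp) (hom_emb_comp hT) nT.
  apply/nondegP => Q cQ hQ; apply: ((nondegP _).1 n0 Q cQ) => x b.
  by have := hQ (c x) b; rewrite cK.
- move=> y y' e; rewrite -[y]c'K -[y']c'K; congr c; apply: (dp_inj dp).
  by apply: mult_eq => z; apply: Ti; rewrite !TbE e.
- move=> b y; rewrite -[b]f'K -{1}[y]c'K -cA cK (dp_A dp) (homM hTb) Tbd //.
- by move=> g y; rewrite -{1}[y]c'K -cG cK (dp_G dp) (homM hTb) Tb1.
- exact: (hom_comp hd' (hom_comp (dp_P dp) hT)).
- exact: (bij_comp bT (bij_comp (dp_bij dp) (Bijective d'K dK))).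
- move=> y w; rewrite -{1}[y]c'K -{1}[w]d'K -(phi_iA ce hd dE) dK (dp_PA dp) TbE //.
- move=> g w; rewrite -{1}[w]d'K.
  have -> : ml (iG (dcp X B) g) (d (d' w)) = d (ml (iG (dcp X A) g) (d' w)).
    symmetry; apply: (integ_intertwine hd (iG_hom _) (iG_nondeg _) (iG_hom _) (iG_nondeg _)).
    by move=> s z; exact: (phi_fv ce hd dE s z).
  by rewrite dK (dp_PG dp) TbE Tb1.
Qed.

Lemma tmap_dual_inv z : bijective P -> P (inv_of 0 P z) = z.
Proof.
by move=> [g gK Pg]; rewrite /inv_of; case: xgetP => [x _ //|/(_ (g z))[]]; exact: Pg.
Qed.

Variables (PB : ccp X B -> mult (tens S B K)) (P' : dcp X B -> tens S B K) (p : mult B).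
Hypotheses (dpB : dual_pair PB P') (sp : sa p) (pp : p ** p = p) (pf : forall a, ml p (f a) = f a).
Hypothesis pd : forall Q : set B, clsub Q -> (forall a b, Q (f a ** b)) -> forall b, Q (ml p b).

Let hf : starhom f. Proof. by case: cf. Qed.
Let hT : starhom T. Proof. exact: tmap_hom hf (@hom_id R _). Qed.
Local Notation p1 := (mtp S p (mone K)).

Lemma corner_sa : sa p1. Proof. by rewrite /sa mtp_star sp mone_star. Qed.
Lemma corner_idem : p1 ** p1 = p1. Proof. by rewrite mtpM pp mone_l. Qed.

Lemma corner_T z : ml p1 (T z) = T z.
Proof.
move: z; apply: (blin_eq (blin_comp (hom_blin hT) (blin_ml _)) (hom_blin hT)) => a k /=.
by rewrite (@tmapE R G S _ _ _ _ _ _ hf (@hom_id R _)) mtpE pf.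
Qed.

Lemma corner_mr z : mr p1 (T z) = T z.
Proof. by rewrite -corner_sa /= -(hom_star hT) corner_T (hom_star hT) starK. Qed.

Lemma corner_dense (Q : set (tens S B K)) : clsub Q -> (forall z y, Q (T z ** y)) -> forall y, Q (ml p1 y).
Proof.
move=> cQ hQ; apply: tens_ind (cspan_eqT (fun Q' cQ' hQ' x => hQ' x I)) (prod_dense K) (clsub_pre (blin_ml _) cQ) _.
move=> b _ _ [k [k' ->]] /=; rewrite mtpE ml_one.
apply: (pd (clsub_pre (@blin_tpl R G S B K (k ** k')) cQ)) => a b' /=.
by rewrite -tpM; have := hQ (tp S a k) (tp S b' k'); rewrite (@tmapE R G S _ _ _ _ _ _ hf (@hom_id R _)).
Qed.

Lemma cext_T : [/\ starhom (cext p1 T), forall m z, cext p1 T m ** emb (T z) = emb (T (ml m z)),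
  forall m, p1 ** cext p1 T m = cext p1 T m /\ cext p1 T m ** p1 = cext p1 T m
  & cext p1 T (mone _) = p1].
Proof. exact: (cext_spec hT corner_sa corner_idem corner_T corner_dense). Qed.

Lemma corner_eq (n n' : mult (tens S B K)) : n ** p1 = n -> n' ** p1 = n' ->
  (forall z, n ** emb (T z) = n' ** emb (T z)) -> n = n'.
Proof.
move=> h h'; apply: (ext_q_eq (f := @emb R _ \o T) _ h h') => Q cQ hQ b.
exact: (corner_dense cQ).
Qed.

(** After multiplication by 1 (x) c the coaction at [f a] comes from the tensor product over [A]
    through f (x) id, where p (x) 1 acts as the identity. *)
Lemma dlam_corner a : dlam (f a) ** p1 = dlam (f a).
Proof.
have e : co (f a) ** mtp S p (mone (CG S)) = co (f a).
  suff h c : @onec R G S B c ** (co (f a) ** mtp S p (mone (CG S))) = @onec R G S B c ** co (f a).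
    apply: (can_inj starK); apply: mult_eq; apply: tens_ind (cspan_eqT (fun Q' cQ' hQ' x => hQ' x I)) (prod_dense _) _ _.
      by apply: clsub_eq; exact: blin_ml.
    move=> b _ _ [c [c' ->]]; have := congr1 (fun m => ml (star m) (tp S b c')) (h (star c)).
    have sE Y : ml (star (@onec R G S B (star c) ** Y)) (tp S b c') = ml (star Y) (tp S b (c ** c')).
      rewrite starM /onec mtp_star mone_star emb_star starK.
      by rewrite -[LHS]/(ml (star Y) (ml (mtp S (mone B) (emb c)) (tp S b c'))) mtpE ml_one.
    by rewrite !sE.
  have [[x xE] _] := coa_tilde (coP A) (star a) (star c).
  have := cf.2 _ _ _ (esym xE); move=> /(congr1 star); rewrite -emb_star starM -(hom_star (coa_hom (coP B))) (hom_star hf) !starK.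
  rewrite {1}/onec mtp_star mone_star -emb_star starK -/(@onec R G S B c) => E; rewrite smulA -E emb_mul; congr emb.
  have hi := @tmap_hom R G S _ _ _ _ _ _ hf (@hom_id R (CG S)).
  rewrite -(hom_star hi); move: (star x); apply: (blin_eq (blin_comp (hom_blin hi) (blin_mr _)) (hom_blin hi)) => b' c' /=.
  rewrite (@tmapE R G S _ _ _ _ _ _ hf (@hom_id R _)) mtp_mr; congr tp.
  by rewrite -sp /= -(hom_star hf) pf (hom_star hf) starK.
rewrite /dlam -{2}e (homM (ext_hom (hl_hom B) (hl_nondeg B))); congr (_ ** _).
rewrite ext_htp_mtp ?ext_embE ?ext_one //; try exact: lamC_hom; try exact: lamC_nondeg; try exact: emb_starhom.
exact: nondeg_emb.
Qed.

Lemma cext_eq m n : n ** p1 = n -> (forall z, n ** emb (T z) = emb (T (ml m z))) -> cext p1 T m = n.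
Proof.
have [_ tE tq _] := cext_T => h hn; apply: corner_eq => // [|z]; first exact: (tq m).2.
by rewrite tE hn.
Qed.

Lemma corner_com m n : mtp S m (mone K) ** mtp S (mone B) n = mtp S (mone B) n ** mtp S m (mone K).
Proof. by rewrite mtp_com -mtp_split. Qed.

Lemma cext_mtp m : cext p1 T (mtp S (mone A) m) = p1 ** mtp S (mone B) m.
Proof.
apply: cext_eq => [|z]; first by rewrite -smulA -corner_com smulA corner_idem.
by rewrite -smulA mul_emb -(tmap_one cf) mul_emb corner_T.
Qed.

(** [f] may be degenerate, so its crossed products are not reached by nondegenerate universal
    properties. The extension [cext] along p (x) 1 carries [PA (jm X a g)] to [PB (jm X (f a) g)];
    this determines the crossed product of [f], and a comparison on generators then determines the
    double one. *)
Lemma corner_dcp w : P' (dcpmap f w) = T (P w).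
Proof.
have [ht tE tq t1] := cext_T.
have key a g : cext p1 T (PA (jm X a g)) = PB (jm X (f a) g).
  rewrite (dp_jm dp) (dp_jm dpB); apply: cext_eq => [|z].
    by rewrite -smulA -corner_com smulA dlam_corner.
  rewrite -smulA mul_emb -(tmap_one cf) mul_emb; congr emb.
  by rewrite -[ml (_ ** _) z]/(ml (dlam a) (ml _ z)) (dlam_T cf).
have rng x : range PB (cext p1 T (PA x)).
  move: x; apply: jm_ind.
    exact: (clsub_pre (blin_comp (hom_blin (dp_hom dp)) (hom_blin ht)) (hom_range_clsub (dp_hom dpB))).
  by move=> a g; rewrite key; exists (jm X (f a) g).
have [c hc cE] := hom_factor (hom_comp (dp_hom dp) ht) (dp_hom dpB) (dp_inj dpB) rng.
have cm : ccpmap f =1 c.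
  by apply: ccpmapP => // a g; apply: (dp_inj dpB); rewrite cE -key.
have [q P'K qK] := dp_bij dpB; have hq := hom_bij_inv (dp_P dpB) (bij_inj (dp_bij dpB)) qK.
suff h : dcpmap f =1 fun w => q (T (P w)) by rewrite h qK.
have -> : dcpmap f = @cpmap R G S X (dual_ac X A) (dual_ac X B) c.
  by rewrite /dcpmap; congr cpmap; apply/funext.
apply: cpmapP => [|x g]; first exact: (hom_comp (dp_P dp) (hom_comp hT hq)).
apply: (bij_inj (dp_bij dpB)); rewrite qK; apply: emb_inj.
rewrite (dp_fcm dpB) cE /=; apply: corner_eq => [||z].
- by rewrite emb_mul corner_mr.
- by rewrite -smulA -corner_com smulA (tq (PA x)).2.
rewrite -embM -(homM hT) -smulA mul_emb -(tmap_one cf) tE; congr (emb (T _)).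
by apply: emb_inj; rewrite embM (dp_fcm dp) -smulA !mul_emb.
Qed.

End Transport.

(** * Imprimitivity bimodules from complementary corners *)

Section PositiveDescent.
Variables (R : realType) (A L : cstarType R) (f : A -> L).
Hypotheses (hf : starhom f) (fi : injective f).

(** [positive] requires a root inside [A]. Uniqueness of positive roots over [L] shows that [a] is
    its own absolute value, and then the iterates [yk] produce a root within [A]. *)
Lemma positive_descend a l : f a = star l ** l -> positive a.
Proof.
move=> fa; have sa_a : sa a by apply: fi; rewrite (hom_star hf) fa starM starK.
have [p [pp p2 pc hp]] := abs_ex sa_a.
have pa : p = a.
  apply: fi; apply: emb_inj; apply: (@pos_uniq R _ _ (@mone_l R L) (@mone_r R L)).
  - exact: hp.
  - by rewrite fa; exact: pos_embM.
  - by apply: (hom_com (@emb_starhom R L)); apply: (hom_com hf); apply: comC; apply: pc.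
  - by rewrite -!embM -!(homM hf) p2.
rewrite {}pa in pp; pose k := (rn a + 1)^-1.
have k0 : 0 < k by rewrite invr_gt0; have := rn_ge0 a; lra.
have pk : pos (emb (k%:C%C *: a)).
  by rewrite (linZ (@emb_lin R A)); apply: posZ => //; exact: ltW.
have k1 : rn (k%:C%C *: a) <= 1.
  rewrite rnZr ?(ltW k0) // /k mulrC ler_pdivrMr ?mul1r; first by lra.
  by have := rn_ge0 a; lra.
have n1 := near_posE pk k1; have [w [cw _]] := yk_cvs n1.
have [pw ww _] := yk_limP (pos_sa pk) n1 cw.
have sw : star w = w by apply: emb_inj; rewrite emb_star; exact: (pos_sa pw).
exists ((Num.sqrt (rn a + 1))%:C%C *: w).
rewrite starZ conjE conjc_real sw smulZl smulZr ww !scalerA.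
have r1 : 0 <= rn a + 1 by have := rn_ge0 a; lra.
have r2 : rn a + 1 != 0 by apply: lt0r_neq0; have := rn_ge0 a; lra.
by rewrite -!rmorphM /= -expr2 sqr_sqrtr // mulfV // scale1r.
Qed.

End PositiveDescent.

Section CornerBimodule.
Variables (R : realType) (L A B : cstarType R) (fA : A -> L) (fB : B -> L) (p q : mult L).
Hypotheses (hA : starhom fA) (hB : starhom fB) (iA : injective fA) (iB : injective fB).
Hypotheses (sp : sa p) (sq : sa q) (pp : p ** p = p) (qq : q ** q = q) (pq : p ** q = 0) (pq1 : p + q = mone L).
Hypotheses (pA : forall a, ml p (fA a) = fA a) (rA : forall l, range fA (ml p (mr p l))).
Hypotheses (qB : forall b, ml q (fB b) = fB b) (rB : forall l, range fB (ml q (mr q l))).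

Lemma mrM (m : mult L) a b : mr m (a ** b) = a ** mr m b.
Proof. by apply: smul_injl => c; rewrite -mlr -!smulA mlr. Qed.

Lemma mr_sa (m : mult L) a : sa m -> mr m (star a) = star (ml m a).
Proof. by move=> {1}<- /=; rewrite starK. Qed.

Lemma ml_sa (m : mult L) a : sa m -> ml m (star a) = star (mr m a).
Proof. by move=> {1}<- /=; rewrite starK. Qed.

Lemma mrA a : mr p (fA a) = fA a.
Proof. by rewrite -[a]starK (hom_star hA) mr_sa // pA. Qed.
Lemma mrB b : mr q (fB b) = fB b.
Proof. by rewrite -[b]starK (hom_star hB) mr_sa // qB. Qed.

Lemma qp : q ** p = 0.
Proof. by rewrite -sq -sp -starM pq st0. Qed.

Lemma orth_pq x y : mr p x = x -> ml q y = y -> x ** y = 0.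
Proof.
move=> <- <-; rewrite -mlr -[ml p (ml q y)]/(ml (p ** q) y) pq; exact: sm0r.
Qed.
Lemma orth_qp x y : mr q x = x -> ml p y = y -> x ** y = 0.
Proof.
move=> <- <-; rewrite -mlr -[ml q (ml p y)]/(ml (q ** p) y) qp; exact: sm0r.
Qed.

Definition offdiag : set L := [set l | ml p l = l] `&` [set l | mr q l = l].
Lemma offdiag_cl : clsub offdiag.
Proof.
by apply: clsub_setI; apply: clsub_eq; [exact: blin_ml | exact: blin_id | exact: blin_mr | exact: blin_id].
Qed.
Definition bim := subv (ClSpace offdiag_cl).
Implicit Types x y z : bim.

Lemma bp x : ml p (sv x) = sv x. Proof. by case: (svP x). Qed.
Lemma bq x : mr q (sv x) = sv x. Proof. by case: (svP x). Qed.

Lemma off_pq l : offdiag (ml p (mr q l)).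
Proof.
split=> /=; first by rewrite -[ml p (ml p _)]/(ml (p ** p) _) pp.
by rewrite -ml_mr -[mr q (mr q _)]/(mr (q ** q) _) qq.
Qed.
Definition bimof l : bim := SubV (S := ClSpace offdiag_cl) (off_pq l).

Lemma bl_off a x : offdiag (fA a ** sv x).
Proof. by split=> /=; [rewrite mlM pA | rewrite mrM bq]. Qed.
Lemma br_off x b : offdiag (sv x ** fB b).
Proof. by split=> /=; [rewrite mlM bp | rewrite mrM mrB]. Qed.
Definition b_lact a x : bim := SubV (S := ClSpace offdiag_cl) (bl_off a x).
Definition b_ract x b : bim := SubV (S := ClSpace offdiag_cl) (br_off x b).

Lemma lip_ex x y : exists a, fA a = sv x ** star (sv y).
Proof.
have [a _ e] := rA (sv x ** star (sv y)); exists a.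
by rewrite e mrM mr_sa // bp mlM bp.
Qed.
Lemma rip_ex x y : exists b, fB b = star (sv x) ** sv y.
Proof.
have [b _ e] := rB (star (sv x) ** sv y); exists b.
by rewrite e mrM bq mlM ml_sa // bq.
Qed.
Definition b_lip x y : A := projT1 (cid (lip_ex x y)).
Definition b_rip x y : B := projT1 (cid (rip_ex x y)).
Lemma b_lipE x y : fA (b_lip x y) = sv x ** star (sv y). Proof. exact: projT2 (cid (lip_ex x y)). Qed.
Lemma b_ripE x y : fB (b_rip x y) = star (sv x) ** sv y. Proof. exact: projT2 (cid (rip_ex x y)). Qed.

Hypothesis fullA : forall Q : set A, clsub Q ->
  (forall a x y, fA a = sv x ** star (sv y) -> Q a) -> forall a, Q a.
Hypothesis fullB : forall Q : set B, clsub Q ->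
  (forall b x y, fB b = star (sv x) ** sv y -> Q b) -> forall b, Q b.

(** The bimodule is the off-diagonal corner with the products of [L]; positivity of the inner
    products is brought down to [A] and [B] by [positive_descend], and the norm is that of [L]
    because [fB] is isometric. *)
Definition corner_imprim : imprim A B.
Proof.
pose lA := hom_lin hA; pose lB := hom_lin hB; pose ls := @sv_lin R L (ClSpace offdiag_cl).
refine (@Imprim R A B bim b_lact b_ract b_lip b_rip _ _ _ _ _ _ _ _ _ _ _ _ _ _ _ _ _ _ _ _).
- by move=> x c a b; apply: sv_inj; rewrite [RHS]ls -[LHS]/(fA (c *: a + b) ** sv x) lA smulDl smulZl.
- by move=> a c x y; apply: sv_inj; rewrite [RHS]ls -[LHS]/(fA a ** sv (c *: x + y)) ls smulDr smulZr.
- by move=> a a' x; apply: sv_inj; rewrite /= (homM hA) smulA.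
- by move=> b c x y; apply: sv_inj; rewrite [RHS]ls -[LHS]/(sv (c *: x + y) ** fB b) ls smulDl smulZl.
- by move=> x c a b; apply: sv_inj; rewrite [RHS]ls -[LHS]/(sv x ** fB (c *: a + b)) lB smulDr smulZr.
- by move=> x b b'; apply: sv_inj; rewrite /= (homM hB) smulA.
- by move=> z c x y; apply: iA; rewrite lA !b_lipE ls smulDl smulZl.
- by move=> x y; apply: iA; rewrite (hom_star hA) !b_lipE starM starK.
- by move=> a x y; apply: iA; rewrite (homM hA) !b_lipE smulA.
- by move=> x; apply: (positive_descend hA iA (l := star (sv x))); rewrite b_lipE starK.
- by move=> z c x y; apply: iB; rewrite lB !b_ripE ls smulDr smulZr.
- by move=> x y; apply: iB; rewrite (hom_star hB) !b_ripE starM starK.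
- by move=> x y b; apply: iB; rewrite (homM hB) !b_ripE smulA.
- by move=> x; apply: (positive_descend hB iB); rewrite b_ripE.
- by move=> a x y; apply: iB; rewrite !b_ripE /= starM (hom_star hA) smulA.
- by move=> b x y; apply: iA; rewrite !b_lipE /= starM (hom_star hB) starK smulA.
- by move=> x y z; apply: sv_inj; rewrite /= b_lipE b_ripE smulA.
- apply: cspan_eqT => Q cQ hQ; apply: (fullA cQ) => a x y e; apply: hQ; exists x, y.
  by apply: iA; rewrite e b_lipE.
- apply: cspan_eqT => Q cQ hQ; apply: (fullB cQ) => b x y e; apply: hQ; exists x, y.
  by apply: iB; rewrite e b_ripE.
move=> x; have -> : `|x| = `|sv x| :> R[i] by [].
by rewrite [RHS]rnE -(hom_iso hB iB) b_ripE -rnE cstar_normC.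
Defined.

Lemma l_split l : l = ml p (mr p l) + ml p (mr q l) + ml q (mr p l) + ml q (mr q l).
Proof.
rewrite -[LHS]ml_one -pq1 -{1}[l]/(mr (mone L) l) -{1}pq1.
by rewrite /= !(linD (ml_lin _)) !addrA [_ + ml q (mr p l)]addrAC -!addrA.
Qed.

Definition corner_linking : linking corner_imprim.
Proof.
pose ls := @sv_lin R L (ClSpace offdiag_cl).
refine (@Linking R A B corner_imprim L fA (@sv R L (ClSpace offdiag_cl)) fB hA hB ls _ _ _ _ _ _ _ _ _ _) => //.
- by move=> x y; rewrite b_lipE.
- by move=> x y; rewrite b_ripE.
- by move=> a b; apply: orth_pq; [exact: mrA | exact: qB].
- by move=> x a; apply: orth_qp; [exact: bq | exact: pA].
- by move=> b x; apply: orth_qp; [exact: mrB | exact: bp].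
- by move=> x y; apply: orth_qp; [exact: bq | exact: bp].
- move=> l; have [a _ ea] := rA l; have [b _ eb] := rB l.
  exists a, (bimof l), (bimof (star l)), b; rewrite ea eb /= [LHS]l_split.
  by rewrite mr_sa // ml_sa // starK -ml_mr.
move=> a x y b e.
have kx : ml p (star (sv y)) = 0 /\ ml q (sv x) = 0 /\ ml p (fB b) = 0 /\ ml q (fA a) = 0.
  have z (m n : mult L) u : m ** n = 0 -> ml n u = u -> ml m u = 0.
    by move=> mn <-; rewrite -[LHS]/(ml (m ** n) u) mn.
  split; first by apply: (z _ _ _ pq); rewrite ml_sa // bq.
  by split; [exact: (z _ _ _ qp (bp x)) | split; [exact: (z _ _ _ pq (qB b)) | exact: (z _ _ _ qp (pA a))]].
have [k1 [k2 [k3 k4]]] := kx.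
have e1 : fA a + sv x = 0.
  have := congr1 (ml p) e; rewrite !(linD (ml_lin p)) k1 k3 !addr0 pA (bp x) => ->.
  exact: (lin0 (ml_lin p)).
have e2 : star (sv y) + fB b = 0.
  have := congr1 (ml q) e; rewrite !(linD (ml_lin q)) k2 k4 !add0r qB ml_sa // bq => ->.
  exact: (lin0 (ml_lin q)).
have o1 : mr p (sv x) = 0.
  by rewrite -(bq x) -[LHS]/(mr (q ** p) (sv x)) qp.
have o2 : mr p (fB b) = 0.
  by rewrite -(mrB b) -[LHS]/(mr (q ** p) (fB b)) qp.
have x0 : sv x = 0.
  have := congr1 (mr p) e1; rewrite (linD (mr_lin p)) o1 addr0 mrA (lin0 (mr_lin p)) => a0.
  by rewrite a0 add0r in e1.
have b0 : fB b = 0.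
  have := congr1 (mr p) e2; rewrite (linD (mr_lin p)) o2 addr0 mr_sa // bp (lin0 (mr_lin p)) => y0.
  by rewrite y0 add0r in e2.
rewrite x0 addr0 in e1; rewrite b0 addr0 in e2; split.
- by apply: iA; rewrite e1 (lin0 (hom_lin hA)).
- by apply: sv_inj.
- by apply: sv_inj; apply: (can_inj starK); rewrite e2 st0.
- by apply: iB; rewrite b0 (lin0 (hom_lin hB)).
Defined.

Lemma corner_lk_q : lk_q corner_linking = q.
Proof.
have qE a x y b : ml q (fA a + sv x + star (sv y) + fB b) = star (sv y) + fB b.
  rewrite !(linD (ml_lin q)) qB ml_sa // bq -(pA a) -[ml q (ml p _)]/(ml (q ** p) _) qp.
  by rewrite -(bp x) -[ml q (ml p _)]/(ml (q ** p) _) qp /= !add0r.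
rewrite /lk_q; case: xgetP => [q' _ h|/(_ q)[] a x y b /=]; last exact: qE.
apply: mult_eq => l; have [a [x [y [b ->]]]] := @lk_span R A B _ corner_linking l.
by rewrite h; symmetry; exact: qE.
Qed.

Lemma corner_lk_p : lk_p corner_linking = p.
Proof.
have pE a x y b : ml p (fA a + sv x + star (sv y) + fB b) = fA a + sv x.
  rewrite !(linD (ml_lin p)) pA (bp x) -(qB b) -[ml p (ml q _)]/(ml (p ** q) _) pq.
  by rewrite -(bq y) -ml_sa // -[ml p (ml q _)]/(ml (p ** q) _) pq /= !addr0.
rewrite /lk_p; case: xgetP => [p' _ h|/(_ p)[] a x y b /=]; last exact: pE.
apply: mult_eq => l; have [a [x [y [b ->]]]] := @lk_span R A B _ corner_linking l.
by rewrite h; symmetry; exact: pE.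
Qed.

End CornerBimodule.

Section TensorMapsMore.
Variables (R : realType) (G : lcGroupType) (S : setting R G).
Implicit Types A B D E : cstarType R.

Lemma tmap_mtp2 A B D E (f : A -> D) (g : B -> E) (hf : starhom f) (hg : starhom g) m m' n n' z :
  (forall x, f (ml m x) = ml m' (f x)) -> (forall x, g (ml n x) = ml n' (g x)) ->
  tmap (S := S) f g (ml (mtp S m n) z) = ml (mtp S m' n') (tmap (S := S) f g z).
Proof.
move=> h h'; have hT := @tmap_hom R G S _ _ _ _ _ _ hf hg; have TE := @tmapE R G S _ _ _ _ _ _ hf hg.
move: z; apply: (blin_eq (blin_comp (blin_ml _) (hom_blin hT)) (blin_comp (hom_blin hT) (blin_ml _))) => a k /=.
by rewrite mtpE !TE mtpE h h'.
Qed.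

(** [T] is compatible with coefficients and group elements but may be degenerate. Since [p] commutes
    with the group, hence with its integrated form, both sides live on the corner cut by [p], where
    testing against the elements [T z] suffices. *)
Lemma corner_map (al0 al1 : action R G) (F0 : full_cp S al0) (F1 : full_cp S al1) (f : al0 -> al1)
  (Y : cstarType R) (Th : F1 -> Y) (p : mult Y) (T : F0 -> Y) : starhom Th -> bijective Th -> starhom T ->
  sa p -> p ** p = p -> (forall z, ml p (T z) = T z) ->
  (forall Q : set Y, clsub Q -> (forall z y, Q (T z ** y)) -> forall y, Q (ml p y)) ->
  (forall s, com p (ext (@emb R Y \o Th) (fv F1 s))) ->
  (forall a, ext (@emb R Y \o Th) (iA F1 (f a)) ** p = ext (@emb R Y \o Th) (iA F1 (f a))) ->
  (forall a z, T (ml (iA F0 a) z) = ml (ext (@emb R Y \o Th) (iA F1 (f a))) (T z)) ->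
  (forall s z, T (ml (fv F0 s) z) = ml (ext (@emb R Y \o Th) (fv F1 s)) (T z)) ->
  forall a c, T (fcm F0 a c) = Th (fcm F1 (f a) c).
Proof.
move=> hTh bTh hT sp pp pT pd cp cA TA TG a c.
have hx := hom_emb_comp hTh; have nx := nondeg_surj hTh (bij_surj bTh); have hE := ext_hom hx nx.
have hi := iG_hom F1; have ni := iG_nondeg F1.
pose W := ext (@emb R Y \o Th) \o iG F1.
have hW : starhom W by exact: (hom_comp hi hE).
have nW : nondeg W by exact: nondeg_ext_comp.
have WE s : ext W (gu S s) = ext (@emb R Y \o Th) (fv F1 s) by rewrite /W ext_comp.
have TW c' z : T (ml (iG F0 c') z) = ml (W c') (T z).
  apply: (integ_intertwine hT (iG_hom F0) (iG_nondeg F0) hW nW) => s z'.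
  by rewrite -/(gu S s) WE; exact: TG.
have fE : emb (Th (fcm F1 (f a) c)) = ext (@emb R Y \o Th) (iA F1 (f a)) ** W c.
  by rewrite -(homM hE) -fcmE ext_emb.
have cW : com p (W c) by apply: com_integ => // s; rewrite -/(gu S s) WE.
apply: emb_inj; apply: (ext_q_eq (f := @emb R Y \o T) (q := p)) => //.
- have mT z : mr p (T z) = T z by rewrite -sp /= -(hom_star hT) pT (hom_star hT) starK.
  by rewrite emb_mul mT.
- by rewrite fE -smulA -cW smulA cA.
move=> z; rewrite fE /= -embM -(homM hT) -smulA !mul_emb -TW -TA; congr (emb (T _)).
by apply: emb_inj; rewrite embM fcmE -smulA !mul_emb.
Qed.

End TensorMapsMore.

(** * Compact operators on the enlarged Hilbert space *)

Section PlusOne.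
Variables (R : realType) (H : hilbert R) (K : compact_ops H) (P : hilbert_plus H).
Local Notation K1 := (kops P).
Local Notation V := (@hpV R H P).
Local Notation w := (@hpw R H P).
Local Notation e := (rko K1 w w).

Lemma hp_bop_eq (S T : bop P) : (forall x, S (V x) = T (V x)) -> S w = T w -> S = T.
Proof.
move=> hV hw; apply: bop_eq; apply: (cspanT_ind (hp_dense P) (clsub_eq (blin_bop S) (blin_bop T))).
by move=> _ [->|[x ->]].
Qed.

Lemma hp_rk x y : hp_op P (rk x y) = rk (V x) (V y).
Proof.
apply: hp_bop_eq => [z|]; rewrite ?hp_opV ?hp_opw /=; last by rewrite ip_conj hp_orth rmorph0 scale0r.
by rewrite hp_ip (linZ (@hp_lin R H P)).
Qed.

Lemma iota_ex : exists i : K -> K1, starhom i /\ forall k, kob (i k) = hp_op P (kob k).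
Proof.
have [|i hi iE] := hom_factor (hom_comp (kob_hom K) (hp_op_hom P)) (kob_hom K1) (@kob_inj R P K1).
  apply: ko_ind => [|x y].
    exact: (clsub_pre (hom_blin (hom_comp (kob_hom K) (hp_op_hom P))) (hom_range_clsub (kob_hom K1))).
  by exists (rko K1 (V x) (V y)) => //; rewrite /= !kob_rko hp_rk.
by exists i.
Qed.
Definition iota : K -> K1 := projT1 (cid iota_ex).
Lemma iota_hom : starhom iota. Proof. by case: (projT2 (cid iota_ex)). Qed.
Lemma iotaE k : kob (iota k) = hp_op P (kob k). Proof. by case: (projT2 (cid iota_ex)) => _; exact. Qed.

Lemma iota_inj : injective iota.
Proof.
apply: (lin_inj (hom_lin iota_hom)) => k /(congr1 (@kob R P K1)); rewrite iotaE (lin0 (hom_lin (kob_hom _))) => h.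
apply: (@kob_inj R H K); rewrite (lin0 (hom_lin (kob_hom _))); apply: bop_eq => x.
apply: (lin_inj (@hp_lin R H P)) => [y y0|].
  by apply: rn_eq0; apply/eqP; rewrite -sqrf_eq0 rn_ipE -(@hp_ip R H P) y0 ip0l.
by rewrite -hp_opV h /= (lin0 (@hp_lin R H P)).
Qed.

Lemma iota_rko x y : iota (rko K x y) = rko K1 (V x) (V y).
Proof. by apply: (@kob_inj R P K1); rewrite iotaE !kob_rko hp_rk. Qed.

(** Rank one operators reduce to those with entries in the old space or [w], and adjoints exchange
    the two mixed cases. *)
Lemma hp_ko_ind (Q : set K1) : clsub Q -> (forall k, Q k -> Q (star k)) -> Q e ->
  (forall x, Q (rko K1 (V x) w)) -> (forall x y, Q (rko K1 (V x) (V y))) -> forall k, Q k.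
Proof.
move=> cQ Qs Qe Qw QV; apply: ko_ind => // x y.
have dn z : (forall x', Q (rko K1 (V x') z)) -> Q (rko K1 w z) -> forall u, Q (rko K1 u z).
  move=> h h'; apply: (cspanT_ind (hp_dense P) (clsub_pre (blin_rko K1 z) cQ)).
  by move=> _ [->|[x' ->]]; [exact: h' | exact: h].
have sw z u : Q (rko K1 z u) -> Q (rko K1 u z) by move=> /Qs; rewrite rko_star.
apply: (dn) => [x'|]; apply: (sw); apply: (dn) => //; apply: (sw); exact: Qw.
Qed.

Definition hpP : mult K1 := opm K1 (hp_op P (bone H)).

Lemma hp_P1 : hpP + emb e = mone K1.
Proof.
rewrite -opm_kob -(linD (hom_lin (opm_hom K1))) -opm_one kob_rko; congr opm.
apply: hp_bop_eq => [x|].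
  by rewrite -[LHS]/(hp_op P (bone H) (V x) + rk w w (V x)) hp_opV /= hp_orth scale0r addr0.
by rewrite -[LHS]/(hp_op P (bone H) w + rk w w w) hp_opw /= hp_unit scale1r add0r.
Qed.

Lemma ml_P x y : ml hpP (rko K1 (V x) y) = rko K1 (V x) y.
Proof. by apply: (@kob_inj R P K1); rewrite opmE kob_rko rk_mull hp_opV. Qed.
Lemma ml_Pw y : ml hpP (rko K1 w y) = 0.
Proof.
apply: (@kob_inj R P K1); rewrite opmE kob_rko rk_mull hp_opw (lin0 (hom_lin (kob_hom _))).
by apply: bop_eq => z /=; rewrite scaler0.
Qed.
Lemma sa_P : sa hpP.
Proof. by rewrite /sa /hpP -(hom_star (opm_hom K1)) -(hom_star (hp_op_hom P)); congr (opm _ (hp_op P _)); exact: bop_eq. Qed.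
Lemma P_idem : hpP ** hpP = hpP.
Proof. by rewrite /hpP -(homM (opm_hom K1)) -(homM (hp_op_hom P)); congr (opm _ (hp_op P _)); exact: bop_eq. Qed.
Lemma ml_iota k : ml hpP (iota k) = iota k.
Proof.
apply: (@kob_inj R P K1); rewrite opmE iotaE -(homM (hp_op_hom P)); congr hp_op.
exact: bop_eq.
Qed.
Lemma e_sa : star e = e. Proof. exact: rko_star. Qed.
Lemma e_idem : e ** e = e. Proof. by rewrite rkoM hp_unit scale1r. Qed.
Lemma iota_dense (Q : set K1) : clsub Q -> (forall k k', Q (iota k ** k')) -> forall k, Q (ml hpP k).
Proof.
move=> cQ hQ; apply: ko_ind => [|z y]; first exact: (clsub_pre (blin_ml _) cQ).
move: z; apply: (cspanT_ind (hp_dense P) (clsub_pre (blin_comp (blin_rko K1 y) (blin_ml _)) cQ)) => _ [->|[x ->]].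
  by rewrite /= ml_Pw; exact: cls0.
rewrite /= ml_P; have [->|nx] := pselect (x = 0).
  rewrite (lin0 (@hp_lin R H P)) (lin0 (blin_rko K1 y).1); exact: cls0.
have := hQ (rko K x x) (rko K1 (V x) y); rewrite iota_rko rkoM hp_ip => /(clsZ cQ (ip x x)^-1).
rewrite scalerA mulVf ?scale1r //; apply/eqP => x0; apply: nx; apply: rn_eq0; apply/eqP.
by rewrite -sqrf_eq0 rn_ipE x0.
Qed.

Lemma PKP k : range iota (ml hpP (mr hpP k)).
Proof.
have cR := hom_range_clsub iota_hom.
have bl := blin_comp (blin_mr hpP) (blin_ml hpP).
have mrs x : mr hpP (star x) = star (ml hpP x) by exact: (mr_sa _ sa_P).
move: k; apply: (hp_ko_ind (clsub_pre bl cR)) => [k [k' _ /= kE]| | x | x y] /=.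
- by exists (star k') => //; rewrite (hom_star iota_hom) kE mrs (ml_sa _ sa_P) -ml_mr.
- by exists 0 => //; rewrite ml_mr ml_Pw (lin0 (mr_lin _)) (lin0 (hom_lin iota_hom)).
- exists 0 => //; rewrite -[rko _ _ w]starK mrs rko_star ml_Pw st0 (lin0 (ml_lin _)).
  exact: (lin0 (hom_lin iota_hom)).
exists (rko K x y) => //; rewrite iota_rko -[rko K1 (V x) (V y) in RHS]starK mrs rko_star ml_P rko_star.
by rewrite ml_P.
Qed.

Lemma eKe k : exists c : R[i], ml (emb e) (mr (emb e) k) = c *: e.
Proof.
exists (ip (ko_act k w) w); transitivity (e ** (k ** e)) => //.
by rewrite rko_mull rkoM.
Qed.

Variables (G : lcGroupType) (U : G -> bop H).
Hypothesis uU : bop_unirep U.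

(** On the added line the group acts trivially, so conjugation fixes [e] and the corner cut by [e]
    carries the original action. *)
Definition hpU s : bop P := hp_op P (U s) + rk w w.
Definition hpv s : mult K1 := opm K1 (hpU s).

Lemma hpU_V s x : hpU s (V x) = V (U s x).
Proof. by rewrite -[LHS]/(hp_op P (U s) (V x) + rk w w (V x)) hp_opV /= hp_orth scale0r addr0. Qed.
Lemma hpU_w s : hpU s w = w.
Proof. by rewrite -[LHS]/(hp_op P (U s) w + rk w w w) hp_opw /= hp_unit scale1r add0r. Qed.

Lemma hpU_unirep : bop_unirep hpU.
Proof.
have [U1 UM Us Uc] := uU.
have h1 : hpU 1%g = bone P.
  by apply: hp_bop_eq => [x|]; rewrite ?hpU_V ?hpU_w ?U1.
have hM s t : hpU (s * t)%g = hpU s ** hpU t.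
  apply: hp_bop_eq => [x|]; first by rewrite -[RHS]/(hpU s (hpU t (V x))) !hpU_V UM.
  by rewrite -[RHS]/(hpU s (hpU t w)) !hpU_w.
have hs s : star (hpU s) = hpU s^-1%g.
  by rewrite /hpU starD -(hom_star (hp_op_hom P)) Us rk_star.
split=> //; apply: (cont_dense (hp_dense P)) => [s|s x|_ [->|[x ->]]]; first exact: bop_lin.
- by rewrite rn_bop_unirep.
- have -> : (fun s => hpU s w) = (fun=> w) by apply/funext => s; exact: hpU_w.
  by move=> s; exact: cvg_cst.
have -> : (fun s => hpU s (V x)) = V \o (fun s => U s x) by apply/funext => s; exact: hpU_V.
apply: (cont_lip (M := 1) (Uc x)) => a b; rewrite -(linB (@hp_lin R H P)) mul1r.
by rewrite -(@ler_pXn2r _ 2) ?nnegrE // !rn_ipE hp_ip.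
Qed.

Lemma hpv_iota s k : iota (ml (opm K (U s)) k) = ml (hpv s) (iota k).
Proof.
apply: (@kob_inj R P K1); rewrite iotaE !opmE iotaE (homM (hp_op_hom P)).
apply: hp_bop_eq => [x|].
  transitivity (V (U s (kob k x))); last first.
    by transitivity (hpU s (hp_op P (kob k) (V x))) => //; rewrite hp_opV hpU_V.
  by transitivity (hp_op P (U s) (hp_op P (kob k) (V x))) => //; rewrite !hp_opV.
transitivity (hp_op P (U s) (hp_op P (kob k) w)) => //; transitivity (hpU s (hp_op P (kob k) w)) => //.
by rewrite !hp_opw (lin0 (bop_lin _)) (lin0 (bop_lin _)).
Qed.

Lemma hpv_e s k : ml (hpv s) (e ** k) = e ** k.
Proof. by rewrite mlM; congr (_ ** _); apply: (@kob_inj R P K1); rewrite opmE kob_rko rk_mull hpU_w. Qed.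

Lemma hpv_P s : com hpP (hpv s).
Proof.
rewrite /com /hpP /hpv -!(homM (opm_hom K1)); congr opm; apply: hp_bop_eq => [x|].
  transitivity (hp_op P (bone H) (hpU s (V x))) => //; transitivity (hpU s (hp_op P (bone H) (V x))) => //.
  by rewrite hpU_V !hp_opV hpU_V.
transitivity (hp_op P (bone H) (hpU s w)) => //; transitivity (hpU s (hp_op P (bone H) w)) => //.
by rewrite hpU_w hp_opw (lin0 (bop_lin _)).
Qed.

End PlusOne.

(** * Induction of ideals along the maximalized bimodule *)

Section OneSide.
Variables (R : realType) (G : lcGroupType) (S : setting R G) (X : crossed S).
Local Notation K := (KG S).
Implicit Types A B L : coaction S.

Lemma comor_comp A B L (f : A -> B) (g : B -> L) : is_comor f -> is_comor g -> is_comor (g \o f).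
Proof.
move=> [hf cf] [hg cg]; split=> [|a c x /cf/cg]; first exact: hom_comp.
by rewrite tmap_comp //; exact: hom_id.
Qed.

Section Corner.
Variables (A L : coaction S) (f : A -> L) (p : mult L).
Hypotheses (cf : is_comor f) (sp : sa p) (pp : p ** p = p) (pf : forall a, ml p (f a) = f a).
Hypothesis pd : forall Q : set L, clsub Q -> (forall a b, Q (f a ** b)) -> forall b, Q (ml p b).
Local Notation T := (tmap (S := S) f (@id K)).
Local Notation p1 := (mtp S p (mone K)).

(** The extended coaction sends [p] to p (x) 1. Both [n] and [p1] act as the identity on the range
    of [T], which gives [p1 ** n = n] and [n ** p1 = p1]; taking adjoints makes them equal. *)
Lemma dlam_p : ext (@dlam R G S L) p = p1.
Proof.
have hd := dlam_hom L; have nd := dlam_nondeg L; have he := ext_hom hd nd.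
set n := ext (@dlam R G S L) p; have sn : star n = n by rewrite /n -(hom_star he) sp.
have s1 : sa p1 by exact: corner_sa.
have hf := cf.1.
have dp a : p1 ** dlam (f a) = dlam (f a).
  rewrite -[a]starK (hom_star hf) (hom_star hd) -{1}s1 -starM; congr star.
  exact: (dlam_corner cf sp pf).
have pn : p1 ** n = n.
  apply: (nondeg_eq nd) => b; rewrite -smulA /n (extE hd nd).
  have hc := clsub_eq (blin_comp (hom_blin hd) (blin_mull p1)) (hom_blin hd).
  by apply: (pd hc) => a b' /=; rewrite (homM hd) smulA dp.
have nT z : ml n (T z) = T z.
  have hT := @tmap_hom R G S _ _ _ _ _ _ hf (@hom_id R K).
  apply: (cspanT_ind (dlam_nondeg A) (clsub_eq (blin_comp (hom_blin hT) (blin_ml n)) (hom_blin hT))).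
  move=> _ [a [z' ->]]; rewrite /= (dlam_T cf) -[LHS]/(ml (n ** dlam (f a)) (T z')).
  by rewrite /n (extE hd nd) pf.
have np : n ** p1 = p1.
  apply: (corner_eq cf pd) => [||z].
  - by rewrite -smulA corner_idem.
  - exact: corner_idem.
  by rewrite -smulA !mul_emb (corner_T cf pf) nT.
by rewrite -np -[n ** p1]starK starM s1 sn pn sn.
Qed.

Variables (PL : ccp X L -> mult (tens S L K)) (P' : dcp X L -> tens S L K).
Hypothesis dpL : dual_pair PL P'.

Definition psi : mult (dcp X L) -> mult (tens S L K) := ext (@emb R _ \o P').

Lemma psiE m x : P' (ml m x) = ml (psi m) (P' x).
Proof. by apply/(ext_surjP _ _ (dp_P dpL) (dp_surj dpL)): x. Qed.
Lemma psi_hom : starhom psi.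
Proof. exact: ext_hom (hom_emb_comp (dp_P dpL)) (nondeg_surj (dp_P dpL) (dp_surj dpL)). Qed.
Lemma psi_emb x : psi (emb x) = emb (P' x).
Proof. exact: (ext_emb (hom_emb_comp (dp_P dpL)) (nondeg_surj (dp_P dpL) (dp_surj dpL)) x). Qed.
Lemma psi_inj : injective psi.
Proof.
by move=> m n e; apply: mult_eq => x; apply: (bij_inj (dp_bij dpL)); rewrite !psiE e.
Qed.
Lemma psi_surj n : exists m, psi m = n.
Proof.
have [g P'K gK] := dp_bij dpL; have hg := hom_bij_inv (dp_P dpL) (bij_inj (dp_bij dpL)) gK.
have sg : range g = setT by apply/seteqP; split=> // y _; exists (P' y).
exists (ext (@emb R _ \o g) n); apply/(ext_surjP _ _ (dp_P dpL) (dp_surj dpL)) => x.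
have /(ext_surjP _ _ hg sg) e := erefl (ext (@emb R _ \o g) n).
by rewrite -[x in LHS]P'K -e gK.
Qed.

Lemma psi_dbl (m : mult L) :
  psi (ext (iA (dcp X L)) (ext (jA (ccp X L)) m)) = ext (@dlam R G S L) m.
Proof.
have hd := dlam_hom L; have nd := dlam_nondeg L.
have k x : PL (ml (ext (jA (ccp X L)) m) x) = ext (@dlam R G S L) m ** PL x.
  apply: (cspanT_ind (jA_nondeg X L) (clsub_eq (blin_comp (blin_ml _) (hom_blin (dp_hom dpL))) (blin_comp (hom_blin (dp_hom dpL)) (blin_mull _)))).
  move=> _ [b [x' ->]]; rewrite /= -[ml _ (ml _ x')]/(ml (ext (jA (ccp X L)) m ** jA _ b) x').
  rewrite (extE (jA_hom X L) (jA_nondeg X L)) !(dp_A dpL) smulA; congr (_ ** _).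
  by rewrite (extE hd nd).
apply/(ext_surjP _ _ (dp_P dpL) (dp_surj dpL)).
have bP := hom_blin (dp_P dpL).
apply: (cspanT_ind (iA_nondeg (dcp X L)) (clsub_eq (blin_comp (blin_ml _) bP) (blin_comp bP (blin_ml _)))).
move=> _ [x [z ->]]; rewrite /=; set M := ext (iA (dcp X L)) _.
rewrite -[ml M (ml _ z)]/(ml (M ** iA _ x) z) (extE (iA_hom _) (iA_nondeg _)) !(dp_PA dpL).
by rewrite k.
Qed.

Variables (pY : mult (dcp X L)) (th : tens S A K -> dcp X L).
Hypotheses (pYE : psi pY = p1) (thE : forall z, P' (th z) = T z).

Lemma psi_cext m : psi (cext pY th m) = cext p1 T m.
Proof.
have hf := cf.1; have hT := @tmap_hom R G S _ _ _ _ _ _ hf (@hom_id R K).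
have [g P'K gK] := dp_bij dpL; have hg := hom_bij_inv (dp_P dpL) (bij_inj (dp_bij dpL)) gK.
have hth : starhom th.
  have -> : th = g \o T by apply/funext => z; rewrite /= -thE P'K.
  exact: hom_comp.
have ph := psi_hom.
have [||z|Q cQ hQ y|_ tE tq _] := @cext_spec R _ _ th pY hth.
- by apply: psi_inj; rewrite (hom_star ph) pYE; exact: corner_sa.
- by apply: psi_inj; rewrite (homM ph) pYE; exact: corner_idem.
- by apply: (bij_inj (dp_bij dpL)); rewrite psiE pYE thE (corner_T cf pf).
- rewrite -[ml pY y]P'K psiE pYE.
  apply: (corner_dense cf pd (clsub_pre (hom_blin hg) cQ)) => z x /=.
  by rewrite -thE (homM hg) P'K.
symmetry; apply: (cext_eq cf sp pp pf pd) => [|z].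
  by rewrite -pYE -(homM ph) (tq m).2.
by rewrite -!thE -!psi_emb -(homM ph) tE.
Qed.

Lemma psi_k k : psi (cext pY th (mtp S (mone A) (emb k))) = mtp S p (emb k).
Proof. by rewrite psi_cext (cext_mtp cf sp pp pf pd) mtpM mone_l mone_r. Qed.

Lemma psi_a a : psi (cext pY th (mtp S (emb a) (mone K))) = mtp S (emb (f a)) (mone K).
Proof.
have hf := cf.1; rewrite psi_cext; apply: (cext_eq cf sp pp pf pd) => [|z].
  rewrite mtpM mone_l emb_mul; congr (mtp S (emb _) _).
  by rewrite -sp /= -(hom_star hf) pf (hom_star hf) starK.
by rewrite mul_emb (@tmap_mtp R G S _ _ _ cf (emb a) (emb (f a))) // => x; exact: (homM hf).
Qed.

End Corner.
End OneSide.

Section Induction.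
Variables (R : realType) (G : lcGroupType) (S : setting R G) (X : crossed S) (M : maximalization X).
Local Notation K := (KG S).
Variables (A B : coaction S) (Z : imprim A B) (zeta : bimodule_coaction Z).
Local Notation L := (lk_co zeta).
Local Notation p := (lk_p (bc_lk zeta) : mult L).
Local Notation q := (lk_q (bc_lk zeta) : mult L).
Local Notation fA := (lkA (bc_lk zeta) : A -> L).
Local Notation fB := (lkB (bc_lk zeta) : B -> L).
Hypotheses (mA : bijective (mx_q M (A := A))) (mB : bijective (mx_q M (A := B))).
Hypotheses (mL : bijective (mx_q M (A := L))).
Hypotheses (sp : sa p) (pp : p ** p = p) (pf : forall a, ml p (fA a) = fA a).
Hypothesis pd : forall Q : set L, clsub Q -> (forall a b, Q (fA a ** b)) -> forall b, Q (ml p b).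
Hypotheses (sq : sa q) (qq : q ** q = q) (qf : forall a, ml q (fB a) = fB a).
Hypothesis qd : forall Q : set L, clsub Q -> (forall a b, Q (fB a ** b)) -> forall b, Q (ml q b).

Lemma mx_dual_pair (C : coaction S) : bijective (mx_q M (A := C)) -> exists PC P,
  @dual_pair R G S X C PC P /\ forall x, P (dcpmap (mx_q M (A := C)) x) = tmap (S := S) (mx_q M) id (Phi x).
Proof.
move=> mC; exact: (dual_transport (max_dual (mx_max M C)) (mx_q_mor M C) mC (mx_q_iso M C)).
Qed.

(** The bimodule is defined inside the multipliers of the double crossed product of [L]; duality for
    [L] moves its ingredients to M(L (x) K), where they are simple tensors. *)
Lemma ind_transport : exists ps : mult (dcp X L) -> mult (tens S L K),
  [/\ starhom ps, injective ps, forall n, exists m, ps m = n,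
      forall z, exists y, ps (emb y) = emb z & ps (pY X zeta) = mtp S p (mone K) /\ ps (qY X zeta) = mtp S q (mone K)] /\
  [/\ forall k, ps (thA' zeta (mtp S (mone (M A)) (emb k))) = mtp S p (emb k),
      forall k, ps (thB' zeta (mtp S (mone (M B)) (emb k))) = mtp S q (emb k),
      forall a : M A, ps (thA' zeta (mtp S (emb a) (mone _))) = mtp S (emb (fA (mx_q M a))) (mone _) &
      forall b : M B, ps (thB' zeta (mtp S (emb b) (mone _))) = mtp S (emb (fB (mx_q M b))) (mone _)].
Proof.
have [PL [P' [dpL _]]] := mx_dual_pair mL.
have side (C : coaction S) (f : C -> L) (r : mult L) (cf : is_comor f) (mC : bijective (mx_q M (A := C)))
  (sr : sa r) (rr : r ** r = r) (rf : forall a, ml r (f a) = f a)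
  (rd : forall Q : set L, clsub Q -> (forall a b, Q (f a ** b)) -> forall b, Q (ml r b))
  (rY : mult (dcp X L)) : psi P' rY = mtp S r (mone K) ->
  let th := fun z => dcpmap f (dcpmap (mx_q M (A := C)) (inv_of 0 (Phi (A := M C)) z)) in
  (forall k, psi P' (cext rY th (mtp S (mone _) (emb k))) = mtp S r (emb k)) /\
  (forall a, psi P' (cext rY th (mtp S (emb a) (mone _))) = mtp S (emb (f (mx_q M a))) (mone _)).
  move=> rYE th; have [PC [P [dpC PE]]] := mx_dual_pair mC.
  have cm := comor_comp (mx_q_mor M C) cf.
  have rf' a : ml r ((f \o mx_q M) a) = (f \o mx_q M) a by exact: rf.
  have rd' (Q : set L) : clsub Q -> (forall a b, Q ((f \o mx_q M (A := C)) a ** b)) -> forall b, Q (ml r b).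
    move=> cQ hQ; apply: rd => // a b; have [g _ gK] := mC.
    by have := hQ (g a) b; rewrite /= gK.
  have thE z : P' (th z) = tmap (S := S) (f \o mx_q M) id z.
    rewrite /th (corner_dcp dpC cf dpL sr rr rf rd) PE (tmap_dual_inv _ (mx_max M C)).
    by rewrite tmap_comp //; [exact: (mx_q_mor M C).1 | exact: cf.1].
  split=> [k|a]; first exact: (psi_k cm sr rr rf' rd' dpL rYE thE).
  exact: (psi_a cm sr rr rf' rd' dpL rYE thE).
have pYE : psi P' (pY X zeta) = mtp S p (mone K).
  by rewrite (psi_dbl dpL) (dlam_p (bc_A zeta) sp pp pf pd).
have qYE : psi P' (qY X zeta) = mtp S q (mone K).
  by rewrite (psi_dbl dpL) (dlam_p (bc_B zeta) sq qq qf qd).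
exists (psi P'); split; split.
- exact: (psi_hom dpL).
- exact: (psi_inj dpL).
- exact: (psi_surj dpL).
- move=> z; have [g _ gK] := dp_bij dpL; exists (g z).
  by rewrite (psi_emb dpL) gK.
- by [].
- exact: (side _ _ _ (bc_A zeta) mA sp pp pf pd _ pYE).1.
- exact: (side _ _ _ (bc_B zeta) mB sq qq qf qd _ qYE).1.
- exact: (side _ _ _ (bc_A zeta) mA sp pp pf pd _ pYE).2.
- exact: (side _ _ _ (bc_B zeta) mB sq qq qf qd _ qYE).2.
Qed.

(** An upper bound for the induced ideal that needs no description of X^m: in the relation x b
    [star y] = a between multipliers, chi (x) id kills the middle factor whatever [x] and [y]
    are. *)
Lemma ind_ker (E : cstarType R) (chi : L -> E) (J : set (M B)) (k0 : K) : k0 <> 0 ->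
  starhom chi -> range chi = setT -> (forall b, J b -> chi (fB (mx_q M b)) = 0) ->
  forall a, ind zeta J a -> chi (fA (mx_q M a)) = 0.
Proof.
move=> k00 hc sc hJ; have [ps [[hps _ _ _ _] [_ _ pa pb]]] := ind_transport.
have bl : blin (fun a => chi (fA (mx_q M a))).
  exact: (hom_blin (hom_comp (mx_q_mor M A).1 (hom_comp (bc_A zeta).1 hc))).
apply: (cspan_ind (clsub_ker bl)) => a [x [y [b [_ _ Jb e]]]] /=.
have hT := @tmap_hom R G S _ _ _ _ _ _ hc (@hom_id R K).
have sT : range (tmap (S := S) chi (@id K)) = setT.
  by apply: tmap_surj => //; apply/seteqP; split=> // k _; exists k.
have hx := ext_hom (hom_emb_comp hT) (nondeg_surj hT sT).
have cE u : ext (@emb R _ \o tmap (S := S) chi (@id K)) (mtp S (emb u) (mone K)) = mtp S (emb (chi u)) (mone K).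
  apply/(ext_surjP _ _ hT sT) => z.
  by apply: tmap_mtp2 => //= v; exact: (homM hc).
have := congr1 (fun m => ext (@emb R _ \o tmap (S := S) chi (@id K)) (ps m)) e.
rewrite /= !(homM hps) !(homM hx) pa pb !cE (hJ b Jb) emb0.
rewrite (lin0 (@mtp_linl R G S E K (mone K))) sm0r sm0l => h.
apply: smul_injl => v; rewrite smul0r; apply: (@tp_eq0 R G S E K _ k0) k00.
by rewrite -[chi _ ** v]/(ml (emb (chi _)) v) -[k0]ml_one -mtpE -h.
Qed.

(** The lower bound: an off-diagonal element [z] of [L] yields the element z (x) 1 of X^m. *)
Lemma ind_gen (J : set (M B)) a b (z y : L) : J b -> ml p z = z -> mr q z = z -> ml p y = y -> mr q y = y ->
  fA (mx_q M a) = z ** fB (mx_q M b) ** star y -> ind zeta J a.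
Proof.
move=> Jb pz qz py qy e; have [ps [[hps ips sps eps [pYE qYE]] [pk qk pa pb]]] := ind_transport.
have xm u : ml p u = u -> mr q u = u -> exists2 m : mult (dcp X L), Xmax M (zeta := zeta) m & ps m = mtp S (emb u) (mone K).
  move=> pu qu; have [m mE] := sps (mtp S (emb u) (mone K)); exists m => //; split.
    apply: ips; rewrite !(homM hps) mE pYE qYE !mtpM !mone_l; congr (mtp S _ _).
    by rewrite mul_emb pu emb_mul qu.
  move=> k; have [w wE] := eps (tp S u k); exists w; split; apply: ips.
    by rewrite (homM hps) pk mE wE mtpM mul_emb pu mone_r mtp_emb.
  by rewrite (homM hps) qk mE wE mtpM emb_mul qu mone_l mtp_emb.
have [m1 X1 E1] := xm z pz qz; have [m2 X2 E2] := xm y py qy.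
apply: cspan_sub; exists m1, m2, b; split=> //; apply: ips.
rewrite !(homM hps) (hom_star hps) E1 E2 pa pb mtp_star !mtpM mone_star !mone_l; congr (mtp S _ _).
by rewrite -emb_star -!embM e.
Qed.

End Induction.

(** * The linking algebra of A x G and its stabilization *)

Section Stabilized.
Variables (R : realType) (G : lcGroupType) (S : setting R G) (X : crossed S) (al : action R G).
Variable P : hilbert_plus (L2G S).
Local Notation K := (KG S).
Local Notation K1 := (kops P).
Local Notation V := (@hpV R (L2G S) P).
Local Notation w := (hpw P).
Local Notation e := (rko K1 w w).
Local Notation v1 := (hpv P (lamU S)).
Local Notation "a '\ox' b" := (tp S a b).
Variables (b : G -> tens S al K -> tens S al K) (bP : is_action b).
Variables (g : G -> tens S al K1 -> tens S al K1) (gP : is_action g).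
Hypothesis bE : forall s a k, b s (a \ox k) = ac s a \ox adk (lamG S) s k.
Hypothesis gE : forall s a k, g s (a \ox k) = ac s a \ox adk v1 s k.
Local Notation be := (Action bP).
Local Notation ga := (Action gP).
Local Notation C := (cp X al).
Local Notation D := (cp X be).
Local Notation L := (cp X ga).
Variables (Th : D -> tens S C K) (TL : L -> tens S C K1).
Hypotheses (hTh : starhom Th) (bTh : bijective Th) (hTL : starhom TL) (bTL : bijective TL).
Hypothesis ThA : forall a k, ext (@emb R _ \o Th) (iA D (a \ox k)) = mtp S (iA C a) (emb k).
Hypothesis ThG : forall s, ext (@emb R _ \o Th) (fv D s) = mtp S (fv C s) (lamG S s).
Hypothesis TLA : forall a k, ext (@emb R _ \o TL) (iA L (a \ox k)) = mtp S (iA C a) (emb k).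
Hypothesis TLG : forall s, ext (@emb R _ \o TL) (fv L s) = mtp S (fv C s) (v1 s).

(** Comes from strict positivity of the Haar integral. The unit vector makes the off-diagonal corner
    full over A x G. *)
Lemma l2_unit : exists u : L2G S, ip u u = 1.
Proof.
have [h|//] := unit_vector (L2G S); have [f f1] := @cc_at1 R G S; have cf := projT2 f.
have [] := @int_pos R G (hmu S) (fun t => projT1 f t * (projT1 f t)^*) 1%g.
- by apply: ccM => //; exact: ((ccP _).1 (cc_conj cf)).1.
- by move=> t; exact: mul_conjC_ge0.
- by move/eqP; rewrite mul_conjC_eq0 => /eqP.
by rewrite -(l2_ip (L2G S) cf cf) (h (l2_of _ _)) ip0l.
Qed.

Definition stabF (A : cstarType R) : tens S A K -> tens S A K1 := tmap (S := S) (@id A) (iota P).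
Lemma stabF_hom A : starhom (@stabF A). Proof. exact: (@tmap_hom R G S _ _ _ _ _ _ (@hom_id R A) (iota_hom K P)). Qed.
Lemma stabFE (A : cstarType R) (a : A) k : stabF (a \ox k) = a \ox iota P k.
Proof. exact: (@tmapE R G S _ _ _ _ _ _ (@hom_id R A) (iota_hom K P)). Qed.

Lemma adk_iota s (k : K) : iota P (adk (lamG S) s k) = adk v1 s (iota P k).
Proof.
have h k' : iota P (ml (lamG S s) k') = ml (v1 s) (iota P k') by rewrite lamGE hpv_iota.
by rewrite /adk h /= (hom_star (iota_hom K P)) h (hom_star (iota_hom K P)).
Qed.

Lemma hpv_ee s : ml (v1 s) e = e.
Proof. by rewrite -e_idem hpv_e. Qed.

Lemma adk_e s : adk v1 s e = e.
Proof. by rewrite /adk /= e_sa hpv_ee e_sa hpv_ee. Qed.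

Lemma tpe_hom : starhom (fun c : C => c \ox e).
Proof.
split=> [c x y|x y|x]; first exact: tp_linl.
  by rewrite tpM e_idem.
by rewrite tp_star e_sa.
Qed.

(** By [corner_map] the embedding is, on generators, the crossed product of the equivariant map a
    (x) k |-> a (x) iota k; compatibility with the dual coactions is then [cp_comor]. *)
Lemma stab_comA (fA : D -> L) : starhom fA -> (forall d, TL (fA d) = stabF (Th d)) ->
  is_comor (A := dual_co X be) (B := dual_co X ga) fA.
Proof.
move=> hA fAE; have hF := stabF_hom.
have am : is_acmor (al := be) (be := ga) (@stabF al).
  split=> [|s]; first exact: hF.
  have h1 := hom_blin (act_hom bP s); have h2 := hom_blin (act_hom gP s).
  apply: (blin_eq (blin_comp h1 (hom_blin (hF al))) (blin_comp (hom_blin (hF al)) h2)) => a k.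
  by rewrite /= bE !stabFE gE adk_iota.
apply: (cp_comor am hA) => a c; apply: (bij_inj bTL); rewrite fAE.
pose T (x : D) := stabF (Th x).
have hT : starhom T by exact: hom_comp.
have TE a' k z : T (ml (iA D (a' \ox k)) z) = ml (mtp S (iA C a') (emb (iota P k))) (T z).
  rewrite /T ((ext_surjP _ _ hTh (bij_surj bTh)).1 (ThA a' k) z).
  apply: (tmap_mtp2 (@hom_id R _) (iota_hom K P)) => // x.
  exact: (homM (iota_hom K P)).
have hxL := ext_hom (hom_emb_comp hTL) (nondeg_surj hTL (bij_surj bTL)).
have bTLA := hom_blin (hom_comp (hF al) (hom_comp (iA_hom L) hxL)).
rewrite -[LHS]/(T (fcm D a c)).
apply: (corner_map (al0 := be) (al1 := ga) (F0 := D) (F1 := L) (f := @stabF al) hTL bTL hT (p := mtp S (mone C) (hpP P))).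
- by rewrite /sa mtp_star mone_star sa_P.
- by rewrite mtpM mone_l P_idem.
- move=> z; rewrite /T; move: (Th z); apply: (blin_eq (blin_comp (hom_blin (hF _)) (blin_ml _)) (hom_blin (hF _))) => c' k /=.
  by rewrite stabFE mtpE ml_iota.
- move=> Q cQ hQ; apply: (tens_ind (prod_dense C) (cspan_eqT (fun Q' cQ' hQ' x => hQ' x I)) (clsub_pre (blin_ml _) cQ)).
  move=> _ k [c1 [c2 ->]] _ /=; rewrite mtpE ml_one.
  apply: (iota_dense (K := K) (clsub_pre (@blin_tpr R G S _ _ (c1 ** c2)) cQ)) => k1 k2 /=.
  have [Thi _ TK] := bTh; have := hQ (Thi (c1 \ox k1)) (c2 \ox k2).
  by rewrite /T TK stabFE tpM.
- by move=> s; rewrite TLG /com !mtpM mone_l mone_r (hpv_P P).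
- apply: (blin_eq (blin_comp bTLA (blin_mulr _)) bTLA) => a' k /=.
  by rewrite stabFE TLA mtpM mone_r emb_mul -sa_P /= -(hom_star (iota_hom K P)) ml_iota (hom_star (iota_hom K P)) starK.
- move=> a' z; move: a'; apply: blin_eq.
  + exact: (blin_comp (blin_comp (hom_blin (iA_hom D)) (blin_mlv z)) (hom_blin hT)).
  + exact: (blin_comp bTLA (blin_mlv (T z))).
  by move=> a' k /=; rewrite TE stabFE TLA.
move=> s z; rewrite TLG /T ((ext_surjP _ _ hTh (bij_surj bTh)).1 (ThG s) z).
apply: (tmap_mtp2 (@hom_id R _) (iota_hom K P)) => // k.
by rewrite lamGE hpv_iota.
Qed.

(** [e] is fixed by conjugation with the enlarged representation, so a |-> a (x) e is equivariant
    and [cp_comor] applies. *)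
Lemma stab_comB (fB : C -> L) : starhom fB -> (forall c, TL (fB c) = c \ox e) ->
  is_comor (A := dual_co X al) (B := dual_co X ga) fB.
Proof.
move=> hB fBE.
have am : is_acmor (al := al) (be := ga) (fun a : al => a \ox e).
  split=> [|s a]; last by rewrite [RHS]gE adk_e.
  split=> [c x y|x y|x]; [exact: tp_linl | by rewrite tpM e_idem | by rewrite tp_star e_sa].
apply: (cp_comor am hB) => a c; apply: (bij_inj bTL); rewrite fBE.
apply: (corner_map (f := fun a : al => (a \ox e : ga)) hTL bTL tpe_hom (p := mtp S (mone C) (emb e))).
- by rewrite /sa mtp_star mone_star -emb_star e_sa.
- by rewrite mtpM mone_l -embM e_idem.
- by move=> z; rewrite mtpE ml_one /= e_idem.
- move=> Q cQ hQ; apply: (tens_ind (prod_dense C) (cspan_eqT (fun Q' cQ' hQ' x => hQ' x I)) (clsub_pre (blin_ml _) cQ)).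
  move=> _ k [c1 [c2 ->]] _ /=; rewrite mtpE ml_one /=.
  by have := hQ c1 (c2 \ox k); rewrite tpM.
- move=> s; rewrite TLG /com !mtpM mone_l mone_r; congr mtp.
  have -> : emb e = mone K1 - hpP P by rewrite -hp_P1 addrC addKr.
  by rewrite smBl smBr mone_l mone_r (hpv_P P).
- by move=> a'; rewrite TLA mtpM mone_r -embM e_idem.
- by move=> a' z; rewrite TLA mtpE /= e_idem.
by move=> s z; rewrite TLG mtpE hpv_ee.
Qed.

(** The crossed product of A (x) K(L^2(G) + C) with its dual coaction is taken as the linking
    algebra. Being a dual coaction, it also has a bijective maximalization map. *)
Lemma stab_bimodule : exists (Z : imprim (dual_co X be) (dual_co X al)) (zeta : bimodule_coaction Z)
    (tl : lk_co zeta -> tens S C K1),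
  let p : mult (lk_co zeta) := lk_p (bc_lk zeta) in let q : mult (lk_co zeta) := lk_q (bc_lk zeta) in
  [/\ starhom tl, bijective tl, forall d, tl (lkA (bc_lk zeta) d) = stabF (Th d),
    forall c, tl (lkB (bc_lk zeta) c) = c \ox e & forall M : maximalization X, bijective (mx_q M (A := lk_co zeta))] /\
  [/\ sa p, p ** p = p, forall l, tl (ml p l) = ml (mtp S (mone C) (hpP P)) (tl l),
    sa q /\ q ** q = q & forall l, tl (ml q l) = ml (mtp S (mone C) (emb e)) (tl l)].
Proof.
have [TLi [TK KT]] := bij_inverse bTL; have hTi := hom_bij_inv hTL (bij_inj bTL) KT.
have sTi : range TLi = setT by apply/seteqP; split=> // y _; exists (TL y).
have [Thi [ThK KTh]] := bij_inverse bTh; have hThi := hom_bij_inv hTh (bij_inj bTh) KTh.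
have Ti := bij_inj bTL; have hx := ext_hom (hom_emb_comp hTi) (nondeg_surj hTi sTi).
pose fA (d : D) : L := TLi (stabF (Th d)); pose fB (c : C) : L := TLi (c \ox e).
have hA : starhom fA by exact: (hom_comp hTh (hom_comp (@stabF_hom _) hTi)).
have hB : starhom fB by exact: (hom_comp tpe_hom hTi).
have iA : injective fA.
  move=> x y /(congr1 TL); rewrite /fA !KT => h; apply: (bij_inj bTh); move: h.
  by apply: tmap_inj; [exact: hom_id | exact: iota_hom | | exact: iota_inj].
have [u uu] := l2_unit.
have e0 : e <> 0 by apply: rko_neq0; exact: hp_unit.
have iB : injective fB.
  apply: (lin_inj (hom_lin hB)) => c /(congr1 TL); rewrite /fB KT (lin0 (hom_lin hTL)) => h.
  exact: (tp_eq0 h).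
pose ex m : mult L := ext (@emb R L \o TLi) (mtp S (mone C) m).
have exM m n : ex m ** ex n = ex (m ** n) by rewrite -(homM hx) mtpM mone_l.
have exs m : star (ex m) = ex (star m) by rewrite -(hom_star hx) mtp_star mone_star.
have exE m l : TL (ml (ex m) l) = ml (mtp S (mone C) m) (TL l).
  rewrite -{1}[l]TK -((ext_surjP _ _ hTi sTi).1 (erefl (ex m)) (TL l)); exact: KT.
have exR m l : sa m -> TL (mr (ex m) l) = mr (mtp S (mone C) m) (TL l).
  move=> sm; have s1 : sa (ex m) by rewrite /sa exs sm.
  have s2 : sa (mtp S (mone C) m) by rewrite /sa mtp_star mone_star sm.
  by rewrite -{1}[l]starK (mr_sa _ s1) (hom_star hTL) exE (hom_star hTL) -(mr_sa _ s2) starK.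
pose p := ex (hpP P); pose q := ex (emb e).
have see : sa (emb e) by rewrite /sa -emb_star e_sa.
have sp : sa p by rewrite /sa exs sa_P.
have sq : sa q by rewrite /sa exs see.
have pp : p ** p = p by rewrite exM P_idem.
have qq : q ** q = q by rewrite exM -embM e_idem.
have pq : p ** q = 0.
  by rewrite exM mul_emb ml_Pw emb0 /ex (lin0 (@mtp_linr R G S C K1 _)) (lin0 (hom_lin hx)).
have pq1 : p + q = mone L.
  rewrite -(linD (hom_lin hx)) -(linD (@mtp_linr R G S C K1 _)) hp_P1 mtp_one.
  exact: (ext_one (hom_emb_comp hTi) (nondeg_surj hTi sTi)).
have pA d : ml p (fA d) = fA d.
  apply: Ti; rewrite exE /fA KT; move: (Th d); have bF := hom_blin (@stabF_hom C).
  by apply: (blin_eq (blin_comp bF (blin_ml _)) bF) => c k /=; rewrite stabFE mtpE ml_iota.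
have qB c : ml q (fB c) = fB c by apply: Ti; rewrite exE /fB KT mtpE /= e_idem.
have rA l : range fA (ml p (mr p l)).
  suff [y _ yE] : range (@stabF C) (ml (mtp S (mone C) (hpP P)) (mr (mtp S (mone C) (hpP P)) (TL l))).
    by exists (Thi y) => //; apply: Ti; rewrite -[LHS]/(TL (TLi (stabF (Th (Thi y))))) KT KTh yE exE exR //; exact: sa_P.
  move: (TL l); apply: tp_ind.
    exact: (clsub_pre (blin_comp (blin_mr _) (blin_ml _)) (hom_range_clsub (@stabF_hom C))).
  move=> c k; rewrite mtp_mr mtpE; have [k' _ kE] := PKP K k; exists (c \ox k') => //.
  by rewrite stabFE kE.
have rB l : range fB (ml q (mr q l)).
  suff [c _ cE] : range (fun c : C => c \ox e) (ml (mtp S (mone C) (emb e)) (mr (mtp S (mone C) (emb e)) (TL l))).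
    by exists c => //; apply: Ti; rewrite -[LHS]/(TL (TLi (c \ox e))) KT exE exR // -cE.
  move: (TL l); apply: tp_ind.
    exact: (clsub_pre (blin_comp (blin_mr _) (blin_ml _)) (hom_range_clsub tpe_hom)).
  move=> c k; rewrite mtp_mr mtpE; have [r rE] := eKe k; exists (r *: c) => //.
  by rewrite rE (linZ (@tp_linl R G S C K1 e)) (linZ (@tp_linr R G S C K1 _)).
(* Elements c (x) |x><w| are off-diagonal; products of two of them, one adjoined, fill the diagonal
   corners, which is the fullness below. *)
have off c x : offdiag p q (TLi (c \ox rko K1 (V x) w)).
  split; apply: Ti; first by rewrite exE KT mtpE ml_P.
  by rewrite exR // KT mtp_mr; congr tp; rewrite -[LHS]/(rko K1 (V x) w ** e) rkoM hp_unit scale1r.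
pose bo c x : bim p q := SubV (S := ClSpace (offdiag_cl p q)) (off c x).
have fullA : forall Q : set D, clsub Q ->
    (forall a (x y : bim p q), fA a = sv x ** star (sv y) -> Q a) -> forall a, Q a.
  move=> Q cQ hQ d; rewrite -[d]ThK; move: (Th d).
  apply: (tens_ind (prod_dense C) (rko_dense K) (clsub_pre (hom_blin hThi) cQ)).
  move=> _ _ [c1 [c2 ->]] [x [y ->]]; apply: (hQ _ (bo c1 x) (bo (star c2) y)).
  rewrite /= -(hom_star hTi) -(homM hTi) tp_star starK rko_star tpM rkoM hp_unit scale1r.
  by rewrite /fA KTh stabFE iota_rko.
have fullB : forall Q : set C, clsub Q ->
    (forall c (x y : bim p q), fB c = star (sv x) ** sv y -> Q c) -> forall c, Q c.
  move=> Q cQ hQ; apply: (prod_ind cQ) => c1 c2; apply: (hQ _ (bo (star c1) u) (bo c2 u)).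
  by rewrite /= -(hom_star hTi) -(homM hTi) tp_star starK rko_star tpM rkoM hp_ip uu scale1r.
have cA := stab_comA hA (fun d => KT (stabF (Th d))).
have cB := stab_comB hB (fun c => KT (c \ox e)).
pose lk := corner_linking (A := dual_co X be) (B := dual_co X al) hA hB iA iB sp sq pp qq pq pq1 pA rA qB rB fullA fullB.
pose zeta := @BimoduleCoaction R G S (dual_co X be) (dual_co X al) _ lk _ (fc_coP L) cA cB.
exists (corner_imprim (A := dual_co X be) (B := dual_co X al) hA hB iA iB sp sq pA rA qB rB fullA fullB), zeta, TL.
have pE : lk_p (bc_lk zeta) = p by exact: corner_lk_p.
have qE : lk_q (bc_lk zeta) = q by exact: corner_lk_q.
move=> /=; rewrite pE qE; split; split => //.
- by move=> d; exact: KT.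
- by move=> c; exact: KT.
- by move=> M; exact: (mx_dual M ga).
- by move=> l; exact: exE.
- by move=> l; exact: exE.
Qed.

End Stabilized.

(** * Transfer to the associated crossed-product functors *)

Section Final.
Variables (R : realType) (G : lcGroupType) (S : setting R G) (X : crossed S).
Variables (M : maximalization X) (N : normalization X).
Implicit Types (T : coaction_functor M N) (al : action R G).
Local Notation "a '\ox' b" := (tp S a b).

Definition mxi al : cp X al -> M (dual_co X al) := inv_of 0 (mx_q M (A := dual_co X al)).
Lemma mxiK al x : mx_q M (@mxi al x) = x.
Proof.
have [h _ hK] := mx_dual M al; rewrite /mxi /inv_of.
by case: xgetP => [y _ //|/(_ (h x))[]]; exact: hK.
Qed.
Lemma mx_qK al m : mxi (mx_q M (A := dual_co X al) m) = m.
Proof. by apply: (bij_inj (mx_dual M al)); rewrite mxiK. Qed.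
Lemma mxi_hom al : starhom (@mxi al).
Proof. apply: (hom_bij_inv (mx_q_mor M (dual_co X al)).1 (bij_inj (mx_dual M al))); exact: mxiK. Qed.

Lemma sq_hom T al : starhom (s_q (assoc_cp T) (al := al)).
Proof. exact: hom_comp (@mxi_hom al) (tau_q_mor T _).1. Qed.

Lemma sq_surj T al : range (s_q (assoc_cp T) (al := al)) = setT.
Proof.
apply/seteqP; split=> // y _.
have /(_ y I)[m _ <-] : forall y, setT y -> range (tau_q T (A := dual_co X al)) y.
  by rewrite (tau_q_surj T).
by exists (mx_q M m) => //=; rewrite -/(mxi _) mx_qK.
Qed.

(** Approximate factorization into three elements of the ideal leaves a factor of the ideal in the
    middle, as the products in [ind_gen] demand. *)
Lemma ideal3_ind (A : cstarType R) (J Q : set A) : clsub J -> (forall x y, J x -> J y -> J (x ** y)) ->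
  (forall x, J x -> J (star x)) -> clsub Q ->
  (forall x y z, J x -> J y -> J z -> Q (x ** y ** z)) -> forall x, J x -> Q x.
Proof.
move=> cJ Jm Js cQ hQ x Jx; pose I := CStarSub cJ Jm Js.
have bs : blin (@sc R A I) by exact: (hom_blin (sc_hom _)).
rewrite -(sc_SubC (S := I) Jx); apply: (prod_ind (clsub_pre bs cQ)) => y z /=.
have bz : blin (fun y : subc I => sc (y ** z)).
  exact: (blin_comp (blin_mulr z) bs).
move: y; apply: (prod_ind (clsub_pre bz cQ)) => y1 y2.
exact: (hQ _ _ _ (scP y1) (scP y2) (scP z)).
Qed.

Lemma morita_transfer T : tau_morita T -> cp_morita (assoc_cp T).
Proof.
move=> mor al b bP st; set be := Action bP.
have [P] := hilbert_plus_ex (L2G S).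
have bE s a k : b s (a \ox k) = ac s a \ox adk (lamG S) s k by apply: st; exact: adkE.
have uv : is_unirep (hpv P (lamU S)) by exact: opm_unirep (hpU_unirep P (lamU_unirep S)).
have [g [gP gE]] := stabilization S al uv.
have [Th [hTh bTh ThA ThG]] := unwinding (cp X al) (lamG_unirep S) bE (cp X be).
have [TL [hTL bTL TLA TLG]] := unwinding (cp X al) uv gE (cp X (Action gP)).
have [Z [zeta [tl [[htl btl tA tB mL] [sp pp pE [sq qq] qE]]]]] :=
  stab_bimodule bE gE hTh bTh hTL bTL ThA ThG TLA TLG.
set q := s_q (assoc_cp T) (al := al); have hq : starhom q by exact: sq_hom.
have [Thi [ThK KTh]] := bij_inverse bTh; have hThi := hom_bij_inv hTh (bij_inj bTh) KTh.
have [tli [tlK Ktl]] := bij_inverse btl; have htli := hom_bij_inv htl (bij_inj btl) Ktl.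
have hF := @stabF_hom R G S P.
have pf (d : cp X be) : ml (lk_p (bc_lk zeta)) (lkA (bc_lk zeta) d) = lkA (bc_lk zeta) d.
  apply: (bij_inj btl); rewrite pE tA; move: (Th d).
  apply: (blin_eq (blin_comp (hom_blin (hF _)) (blin_ml _)) (hom_blin (hF _))) => c k /=.
  by rewrite stabFE mtpE ml_iota.
have qf (c : cp X al) : ml (lk_q (bc_lk zeta)) (lkB (bc_lk zeta) c) = lkB (bc_lk zeta) c.
  by apply: (bij_inj btl); rewrite qE tB mtpE /= e_idem.
have dns (r : mult (lk_co zeta)) m (Q : set (lk_co zeta)) : (forall l, tl (ml r l) = ml (mtp S (mone _) m) (tl l)) ->
    clsub Q -> (forall (c1 c2 : cp X al) k, Q (tli ((c1 ** c2) \ox ml m k))) -> forall l, Q (ml r l).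
  move=> rE cQ hQ l; rewrite -[ml r l]tlK rE; move: (tl l).
  apply: (tens_ind (prod_dense _) (cspan_eqT (fun Q' cQ' hQ' x => hQ' x I)) (clsub_pre (blin_comp (blin_ml _) (hom_blin htli)) cQ)).
  by move=> _ k [c1 [c2 ->]] _ /=; rewrite mtpE ml_one.
have pd (Q : set (lk_co zeta)) : clsub Q -> (forall (a : cp X be) l, Q (lkA (bc_lk zeta) a ** l)) ->
    forall l, Q (ml (lk_p (bc_lk zeta)) l).
  move=> cQ hQ; apply: (dns _ _ _ pE cQ) => c1 c2.
  apply: (iota_dense (K := KG S) (clsub_pre (blin_comp (@blin_tpr R G S _ _ (c1 ** c2)) (hom_blin htli)) cQ)) => k1 k2 /=.
  have := hQ (Thi (c1 \ox k1)) (tli (c2 \ox k2)).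
  by rewrite -[lkA _ _]tlK tA KTh stabFE -(homM htli) tpM.
have qd (Q : set (lk_co zeta)) : clsub Q -> (forall (a : cp X al) l, Q (lkB (bc_lk zeta) a ** l)) ->
    forall l, Q (ml (lk_q (bc_lk zeta)) l).
  move=> cQ hQ; apply: (dns _ _ _ qE cQ) => c1 c2 k.
  have := hQ c1 (tli (c2 \ox k)).
  by rewrite -[lkB _ _]tlK tB -(homM htli) tpM.
have mA := mx_dual M be; have mB := mx_dual M al.
(* The unwinding descends exactly when these two kernels agree; each inclusion uses one of the
   bounds on the induced ideal. *)
have key (d : cp X be) : s_q (assoc_cp T) d = 0 <-> tmap (S := S) q id (Th d) = 0.
  have hqi := @tmap_hom R G S _ _ _ _ _ _ hq (@hom_id R (KG S)).
  have hqk := @tmap_hom R G S _ _ _ _ _ _ hq (@hom_id R (kops P)).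
  have sqk : range (tmap (S := S) q (@id (kops P))) = setT.
    by apply: tmap_surj => //; [exact: sq_surj | apply/seteqP; split=> // k _; exists k].
  split=> [d0|].
    have : tau_ker T (dual_co X be) (mxi d) by [].
    rewrite -(mor _ _ _ zeta) => hind.
    have [u uu] := @l2_unit R G S.
    have k0 : rko (KG S) u u <> 0 by exact: rko_neq0.
    have sc : range (fun l => tmap (S := S) q (@id (kops P)) (tl l)) = setT.
      apply/seteqP; split=> // y _.
      have /(_ y I)[z _ <-] : forall y, setT y -> range (tmap (S := S) q (@id (kops P))) y by rewrite sqk.
      by exists (tli z); rewrite ?Ktl.
    (* [ind_ker] is applied to q (x) id on the linking algebra, which kills the copy of ker q in the
       corner of A x G. *)
    have jz m : tau_ker T (dual_co X al) m -> tmap (S := S) q (@id (kops P)) (tl (lkB (bc_lk zeta) (mx_q M m))) = 0.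
      move=> m0; rewrite tB (@tmapE R G S _ _ _ _ _ _ hq (@hom_id R _)).
      have -> : q (mx_q M m) = 0 by rewrite /q /= -/(mxi _) mx_qK.
      exact: (lin0 (@tp_linl R G S _ _ _)).
    have := ind_ker mA mB (mL M) sp pp pf pd sq qq qf qd k0 (hom_comp htl hqk) sc jz hind.
    rewrite /= mxiK tA => h.
    have : stabF P (tmap (S := S) q id (Th d)) = 0.
      by rewrite -h /stabF !tmap_comp //; exact: (iota_hom (KG S) P).
    rewrite -(lin0 (hom_lin (hF _))); apply: tmap_inj => //; [exact: iota_hom | exact: iota_inj].
  (* Exactness of the tensor product with the compact operators reduces the claim to simple tensors
     c (x) |x><y| with q c = 0. *)
  move=> /(ker_tmap hq).
  have bl : blin (fun y => s_q (assoc_cp T) (al := be) (Thi y)).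
    exact: (blin_comp (hom_blin hThi) (hom_blin (sq_hom T be))).
  rewrite -{2}[d]ThK; move: (Th d); apply: (cspan_ind (clsub_ker bl)) => _ [c [k [qc ->]]] /=.
  move: k; apply: (ko_ind (clsub_pre (@blin_tpr R G S _ _ c) (clsub_ker bl))) => x y /=.
  move: c qc; apply: (ideal3_ind (clsub_ker (hom_blin hq)) _ _ (clsub_pre (@blin_tpl R G S _ _ (rko (KG S) x y)) (clsub_ker bl))).
  - by move=> c1 c2 /= h _; rewrite (homM hq) h sm0l.
  - by move=> c1 /= h; rewrite (hom_star hq) h st0.
  move=> c1 c2 c3 _ /= h2 _; have : ind zeta (tau_ker T (dual_co X al)) (mxi (Thi ((c1 ** c2 ** c3) \ox rko (KG S) x y))).
    have lp c z : ml (lk_p (bc_lk zeta)) (tli (c \ox rko (kops P) (hpV P z) (hpw P))) = tli (c \ox rko (kops P) (hpV P z) (hpw P)).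
      by apply: (bij_inj btl); rewrite pE Ktl mtpE ml_P.
    have rq c z : mr (lk_q (bc_lk zeta)) (tli (c \ox rko (kops P) (hpV P z) (hpw P))) = tli (c \ox rko (kops P) (hpV P z) (hpw P)).
      apply: (bij_inj btl); rewrite -[X in mr _ X]starK (mr_sa _ sq) (hom_star htl) qE (hom_star htl) Ktl.
      rewrite tp_star rko_star mtpE ml_one -[ml (emb _) _]/(rko (kops P) (hpw P) (hpw P) ** _).
      by rewrite rkoM hp_unit scale1r tp_star starK rko_star.
    (* c1 (x) |x><w|, c2 (x) |w><w| and c3 (x) |w><y| multiply to c1 c2 c3 (x) |x><y|; only the
       middle factor [c2] has to lie in the kernel. *)
    apply: (ind_gen mA mB (mL M) sp pp pf pd sq qq qf qd (b := mxi c2)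
      (z := tli (c1 \ox rko (kops P) (hpV P x) (hpw P))) (y := tli (star c3 \ox rko (kops P) (hpV P y) (hpw P)))) => //.
    apply: (bij_inj btl); rewrite tA [X in Th X](@mxiK be) KTh stabFE iota_rko !(homM htl) (hom_star htl) !Ktl tB mxiK.
    by rewrite tp_star starK rko_star tpM rkoM hp_unit scale1r tpM rkoM hp_unit scale1r.
  by rewrite (mor _ _ _ zeta).
exists Th; first by split.
have hqi := @tmap_hom R G S _ _ _ _ _ _ hq (@hom_id R (KG S)).
have [Ths hTs TsE] := hom_descend (sq_hom T be) (hom_comp hTh hqi) (sq_surj T be) (fun d h => (key d).1 h).
exists Ths; split=> //; apply: inj_surj_bij.
  apply: (lin_inj (hom_lin hTs)) => y.
  have /(_ y I)[d _ <-] : forall y, setT y -> range (s_q (assoc_cp T) (al := be)) y by rewrite sq_surj.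
  by rewrite TsE => /(key d).2.
apply/seteqP; split=> // y _.
have sqk : range (tmap (S := S) q (@id (KG S))) = setT.
  by apply: tmap_surj => //; [exact: sq_surj | apply/seteqP; split=> // k _; exists k].
have /(_ y I)[z _ <-] : forall y, setT y -> range (tmap (S := S) q (@id (KG S))) y by rewrite sqk.
by exists (s_q (assoc_cp T) (Thi z)) => //; rewrite TsE /= KTh.
Qed.

Lemma le_transfer T1 T2 : tau_le T1 T2 -> cp_le (assoc_cp T1) (assoc_cp T2).
Proof.
move=> le al; set A := dual_co X al.
have [h hh hE] := hom_descend (tau_q_mor T2 A).1 (tau_q_mor T1 A).1 (tau_q_surj T2 A) (le A).
exists h => // y; rewrite /=; congr dual_nm.
have /(_ y I)[x _ <-] : forall y, setT y -> range (tau_q T2 (A := A)) y by rewrite (tau_q_surj T2).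
(* [tau_q] is surjective, so its values determine [tau_Lam], which exists because [tau_q_ker] lets
   [Lam_max] descend. *)
have LE T : tau_Lam (T := T) (tau_q T x) = Lam_max N x.
  rewrite /tau_Lam; case: xgetP => [k _ /(_ x)//|nk].
  have hL : starhom (@Lam_max R G S X M N A).
    exact: (hom_comp (mx_q_mor M A).1 (nm_L_mor N A).1).
  have [k _ kE] := hom_descend (tau_q_mor T A).1 hL (tau_q_surj T A) (@tau_q_ker _ _ _ _ _ _ T A).
  by case: (nk k).
by rewrite hE !LE.
Qed.

Lemma exact_transfer T : tau_exact T -> cp_exact (assoc_cp T).
Proof.
move=> ex al be ga f g cf cg sx; have [fi fg sg] := sx.
have fI a b : range f (b ** f a).
  rewrite fg /= (homM cg.1).
  have : [set b | g b = 0] (f a) by rewrite -fg; exists a.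
  by move=> /= ->; rewrite sm0r.
(* The range of the surjection [g] is an ideal as well, so [cp_ideal] also supplies the crossed
   product of [g]. *)
have gI a b : range g (b ** g a) by rewrite sg.
have [phi [hphi phiE _]] := cp_ideal (cp X al) (cp X be) cf fI.
have [psi [hpsi psiE _]] := cp_ideal (cp X be) (cp X ga) cg gI.
have e1 : @cpmap _ _ _ X al be f = phi by apply/funext; exact: cpmapP.
have e2 : @cpmap _ _ _ X be ga g = psi by apply/funext; exact: cpmapP.
rewrite /= e1 e2; apply: ex.
- exact: (cp_comor cf hphi phiE).
- exact: (cp_comor cg hpsi psiE).
- exact: (cp_exact_seq cf cg sx hphi phiE hpsi psiE).
Qed.

End Final.

Theorem proposition4p24 (R : realType) (G : lcGroupType) (S : setting R G)
    (X : crossed S) (M : maximalization X) (N : normalization X) :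
  (forall tau : coaction_functor M N, tau_exact tau -> cp_exact (assoc_cp tau)) /\
  (forall tau : coaction_functor M N, tau_morita tau -> cp_morita (assoc_cp tau)) /\
  (forall tau1 tau2 : coaction_functor M N,
     tau_le tau1 tau2 -> cp_le (assoc_cp tau1) (assoc_cp tau2)).
Proof.
split; [exact: exact_transfer | split; [exact: morita_transfer | exact: le_transfer]].
Qed.
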